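(* Let $n,d$ be integers with $d>2n\ge 4$. Let $S\in\mathcal{O}^d(\mathbb{R}^n\times\mathbb{R}^n)$ and suppose that the function $(x,y)\mapsto \|S''_{xy}(x,y)\|_{HS}^{1/(d-2)}$ is a norm on $\mathbb{R}^n\times\mathbb{R}^n$. Let $\psi$ be a smooth function on $\mathbb{R}^n\times\mathbb{R}^n$ supported in a compact neighborhood of the origin, let $\delta=\delta(S)$ be the Newton distance of $S$, and let $$T_\lambda f(x)=\int_{\mathbb{R}^n}e^{i\lambda S(x,y)}\psi(x,y)f(y)\,dy .$$ Write $\|T_\lambda\|_p$ for the operator norm of $T_\lambda$ on $L^p(\mathbb{R}^n)$. Then for every $1<p<\infty$ there is a constant $C$, independent of $\lambda$, such that for all $\lambda\ge 2$: $$\|T_\lambda\|_p\le\begin{cases} C\lambda^{-\delta/2}, & d/(d-n)<p<d/n,\\ C\lambda^{-\delta/2}(\log\lambda)^{\delta}, & p=d/n\ \text{ or }\ p=d/(d-n),\\ C\lambda^{-1/p'}, & 1<p<d/(d-n),\\ C\lambda^{-1/p}, & d/n<p<\infty,\end{cases}$$ where $1/p+1/p'=1$. Moreover: (a) If $d/(d-n)<p<d/n$, the decay rate $\lambda^{-\delta/2}$ is sharp; if $p=d/n$ or $p=d/(d-n)$, the decay is sharp except possibly for the logarithmic factor. That is, for every $p$ with $d/(d-n)\le p\le d/n$, if $\psi(0,0)\neq 0$ then there is $c>0$ such that $\|T_\lambda\|_p\ge c\,\lambda^{-\delta/2}$ for all sufficiently large $\lambda$. (b) The condition $d/(d-n)\le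 p\le d/n$ is not necessary for the sharp decay: there exist integers $n$, $d$ with $d>2n\ge 4$ and $S\in\mathcal{O}^d(\mathbb{R}^n\times\mathbb{R}^n)$ such that $(x,y)\mapsto \|S''_{xy}(x,y)\|_{HS}^{1/(d-2)}$ is a norm on $\mathbb{R}^n\times\mathbb{R}^n$, and an exponent $p\in(1,\infty)$ with $p\notin[d/(d-n),d/n]$, such that for every smooth function $\psi$ on $\mathbb{R}^n\times\mathbb{R}^n$ supported in a compact neighborhood of the origin, the operator $T_\lambda f(x)=\int_{\mathbb{R}^n}e^{i\lambda S(x,y)}\psi(x,y)f(y)\,dy$ satisfies $\|T_\lambda\|_p\le C\lambda^{-\delta/2}$ for all $\lambda\ge 2$ with $C$ independent of $\lambda$, where $\delta=\delta(S)$, and this rate is sharp (if $\psi(0,0)\ne0$ then $\|T_\lambda\|_p\ge c\lambda^{-\delta/2}$ for some $c>0$ and all sufficiently large $\lambda$).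
   Context: $\mathcal{O}^d(\mathbb{R}^n\times\mathbb{R}^n)$ is the space of real-valued homogeneous polynomials $S(x,y)=\sum_{|\alpha|+|\beta|=d}a_{\alpha,\beta}x^\alpha y^\beta$ of degree $d$ on $\mathbb{R}^n\times\mathbb{R}^n$ (with $\alpha,\beta$ multi-indices) containing no pure $x$-terms and no pure $y$-terms (i.e. $a_{\alpha,0}=0$ and $a_{0,\beta}=0$ for all $\alpha,\beta$). $S''_{xy}(x,y)$ is the $n\times n$ mixed Hessian matrix $\big(\partial^2S/\partial x_i\partial y_j\big)_{i,j}$, and $\|A\|_{HS}=\big(\sum_{i,j}|a_{ij}|^2\big)^{1/2}$ is the Hilbert–Schmidt norm of a matrix $A=(a_{ij})$. Newton distance: for $S=\sum a_{\alpha,\beta}x^\alpha y^\beta$ with no pure $x$- or $y$-terms, let $\mathcal{N}_0(S)$ be the convex hull of $\bigcup_{a_{\alpha,\beta}\ne0}\big((\alpha,\beta)+\mathbb{R}_+^{2n}\big)$ and $\mathcal{N}(S)=\partial\mathcal{N}_0(S)$ (the Newton polytope). The Newton distance $\delta=\delta(S)$ is determined by $\delta^{-1}=\inf\{s>0:(s,\dots,s)\in\mathcal{N}(S)\}$. It is known that for $S\in\mathcal{O}^d(\mathbb{R}^n\times\mathbb{R}^n)$, with $d>2n\ge 4$, such that $(x,y)\mapsto\|S''_{xy}(x,y)\|_{HS}^{1/(d-2)}$ is a norm on $\mathbb{R}^n\times\mathbb{R}^n$, $\delta(S)=2n/d$. *)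

(* Defs.v *)
From HB Require Import structures.
From mathcomp Require Import all_boot all_order all_algebra.
From mathcomp Require mpoly.
Import -(notations) mpoly.
From mathcomp Require Import all_classical all_reals all_analysis.
From mathcomp Require Import complex.
Import Order.TTheory GRing.Theory Num.Theory numFieldNormedType.Exports.

Set Implicit Arguments.
Unset Strict Implicit.
Unset Printing Implicit Defensive.

Local Open Scope classical_set_scope.
Local Open Scope ring_scope.

(* The product sigma-algebra on rows of length n; over a realType it is the
   Borel sigma-algebra of R^n, and R^n is always 'rV[R]_n below. *)
Section rV_measurable.
Context {d : measure_display} {T : measurableType d} (n : nat).

Let coords : 'I_n -> 'rV[T]_n -> T := fun i x => x ord0 i.

Let rV_set0 : g_sigma_preimage coords set0.
Proof. exact: sigma_algebra0. Qed.

Let rV_setC A : g_sigma_preimage coords A -> g_sigma_preimage coords (~` A).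
Proof. exact: sigma_algebraC. Qed.

Let rV_bigcup (F : (set 'rV[T]_n)^nat) :
  (forall i, g_sigma_preimage coords (F i)) ->
  g_sigma_preimage coords (\bigcup_i F i).
Proof. exact: sigma_algebra_bigcup. Qed.

HB.instance Definition _ := @isMeasurable.Build (measure_tuple_display d)
  'rV[T]_n (g_sigma_preimage coords) rV_set0 rV_setC rV_bigcup.

End rV_measurable.

Lemma measurable_rVP d1 d2 (T1 : measurableType d1) (T2 : measurableType d2) n
    (f : T1 -> 'rV[T2]_n) :
  (forall i, measurable_fun setT (fun x => f x ord0 i)) ->
  measurable_fun setT f.
Proof.
move=> mf; have : g_sigma_preimage
    (fun i => (fun x : 'rV[T2]_n => x ord0 i) \o f) `<=` measurable.
  apply: smallest_sub; first exact: sigma_algebra_measurable.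
  case: n f mf => [|n] f mf; first by rewrite big_ord0.
  rewrite -bigcup_mkord_ord; apply: bigcup_sub => i Ii.
  by move=> A [B mB <-]; exact: mf.
by rewrite g_sigma_preimage_comp => pS _ A mA; apply: pS; exists A.
Qed.

Lemma measurable_rV_coord d (T : measurableType d) n (i : 'I_n) :
  measurable_fun setT (fun x : 'rV[T]_n => x ord0 i).
Proof.
move=> _ Y mY; rewrite setTI; apply: sub_sigma_algebra => /=.
rewrite -bigcup_seq/=; exists i => /=; first by rewrite mem_index_enum.
by exists Y => //; rewrite setTI.
Qed.

Definition rV_cons (T : Type) n (z : T * 'rV[T]_n) : 'rV[T]_n.+1 :=
  @row_mx T 1 1 n (const_mx z.1) z.2.

Lemma measurable_rV_cons d (T : measurableType d) n :
  measurable_fun setT (@rV_cons T n).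
Proof.
apply: measurable_rVP => i.
have [j ->|j ->] := split_ordP (i : 'I_(1 + n)).
  rewrite (_ : (fun _ => _) = fst) //; apply/funext => z.
  by rewrite [LHS](@row_mxEl T 1 1 n) mxE.
rewrite (_ : (fun _ => _) = (fun x : 'rV[T]_n => x ord0 j) \o snd); last first.
  by apply/funext => z; rewrite [LHS](@row_mxEr T 1 1 n).
by apply: measurableT_comp => //; exact: measurable_rV_coord.
Qed.

Section lebesgue_rV.
Variable R : realType.

Section step.
Variables (n : nat) (mu : {measure set 'rV[R]_n -> \bar R}).

Definition lebesgue_rV_step : set 'rV[R]_n.+1 -> \bar R :=
  pushforward (@lebesgue_measure R \x^ mu)%E (@rV_cons R n).

Let step0 : lebesgue_rV_step set0 = 0%E.
Proof. by apply: measure0; exact: measurable_rV_cons. Qed.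

Let step_ge0 A : (0 <= lebesgue_rV_step A)%E.
Proof. by apply: measure_ge0; exact: measurable_rV_cons. Qed.

Let step_sigma_additive : semi_sigma_additive lebesgue_rV_step.
Proof.
by apply: measure_semi_sigma_additive; exact: measurable_rV_cons.
Qed.

HB.instance Definition _ := isMeasure.Build _ _ _
  lebesgue_rV_step step0 step_ge0 step_sigma_additive.
End step.

(* Lebesgue measure on R^n: the point mass for n = 0, then the iterated
   product with the one-dimensional Lebesgue measure. *)
Fixpoint lebesgue_rV n : {measure set 'rV[R]_n -> \bar R} :=
  if n is n'.+1 then lebesgue_rV_step (lebesgue_rV n') else \d_(0 : 'rV[R]_0).

Lemma lebesgue_rV_box n (a b : 'rV[R]_n) : (forall i, a ord0 i <= b ord0 i) ->
  lebesgue_rV n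
    [set x : 'rV[R]_n | forall i, x ord0 i \in `[a ord0 i, b ord0 i]] =
  (\prod_(i < n) (b ord0 i - a ord0 i))%:E.
Proof.
elim: n a b => [|n IHn] a b ab.
  rewrite big_ord0 /= diracE mem_set//= => -[].
  by [].
pose tl (c : 'rV[R]_n.+1) : 'rV[R]_n := \row_i c ord0 (lift ord0 i).
have mbox : measurable [set x : 'rV[R]_n |
    forall i, x ord0 i \in `[tl a ord0 i, tl b ord0 i]].
  rewrite [X in measurable X](_ : _ = \bigcap_(i in [set: 'I_n])
      ((fun x : 'rV[R]_n => x ord0 i) @^-1` `[tl a ord0 i, tl b ord0 i])).
    apply: fin_bigcap_measurable => // i _; rewrite -[X in measurable X]setTI.
    exact: measurable_rV_coord.
  by apply/seteqP; split => [x xab i _|x xab i]; [exact: xab|exact: (xab i I)].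
rewrite /= /lebesgue_rV_step /pushforward.
rewrite [X in (_ \x^ _)%E X](_ : _ = `[a ord0 ord0, b ord0 ord0]%classic `*`
    [set x : 'rV[R]_n | forall i, x ord0 i \in `[tl a ord0 i, tl b ord0 i]]).
  rewrite product_measure2E// IHn; last by move=> i; rewrite !mxE.
  have leb1 : lebesgue_measure `[a ord0 ord0, b ord0 ord0]%classic =
      (b ord0 ord0 - a ord0 ord0)%:E.
    rewrite lebesgue_measure_itv/= lte_fin lt_neqAle ab andbT.
    by case: eqVneq => //= ->; rewrite subrr.
  rewrite big_ord_recl EFinM; congr (_ * _)%E; first exact: leb1.
  by congr EFin; apply: eq_bigr => i _; rewrite !mxE.
have cons0 t (x : 'rV[R]_n) : rV_cons (t, x) ord0 ord0 = t.
  have -> : ord0 = lshift n ord0 :> 'I_(1 + n) by exact/val_inj.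
  by rewrite [LHS](@row_mxEl R 1 1 n) mxE.
have consS t (x : 'rV[R]_n) i : rV_cons (t, x) ord0 (lift ord0 i) = x ord0 i.
  have -> : lift ord0 i = rshift 1 i :> 'I_(1 + n) by exact/val_inj.
  by rewrite [LHS](@row_mxEr R 1 1 n).
apply/seteqP; split => [[t x] /= tx|[t x] /= [abt abx] i].
  split => [|i]; first by have := tx ord0; rewrite cons0.
  by have := tx (lift ord0 i); rewrite consS !mxE.
have [j ->|->] := unliftP ord0 i; last by rewrite cons0.
by rewrite consS; have := abx j; rewrite !mxE.
Qed.

End lebesgue_rV.

Section polynomial_phase.
Variables (R : realType) (n : nat).
Implicit Type S : mpoly (n + n) R.

(* The first n variables of S are the x_i, the last n the y_j; a monomial is a
   pure x-term when all its y-exponents vanish, and conversely. *)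
Definition mixed_homog d S : Prop :=
  [/\ S \is ishomog1 d mdeg,
      forall m : multinom (n + n),
        (forall j : 'I_n, m (rshift n j) = 0%N) -> mcoeff m S = 0
    & forall m : multinom (n + n),
        (forall i : 'I_n, m (lshift n i) = 0%N) -> mcoeff m S = 0].

Definition phase_eval S (z : 'rV[R]_n * 'rV[R]_n) : R :=
  meval (fun k => row_mx z.1 z.2 ord0 k) S.

Definition mixed_hessian S (z : 'rV[R]_n * 'rV[R]_n) : 'M[R]_n :=
  \matrix_(i, j) phase_eval (mderiv (lshift n i) (mderiv (rshift n j) S)) z.

(* smallest convex_set G is the convex hull of G. *)
Definition newton_polyhedron S : set 'rV[R]_(n + n) :=
  smallest (@convex_set R 'rV[R]_(n + n))
    (\bigcup_(m in [set m : multinom (n + n) | mcoeff m S != 0])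
      [set z | forall k, (m k)%:R <= z ord0 k]).

Definition newton_polytope S : set 'rV[R]_(n + n) :=
  closure (newton_polyhedron S) `\` (newton_polyhedron S)°.

Definition newton_distance S : R :=
  (inf [set s : R | 0 < s /\ newton_polytope S (const_mx s)])^-1.

End polynomial_phase.

Definition HS_norm (R : realType) m n (A : 'M[R]_(m, n)) : R :=
  Num.sqrt (\sum_i \sum_j `|A i j| ^+ 2).

Definition is_norm (R : realType) (V : lmodType R) (N : V -> R) : Prop :=
  [/\ forall v, 0 <= N v,
      forall v, N v = 0 -> v = 0,
      forall (a : R) v, N (a *: v) = `|a| * N v
    & forall v w, N (v + w) <= N v + N w].

Definition hessian_norm (R : realType) n d (S : mpoly (n + n) R)
    (z : 'rV[R]_n * 'rV[R]_n) : R :=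
  HS_norm (mixed_hessian S z) `^ (d%:R - 2)^-1.

(* C^k through iterated directional derivatives in arbitrary directions;
   in finite dimension this is the usual notion. *)
Fixpoint Ck (R : realType) (V : normedModType R) (k : nat) (f : V -> R) : Prop :=
  continuous f /\
  if k is k'.+1 then
    forall v, (forall x, derivable f x v) /\ Ck k' (fun x => 'D_v f x)
  else True.

Definition smooth (R : realType) (V : normedModType R) (f : V -> R) : Prop :=
  forall k, Ck k f.

Definition cutoff (R : realType) n (psi : 'rV[R]_n * 'rV[R]_n -> R[i]) : Prop :=
  [/\ smooth (fun z => complex.Re (psi z)),
      smooth (fun z => complex.Im (psi z))
    & exists K : set ('rV[R]_n * 'rV[R]_n),
        [/\ compact K, nbhs (0 : 'rV[R]_n * 'rV[R]_n) K
          & forall z, ~ K z -> psi z = 0]].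

Section Lp_operator.
Variables (R : realType) (n : nat).
Implicit Types (f : 'rV[R]_n -> R[i])
  (T : ('rV[R]_n -> R[i]) -> 'rV[R]_n -> R[i]).

Definition cmeasurable f : Prop :=
  measurable_fun setT (fun x => complex.Re (f x)) /\
  measurable_fun setT (fun x => complex.Im (f x)).

Definition cintegral f : R[i] :=
  Complex (\int[lebesgue_rV R n]_x complex.Re (f x))
          (\int[lebesgue_rV R n]_x complex.Im (f x)).

Definition Lp_norm (p : R) f : \bar R :=
  'N[lebesgue_rV R n]_p%:E [(fun x => (Normc.normc (f x))%:E)]%E.

(* Elements of L^p are represented by Borel functions, so the unit ball ranges
   over genuine functions rather than almost-everywhere classes. *)
Definition op_norm (p : R) T : \bar R :=
  ereal_sup [set Lp_norm p (T f) |
    f in [set f | cmeasurable f /\ (Lp_norm p f <= 1)%E]].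

(* The kernel is exp (i lam S(x, y)) psi(x, y). *)
Definition osc_op (S : mpoly (n + n) R) (psi : 'rV[R]_n * 'rV[R]_n -> R[i])
    (lam : R) f (x : 'rV[R]_n) : R[i] :=
  cintegral (fun y => (cos (lam * phase_eval S (x, y)) +i*
                       sin (lam * phase_eval S (x, y)))%C *
                      psi (x, y) * f y).

End Lp_operator.

(* Main.v *)
Require Import Defs.
From HB Require Import structures.
From mathcomp Require Import all_boot all_order all_algebra.
From mathcomp Require mpoly.
Import -(notations) mpoly.
From mathcomp Require Import all_classical all_reals all_analysis.
From mathcomp Require Import complex.
From mathcomp Require Import measurable_realfun unstable ring lra.
Import Order.TTheory GRing.Theory Num.Theory numFieldNormedType.Exports.

Set Implicit Arguments.
Unset Strict Implicit.
Unset Printing Implicit Defensive.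

Local Open Scope classical_set_scope.
Local Open Scope ring_scope.

(** Let p' be the exponent conjugate to p, and q the larger of p and p'. The
    upper bounds follow from the single estimate (osc_op_upper)
        ||T_lam||_p <= C (lam^(-1/q) + lam^(-n/d)),
    because the Newton distance is 2 n / d, and 1/q is compared with n/d in
    each of the four ranges of p.

    The estimate is local. The mixed Hessian vanishes at the origin only and
    is homogeneous, so that at every point z one of its entries, say that of
    (x_i, y_j), is at least c |z|^(d-2) (hessian_entry_ge). On a pair of small
    cubes at distance rho from the origin the same entry works for all points.
    With the other variables frozen, the operator in (x_i, y_j) lives on
    intervals of length comparable to rho and has a phase whose mixed
    derivative is at least m = c lam rho^(d-2). Its norm on L^2 is at most
    C m^(-1/2): the kernel of its square is controlled by two integrations by
    parts, and then by Schur's test (van_der_corput2, oscillatory_L2). Its norm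
    on L^1 and on L^oo is at most C rho, and interpolation gives
    C m^(-1/q) rho^(1-2/q) (oscillating_block_Lp). Integrating out the frozen
    variables costs a factor rho^(n-1), or less when one cube is smaller
    (cube_bound).

    The ball that carries the cutoff is cut into dyadic shells of radii
    B / 2^j, down to lam^(-1/d), and each shell into a fixed number of cubes.
    Because n is at least 2, the bound for a pair of cubes decays
    geometrically with the distance of the two shells, so that Schur's test on
    the matrix of these bounds sums them (Lp_bounded_codes, dyadic_bound). The
    innermost pair is bounded by its volume lam^(-n/d).

    The rate lam^(-n/d) is attained on the indicator of a cube of side
    lam^(-1/d), on which the phase hardly varies (osc_op_lower).

    For the Newton distance, homogeneity puts the Newton polyhedron on one
    side of the hyperplane where the exponents sum to d. Since the Hessian does
    not vanish on the coordinate axes, S contains for each variable a monomial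
    that is a power of this variable up to two exponents; convex combinations
    of these monomials approach the diagonal point of the hyperplane
    (newton_distanceE).

    The last part of the theorem is witnessed by the phase
    x_1^5 y_1 + x_1 y_1^5 + x_2^5 y_2 + x_2 y_2^5, for which n = 2 and d = 6,
    and by p = 4 > d/n = 3. In one pair of variables the estimate above gives
    lam^(-1/6) as long as q < 6. If the amplitude were a product, the operator
    would be a tensor product and have norm C lam^(-1/3). A general amplitude
    is the integral of its derivative in x_2, which exhibits the operator as
    an average of such tensor products (osc_op_quintic_upper). *)

(** * Powers and integrals *)

Lemma powR_convex2 (R : realType) (p w u v : R) : 1 <= p -> 0 <= w <= 1 ->
  0 <= u -> 0 <= v ->
  (w * u + (1 - w) * v) `^ p <= w * u `^ p + (1 - w) * v `^ p.
Proof.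
move=> p1 /andP[w0 w1] u0 v0.
have := @convex_powR R p p1 (Itv01 w0 w1) u v.
by rewrite !inE /= !in_itv /= !andbT u0 v0 => /(_ isT isT); rewrite !convRE.
Qed.

(** Convexity of the power function, by induction on the list: the weights a i /
    S sum to at most one, and the missing weight sits on the value 0. *)
Lemma powR_jensen (R : realType) (p : R) (I : eqType) (s : seq I) (a t : I -> R)
    (S : R) :
  1 <= p -> (forall i, i \in s -> 0 < a i) -> (forall i, i \in s -> 0 <= t i) ->
  0 < S -> \sum_(i <- s) a i <= S ->
  ((\sum_(i <- s) t i) / S) `^ p <=
    \sum_(i <- s) a i / S * (t i / a i) `^ p.
Proof.
move=> p1; have p0 : p != 0 by rewrite gt_eqF// (lt_le_trans _ p1).
elim: s S => [|i s IHs] S ha ht S0; first by rewrite !big_nil mul0r powR0.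
have ai : 0 < a i by apply: ha; rewrite inE eqxx.
have ti : 0 <= t i by apply: ht; rewrite inE eqxx.
have ha' j : j \in s -> 0 < a j by move=> js; apply: ha; rewrite inE js orbT.
have ht' j : j \in s -> 0 <= t j by move=> js; apply: ht; rewrite inE js orbT.
have t0 : 0 <= \sum_(j <- s) t j by rewrite big_seq sumr_ge0.
rewrite !big_cons => hS.
have sge0 : 0 <= \sum_(j <- s) a j by rewrite big_seq sumr_ge0// => j /ha'/ltW.
have [Sa|Sa] := ltP (a i) S; last first.
  case: s {IHs t0 sge0 ht ha} ha' ht' hS => [|j s] ha' ht' hS; last first.
    have : 0 <= \sum_(j <- s) a j.
      by rewrite big_seq sumr_ge0// => l ls; apply/ltW/ha'; rewrite inE ls orbT.
    have : 0 < a j by apply: ha'; rewrite inE eqxx.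
    by move: hS; rewrite big_cons; lra.
  move: hS; rewrite !big_nil !addr0 => hS.
  have -> : S = a i by apply/eqP; rewrite eq_le Sa hS.
  by rewrite divff ?mul1r ?gt_eqF.
set b := S - a i; have b0 : 0 < b by rewrite subr_gt0.
have sb : \sum_(j <- s) a j <= b by rewrite /b; lra.
have w01 : 0 <= a i / S <= 1.
  by rewrite divr_ge0 ?(ltW ai) ?(ltW S0)//= ler_pdivrMr// mul1r ltW.
have := powR_convex2 p1 w01 (divr_ge0 ti (ltW ai)) (divr_ge0 t0 (ltW b0)).
have -> : a i / S * (t i / a i) + (1 - a i / S) * ((\sum_(j <- s) t j) / b) =
    (t i + \sum_(j <- s) t j) / S.
  by rewrite /b; field; rewrite !gt_eqF//= subr_gt0.
move=> /le_trans; apply; rewrite lerD2l.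
have -> : 1 - a i / S = b / S by rewrite /b; field; rewrite gt_eqF.
apply: le_trans (ler_wpM2l _ (IHs b ha' ht' b0 sb)) _.
  by rewrite divr_ge0 ?ltW.
rewrite mulr_sumr; apply: ler_sum => j _; rewrite mulrA ler_wpM2r ?powR_ge0//.
by rewrite le_eqVlt; apply/orP; left; apply/eqP; field; rewrite !gt_eqF.
Qed.

(** The p-th power of the L^p norm, which is additive over disjoint supports and
    avoids roots of extended reals. *)
Definition Lpp d (T : measurableType d) (R : realType)
  (mu : {measure set T -> \bar R}) (p : R) (f : T -> R) : \bar R :=
  (\int[mu]_x (`|f x| `^ p)%:E)%E.

Section Lpp_lemmas.
Context d (T : measurableType d) (R : realType) (mu : {measure set T -> \bar R}).
Implicit Types (f g : T -> R) (p a : R).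
Local Open Scope ereal_scope.

Lemma measurable_normpow p f : measurable_fun setT f ->
  measurable_fun setT (fun x => (`|f x| `^ p)%:E).
Proof.
move=> mf; apply/measurable_EFinP.
apply: (measurableT_comp (@measurable_powR R p)).
exact: measurableT_comp.
Qed.

Lemma Lpp_ge0 p f : 0 <= Lpp mu p f.
Proof. by apply: integral_ge0 => x _; rewrite lee_fin powR_ge0. Qed.

Lemma le_Lpp p f g : (0 <= p)%R -> measurable_fun setT f -> measurable_fun setT g ->
  (forall x, `|f x| <= `|g x|)%R -> Lpp mu p f <= Lpp mu p g.
Proof.
move=> p0 mf mg fg; apply: ge0_le_integral => //.
- exact: measurable_normpow.
- exact: measurable_normpow.
- by move=> x _; rewrite lee_fin ge0_ler_powR ?nnegrE.
Qed.

Lemma LppZ p a f : measurable_fun setT f ->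
  Lpp mu p (fun x => a * f x)%R = (`|a| `^ p)%:E * Lpp mu p f.
Proof.
move=> mf; rewrite /Lpp -(ge0_integralZl mu measurableT (measurable_normpow p mf)).
- by apply: eq_integral => x _; rewrite -EFinM normrM powRM.
- by move=> x _; rewrite lee_fin powR_ge0.
- by rewrite lee_fin powR_ge0.
Qed.

(** Since |f| <= 1 + |f|^p, the product is dominated by |A| (1_Y + |f|^p). *)
Lemma Lpp_integrable p f g (Y : set T) (A : R) :
  (1 <= p)%R -> measurable_fun setT f -> measurable_fun setT g ->
  measurable Y -> mu Y < +oo -> (forall y, `|g y| <= A * \1_Y y)%R ->
  Lpp mu p f < +oo -> mu.-integrable setT (EFin \o (fun y => g y * f y)%R).
Proof.
move=> p1 mf mg mY Yoo gA foo.
have A0 y : (0 <= A * \1_Y y)%R by exact: le_trans (gA y).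
have i1 : mu.-integrable setT (EFin \o (fun y => `|A| * \1_Y y + `|A| * (`|f y| `^ p))%R).
  rewrite /comp; under eq_fun do rewrite EFinD.
  apply: integrableD => //.
    under eq_fun do rewrite EFinM.
    apply: integrableZl => //; apply/integrableP; split.
      exact/measurable_EFinP/measurable_indic.
    under eq_integral do rewrite gee0_abs ?lee_fin//.
    by rewrite integral_indic// setIT.
  under eq_fun do rewrite EFinM.
  apply: integrableZl => //; apply/integrableP; split.
    exact: measurable_normpow.
  by under eq_integral do rewrite gee0_abs ?lee_fin ?powR_ge0//.
apply: le_integrable i1 => //.
  by apply/measurable_EFinP; exact: measurable_funM.
move=> y _ /=; rewrite lee_fin normrM.
have gA' : (`|g y| <= `|A| * \1_Y y)%R.
  by apply: le_trans (gA y) _; rewrite ler_wpM2r ?ler_norm.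

rewrite [leRHS]ger0_norm ?addr_ge0 ?mulr_ge0 ?powR_ge0//.
apply: le_trans (ler_wpM2r (normr_ge0 _) gA') _.
have [f1|f1] := leP (`|f y|%R) 1%R.
  apply: (@le_trans _ _ (`|A| * \1_Y y)%R).
    by rewrite ler_piMr// mulr_ge0.
  by rewrite lerDl mulr_ge0// powR_ge0.
rewrite -mulrDr -mulrA ler_wpM2l//.
apply: (@le_trans _ _ `|f y|)%R; first by rewrite ler_piMl// indicE; case: (_ \in _).
apply: (@le_trans _ _ (`|f y| `^ p)%R); last by rewrite lerDr.
by rewrite le1r_powR// ltW.
Qed.

(** Hölder's inequality against the indicator of Y. *)
Lemma powR_integral_le p f (Y : set T) : (1 <= p)%R -> measurable Y -> mu Y < +oo ->
  measurable_fun setT f -> (forall y, ~ Y y -> f y = 0%R) ->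
  Lpp mu p f < +oo ->
  ((`|\int[mu]_y f y| `^ p)%R)%:E <= (fine (mu Y) `^ (p - 1))%:E * Lpp mu p f.
Proof.
move=> p1 mY Yoo mf fY foo.
have p0 : (0 < p)%R by exact: lt_le_trans p1.
have mYfin : mu Y \is a fin_num by rewrite ge0_fin_numE.
have fE : f = (fun y => \1_Y y * f y)%R.
  apply/funext => y; rewrite indicE; case: (boolP (y \in Y)) => [_|yY].
    by rewrite mul1r.
  by rewrite mul0r fY//; rewrite notin_setE in yY.
have fint : mu.-integrable setT (EFin \o f).
  rewrite fE; apply: (@Lpp_integrable p f (\1_Y) Y 1) => //.
  by move=> y; rewrite mul1r ger0_norm.
have Fint : \int[mu]_y (`|f y|%R)%:E \is a fin_num.
  rewrite ge0_fin_numE; last by apply: integral_ge0 => y _; rewrite lee_fin.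
  by case/integrableP : fint.
have le1 : (`|\int[mu]_y f y|%R <= \int[mu]_y `|f y|)%R by exact: le_normr_Rintegral.
have Vfin : Lpp mu p f \is a fin_num by rewrite ge0_fin_numE// Lpp_ge0.
apply: (@le_trans _ _ (((\int[mu]_y `|f y|) `^ p)%R)%:E).
  by rewrite lee_fin ge0_ler_powR ?nnegrE ?(ltW p0)//; exact: le_trans le1.
move: p1; rewrite le_eqVlt => /predU1P[<-|p1].
  rewrite subrr powRr0 mul1e powRr1; last by apply: Rintegral_ge0.
  rewrite /Rintegral fineK// /Lpp le_eqVlt; apply/orP; left; apply/eqP.
  by apply: eq_integral => y _; rewrite powRr1.
pose q := (p / (p - 1))%R.
have p10 : (0 < p - 1)%R by rewrite subr_gt0.
have q0 : (0 < q)%R by rewrite divr_gt0.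
have pq : (p^-1 + q^-1 = 1)%R by rewrite /q; field; rewrite !gt_eqF.
have := hoelder mu (measurable_indic mY) mf q0 p0; rewrite addrC pq => /(_ erefl).
rewrite Lnorm1 unlock /=.
under eq_integral do rewrite -[(_ * _)%R]/((fun y => \1_Y y * f y)%R _) -fE.
have -> : \int[mu]_x (`|\1_Y x| `^ q)%:E = mu Y.
  transitivity (mu (Y `&` setT)); last by rewrite setIT.
  rewrite -integral_indic//; apply: eq_integral => y _.
  rewrite indicE; case: (_ \in _) => /=; first by rewrite normr1 powR1.
  by rewrite normr0 powR0// gt_eqF.
rewrite -/(Lpp mu p f) -(fineK Fint) -(fineK Vfin) -(fineK mYfin) !poweR_EFin.
rewrite -!EFinM !lee_fin /= => h.
apply: le_trans (ge0_ler_powR (ltW p0) _ _ h) _.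
- by rewrite nnegrE Rintegral_ge0.
- by rewrite nnegrE mulr_ge0// powR_ge0.
rewrite powRM ?powR_ge0// -!powRrM mulVf ?gt_eqF// powRr1; last first.
  by rewrite fine_ge0// Lpp_ge0.
suff -> : (q^-1 * p = p - 1)%R by [].
by rewrite /q; field; rewrite !gt_eqF.
Qed.

End Lpp_lemmas.

(** * Integral operators with bounded kernels *)

Definition kop d1 d2 (T1 : measurableType d1) (T2 : measurableType d2)
    (R : realType) (nu : {measure set T2 -> \bar R}) (k : T1 * T2 -> R)
    (f : T2 -> R) (x : T1) : R :=
  \int[nu]_y (k (x, y) * f y).

(** Domination by a constant on a rectangle of finite measure, which justifies
    every exchange of integrals against functions of L^p. *)
Definition tame_on d1 d2 (T1 : measurableType d1) (T2 : measurableType d2)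
    (R : realType) (mu : {measure set T1 -> \bar R})
    (nu : {measure set T2 -> \bar R}) (X : set T1) (Y : set T2) (A : R)
    (k : T1 * T2 -> R) : Prop :=
  [/\ measurable_fun setT k,
      measurable X /\ (mu X < +oo)%E,
      measurable Y /\ (nu Y < +oo)%E
    & forall x y, `|k (x, y)| <= A * \1_X x * \1_Y y].

(** The operator norm on L^p is at most a, stated for p-th powers. *)
Definition Lp_bounded d1 d2 (T1 : measurableType d1) (T2 : measurableType d2)
    (R : realType) (mu : {measure set T1 -> \bar R})
    (nu : {measure set T2 -> \bar R}) (p : R) (k : T1 * T2 -> R) (a : R) : Prop :=
  forall f : T2 -> R, measurable_fun setT f -> (Lpp nu p f < +oo)%E ->
    (Lpp mu p (kop nu k f) <= (a `^ p)%:E * Lpp nu p f)%E.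

Section tame_kernel.
Context d1 d2 (T1 : measurableType d1) (T2 : measurableType d2) (R : realType).
Variables (mu : {measure set T1 -> \bar R}) (nu : {measure set T2 -> \bar R}).
Implicit Types (k : T1 * T2 -> R) (f : T2 -> R) (p a A : R)
  (X : set T1) (Y : set T2).

Lemma measurable_section k x : measurable_fun setT k ->
  measurable_fun setT (fun y => k (x, y)).
Proof. by move=> mk; exact: (measurableT_comp mk). Qed.

Lemma tame_integrable X Y A k f p x : tame_on mu nu X Y A k -> 1 <= p ->
  measurable_fun setT f -> (Lpp nu p f < +oo)%E ->
  nu.-integrable setT (EFin \o (fun y => k (x, y) * f y)).
Proof.
move=> [mk [mX Xoo] [mY Yoo] kA] p1 mf foo.
apply: (@Lpp_integrable _ _ _ nu p f (fun y => k (x, y)) Y (A * \1_X x)) => //.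
exact: measurable_section.
Qed.

End tame_kernel.

Section kernel_operator.
Context d1 d2 (T1 : measurableType d1) (T2 : measurableType d2) (R : realType).
Variables (mu : {measure set T1 -> \bar R})
          (nu : {sigma_finite_measure set T2 -> \bar R}).
Implicit Types (k : T1 * T2 -> R) (f : T2 -> R) (p a A : R)
  (X : set T1) (Y : set T2).

Lemma measurable_kop k f : measurable_fun setT k -> measurable_fun setT f ->
  measurable_fun setT (kop nu k f).
Proof.
move=> mk mf; apply: measurableT_comp; first exact: fine_measurable.
pose h (z : T1 * T2) := (k z * f z.2)%:E.
have mh : measurable_fun setT h.
  by apply/measurable_EFinP; apply: measurable_funM => //; exact: measurableT_comp.
have -> : (fun x => \int[nu]_y (k (x, y) * f y)%:E)%E =
    (fubini_F nu h^\+ \- fubini_F nu h^\-)%E.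
  apply/funext => x; rewrite [LHS]integralE /fubini_F /=.
  by congr (_ - _)%E; apply: eq_integral => y _; rewrite ?funeposE ?funenegE.
apply: emeasurable_funB; apply: measurable_fun_fubini_tonelli_F => //.
  exact: measurable_funepos.
exact: measurable_funeneg.
Qed.

Lemma Lp_bounded_restrict p k a (E : set T1) (F : set T2) : 1 <= p ->
  measurable E -> measurable F -> measurable_fun setT k ->
  Lp_bounded mu nu p k a ->
  Lp_bounded mu nu p (fun z => \1_E z.1 * k z * \1_F z.2) a.
Proof.
move=> p1 mE mF mk ka f mf foo.
have p0 : 0 <= p by exact: le_trans p1.
pose g y := \1_F y * f y.
have mg : measurable_fun setT g by apply: measurable_funM => //; exact: measurable_indic.
have gf : (Lpp nu p g <= Lpp nu p f)%E.
  apply: le_Lpp => // y; rewrite /g normrM ler_piMl// indicE.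
  by case: (_ \in _); rewrite ?normr1 ?normr0.
apply: (@le_trans _ _ (Lpp mu p (kop nu k g))); last first.
  apply: le_trans (ka g mg (le_lt_trans gf foo)) _.
  by rewrite lee_wpmul2l// lee_fin powR_ge0.
apply: le_Lpp => //.
- apply: measurable_kop => //; apply: measurable_funM.
    by apply: measurable_funM => //; apply: measurableT_comp => //; exact: measurable_indic.
  by apply: measurableT_comp => //; exact: measurable_indic.
- exact: measurable_kop.
move=> x; rewrite /kop /= /g indicE; case: (x \in E) => /=; last first.
  under eq_Rintegral do rewrite !mul0r.
  by rewrite /Rintegral integral0 normr0.
by under eq_Rintegral do rewrite mul1r -mulrA.
Qed.

(** Hölder's inequality in y for each x, then integration over x in X. *)
Lemma tame_Lp_bounded X Y A k p a : 1 <= p -> 0 <= A -> tame_on mu nu X Y A k ->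
  A `^ p * fine (mu X) * fine (nu Y) `^ (p - 1) <= a `^ p ->
  Lp_bounded mu nu p k a.
Proof.
move=> p1 A0 tk ha f mf foo.
have [mk [mX Xoo] [mY Yoo] kA] := tk.
have p0 : 0 < p by exact: lt_le_trans p1.
have mXfin : mu X \is a fin_num by rewrite ge0_fin_numE.
apply: (@le_trans _ _ (\int[mu]_x ((A `^ p * fine (nu Y) `^ (p - 1))%:E * Lpp nu p f *
    (\1_X x)%:E))%E).
  apply: ge0_le_integral => //.
  - by apply: measurable_normpow; exact: measurable_kop.
  - apply: emeasurable_funM => //; apply/measurable_EFinP; exact: measurable_indic.
  move=> x _; have [xX|xX] := boolP (x \in X); last first.
    have -> : kop nu k f x = 0.
      rewrite /kop; under eq_Rintegral => y _.
        have -> : k (x, y) = 0.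
          apply/eqP; rewrite -normr_le0; apply: le_trans (kA x y) _.
          by rewrite indicE (negbTE xX) mulr0 mul0r.
        rewrite mul0r; over.
      by rewrite /Rintegral integral0.
    rewrite normr0 powR0 ?gt_eqF//; rewrite mule_ge0 ?mule_ge0 ?Lpp_ge0//.
    by rewrite lee_fin mulr_ge0 ?powR_ge0.
  rewrite indicE xX mule1.
  have mkx : measurable_fun setT (fun y => k (x, y) * f y).
    by apply: measurable_funM => //; exact: measurable_section.
  have le1 y : `|k (x, y) * f y| <= `|A * f y|.
    rewrite !normrM ler_wpM2r//; apply: le_trans (kA x y) _.
    rewrite ger0_norm// -mulrA ler_piMr//.
  have Aoo : (Lpp nu p (fun y => k (x, y) * f y)%R < +oo)%E.
    apply: le_lt_trans (le_Lpp _ (ltW p0) mkx _ le1) _.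
      by apply: measurable_funM => //; exact: measurable_cst.
    rewrite LppZ// lte_mul_pinfty ?lee_fin ?powR_ge0//.
  apply: le_trans (powR_integral_le p1 mY Yoo mkx _ Aoo) _.
    move=> y yY; have : `|k (x, y)| <= 0.
      apply: le_trans (kA x y) _; rewrite [\1_Y y]indicE memNset//= mulr0//.
    by rewrite normr_le0 => /eqP ->; rewrite mul0r.
  rewrite mulrC EFinM -muleA lee_wpmul2l ?lee_fin ?powR_ge0//.
  apply: le_trans (le_Lpp _ (ltW p0) mkx _ le1) _.
    by apply: measurable_funM => //; exact: measurable_cst.
  by rewrite LppZ// ger0_norm.
rewrite ge0_integralZl//.
- rewrite integral_indic// setIT -muleA [(Lpp _ _ _ * _)%E]muleC muleA.
  rewrite -[Z in (_ * Z * _)%E]fineK// -EFinM lee_wpmul2r ?Lpp_ge0// lee_fin.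
  by rewrite mulrAC.
- by apply/measurable_EFinP; exact: measurable_indic.
- by rewrite mule_ge0 ?Lpp_ge0// lee_fin mulr_ge0 ?powR_ge0.
Qed.

Lemma Lp_bounded_le p k a b : 0 <= p -> 0 <= a <= b -> Lp_bounded mu nu p k a ->
  Lp_bounded mu nu p k b.
Proof.
move=> p0 /andP[a0 ab] ka f mf foo; apply: le_trans (ka f mf foo) _.
rewrite lee_wpmul2r ?Lpp_ge0// lee_fin ge0_ler_powR ?nnegrE//.
exact: le_trans ab.
Qed.

Section codes.
Variables (J L : finType) (cx : T1 -> J) (cy : T2 -> L) (k : T1 * T2 -> R)
  (a : J -> L -> R) (p C : R).
Hypothesis mcx : forall j, measurable [set x | cx x = j].
Hypothesis mcy : forall l, measurable [set y | cy y = l].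
Hypothesis p1 : 1 <= p.
Hypothesis a0 : forall j l, 0 < a j l.
Hypothesis C0 : 0 < C.

Let kc j l (z : T1 * T2) := \1_[set x | cx x = j] z.1 * k z * \1_[set y | cy y = l] z.2.

(** An almost orthogonality principle: the two spaces are cut into finitely many
    pieces, and Schur's test is applied to the matrix of the norms of the
    pieces. Jensen's inequality with the weights of one row bounds the output at
    each point; the column sums then recombine the pieces of f. *)
Lemma Lp_bounded_codes X Y A : tame_on mu nu X Y A k ->
  (forall j, \sum_l a j l <= C) -> (forall l, \sum_j a j l <= C) ->
  (forall j l, Lp_bounded mu nu p (kc j l) (a j l)) ->
  Lp_bounded mu nu p k C.
Proof.
move=> tk row col ka f mf foo.
have [mk [mX Xoo] [mY Yoo] kA] := tk.
have p0 : 0 < p by exact: lt_le_trans p1.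
pose g l y := \1_[set y | cy y = l] y * f y.
have mg l : measurable_fun setT (g l).
  by apply: measurable_funM => //; exact: measurable_indic.
have gf l : (Lpp nu p (g l) <= Lpp nu p f)%E.
  apply: le_Lpp => //; first exact: ltW.
  move=> y; rewrite /g normrM ler_piMl// indicE.
  by case: (_ \in _); rewrite ?normr1 ?normr0.
have goo l : (Lpp nu p (g l) < +oo)%E by exact: le_lt_trans foo.
have mkc j l : measurable_fun setT (kc j l).
  apply: measurable_funM.
    by apply: measurable_funM => //; apply: measurableT_comp => //; exact: measurable_indic.
  by apply: measurableT_comp => //; exact: measurable_indic.
have tkc j l : tame_on mu nu X Y A (kc j l).
  split => // x y; rewrite /kc /= !normrM -mulrA mulrCA.
  apply: le_trans (kA x y); rewrite ler_piMr//.
  by rewrite !indicE; do 2 case: (_ \in _); rewrite ?normr1 ?normr0 ?mulr1 ?mulr0.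
(* the output at x only sees the pieces of the block containing x *)
have split1 x : kop nu k f x = \sum_l kop nu (kc (cx x) l) (g l) x.
  rewrite /kop /Rintegral.
  have -> : (\int[nu]_y (k (x, y) * f y)%:E =
             \int[nu]_y (\sum_l (kc (cx x) l (x, y) * g l y)%:E))%E.
    apply: eq_integral => y _; rewrite sumEFin; congr EFin.
    rewrite (bigD1 (cy y))//= big1 ?addr0 => [|l ly].
      by rewrite /kc /g /= !indicE !mem_set//= !mul1r !mulr1.
    have -> : g l y = 0.
      by rewrite /g indicE memNset/= ?mul0r// => h; rewrite h eqxx in ly.
    by rewrite mulr0.
  rewrite integral_sum//.
    rewrite sum_fine// => l _; apply: integrable_fin_num => //.
    exact: tame_integrable (tkc (cx x) l) p1 (mg l) (goo l).
  by move=> l; exact: tame_integrable (tkc (cx x) l) p1 (mg l) (goo l).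
pose t j l x : R := `|kop nu (kc j l) (g l) x|.
pose c j l := C `^ p * (a j l / C) * (a j l)^-1 `^ p.
have c0 j l : 0 <= c j l.
  by rewrite /c !mulr_ge0 ?powR_ge0 ?invr_ge0 ?(ltW (a0 _ _)) ?(ltW C0).
have pt x : `|kop nu k f x| `^ p <= \sum_j \sum_l c j l * t j l x `^ p.
  rewrite (bigD1 (cx x))//=; apply: ler_wpDr.
    by do 2 (apply: sumr_ge0 => ? _); rewrite mulr_ge0 ?powR_ge0.
  have -> : `|kop nu k f x| = C * (`|kop nu k f x| / C) by field; rewrite gt_eqF.
  rewrite powRM ?divr_ge0 ?(ltW C0)//.
  apply: (@le_trans _ _ (C `^ p * ((\sum_l t (cx x) l x) / C) `^ p)).
    rewrite ler_wpM2l ?powR_ge0// ge0_ler_powR ?nnegrE ?(ltW p0)//.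
    - by rewrite divr_ge0 ?(ltW C0).
    - by rewrite divr_ge0 ?(ltW C0)//; apply: sumr_ge0 => l _; exact: normr_ge0.
    - by rewrite ler_wpM2r ?invr_ge0 ?(ltW C0)// split1; exact: ler_norm_sum.
  apply: (@le_trans _ _ (C `^ p *
      \sum_l a (cx x) l / C * (t (cx x) l x / a (cx x) l) `^ p)).
    rewrite ler_wpM2l ?powR_ge0//; apply: powR_jensen => //.
    by move=> l _; exact: normr_ge0.
  rewrite mulr_sumr; apply: ler_sum => l _.
  rewrite /c /t powRM ?invr_ge0 ?(ltW (a0 _ _))//.
  by rewrite [X in _ * (_ * X) <= _]mulrC !mulrA.
have mt j l : measurable_fun setT (fun x => (t j l x `^ p)%:E).
  by apply: measurable_normpow; exact: measurable_kop.
have mct j l : measurable_fun setT (fun x => ((c j l)%:E * (t j l x `^ p)%:E)%E).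
  by apply: emeasurable_funM.
apply: (@le_trans _ _ (\sum_j \sum_l (c j l)%:E *
    Lpp mu p (kop nu (kc j l) (g l)))%E).
  apply: (@le_trans _ _ (\int[mu]_x (\sum_j \sum_l (c j l)%:E * (t j l x `^ p)%:E))%E).
    apply: ge0_le_integral => //.
    - by apply: measurable_normpow; exact: measurable_kop.
    - by apply: emeasurable_sum => j; exact: emeasurable_sum.
    - move=> x _; have := pt x; rewrite -lee_fin => /le_trans; apply.
      rewrite -sumEFin; apply: lee_sum => j _; rewrite -sumEFin.
      by apply: lee_sum => l _; rewrite EFinM.
  rewrite ge0_integral_sum//; last first.
  - move=> j x _; apply: sume_ge0 => l _; rewrite mule_ge0// lee_fin//.
    by rewrite powR_ge0.
  - by move=> j; exact: emeasurable_sum.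
  apply: lee_sum => j _; rewrite ge0_integral_sum//; last first.
    by move=> l x _; rewrite mule_ge0// lee_fin// powR_ge0.
  apply: lee_sum => l _; rewrite ge0_integralZl//.
    by move=> x _; rewrite lee_fin powR_ge0.
  by rewrite lee_fin.
apply: (@le_trans _ _ (\sum_j \sum_l (C `^ p * (a j l / C))%:E * Lpp nu p (g l))%E).
  apply: lee_sum => j _; apply: lee_sum => l _.
  apply: le_trans (lee_wpmul2l _ (ka j l (g l) (mg l) (goo l))) _.
    by rewrite lee_fin.
  rewrite muleA -EFinM; suff -> : c j l * a j l `^ p = C `^ p * (a j l / C) by [].
  rewrite /c -[LHS]mulrA -powRM ?invr_ge0 ?(ltW (a0 _ _))//.
  by rewrite mulVf ?gt_eqF// powR1 mulr1.
rewrite exchange_big /=.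
have -> : Lpp nu p f = (\sum_l Lpp nu p (g l))%E.
  rewrite /Lpp -ge0_integral_sum//.
  - apply: eq_integral => y _; rewrite (bigD1 (cy y))//= big1 ?adde0 => [|l ly].
      by rewrite /g indicE mem_set//= mul1r.
    rewrite /g indicE memNset/= ?mul0r ?normr0 ?powR0 ?gt_eqF//.
    by move=> h; rewrite h eqxx in ly.
  - by move=> l; exact: measurable_normpow.
rewrite ge0_sume_distrr; last by move=> l _; exact: Lpp_ge0.
apply: lee_sum => l _; rewrite -ge0_sume_distrl; last first.
  by move=> j _; rewrite lee_fin mulr_ge0 ?powR_ge0// divr_ge0 ?(ltW C0) ?(ltW (a0 _ _)).
rewrite lee_wpmul2r ?Lpp_ge0// sumEFin lee_fin -mulr_sumr ler_piMr ?powR_ge0//.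
by rewrite -mulr_suml ler_pdivrMr// mul1r.
Qed.

End codes.

End kernel_operator.

(** * Integral operators on products *)

Ltac mproj :=
  solve [ exact: measurable_cst | exact: measurable_id | exact: measurable_fst
        | exact: measurable_snd
        | exact: (measurableT_comp measurable_fst measurable_fst)
        | exact: (measurableT_comp measurable_snd measurable_fst)
        | exact: (measurableT_comp measurable_fst measurable_snd)
        | exact: (measurableT_comp measurable_snd measurable_snd)
        | apply: measurable_fun_pair; mproj ].

Lemma measurable_Rintegral_section d1 d2 (T1 : measurableType d1)
    (T2 : measurableType d2) (R : realType)
    (nu : {sigma_finite_measure set T2 -> \bar R}) (F : T1 * T2 -> R) :
  measurable_fun setT F -> measurable_fun setT (fun x => \int[nu]_y F (x, y)).
Proof.
move=> mF; have := @measurable_kop _ _ T1 T2 R nu F (cst 1) mF.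
rewrite /kop; under [X in _ -> measurable_fun _ X]eq_fun do under eq_Rintegral do rewrite -[F _]mulr1.
by apply; exact: measurable_cst.
Qed.

Section Rintegral_fubini.
Context d1 d2 (T1 : measurableType d1) (T2 : measurableType d2) (R : realType).
Variables (mu : {sigma_finite_measure set T1 -> \bar R})
          (nu : {sigma_finite_measure set T2 -> \bar R}).
Implicit Types F : T1 * T2 -> R.

Lemma measurable_Rintegral_section2 F : measurable_fun setT F ->
  measurable_fun setT (fun y => \int[mu]_x F (x, y)).
Proof.
move=> mF; apply: (@measurable_Rintegral_section _ _ T2 T1 _ mu (F \o swap)).
by apply: measurableT_comp => //; exact: measurable_swap.
Qed.

Lemma Rintegral_fubini1 F : (mu \x nu)%E.-integrable setT (EFin \o F) ->
  \int[(mu \x nu)%E]_z F z = \int[mu]_x \int[nu]_y F (x, y).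
Proof.
move=> iF; rewrite /Rintegral -(integral12_prod_meas1 iF); congr fine.
have mF : measurable_fun setT F by apply/measurable_EFinP; case/integrableP : iF.
apply: ae_eq_integral => //.
- exact: (measurable_fubini_F iF).
- by apply/measurable_EFinP; exact: measurable_Rintegral_section.
apply: filterS (ae_integrable1 iF) => x ix _.
by rewrite /fubini_F fineK//; exact: integrable_fin_num.
Qed.

Lemma Rintegral_fubini2 F : (mu \x nu)%E.-integrable setT (EFin \o F) ->
  \int[(mu \x nu)%E]_z F z = \int[nu]_y \int[mu]_x F (x, y).
Proof.
move=> iF; rewrite /Rintegral -(integral21_prod_meas1 iF); congr fine.
have mF : measurable_fun setT F by apply/measurable_EFinP; case/integrableP : iF.
apply: ae_eq_integral => //.
- exact: (measurable_fubini_G iF).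
- by apply/measurable_EFinP; exact: measurable_Rintegral_section2.
apply: filterS (ae_integrable2 iF) => x ix _.
by rewrite /fubini_G fineK//; exact: integrable_fin_num.
Qed.

End Rintegral_fubini.

Lemma powR_Rintegral_le d (T : measurableType d) (R : realType)
    (mu : {measure set T -> \bar R}) (p : R) (f : T -> R) (Y : set T) :
  1 <= p -> measurable Y -> (mu Y < +oo)%E ->
  measurable_fun setT f -> (forall y, ~ Y y -> f y = 0) ->
  ((`|\int[mu]_y f y| `^ p)%:E <= (fine (mu Y) `^ (p - 1))%:E * Lpp mu p f)%E.
Proof.
move=> p1 mY Yoo mf fY.
have [foo|] := ltP (Lpp mu p f) +oo%E; first exact: powR_integral_le.
rewrite leye_eq => /eqP ->.
have [Y0|Y0] := eqVneq (mu Y) 0%E; last first.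
  rewrite gt0_muley ?leey// lte_fin powR_gt0// fine_gt0// Yoo andbT.
  by rewrite lt0e Y0 measure_ge0.
suff -> : \int[mu]_y f y = 0.
  rewrite normr0 powR0 ?gt_eqF ?(lt_le_trans _ p1)// mule_ge0// ?leey//.
have -> : \int[mu]_y f y = \int[mu]_(y in Y) f y.
  rewrite [RHS]Rintegral_mkcond; apply: eq_Rintegral => y _.
  by rewrite patchE; case: ifPn => //; rewrite notin_setE => /fY.
rewrite /Rintegral null_set_integral//; apply/measurable_EFinP.
exact: measurable_funTS.
Qed.

(** The right-hand side is infinite when f is not in L^p. *)
Lemma Lp_bounded_gt0 d1 d2 (T1 : measurableType d1) (T2 : measurableType d2)
    (R : realType) (mu : {measure set T1 -> \bar R})
    (nu : {measure set T2 -> \bar R}) (p : R) (k : T1 * T2 -> R) (a : R) f :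
  0 < a -> Lp_bounded mu nu p k a -> measurable_fun setT f ->
  (Lpp mu p (kop nu k f) <= (a `^ p)%:E * Lpp nu p f)%E.
Proof.
move=> a0 ka mf; have [foo|] := ltP (Lpp nu p f) +oo%E; first exact: ka.
by rewrite leye_eq => /eqP ->; rewrite gt0_muley ?leey// lte_fin powR_gt0.
Qed.

Section freeze.
Context d1 d1' d2 d2' (T1 : measurableType d1) (T1' : measurableType d1')
  (T2 : measurableType d2) (T2' : measurableType d2') (R : realType).
Variables (mu : {sigma_finite_measure set T1 -> \bar R})
          (mu' : {sigma_finite_measure set T1' -> \bar R})
          (nu : {sigma_finite_measure set T2 -> \bar R})
          (nu' : {sigma_finite_measure set T2' -> \bar R}).
Variables (X : set T1) (X' : set T1') (Y : set T2) (Y' : set T2') (A p a b : R)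
  (k : (T1 * T1') * (T2 * T2') -> R).

(** For each pair of frozen values (x, y) the slice is bounded by a. Hölder's
    inequality in y costs a power of the measure of Y', and the integration over
    x costs the measure of X'. *)
Lemma Lp_bounded_freeze :
  1 <= p -> 0 < a -> measurable_fun setT k ->
  measurable X -> (mu X < +oo)%E -> measurable X' -> (mu' X' < +oo)%E ->
  measurable Y -> (nu Y < +oo)%E -> measurable Y' -> (nu' Y' < +oo)%E ->
  (forall s x t y, `|k ((s, x), (t, y))| <=
     A * \1_(X `*` X') (s, x) * \1_(Y `*` Y') (t, y)) ->
  (forall x y, Lp_bounded mu nu p (fun z => k ((z.1, x), (z.2, y))) a) ->
  a `^ p * fine (mu' X') * fine (nu' Y') `^ (p - 1) <= b `^ p ->
  Lp_bounded (mu \x mu')%E (nu \x nu')%E p k b.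
Proof.
move=> p1 a0 mk mX Xoo mX' X'oo mY Yoo mY' Y'oo kA ka hb f mf foo.
have p0 : 0 < p by exact: lt_le_trans p1.
have mXX : measurable (X `*` X') by exact: measurableX.
have mYY : measurable (Y `*` Y') by exact: measurableX.
have XXoo : ((mu \x mu') (X `*` X') < +oo)%E.
  by rewrite product_measure1E// lte_mul_pinfty// ge0_fin_numE.
have YYoo : ((nu \x nu') (Y `*` Y') < +oo)%E.
  by rewrite product_measure1E// lte_mul_pinfty// ge0_fin_numE.
have tk : tame_on (mu \x mu')%E (nu \x nu')%E (X `*` X') (Y `*` Y') A k.
  by split => // -[s x] [t y]; exact: kA.
pose G (w : (T1 * T1') * T2') : R := \int[nu]_t (k (w.1, (t, w.2)) * f (t, w.2)).
have mG : measurable_fun setT G.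
  apply: (@measurable_Rintegral_section _ _ _ _ _ nu
    (fun z : (T1 * T1') * T2' * T2 => k (z.1.1, (z.2, z.1.2)) * f (z.2, z.1.2))).
  apply: measurable_funM; apply: measurableT_comp => //.
  - mproj.
  - mproj.
have kE w : kop (nu \x nu')%E k f w = \int[nu']_y G (w, y).
  by rewrite /kop Rintegral_fubini2//; have := tame_integrable w tk p1 mf foo.
have mK : measurable_fun setT (kop (nu \x nu')%E k f).
  rewrite (funext kE); exact: (measurable_Rintegral_section nu' mG).
have mKpow : measurable_fun setT (fun w => (`|kop (nu \x nu')%E k f w| `^ p)%:E).
  exact: measurable_normpow.
have mGs x' s : measurable_fun setT (fun y => G ((s, x'), y)).
  exact: (measurableT_comp mG).
have mGpow : measurable_fun setT (fun w => (`|G w| `^ p)%:E) by exact: measurable_normpow.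
have supp s x y : x \notin X' \/ y \notin Y' -> G ((s, x), y) = 0.
  move=> h; rewrite /G /=; under eq_Rintegral => t _.
    have -> : k (s, x, (t, y)) = 0.
      apply/eqP; rewrite -normr_le0; apply: le_trans (kA _ _ _ _) _.
      rewrite !indicE !in_setX; by case: h => /negbTE ->; rewrite !(andbF, mulr0, mul0r).
    rewrite mul0r; over.
  by rewrite /Rintegral integral0.
pose c := fine (nu' Y') `^ (p - 1).
have c0 : 0 <= c by exact: powR_ge0.
have pt s x : ((`|kop (nu \x nu')%E k f (s, x)| `^ p)%:E <=
    (c * \1_X' x)%:E * \int[nu']_y (`|G ((s, x), y)| `^ p)%:E)%E.
  rewrite kE; have [xX|xX] := boolP (x \in X'); last first.
    have -> : \int[nu']_y G ((s, x), y) = 0.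
      rewrite /Rintegral integral0_eq// => y _; rewrite supp//; by left.
    rewrite normr0 powR0 ?gt_eqF// mule_ge0//.
      by rewrite lee_fin mulr_ge0.
    by apply: integral_ge0 => y _; rewrite lee_fin powR_ge0.
  rewrite indicE xX mulr1; apply: powR_Rintegral_le => // y.
  by move=> yY; rewrite supp//; right; rewrite notin_setE.
have Gle x y : (\int[mu]_s (`|G ((s, x), y)| `^ p)%:E <=
    (a `^ p)%:E * \int[nu]_t (`|f (t, y)| `^ p)%:E)%E.
  have mfy : measurable_fun setT (fun t => f (t, y)).
    exact: (measurableT_comp mf (measurable_pair2 y)).
  exact: Lp_bounded_gt0 a0 (ka x y) mfy.
rewrite /Lpp fubini_tonelli2; last 2 first.
- exact: mKpow.
- by move=> w; rewrite lee_fin powR_ge0.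
apply: (@le_trans _ _ (\int[mu']_x ((c * a `^ p)%:E * Lpp (nu \x nu')%E p f *
    (\1_X' x)%:E))%E).
  apply: ge0_le_integral => //.
  - by move=> x _; apply: integral_ge0 => s _; rewrite lee_fin powR_ge0.
  - apply: measurable_fun_fubini_tonelli_G.
      exact: mKpow.
    by move=> w; rewrite lee_fin powR_ge0.
  - apply: emeasurable_funM => //; apply/measurable_EFinP; exact: measurable_indic.
  move=> x _.
  have mGx : measurable_fun setT (fun z : T1 * T2' => (`|G ((z.1, x), z.2)| `^ p)%:E).
    apply: (measurableT_comp mGpow).
    mproj.
  apply: (@le_trans _ _ (\int[mu]_s ((c * \1_X' x)%:E *
      \int[nu']_y (`|G ((s, x), y)| `^ p)%:E))%E).
    apply: ge0_le_integral => //.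
    - exact: (measurableT_comp mKpow (measurable_pair2 x)).
    - apply: emeasurable_funM => //.
      apply: (measurable_fun_fubini_tonelli_F (fun z : T1 * T2' =>
        (`|G ((z.1, x), z.2)| `^ p)%:E)) => //.
  rewrite ge0_integralZl//; last 3 first.
  - apply: (measurable_fun_fubini_tonelli_F (fun z : T1 * T2' =>
        (`|G ((z.1, x), z.2)| `^ p)%:E)) => //.
  - by move=> s _; apply: integral_ge0 => y _; rewrite lee_fin powR_ge0.
  - by rewrite lee_fin mulr_ge0.
  rewrite mulrC EFinM EFinM -!muleA [(Lpp _ _ _ * _)%E]muleC.
  rewrite [leRHS](_ : _ = ((\1_X' x)%:E * (c%:E * ((a `^ p)%:E * Lpp (nu \x nu')%E p f)))%E); last first.
    by rewrite !muleA; congr (_ * _)%E; rewrite -!EFinM; congr EFin; ring.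
  rewrite lee_wpmul2l ?lee_fin// lee_wpmul2l ?lee_fin//.
  rewrite (fubini_tonelli (fun z : T1 * T2' => (`|G ((z.1, x), z.2)| `^ p)%:E))//=.
  rewrite /Lpp fubini_tonelli2; last 2 first.
  - exact: measurable_normpow.
  - by move=> w; rewrite lee_fin powR_ge0.
  have mf2 : measurable_fun setT (fun y => \int[nu]_t (`|f (t, y)| `^ p)%:E)%E.
    apply: (measurable_fun_fubini_tonelli_G (fun z => (`|f z| `^ p)%:E)).
      exact: measurable_normpow.
    by move=> w; rewrite lee_fin powR_ge0.
  rewrite -ge0_integralZl//; last 2 first.
  - by move=> y _; apply: integral_ge0 => t _; rewrite lee_fin powR_ge0.
  - by rewrite lee_fin powR_ge0.
  apply: ge0_le_integral => //.
  - by move=> y _; apply: integral_ge0 => t _; rewrite lee_fin powR_ge0.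
  - apply: (measurable_fun_fubini_tonelli_G (fun z : T1 * T2' =>
        (`|G ((z.1, x), z.2)| `^ p)%:E)) => //.
  - exact: emeasurable_funM.
rewrite ge0_integralZl//.
- rewrite integral_indic// setIT -[Z in (_ * Z <= _)%E]fineK ?ge0_fin_numE//.
  rewrite -muleA [(Lpp _ _ _ * _)%E]muleC muleA -EFinM lee_wpmul2r ?Lpp_ge0//.
  by rewrite lee_fin; move: hb; rewrite -/c; congr (_ <= _); ring.
- by apply/measurable_EFinP; exact: measurable_indic.
- by rewrite mule_ge0 ?Lpp_ge0// lee_fin mulr_ge0 ?powR_ge0.
Qed.

End freeze.

(** * Distribution functions *)

Section exponential_layers.
Variable R : realType.
Local Notation leb := (@lebesgue_measure R).

Lemma integral_expRN_ge (g c : R) : 0 < g ->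
  (\int[leb]_(u in `[c, +oo[) (g * expR (- (g * u)))%:E = (expR (- (g * c)))%:E)%E.
Proof.
move=> g0.
have dF (x : R) : is_derive x 1 (fun u => - expR (- (g * u)) : R) (g * expR (- (g * x))).
  apply: is_derive_eq; rewrite /GRing.scale /=; ring.
have ce : continuous (fun x : R => expR (- (g * x))).
  move=> x; apply: continuous_comp; last exact: continuous_expR.
  by apply: cvgN; apply: cvgM; [exact: cvg_cst|exact: cvg_id].
rewrite (@ge0_continuous_FTC2y _ _ (fun u => - expR (- (g * u))) c 0).
- by rewrite add0e -EFinN opprK.
- by move=> x _; rewrite mulr_ge0 ?expR_ge0// ltW.
- by apply: continuous_subspaceT => x; apply: cvgM; [exact: cvg_cst|exact: ce].
- rewrite -oppr0; apply: cvgN.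
  by apply: cvg_comp (@cvgr_expR R); exact: gt0_cvgMry.
- by move=> x _; exact: (@ex_derive _ _ _ _ _ _ _ (dF x)).
- by apply: cvg_at_right_filter; apply: cvgN; exact: ce.
- by move=> x _; rewrite derive1E; exact: (@derive_val _ _ _ _ _ _ _ (dF x)).
Qed.

Lemma integral_expR_le (g c : R) : 0 < g ->
  (\int[leb]_(u in `]-oo, c]) (g * expR (g * u))%:E = (expR (g * c))%:E)%E.
Proof.
move=> g0; rewrite -{1}[c]opprK ge0_integration_by_substitutionNy.
- rewrite (_ : (fun u => _) = (fun u => (g * expR (- (g * u)))%:E)).
    by rewrite integral_expRN_ge// mulrN opprK.
  by apply/funext => u /=; rewrite mulrN.
- apply: continuous_subspaceT => x.
  apply: cvgM; first exact: cvg_cst.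
  apply: continuous_comp; last exact: continuous_expR.
  by apply: cvgM; [exact: cvg_cst|exact: cvg_id].
- by move=> x _; rewrite mulr_ge0 ?expR_ge0// ltW.
Qed.

Lemma integral_layer_le (g t : R) : 0 < g -> 0 <= t ->
  (\int[leb]_u (g * expR (g * u) * (expR u <= t)%R%:R)%:E = (t `^ g)%:E)%E.
Proof.
move=> g0; rewrite le_eqVlt => /predU1P[<-|t0].
  rewrite powR0 ?gt_eqF// integral0_eq// => u _.
  by rewrite leNgt expR_gt0 mulr0.
rewrite /powR gt_eqF// -integral_expR_le// [RHS]integral_mkcond.
apply: eq_integral => u _; rewrite patchE mem_setE in_itv /=.
have -> : (u <= ln t) = (expR u <= t) by rewrite -[LHS]ler_expR lnK ?posrE.
by case: ifPn => _; rewrite ?mulr1 ?mulr0.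
Qed.

Lemma integral_layer_ge (g t : R) : 0 < g -> 0 < t ->
  (\int[leb]_u (g * expR (- (g * u)) * (t <= expR u)%R%:R)%:E = (t `^ (- g))%:E)%E.
Proof.
move=> g0 t0; rewrite /powR gt_eqF// mulNr -integral_expRN_ge// [RHS]integral_mkcond.
apply: eq_integral => u _; rewrite patchE mem_setE in_itv /= andbT.
have -> : (ln t <= u) = (t <= expR u) by rewrite -[LHS]ler_expR lnK ?posrE.
by case: ifPn => _; rewrite ?mulr1 ?mulr0.
Qed.

End exponential_layers.

Section layer_cake.
Context d1 d2 (T1 : measurableType d1) (T2 : measurableType d2) (R : realType).
Variables (mu : {sigma_finite_measure set T1 -> \bar R})
          (nu : {sigma_finite_measure set T2 -> \bar R}).
Local Notation leb := (@lebesgue_measure R).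

(** The distribution function of g is integrated against p s^p ds / s, where s =
    exp u; the two integrals over u converge because r0 < p < r1. The high and
    low parts of f, cut at the height alpha s, have already been separated in
    the hypothesis on the distribution function, so that the lemma serves the
    interpolation on both sides of 2. *)
Lemma distribution_interpolation (g : T1 -> R) (f : T2 -> R)
    (A B r0 r1 p alpha : R) :
  measurable_fun setT g -> measurable_fun setT f ->
  0 <= A -> 0 <= B -> 0 < r0 < p -> p < r1 -> 0 < alpha ->
  (forall u : R, (mu [set x | (expR u <= `|g x|)%R] <= \int[nu]_y
     (A * expR (- (r0 * u)) * (`|f y| `^ r0 * (alpha * expR u <= `|f y|)%R%:R) +
      B * expR (- (r1 * u)) * (`|f y| `^ r1 * (`|f y| <= alpha * expR u)%R%:R))%:E)%E) ->
  (Lpp mu p g <= (A * p / (p - r0) * alpha `^ (r0 - p) +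
                  B * p / (r1 - p) * alpha `^ (r1 - p))%:E * Lpp nu p f)%E.
Proof.
move=> mg mf A0 B0 /andP[r00 r0p] pr1 al0 tail.
have p0 : 0 < p by exact: lt_trans r0p.
have mexpm (c : R) : measurable_fun setT (fun u => expR (c * u)).
  by apply: (measurableT_comp (@measurable_expR R)); exact: mulrl_measurable.
pose W (z : R * T2) : R :=
  A * expR (- (r0 * z.1)) * (`|f z.2| `^ r0 * (alpha * expR z.1 <= `|f z.2|)%R%:R) +
  B * expR (- (r1 * z.1)) * (`|f z.2| `^ r1 * (`|f z.2| <= alpha * expR z.1)%R%:R).
have W0 z : 0 <= W z by rewrite /W addr_ge0// !mulr_ge0 ?expR_ge0.
pose H (z : R * T2) : R := p * expR (p * z.1) * W z.
have H0 z : 0 <= H z by rewrite /H !mulr_ge0 ?expR_ge0 ?(ltW p0).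
have mfz : measurable_fun setT (fun z : R * T2 => `|f z.2|).
  by apply: measurableT_comp => //; exact: measurableT_comp.
have mez (c : R) : measurable_fun setT (fun z : R * T2 => expR (c * z.1)).
  exact: (measurableT_comp (mexpm c)).
have mez1 : measurable_fun setT (fun z : R * T2 => alpha * expR z.1).
  by apply: measurable_funM => //; apply: measurableT_comp.
have mb d (T : measurableType d) (a b : T -> R) : measurable_fun setT a ->
    measurable_fun setT b -> measurable_fun setT (fun z => (a z <= b z)%R%:R : R).
  move=> ma mb; apply: (measurableT_comp (f := fun c : bool => c%:R : R)) => //.
  exact: measurable_fun_ler.
have mezN (c : R) : measurable_fun setT (fun z : R * T2 => expR (- (c * z.1))).
  by under eq_fun do rewrite -mulNr; exact: mez.
have mW : measurable_fun setT W.
  apply: measurable_funD; apply: measurable_funM.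
  - exact: measurable_funM.
  - apply: measurable_funM; last exact: mb.
    exact: (measurableT_comp (@measurable_powR R _)).
  - exact: measurable_funM.
  - apply: measurable_funM; last exact: mb.
    exact: (measurableT_comp (@measurable_powR R _)).
have mH : measurable_fun setT H.
  by apply: measurable_funM => //; exact: measurable_funM.
pose L (z : T1 * R) : R := p * expR (p * z.2) * (expR z.2 <= `|g z.1|)%R%:R.
have mL : measurable_fun setT L.
  apply: measurable_funM.
    apply: measurable_funM; first exact: measurable_cst.
    exact: (measurableT_comp (mexpm p)).
  apply: mb.
    by apply: measurableT_comp.
  by apply: measurableT_comp => //; exact: measurableT_comp.
have -> : Lpp mu p g = (\int[mu]_x \int[leb]_u (L (x, u))%:E)%E.
  by apply: eq_integral => x _; rewrite -integral_layer_le.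
rewrite (@fubini_tonelli _ _ _ _ _ mu leb (fun z => (L z)%:E)); last 2 first.
- exact/measurable_EFinP.
- by move=> z; rewrite lee_fin !mulr_ge0 ?expR_ge0 ?(ltW p0).
apply: (@le_trans _ _ (\int[leb]_u \int[nu]_y (H (u, y))%:E)%E).
  apply: ge0_le_integral => //.
  - move=> u _; apply: integral_ge0 => x _.
    by rewrite lee_fin !mulr_ge0 ?expR_ge0 ?(ltW p0).
  - apply: (measurable_fun_fubini_tonelli_G (fun z => (L z)%:E)).
      exact/measurable_EFinP.
    by move=> z; rewrite lee_fin !mulr_ge0 ?expR_ge0 ?(ltW p0).
  - apply: (measurable_fun_fubini_tonelli_F (fun z => (H z)%:E)).
      exact/measurable_EFinP.
    by move=> z; rewrite lee_fin.
  move=> u _.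
  have mE : measurable [set x | (expR u <= `|g x|)%R].
    rewrite -[X in measurable X]setTI.
    rewrite (_ : _ `&` _ = setT `&` (fun x => expR u <= `|g x|) @^-1` [set true]) ; last by [].
    apply: measurable_fun_ler => //.
    exact: measurableT_comp.
  have -> : (\int[mu]_x (L (x, u))%:E = (p * expR (p * u))%:E * mu [set x | (expR u <= `|g x|)%R])%E.
    rewrite -[X in (_ * mu X)%E]setIT -integral_indic// -ge0_integralZl//.
    - apply: eq_integral => x _; rewrite -EFinM /L /=; congr (_ * _)%:E.
      by rewrite indicE; congr (nat_of_bool _)%:R; apply/idP/idP => [|/set_mem//]; rewrite inE.
    - by apply/measurable_EFinP; exact: measurable_indic.
    - by rewrite lee_fin mulr_ge0 ?expR_ge0 ?(ltW p0).
  have -> : (\int[nu]_y (H (u, y))%:E =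
      (p * expR (p * u))%:E * \int[nu]_y (W (u, y))%:E)%E.
    rewrite -ge0_integralZl//.
    - apply/measurable_EFinP; exact: (measurableT_comp mW (measurable_pair1 u)).
    - by move=> y _; rewrite lee_fin.
    - by rewrite lee_fin mulr_ge0 ?expR_ge0 ?(ltW p0).
  by rewrite lee_wpmul2l ?tail// lee_fin mulr_ge0 ?expR_ge0 ?(ltW p0).
rewrite (@fubini_tonelli _ _ _ _ _ leb nu (fun z => (H z)%:E)); last 2 first.
- exact/measurable_EFinP.
- by move=> z; rewrite lee_fin.
have mnp := measurable_normpow p mf.
rewrite /Lpp -ge0_integralZl//; last first.
  by rewrite lee_fin addr_ge0// mulr_ge0 ?powR_ge0// divr_ge0 ?mulr_ge0 ?(ltW p0)// subr_ge0 ltW.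
apply: ge0_le_integral => //.
- by move=> y _; apply: integral_ge0 => u _; rewrite lee_fin.
- apply: (@measurable_fun_fubini_tonelli_G _ _ _ _ _ leb (fun z => (H z)%:E)).
    exact/measurable_EFinP.
  by move=> z; rewrite lee_fin.
- by apply: emeasurable_funM => //; exact: measurable_normpow.
move=> y _; have [fy0|fy0] := eqVneq (f y) 0.
  rewrite integral0_eq => [|u _].
    by rewrite mule_ge0 ?lee_fin ?powR_ge0// addr_ge0// mulr_ge0 ?powR_ge0// divr_ge0 ?mulr_ge0 ?(ltW p0)// subr_ge0 ltW.
  rewrite /H /W /= fy0 normr0 !powR0 ?gt_eqF//; last exact: lt_trans pr1.
  by rewrite !(mul0r, mulr0, addr0).
set t := `|f y|; have t0 : 0 < t by rewrite normr_gt0.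
have pr0 : 0 < p - r0 by rewrite subr_gt0.
have r1p : 0 < r1 - p by rewrite subr_gt0.
have ta0 : 0 < t / alpha by rewrite divr_gt0.
pose c0 := A * t `^ r0 * p / (p - r0); pose c1 := B * t `^ r1 * p / (r1 - p).
have c00 : 0 <= c0 by rewrite /c0 divr_ge0 ?mulr_ge0 ?powR_ge0 ?(ltW p0) ?(ltW pr0).
have c10 : 0 <= c1 by rewrite /c1 divr_ge0 ?mulr_ge0 ?powR_ge0 ?(ltW p0) ?(ltW r1p).
have HE u : (H (u, y))%:E =
   (c0%:E * ((p - r0) * expR ((p - r0) * u) * (expR u <= t / alpha)%R%:R)%:E +
    c1%:E * ((r1 - p) * expR (- ((r1 - p) * u)) * (t / alpha <= expR u)%R%:R)%:E)%E.
  rewrite -!EFinM -EFinD /H /W /= -/t.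
  rewrite ler_pdivlMr// ler_pdivrMr// ![alpha * _]mulrC.
  have -> : expR ((p - r0) * u) = expR (p * u) * expR (- (r0 * u)).
    by rewrite -expRD; congr expR; ring.
  have -> : expR (- ((r1 - p) * u)) = expR (p * u) * expR (- (r1 * u)).
    by rewrite -expRD; congr expR; ring.
  by congr EFin; rewrite /c0 /c1; field; rewrite ?gt_eqF.
under eq_integral do rewrite HE.
have mexp (c : R) : measurable_fun setT (fun u : R => expR (- (c * u))).
  by under eq_fun do rewrite -mulNr; exact: mexpm.
have m0 : measurable_fun setT (fun u : R =>
    ((p - r0) * expR ((p - r0) * u) * (expR u <= t / alpha)%R%:R)%:E).
  apply/measurable_EFinP; apply: measurable_funM; last exact: mb.
  by apply: measurable_funM => //; exact: mexpm.
have m1 : measurable_fun setT (fun u : R =>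
    ((r1 - p) * expR (- ((r1 - p) * u)) * (t / alpha <= expR u)%R%:R)%:E).
  apply/measurable_EFinP; apply: measurable_funM; last exact: mb.
  by apply: measurable_funM => //; exact: mexp.
have n0 (u : R) : (0 <= ((p - r0) * expR ((p - r0) * u) * (expR u <= t / alpha)%R%:R)%:E)%E.
  by rewrite lee_fin !mulr_ge0 ?expR_ge0 ?(ltW pr0).
have n1 (u : R) :
    (0 <= ((r1 - p) * expR (- ((r1 - p) * u)) * (t / alpha <= expR u)%R%:R)%:E)%E.
  by rewrite lee_fin !mulr_ge0 ?expR_ge0 ?(ltW r1p).
rewrite ge0_integralD//; last 4 first.
- by move=> u _; apply: mule_ge0; [rewrite lee_fin|exact: n0].
- exact: emeasurable_funM.
- by move=> u _; apply: mule_ge0; [rewrite lee_fin|exact: n1].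
- exact: emeasurable_funM.
rewrite !ge0_integralZl//.
rewrite integral_layer_le ?(ltW ta0)// integral_layer_ge// -!EFinM -EFinD lee_fin.
have hta (q : R) : (t / alpha) `^ q = t `^ q * alpha `^ (- q).
  by rewrite powRM ?(ltW t0) ?invr_ge0 ?(ltW al0)// -powR_inv1 ?(ltW al0)// -powRrM mulN1r.
have ht r : t `^ r * t `^ (p - r) = t `^ p.
  by rewrite -powRD ?(gt_eqF t0) ?implybT//; congr (_ `^ _); ring.
rewrite !hta opprK !opprB /c0 /c1 -[X in _ <= X]mulrC mulrDr.
rewrite -{1}(ht r0) -(ht r1) -/t le_eqVlt; apply/orP; left; apply/eqP; ring.
Qed.

End layer_cake.

(** * Interpolation with L^2 *)

Lemma invr_powR (R : realType) (a q : R) : 0 <= a -> a^-1 `^ q = a `^ (- q).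
Proof. by move=> a0; rewrite -(powR_inv1 a0) -powRrM mulN1r. Qed.

Lemma expR2N (R : realType) (u : R) : expR (- (2 * u)) = (expR u ^+ 2)^-1.
Proof. by rewrite expRN mulr_natl mulr2n expRD expr2. Qed.

Lemma integrable_cindic d (T : measurableType d) (R : realType)
    (mu : {measure set T -> \bar R}) (Y : set T) (c : R) :
  measurable Y -> (mu Y < +oo)%E ->
  mu.-integrable setT (EFin \o (fun y => c * \1_Y y)).
Proof.
move=> mY Yoo.
rewrite (_ : _ \o _ = (fun y => c%:E * (\1_Y y)%:E)%E); last first.
  by apply/funext => y /=; rewrite EFinM.
apply: integrableZl => //; apply/integrableP; split.
  exact/measurable_EFinP/measurable_indic.
under eq_integral do rewrite gee0_abs ?lee_fin//.
by rewrite integral_indic// setIT.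
Qed.

Lemma powR_prod3 (R : realType) (K u v p a b : R) :
  0 <= K -> 0 <= u -> 0 <= v -> 0 < p ->
  (K `^ p^-1 * u `^ (a / p) * v `^ (b / p)) `^ p = K * u `^ a * v `^ b.
Proof.
move=> K0 u0 v0 p0.
rewrite !powRM ?mulr_ge0 ?powR_ge0// -!powRrM !divfK ?gt_eqF//.
by rewrite mulVf ?gt_eqF// powRr1.
Qed.

Lemma chebyshev2 d (T : measurableType d) (R : realType)
    (mu : {measure set T -> \bar R}) (E : set T) (g h : T -> R) (r s c c' : R) :
  measurable E -> measurable_fun setT g -> measurable_fun setT h ->
  0 <= c -> 0 <= c' ->
  (forall x, E x -> 1 <= c * `|g x| `^ r + c' * `|h x| `^ s) ->
  (mu E <= c%:E * Lpp mu r g + c'%:E * Lpp mu s h)%E.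
Proof.
move=> mE mg mh c0 c'0 pt.
have mgr := measurable_normpow r mg; have mhs := measurable_normpow s mh.
rewrite /Lpp -!ge0_integralZl//.
rewrite -ge0_integralD//; last 4 first.
- by move=> x _; rewrite mule_ge0// lee_fin powR_ge0.
- exact: emeasurable_funM.
- by move=> x _; rewrite mule_ge0// lee_fin powR_ge0.
- exact: emeasurable_funM.
rewrite -[mu E]/(mu E) -(setIT E) -integral_indic//.
apply: ge0_le_integral => //.
- exact/measurable_EFinP/measurable_indic.
- by apply: emeasurable_funD; exact: emeasurable_funM.
move=> x _; rewrite -!EFinM -EFinD lee_fin indicE.
have [xE|_] := boolP (x \in E); first by apply: pt; exact/set_mem.
by rewrite addr_ge0 ?mulr_ge0 ?powR_ge0.
Qed.

Section interpolation.
Context d1 d2 (T1 : measurableType d1) (T2 : measurableType d2) (R : realType).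
Variables (mu : {sigma_finite_measure set T1 -> \bar R})
          (nu : {sigma_finite_measure set T2 -> \bar R}).
Variables (k : T1 * T2 -> R) (X : set T1) (Y : set T2) (A l N2 p : R).
Hypothesis tk : tame_on mu nu X Y A k.
Hypothesis A0 : 0 < A.
Hypothesis l0 : 0 < l.
Hypothesis N20 : 0 < N2.
Hypothesis Xl : (mu X <= l%:E)%E.
Hypothesis Yl : (nu Y <= l%:E)%E.
Hypothesis k2 : Lp_bounded mu nu 2 k N2.
Let N : R := A * l.
Let N0 : 0 < N. Proof. exact: mulr_gt0. Qed.
Let mk : measurable_fun setT k. Proof. by case: tk. Qed.

Let fineXl : fine (mu X) <= l.
Proof.
by case: tk => _ [_ Xoo] _ _; rewrite -lee_fin fineK// ge0_fin_numE.
Qed.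

Let fineYl : fine (nu Y) <= l.
Proof.
by case: tk => _ _ [_ Yoo] _; rewrite -lee_fin fineK// ge0_fin_numE.
Qed.

Let k1 : Lp_bounded mu nu 1 k N.
Proof.
apply: (tame_Lp_bounded _ (ltW A0) tk) => //.
rewrite subrr powRr0 mulr1 !powRr1 ?(ltW A0) ?(ltW N0)//.
by rewrite ler_wpM2l ?(ltW A0).
Qed.

Let koo (f : T2 -> R) (s : R) x : measurable_fun setT f -> 0 <= s -> (forall y, `|f y| <= s) ->
  `|kop nu k f x| <= N * s.
Proof.
move=> mf s0 fs; have [_ _ [mY Yoo] kA] := tk.
have i1 := integrable_cindic (A * s) mY Yoo.
have le1 y : `|k (x, y) * f y| <= A * s * \1_Y y.
  rewrite normrM; apply: le_trans (ler_pM _ _ (kA x y) (fs y)) _ => //.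
  rewrite -!mulrA ler_wpM2l ?(ltW A0)// mulrCA [s * _]mulrC.
  by rewrite ler_wpM2l// ler_piMl// indicE; case: (_ \in _).
have i0 : nu.-integrable setT (EFin \o (fun y => k (x, y) * f y)).
  apply: le_integrable i1 => //.
    by apply/measurable_EFinP; apply: measurable_funM => //; exact: measurable_section.
  move=> y _ /=; rewrite lee_fin (le_trans (le1 y))// ler_norm//.
apply: le_trans (le_normr_Rintegral _ i0) _ => //.
apply: (@le_trans _ _ (\int[nu]_y (A * s * \1_Y y))).
  by apply: le_Rintegral => //; exact: integrable_norm.
rewrite RintegralZl//; last first.
  have := integrable_cindic 1 mY Yoo; apply: eq_integrable => // y _ /=.
  by rewrite mul1r.
rewrite /Rintegral integral_indic// setIT /N.
by rewrite mulrAC ler_wpM2r// ler_wpM2l ?(ltW A0).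
Qed.

Let high (f : T2 -> R) (u al : R) y : R := (al * expR u <= `|f y|)%R%:R * f y.
Let low (f : T2 -> R) (u al : R) y : R := (~~ (al * expR u <= `|f y|)%R)%:R * f y.

Let highE f u al y r : r != 0 ->
  `|high f u al y| `^ r = `|f y| `^ r * (al * expR u <= `|f y|)%R%:R.
Proof.
move=> r0; rewrite /high; case: (al * _ <= _); first by rewrite mul1r mulr1.
by rewrite mul0r normr0 powR0// mulr0.
Qed.

Let lowE f u al y r : r != 0 ->
  `|low f u al y| `^ r <= `|f y| `^ r * (`|f y| <= al * expR u)%R%:R.
Proof.
move=> r0; rewrite /low; case: (leP (al * expR u) `|f y|) => h /=.
  by rewrite mul0r normr0 powR0// mulr_ge0 ?powR_ge0.
by rewrite mul1r (ltW h) mulr1.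
Qed.

Let mle (f : T2 -> R) (c : R) : measurable_fun setT f -> measurable_fun setT (fun y : T2 => (c <= `|f y|)%R).
Proof.
by move=> mf; apply: measurable_fun_ler => //; exact: measurableT_comp.
Qed.

Let mhigh f u al : measurable_fun setT f -> measurable_fun setT (high f u al).
Proof.
move=> mf; apply: measurable_funM => //.
by apply: (measurableT_comp (f := fun c : bool => c%:R : R)) => //; exact: mle.
Qed.

Let mlow f u al : measurable_fun setT f -> measurable_fun setT (low f u al).
Proof.
move=> mf; apply: measurable_funM => //.
by apply: (measurableT_comp (f := fun c : bool => (~~ c)%:R : R)) => //; exact: mle.
Qed.

Let split f u al x : 1 <= p -> measurable_fun setT f -> (Lpp nu p f < +oo)%E ->
  kop nu k f x = kop nu k (high f u al) x + kop nu k (low f u al) x.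
Proof.
move=> p1 mf foo; have p0 : 0 <= p by exact: le_trans p1.
rewrite /kop -RintegralD//.
- apply: eq_Rintegral => y _; rewrite /high /low -mulrDr -mulrDl.
  by case: (_ <= _); rewrite ?addr0 ?add0r mul1r.
- apply: tame_integrable tk p1 (mhigh u al mf) _.
  apply: le_lt_trans foo; apply: le_Lpp => //; first exact: mhigh.
  by move=> y; rewrite /high /low; case: (al * _ <= _); rewrite ?mul1r ?mul0r ?normr0.
- apply: tame_integrable tk p1 (mlow u al mf) _.
  apply: le_lt_trans foo; apply: le_Lpp => //; first exact: mlow.
  by move=> y; rewrite /high /low; case: (al * _ <= _); rewrite ?mul1r ?mul0r ?normr0.
Qed.

Let mset (f : T2 -> R) (u : R) : measurable_fun setT f -> measurable [set x | (expR u <= `|kop nu k f x|)%R].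
Proof.
move=> mf; rewrite -[X in measurable X]setTI.
rewrite (_ : _ `&` _ = setT `&` (fun x => expR u <= `|kop nu k f x|) @^-1` [set true]); last by [].
apply: measurable_fun_ler => //; apply: measurableT_comp => //.
exact: measurable_kop.
Qed.

(** Here N = A l bounds the operator on L^oo. Cutting f at the height s / (2 N),
    the low part contributes at most s / 2 to the output, so that the high part,
    which is controlled on L^2, contributes at least s / 2 wherever the output
    exceeds s. *)
Lemma interp_high : 2 < p ->
  Lp_bounded mu nu p k
    ((4 * p / (p - 2) * 2 `^ (p - 2)) `^ p^-1 * N2 `^ (2 / p) * N `^ ((p - 2) / p)).
Proof.
move=> p2 f mf foo.
have p0 : 0 < p by exact: lt_trans p2.
have p20 : 0 < p - 2 by rewrite subr_gt0.
have p1 : 1 <= p by rewrite ltW// (lt_trans _ p2)// ltr1n.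
pose al := (2 * N)^-1; have al0 : 0 < al by rewrite invr_gt0 mulr_gt0.
have := @distribution_interpolation _ _ _ _ R mu nu (kop nu k f) f
  (4 * N2 `^ 2) 0 2 (p + 1) p al (measurable_kop _ mk mf) mf.
have pp1 : p < p + 1 by rewrite ltrDl.
rewrite mulr_ge0 ?powR_ge0// lexx p2 pp1 al0 !mul0r addr0 andbT ltr0n.
move=> /(_ isT isT isT isT isT) H.
apply: le_trans (H _) _; last first.
  rewrite lee_wpmul2r ?Lpp_ge0// lee_fin powR_prod3 ?(ltW N20) ?(ltW N0)//; last first.
    by rewrite !mulr_ge0 ?invr_ge0 ?powR_ge0 ?(ltW p0) ?(ltW p20).
  have -> : al `^ (2 - p) = 2 `^ (p - 2) * N `^ (p - 2).
    by rewrite -powRM ?(ltW N0)// /al invr_powR ?opprB// mulr_ge0 ?(ltW N0).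
  by rewrite le_eqVlt; apply/orP; left; apply/eqP; ring.
move=> u; under eq_integral do rewrite !mul0r addr0.
have e0 := expR_gt0 u.
have pt x : expR u <= `|kop nu k f x| ->
    1 <= 4 * expR (- (2 * u)) * `|kop nu k (high f u al) x| `^ 2.
  rewrite (split u al x p1 mf foo) => h.
  have h2 : `|kop nu k (low f u al) x| <= N * (al * expR u).
    apply: koo; first exact: mlow.
      by rewrite mulr_ge0 ?expR_ge0 ?(ltW al0).
    move=> y; rewrite /low; case: (leP (al * expR u) `|f y|) => h1 /=; first by rewrite mul0r normr0 mulr_ge0 ?expR_ge0 ?(ltW al0).
    by rewrite mul1r ltW.
  have E2 : N * (al * expR u) = expR u / 2.
    by rewrite /al; field; rewrite gt_eqF.
  have h3 : expR u / 2 <= `|kop nu k (high f u al) x|.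
    have := ler_normD (kop nu k (high f u al) x) (kop nu k (low f u al) x); lra.
  rewrite powR_mulrn//.
  have -> : 4 * expR (- (2 * u)) = (expR u / 2) ^- 2.
    rewrite expR2N; field.
    by rewrite gt_eqF.
  have e2 : 0 < (expR u / 2) ^+ 2 by apply: exprn_gt0; rewrite divr_gt0.
  rewrite mulrC (ler_pdivlMr _ _ e2) mul1r.
  by rewrite ler_sqr ?nnegrE ?divr_ge0 ?expR_ge0.
have mh := mhigh u al mf; have mT := measurable_kop (T1 := T1) nu mk mh.
have pt' x : expR u <= `|kop nu k f x| -> 1 <= 4 * expR (- (2 * u)) *
    `|kop nu k (high f u al) x| `^ 2 + 0 * `|(cst 0 : T1 -> R) x| `^ 1.
  by move=> h; rewrite mul0r addr0; exact: pt.
have c0 : 0 <= 4 * expR (- (2 * u)) by rewrite mulr_ge0 ?expR_ge0.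
apply: le_trans (@chebyshev2 _ _ _ mu _ _ _ _ _ _ _ (mset u mf) mT (measurable_cst _)
  c0 (lexx 0) pt') _.
rewrite mul0e adde0.
apply: le_trans (lee_wpmul2l _ (Lp_bounded_gt0 N20 k2 mh)) _.
  by rewrite lee_fin mulr_ge0 ?expR_ge0.
rewrite muleA -EFinM /Lpp -ge0_integralZl//; last 2 first.
- exact: measurable_normpow.
- by rewrite lee_fin !mulr_ge0 ?expR_ge0 ?powR_ge0.
rewrite le_eqVlt; apply/orP; left; apply/eqP; apply: eq_integral => y _.
by rewrite -EFinM highE ?pnatr_eq0//; congr EFin; ring.
Qed.

(** Marcinkiewicz interpolation between L^1, where the norm is at most N, and
    L^2. The height alpha = N / N2^2 balances the two contributions. *)
Lemma interp_low : 1 < p < 2 ->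
  Lp_bounded mu nu p k
    ((2 * p / (p - 1) + 4 * p / (2 - p)) `^ p^-1 *
       N2 `^ (2 * (p - 1) / p) * N `^ ((2 - p) / p)).
Proof.
move=> /andP[p1 p2] f mf foo.
have p0 : 0 < p by exact: lt_trans p1.
have p10 : 0 < p - 1 by rewrite subr_gt0.
have p20 : 0 < 2 - p by rewrite subr_gt0.
pose al := N / N2 `^ 2; have al0 : 0 < al by rewrite divr_gt0 ?powR_gt0.
have := @distribution_interpolation _ _ _ _ R mu nu (kop nu k f) f
  (2 * N) (4 * N2 `^ 2) 1 2 p al (measurable_kop _ mk mf) mf.
rewrite mulr_ge0 ?(ltW N0)// mulr_ge0 ?powR_ge0// p1 p2 al0 ltr01.
move=> /(_ isT isT isT isT isT) H.
apply: le_trans (H _) _; last first.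
  rewrite lee_wpmul2r ?Lpp_ge0// lee_fin powR_prod3 ?(ltW N20) ?(ltW N0)//; last first.
    by rewrite addr_ge0 ?mulr_ge0 ?invr_ge0 ?(ltW p0) ?(ltW p10) ?(ltW p20).
  have ale q : al `^ q = N `^ q * N2 `^ (- (2 * q)).
    rewrite /al powRM ?(ltW N0) ?invr_ge0 ?powR_ge0//; congr (_ * _).
    by rewrite -powRN -powRrM; congr (_ `^ _); ring.
  have NE : N * N `^ (1 - p) = N `^ (2 - p).
    rewrite -{1}[N]powRr1 ?(ltW N0)// -powRD ?(gt_eqF N0) ?implybT//.
    by congr (_ `^ _); ring.
  have N2E : N2 `^ 2 * N2 `^ (- (2 * (2 - p))) = N2 `^ (2 * (p - 1)).
    by rewrite -powRD ?(gt_eqF N20) ?implybT//; congr (_ `^ _); ring.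
  have -> : 2 * N * p / (p - 1) * al `^ (1 - p) =
      2 * p / (p - 1) * N2 `^ (2 * (p - 1)) * N `^ (2 - p).
    rewrite ale -NE (_ : - (2 * (1 - p)) = 2 * (p - 1)); ring.
  have -> : 4 * N2 `^ 2 * p / (2 - p) * al `^ (2 - p) =
      4 * p / (2 - p) * N2 `^ (2 * (p - 1)) * N `^ (2 - p).
    rewrite ale -N2E; ring.
  by rewrite le_eqVlt; apply/orP; left; apply/eqP; ring.
move=> u; have e0 := expR_gt0 u.
have pt x : expR u <= `|kop nu k f x| ->
    1 <= 2 * expR (- (1 * u)) * `|kop nu k (high f u al) x| `^ 1 +
         4 * expR (- (2 * u)) * `|kop nu k (low f u al) x| `^ 2.
  rewrite (split u al x (ltW p1) mf foo) => h.
  set a := `|kop nu k (high f u al) x|; set b := `|kop nu k (low f u al) x|.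
  have a0 : 0 <= a by exact: normr_ge0.
  have b0 : 0 <= b by exact: normr_ge0.
  have hab : expR u <= a + b by apply: le_trans h (ler_normD _ _).
  rewrite powR_mulrn// powRr1// mul1r.
  have -> : 4 * expR (- (2 * u)) * b ^+ 2 = (2 * b / expR u) ^+ 2.
    rewrite expR2N; field.
    by rewrite gt_eqF.
  have -> : 2 * expR (- u) * a = 2 * a / expR u by rewrite expRN; field; rewrite gt_eqF.
  have [ha|ha] := leP (expR u / 2) a.
    have : 1 <= 2 * a / expR u by rewrite ler_pdivlMr// mul1r; lra.
    by have := sqr_ge0 (2 * b / expR u); lra.
  have hb : 1 <= 2 * b / expR u by rewrite ler_pdivlMr// mul1r; lra.
  have : 1 <= (2 * b / expR u) ^+ 2 by rewrite expr_ge1//; lra.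
  have : 0 <= 2 * a / expR u by rewrite divr_ge0 ?mulr_ge0 ?(ltW e0).
  lra.
have mh := mhigh u al mf; have mTh := measurable_kop (T1 := T1) nu mk mh.
have ml := mlow u al mf; have mTl := measurable_kop (T1 := T1) nu mk ml.
have E1 : (0 <= 2 * expR (- (1 * u)))%R by rewrite mulr_ge0 ?expR_ge0.
have E2 : (0 <= 4 * expR (- (2 * u)))%R by rewrite mulr_ge0 ?expR_ge0.
apply: le_trans (@chebyshev2 _ _ _ mu _ _ _ _ _ _ _ (mset u mf) mTh mTl E1 E2 pt) _.
have S1 := lee_wpmul2l (x := (2 * expR (- (1 * u)))%:E) E1 (Lp_bounded_gt0 N0 k1 mh).
have S2 := lee_wpmul2l (x := (4 * expR (- (2 * u)))%:E) E2 (Lp_bounded_gt0 N20 k2 ml).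
apply: le_trans (leeD S1 S2) _.
rewrite !muleA -!EFinM /Lpp -!ge0_integralZl//; last 4 first.
- exact: measurable_normpow.
- by rewrite lee_fin !mulr_ge0 ?expR_ge0 ?powR_ge0.
- exact: measurable_normpow.
- by rewrite lee_fin !mulr_ge0 ?expR_ge0 ?powR_ge0.
rewrite -ge0_integralD//; last 4 first.
- by move=> y _; rewrite mule_ge0 ?lee_fin ?powR_ge0 ?mulr_ge0 ?expR_ge0 ?powR_ge0.
- by apply: emeasurable_funM => //; exact: measurable_normpow.
- by move=> y _; rewrite mule_ge0 ?lee_fin ?powR_ge0 ?mulr_ge0 ?expR_ge0 ?powR_ge0.
- by apply: emeasurable_funM => //; exact: measurable_normpow.
apply: ge0_le_integral => //.
- by move=> y _; rewrite adde_ge0 ?mule_ge0 ?lee_fin ?mulr_ge0 ?expR_ge0 ?powR_ge0.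
- by apply: emeasurable_funD; apply: emeasurable_funM => //; exact: measurable_normpow.
- apply/measurable_EFinP; apply: measurable_funD; apply: measurable_funM => //.
    apply: measurable_funM; first by apply: (measurableT_comp (@measurable_powR R _)); exact: measurableT_comp.
    by apply: (measurableT_comp (f := fun c : bool => c%:R : R)) => //; exact: mle.
  apply: measurable_funM; first by apply: (measurableT_comp (@measurable_powR R _)); exact: measurableT_comp.
  apply: (measurableT_comp (f := fun c : bool => c%:R : R)) => //.
  by apply: measurable_fun_ler => //; exact: measurableT_comp.
move=> y _; rewrite -!EFinM -EFinD lee_fin highE ?oner_eq0//.
have -> : N `^ 1 = N by rewrite powRr1 ?(ltW N0).
apply: lerD.
  by rewrite le_eqVlt; apply/orP; left; apply/eqP; ring.
rewrite (mulrAC 4) ler_wpM2l ?mulr_ge0 ?powR_ge0 ?expR_ge0//.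
by apply: lowE; rewrite pnatr_eq0.
Qed.

End interpolation.

Definition interp_cst (R : realType) (p : R) : R :=
  if p < 2 then (2 * p / (p - 1) + 4 * p / (2 - p)) `^ p^-1
  else if 2 < p then (4 * p / (p - 2) * 2 `^ (p - 2)) `^ p^-1 else 1.

Lemma interp_cst_gt0 (R : realType) (p : R) : 1 < p -> 0 < interp_cst p.
Proof.
move=> p1; have p0 : 0 < p by exact: lt_trans p1.
rewrite /interp_cst; case: (ltP p 2) => p2.
  by rewrite powR_gt0// addr_gt0// divr_gt0 ?mulr_gt0 ?subr_gt0.
case: (ltP 2 p) => // p2'; rewrite powR_gt0// mulr_gt0 ?powR_gt0//.
by rewrite divr_gt0 ?mulr_gt0 ?subr_gt0.
Qed.

(** The exponents on the two sides of 2 agree when written with q, because 2 / q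
    is symmetric in p and p'. *)
Lemma Lp_bounded_interp d1 d2 (T1 : measurableType d1) (T2 : measurableType d2)
    (R : realType) (mu : {sigma_finite_measure set T1 -> \bar R})
    (nu : {sigma_finite_measure set T2 -> \bar R}) (k : T1 * T2 -> R)
    (X : set T1) (Y : set T2) (A l N2 p p' : R) :
  tame_on mu nu X Y A k -> 0 < A -> 0 < l -> 0 < N2 ->
  (mu X <= l%:E)%E -> (nu Y <= l%:E)%E -> Lp_bounded mu nu 2 k N2 ->
  1 < p -> p^-1 + p'^-1 = 1 ->
  let q := Num.max p p' in
  Lp_bounded mu nu p k
    (interp_cst p * N2 `^ (2 / q) * (A * l) `^ (1 - 2 / q)).
Proof.
move=> tk A0 l0 N20 Xl Yl k2 p1 pp' q.
have p0 : 0 < p by exact: lt_trans p1.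
have p10 : 0 < p - 1 by rewrite subr_gt0.
have p'E : p' = p / (p - 1).
  have -> : p' = (1 - p^-1)^-1 by rewrite -pp' addrAC subrr add0r invrK.
  by field; rewrite !gt_eqF.
rewrite /interp_cst; case: (ltgtP p 2) => p2.
- have -> : q = p'.
    by apply/max_idPr; rewrite p'E ler_pdivlMr//; nra.
  rewrite p'E.
  have -> : 2 / (p / (p - 1)) = 2 * (p - 1) / p by field; rewrite !gt_eqF.
  have -> : 1 - 2 * (p - 1) / p = (2 - p) / p by field; rewrite !gt_eqF.
  by apply: (interp_low tk) => //; rewrite p1.
- have -> : q = p.
    by apply/max_idPl; rewrite p'E ler_pdivrMr//; nra.
  have -> : 1 - 2 / p = (p - 2) / p by field; rewrite gt_eqF.
  exact: (interp_high tk).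
have -> : q = 2.
  by rewrite /q p'E p2 (_ : 2 / (2 - 1) = 2) ?maxxx//; field.
rewrite divff// subrr powRr0 powRr1 ?(ltW N20)// mul1r mulr1.
by rewrite p2.
Qed.

(** * Oscillatory integrals in one variable *)

Notation is_derive1 f x d := (is_derive (x : _) (1 : Real.sort _) f d).

Section derivation_rules.
Variable R : realType.
Implicit Types (f g : R -> R) (x a b : R).

Lemma is_derive1_eq f x a b : is_derive1 f x a -> a = b -> is_derive1 f x b.
Proof. by move=> h <-. Qed.

Lemma is_derive1_cst c x : is_derive1 (fun=> c : R) x 0.
Proof. exact: is_derive_cst. Qed.

Lemma is_derive1D f g x a b : is_derive1 f x a -> is_derive1 g x b ->
  is_derive1 (fun y => f y + g y) x (a + b).
Proof. by move=> df dg; exact: is_deriveD. Qed.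

Lemma is_derive1B f g x a b : is_derive1 f x a -> is_derive1 g x b ->
  is_derive1 (fun y => f y - g y) x (a - b).
Proof. by move=> df dg; exact: is_deriveB. Qed.

Lemma is_derive1M f g x a b : is_derive1 f x a -> is_derive1 g x b ->
  is_derive1 (fun y => f y * g y) x (a * g x + f x * b).
Proof.
move=> df dg; have H := is_deriveM df dg.
apply: (@is_derive1_eq (fun y => f y * g y) _ _ _ H).
by rewrite /GRing.scale /=; ring.
Qed.

Lemma is_derive1_cos f x a : is_derive1 f x a ->
  is_derive1 (fun y => cos (f y)) x (- sin (f x) * a).
Proof. by move=> df; exact: (is_derive1_comp (is_derive_cos _) df). Qed.

Lemma is_derive1_continuous f f' : (forall x, is_derive1 f x (f' x)) -> continuous f.
Proof.
move=> df x; apply: differentiable_continuous; apply/derivable1_diffP.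
exact: (@ex_derive _ _ _ _ _ _ _ (df x)).
Qed.

End derivation_rules.

Section van_der_corput.
Variable R : realType.
Local Notation leb := (@lebesgue_measure R).
Variables (P P1 P2 P3 b b1 b2 : R -> R) (al be D K B l : R).
Hypothesis albe : al < be.
Hypothesis dP : forall x, is_derive1 P x (P1 x).
Hypothesis dP1 : forall x, is_derive1 P1 x (P2 x).
Hypothesis dP2 : forall x, is_derive1 P2 x (P3 x).
Hypothesis cP3 : continuous P3.
Hypothesis db : forall x, is_derive1 b x (b1 x).
Hypothesis db1 : forall x, is_derive1 b1 x (b2 x).
Hypothesis cb2 : continuous b2.
Hypothesis D0 : 0 < D.
Hypothesis l0 : 0 < l.
Hypothesis hP1 : forall x, al <= x <= be -> D <= `|P1 x|.
Hypothesis hP2 : forall x, al <= x <= be -> `|P2 x| <= K * D / l.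
Hypothesis hP3 : forall x, al <= x <= be -> `|P3 x| <= K * D / l ^+ 2.
Hypothesis hb : forall x, al <= x <= be -> `|b x| <= B.
Hypothesis hb1 : forall x, al <= x <= be -> `|b1 x| <= B / l.
Hypothesis hb2 : forall x, al <= x <= be -> `|b2 x| <= B / l ^+ 2.
Hypothesis bal : b al = 0 /\ b1 al = 0.
Hypothesis bbe : b be = 0 /\ b1 be = 0.

Let cP : continuous P. Proof. exact: is_derive1_continuous dP. Qed.
Let cP1 : continuous P1. Proof. exact: is_derive1_continuous dP1. Qed.
Let cP2 : continuous P2. Proof. exact: is_derive1_continuous dP2. Qed.
Let cb : continuous b. Proof. exact: is_derive1_continuous db. Qed.
Let cb1 : continuous b1. Proof. exact: is_derive1_continuous db1. Qed.

Let P1n0 x : al <= x <= be -> P1 x != 0.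
Proof. by move=> /hP1 h; rewrite -normr_gt0; exact: lt_le_trans h. Qed.

(** With u = b / P' and v = u' / P', the function sin P * u + cos P * v is an
    antiderivative of cos P * (b + v'). *)
Let v' x := b2 x / P1 x ^+ 2 - 3 * b1 x * P2 x / P1 x ^+ 3
   - b x * P3 x / P1 x ^+ 3 + 3 * b x * P2 x ^+ 2 / P1 x ^+ 4.

Let G x := sin (P x) * (b x / P1 x) +
   cos (P x) * (b1 x / P1 x ^+ 2 - b x * P2 x / P1 x ^+ 3).

Let dG x : al <= x <= be -> is_derive1 G x (cos (P x) * (b x + v' x)).
Proof.
move=> /P1n0 n0.
have n2 : P1 x ^+ 2 != 0 by rewrite expf_neq0.
have n3 : P1 x ^+ 3 != 0 by rewrite expf_neq0.
have dP12 : is_derive1 (fun y => P1 y * P1 y) x (P2 x * P1 x + P1 x * P2 x).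
  exact: is_derive1M.
have dP13 : is_derive1 (fun y => P1 y * P1 y * P1 y) x
    ((P2 x * P1 x + P1 x * P2 x) * P1 x + P1 x * P1 x * P2 x).
  exact: is_derive1M.
have GE : G = (fun y => sin (P y) * (b y * (P1 y)^-1) +
   cos (P y) * (b1 y * (P1 y * P1 y)^-1 - b y * P2 y * (P1 y * P1 y * P1 y)^-1)).
  by apply/funext => y; rewrite /G !exprS expr0 !mulr1 !mulrA.
have n2' : P1 x * P1 x != 0 by rewrite mulf_neq0.
have n3' : P1 x * P1 x * P1 x != 0 by rewrite !mulf_neq0.
rewrite GE; apply: is_derive1_eq.
by rewrite /v' /GRing.scale /=; field.
Qed.

Let cX (f : R -> R) n : continuous f -> continuous (fun x => f x ^+ n).
Proof. move=> cf x; apply: (@continuous_comp _ _ _ f (fun y => y ^+ n) x (cf x)).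
exact: exprn_continuous. Qed.

Let w x := cos (P x) * (b x + v' x).

Let cv' : {within `[al, be], continuous v'}.
Proof.
apply: continuous_in_subspaceT => x; rewrite inE /= in_itv /= => /P1n0 n0.
have cPn n : {for x, continuous (fun y => (P1 y ^+ n)^-1)}.
  by apply: cvgV; [rewrite expf_neq0|exact: cX].
have c3 : {for x, continuous (fun=> 3 : R)} by exact: cst_continuous.
apply: cvgD; [apply: cvgB; [apply: cvgB|]|]; apply: cvgM => //.
- exact: cb2.
- exact: cPn.
- by apply: cvgM; [apply: cvgM; [exact: c3|exact: cb1]|exact: cP2].
- exact: cPn.
- by apply: cvgM; [exact: cb|exact: cP3].
- exact: cPn.
- by apply: cvgM; [apply: cvgM; [exact: c3|exact: cb]|exact: cX].
- exact: cPn.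
Qed.

Let ccP : continuous (fun x => cos (P x)).
Proof.
exact: (is_derive1_continuous (fun x => is_derive1_cos (dP x))). Qed.

Let iw : leb.-integrable `[al, be] (EFin \o (fun x => cos (P x) * v' x)).
Proof.
apply: continuous_compact_integrable; first exact: segment_compact.
by move=> x; apply: cvgM; [exact: continuous_subspaceT|exact: cv'].
Qed.

Let ib : leb.-integrable `[al, be] (EFin \o (fun x => b x * cos (P x))).
Proof.
apply: continuous_compact_integrable; first exact: segment_compact.
by apply: continuous_subspaceT => x; apply: cvgM; [exact: cb|exact: ccP].
Qed.

Let v'_le x : al <= x <= be ->
  `|v' x| <= B * (1 + 4 * K + 3 * K ^+ 2) / (l * D) ^+ 2.
Proof.
move=> xab.
have D1 := hP1 xab; have D2 := hP2 xab; have D3 := hP3 xab.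
have B1 := hb xab; have B2 := hb1 xab; have B3 := hb2 xab.
have pD n : `|P1 x| ^- n <= D ^- n.
  by rewrite lef_pV2 ?posrE ?exprn_gt0 ?(lt_le_trans D0)// lerXn2r ?nnegrE// ltW.
have iD n : 0 <= `|P1 x| ^- n by rewrite invr_ge0 exprn_ge0.
have t1 : `|b2 x / P1 x ^+ 2| <= B / l ^+ 2 * D ^- 2.
  by rewrite normrM normfV normrX ler_pM.
have t2 : `|3 * b1 x * P2 x / P1 x ^+ 3| <= 3 * (B / l) * (K * D / l) * D ^- 3.
  rewrite !normrM normfV normrX ger0_norm// !ler_pM ?mulr_ge0//.
have t3 : `|b x * P3 x / P1 x ^+ 3| <= B * (K * D / l ^+ 2) * D ^- 3.
  by rewrite !normrM normfV normrX !ler_pM ?mulr_ge0.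
have t4 : `|3 * b x * P2 x ^+ 2 / P1 x ^+ 4| <= 3 * B * (K * D / l) ^+ 2 * D ^- 4.
  rewrite !normrM normfV !normrX ger0_norm// !ler_pM ?mulr_ge0 ?exprn_ge0//.
apply: (@le_trans _ _ (B / l ^+ 2 * D ^- 2 + 3 * (B / l) * (K * D / l) * D ^- 3 +
   B * (K * D / l ^+ 2) * D ^- 3 + 3 * B * (K * D / l) ^+ 2 * D ^- 4)).
  apply: le_trans (ler_normD _ _) _; apply: lerD t4.
  apply: le_trans (ler_normB _ _) _; apply: lerD t3.
  by apply: le_trans (ler_normB _ _) _; apply: lerD t1 t2.
rewrite le_eqVlt; apply/orP; left; apply/eqP; field.
by rewrite !gt_eqF.
Qed.

(** Two integrations by parts, each of which gains a factor 1 / (l D). The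
    boundary terms vanish because b and its derivative vanish at the ends. *)
Lemma van_der_corput2 :
  `|\int[leb]_(x in `[al, be]) (b x * cos (P x))| <=
     (be - al) * (B * (1 + 4 * K + 3 * K ^+ 2) / (l * D) ^+ 2).
Proof.
have Gw : (\int[leb]_(x in `[al, be]) (b x * cos (P x) + cos (P x) * v' x) = 0)%R.
  rewrite /Rintegral (_ : (fun x => _) = (fun x => (w x)%:E)); last first.
    by apply/funext => x; rewrite /w; congr EFin; ring.
  have GE0 : G al = 0 by rewrite /G; case: bal => -> ->; rewrite !(mul0r, mulr0, subr0, addr0).
  have GE1 : G be = 0 by rewrite /G; case: bbe => -> ->; rewrite !(mul0r, mulr0, subr0, addr0).
  rewrite (@continuous_FTC2 _ w G)//.
  - by rewrite GE0 GE1 -EFinB subrr.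
  - move=> x; apply: cvgM; first exact: continuous_subspaceT.
    by apply: cvgD; [exact: continuous_subspaceT|exact: cv'].
  - have h x : al <= x <= be -> derivable G x 1 by move=> /dG /(@ex_derive _ _ _ _ _ _ _).
    have c x : al <= x <= be -> {for x, continuous G}.
      by move=> /h /derivable1_diffP /differentiable_continuous.
    split.
    + by move=> x; rewrite in_itv /= => /andP[h1 h2]; apply: h; rewrite !ltW.
    + by apply: cvg_at_right_filter; apply: c; rewrite lexx ltW.
    + by apply: cvg_at_left_filter; apply: c; rewrite lexx ltW.
  - move=> x; rewrite in_itv /= => /andP[h1 h2]; rewrite derive1E.
    by apply: (@derive_val _ _ _ _ _ _ _ (dG _)); rewrite !ltW.
rewrite RintegralD// in Gw.
have -> : \int[leb]_(x in `[al, be]) (b x * cos (P x)) =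
    - \int[leb]_(x in `[al, be]) (cos (P x) * v' x).
  by apply/eqP; rewrite -subr_eq0 opprK Gw.
rewrite normrN; apply: le_trans (le_normr_Rintegral _ iw) _ => //.
apply: (@le_trans _ _ (\int[leb]_(x in `[al, be])
    (cst (B * (1 + 4 * K + 3 * K ^+ 2) / (l * D) ^+ 2) x))).
  apply: le_Rintegral => //.
  - exact: integrable_norm.
  - by apply: continuous_compact_integrable; [exact: segment_compact|apply: continuous_subspaceT => x; exact: cst_continuous].
  - move=> x /=; rewrite in_itv /= => xab.
    rewrite normrM; apply: le_trans (ler_piMl _ _) (v'_le xab) => //.
    by rewrite ler_norml cos_geN1 cos_le1.
have lE : lebesgue_measure `[al, be]%classic = (be - al)%:E :> \bar R.
  by rewrite lebesgue_measure_itv /= lte_fin albe EFinB.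
by rewrite Rintegral_cst// [X in fine X]lE /= mulrC.
Qed.

End van_der_corput.

(** * The L^2 bound in one variable *)

Section oscillatory_L2.
Variable R : realType.
Local Notation leb := (@lebesgue_measure R).
Variables (P P1 P2 P3 a a1 a2 : R -> R -> R) (c l m C A e1 e2 : R).
Local Notation al := (c - l).
Local Notation be := (c + l).
Hypothesis l0 : 0 < l.
Hypothesis m0 : 0 < m.
Hypothesis C0 : 0 <= C.
Hypothesis A0 : 0 <= A.
Hypothesis e12 : e1 < e2.
Hypothesis dP : forall y x, is_derive1 (P^~ y) x (P1 x y).
Hypothesis dP1 : forall y x, is_derive1 (P1^~ y) x (P2 x y).
Hypothesis dP2 : forall y x, is_derive1 (P2^~ y) x (P3 x y).
Hypothesis cP3 : forall y, continuous (P3^~ y).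
Hypothesis da : forall y x, is_derive1 (a^~ y) x (a1 x y).
Hypothesis da1 : forall y x, is_derive1 (a1^~ y) x (a2 x y).
Hypothesis ca2 : forall y, continuous (a2^~ y).
Hypothesis mP : measurable_fun setT (fun z : R * R => P z.1 z.2).
Hypothesis ma : measurable_fun setT (fun z : R * R => a z.1 z.2).
Hypothesis hP1 : forall x y y', al <= x <= be -> e1 <= y <= e2 -> e1 <= y' <= e2 ->
  m * `|y - y'| <= `|P1 x y - P1 x y'|.
Hypothesis hP2 : forall x y y', al <= x <= be -> e1 <= y <= e2 -> e1 <= y' <= e2 ->
  `|P2 x y - P2 x y'| <= C * m / l * `|y - y'|.
Hypothesis hP3 : forall x y y', al <= x <= be -> e1 <= y <= e2 -> e1 <= y' <= e2 ->
  `|P3 x y - P3 x y'| <= C * m / l ^+ 2 * `|y - y'|.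
Hypothesis ha : forall x y, al <= x <= be -> e1 <= y <= e2 -> `|a x y| <= A.
Hypothesis ha1 : forall x y, al <= x <= be -> e1 <= y <= e2 -> `|a1 x y| <= A / l.
Hypothesis ha2 : forall x y, al <= x <= be -> e1 <= y <= e2 -> `|a2 x y| <= A / l ^+ 2.

(** The bump (1 - t^2)^2: it vanishes to first order at the ends, as two
    integrations by parts require, and is bounded below on the interval of half
    the size. *)
Let tt x := (x - c) / l.
Let chi x := (1 - tt x ^+ 2) ^+ 2.
Let chi1 x := - 4 * tt x * (1 - tt x ^+ 2) / l.
Let chi2 x := (12 * tt x ^+ 2 - 4) / l ^+ 2.

Let ln0 : l != 0. Proof. by rewrite gt_eqF. Qed.

Let dtt x : is_derive1 tt x l^-1.
Proof.
apply: is_derive1_eq.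
by rewrite /GRing.scale /=; field.
Qed.

Let dchi x : is_derive1 chi x (chi1 x).
Proof.
have -> : chi = (fun x => (1 - tt x * tt x) * (1 - tt x * tt x)) by apply/funext.
have d := dtt x; apply: is_derive1_eq.
by rewrite /chi1 /GRing.scale /=; field.
Qed.

Let dchi1 x : is_derive1 chi1 x (chi2 x).
Proof.
have -> : chi1 = (fun x => (- 4 / l) * (tt x * (1 - tt x * tt x))).
  by apply/funext => y; rewrite /chi1; ring.
have d := dtt x; apply: is_derive1_eq.
by rewrite /chi2 /GRing.scale /=; field.
Qed.

Let tt_le1 x : al <= x <= be -> `|tt x| <= 1.
Proof.
move=> xab; rewrite /tt normrM normfV (gtr0_norm l0) ler_pdivrMr// mul1r ler_norml; lra.
Qed.

Let tt_le x : al <= x <= be -> tt x ^+ 2 <= 1.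
Proof. by move=> /tt_le1; rewrite ler_norml; nra. Qed.

Let chi_le x : al <= x <= be -> 0 <= chi x <= 1.
Proof. by move=> /tt_le h; have := sqr_ge0 (tt x); rewrite /chi; nra. Qed.

Let chi1_le x : al <= x <= be -> `|chi1 x| <= 4 / l.
Proof.
move=> xab; move: (tt_le1 xab) (tt_le xab); rewrite /chi1; move: (tt x) => t h1 h.
rewrite normrM normfV (gtr0_norm l0) ler_wpM2r ?invr_ge0 ?(ltW l0)//.
rewrite !normrM normrN (ger0_norm (ler0n _ 4)) -mulrA ler_piMr//.
have h2 : `|1 - t ^+ 2| <= 1 by have := sqr_ge0 t; rewrite ler_norml; lra.
by rewrite mulr_ile1.
Qed.

Let chi2_le x : al <= x <= be -> `|chi2 x| <= 8 / l ^+ 2.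
Proof.
move=> /tt_le h; rewrite /chi2 normrM normfV normrX (gtr0_norm l0).
rewrite ler_wpM2r ?invr_ge0 ?exprn_ge0 ?(ltW l0)//.
by have := sqr_ge0 (tt x); rewrite ler_norml; lra.
Qed.

Let alx : al < be. Proof. by have := l0; lra. Qed.

Let M := 112 * A ^+ 2 * (1 + 4 * C + 3 * C ^+ 2) * l.
(** The real part of the kernel of the operator T^t chi T, where T has the
    kernel exp (i P) a and T^t is its adjoint. *)
Let kappa y y' := \int[leb]_(x in `[al, be])
  (chi x * a x y * a x y' * cos (P x y - P x y')).

(** The sum of the trivial bound and of the bound by two integrations by parts,
    in which the derivative of the phase difference is at least m |y - y'|. *)
Let kappa_le y y' : e1 <= y <= e2 -> e1 <= y' <= e2 ->
  `|kappa y y'| <= M / (1 + (l * m * (y - y')) ^+ 2).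
Proof.
move=> yJ y'J.
pose b x := chi x * (a x y * a x y').
pose b1 x := chi1 x * (a x y * a x y') + chi x * (a1 x y * a x y' + a x y * a1 x y').
pose b2 x := (chi2 x * (a x y * a x y') + chi1 x * (a1 x y * a x y' + a x y * a1 x y')) +
  (chi1 x * (a1 x y * a x y' + a x y * a1 x y') +
   chi x * ((a2 x y * a x y' + a1 x y * a1 x y') + (a1 x y * a1 x y' + a x y * a2 x y'))).
have daa x : is_derive1 (fun x => a x y * a x y') x (a1 x y * a x y' + a x y * a1 x y').
  exact: is_derive1M.
have daa1 x : is_derive1 (fun x => a1 x y * a x y' + a x y * a1 x y') x
   ((a2 x y * a x y' + a1 x y * a1 x y') + (a1 x y * a1 x y' + a x y * a2 x y')).
  by apply: is_derive1D; apply: is_derive1M.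
have db x : is_derive1 b x (b1 x) by exact: is_derive1M.
have db1 x : is_derive1 b1 x (b2 x).
  by apply: is_derive1D; apply: is_derive1M.
have cchi2 : continuous chi2.
  move=> x; apply: cvgM; last exact: cst_continuous.
  apply: cvgB; last exact: cst_continuous.
  apply: cvgM; first exact: cst_continuous.
  have ctt := is_derive1_continuous dtt.
  by under eq_fun do rewrite expr2; apply: cvgM; exact: ctt.
have cchi1 := is_derive1_continuous dchi1.
have cchi := is_derive1_continuous dchi.
have ca y0 := is_derive1_continuous (da y0).
have ca1 y0 := is_derive1_continuous (da1 y0).
have cb2 : continuous b2.
  have c1 := is_derive1_continuous daa1; have c0 := is_derive1_continuous daa.
  move=> x; apply: cvgD; apply: cvgD; apply: cvgM;
    [exact: cchi2|exact: c0|exact: cchi1|exact: c1|exact: cchi1|exact: c1|exact: cchi|].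
  by apply: cvgD; apply: cvgD; apply: cvgM; [exact: ca2|exact: ca|exact: ca1|exact: ca1|exact: ca1|exact: ca1|exact: ca|exact: ca2].
have nM (u v U V : R) : `|u| <= U -> `|v| <= V -> `|u * v| <= U * V.
  by move=> hu hv; rewrite normrM ler_pM.
have nD (u v U V : R) : `|u| <= U -> `|v| <= V -> `|u + v| <= U + V.
  by move=> hu hv; apply: le_trans (ler_normD _ _) _; exact: lerD.
have nchi x : al <= x <= be -> `|chi x| <= 1.
  by move=> /chi_le /andP[h1 h2]; rewrite ger0_norm.
have A2 : 0 <= A ^+ 2 by exact: sqr_ge0.
have hb x : al <= x <= be -> `|b x| <= 28 * A ^+ 2.
  move=> xI; apply: le_trans (nM _ _ _ _ (nchi _ xI) (nM _ _ _ _ (ha xI yJ) (ha xI y'J))) _.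
  by rewrite -expr2; lra.
have haa x : al <= x <= be -> `|a1 x y * a x y' + a x y * a1 x y'| <= 2 * A ^+ 2 / l.
  move=> xI; apply: le_trans (nD _ _ _ _ (nM _ _ _ _ (ha1 xI yJ) (ha xI y'J))
     (nM _ _ _ _ (ha xI yJ) (ha1 xI y'J))) _.
  by rewrite le_eqVlt; apply/orP; left; apply/eqP; ring.
have hb1 x : al <= x <= be -> `|b1 x| <= 28 * A ^+ 2 / l.
  move=> xI; apply: le_trans (nD _ _ _ _
    (nM _ _ _ _ (chi1_le xI) (nM _ _ _ _ (ha xI yJ) (ha xI y'J)))
    (nM _ _ _ _ (nchi _ xI) (haa _ xI))) _.
  rewrite (_ : _ + _ = 6 * A ^+ 2 / l); last by ring.
  by rewrite ler_wpM2r ?invr_ge0 ?(ltW l0)//; lra.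
have hb2 x : al <= x <= be -> `|b2 x| <= 28 * A ^+ 2 / l ^+ 2.
  move=> xI; apply: le_trans (nD _ _ _ _
    (nD _ _ _ _ (nM _ _ _ _ (chi2_le xI) (nM _ _ _ _ (ha xI yJ) (ha xI y'J)))
      (nM _ _ _ _ (chi1_le xI) (haa _ xI)))
    (nD _ _ _ _ (nM _ _ _ _ (chi1_le xI) (haa _ xI))
      (nM _ _ _ _ (nchi _ xI) (nD _ _ _ _
        (nD _ _ _ _ (nM _ _ _ _ (ha2 xI yJ) (ha xI y'J)) (nM _ _ _ _ (ha1 xI yJ) (ha1 xI y'J)))
        (nD _ _ _ _ (nM _ _ _ _ (ha1 xI yJ) (ha1 xI y'J)) (nM _ _ _ _ (ha xI yJ) (ha2 xI y'J))))))) _.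
  by rewrite le_eqVlt; apply/orP; left; apply/eqP; field.
have kE : kappa y y' = \int[leb]_(x in `[al, be]) (b x * cos (P x y - P x y')).
  by apply: eq_Rintegral => x _; rewrite /b mulrA.
have K1 : 1 <= 1 + 4 * C + 3 * C ^+ 2 by have := C0; have := sqr_ge0 C; lra.
set W := M / 2.
have WE : W = 2 * l * (28 * A ^+ 2 * (1 + 4 * C + 3 * C ^+ 2)) by rewrite /W /M; field.
have k1 : `|kappa y y'| <= W.
  have cb := is_derive1_continuous db.
  have dd x : is_derive1 (fun x => P x y - P x y') x (P1 x y - P1 x y') by exact: is_derive1B.
  have ccos := is_derive1_continuous (fun x => is_derive1_cos (dd x)).
  have ib : leb.-integrable `[al, be] (EFin \o (fun x => b x * cos (P x y - P x y'))).
    apply: continuous_compact_integrable; first exact: segment_compact.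
    by apply: continuous_subspaceT => x; apply: cvgM; [exact: cb|exact: ccos].
  rewrite kE; apply: le_trans (le_normr_Rintegral _ ib) _ => //.
  apply: (@le_trans _ _ (\int[leb]_(x in `[al, be]) (cst (28 * A ^+ 2) x))).
    apply: le_Rintegral => //.
    - exact: integrable_norm.
    - by apply: continuous_compact_integrable; [exact: segment_compact|apply: continuous_subspaceT => x; exact: cst_continuous].
    - move=> x /=; rewrite in_itv /= => xab.
      have c1 : `|cos (P x y - P x y')| <= 1 by rewrite ler_norml cos_geN1 cos_le1.
      by have := nM _ _ _ _ (hb x xab) c1; rewrite mulr1.
  have lE : lebesgue_measure `[al, be]%classic = (be - al)%:E :> \bar R.
    by rewrite lebesgue_measure_itv /= lte_fin alx EFinB.
  rewrite Rintegral_cst// [X in fine X]lE /= WE.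
  have -> : be - al = 2 * l by ring.
  rewrite mulrC ler_wpM2l ?mulr_ge0 ?(ltW l0)//.
  by rewrite ler_peMr// mulr_ge0.
have k2 : `|kappa y y'| * (l * m * (y - y')) ^+ 2 <= W.
  have [yy|yy] := eqVneq y y'.
    rewrite yy subrr mulr0 expr0n /= mulr0 /W /M divr_ge0// !mulr_ge0 ?(ltW l0)//.
    by rewrite (le_trans _ K1).
  have d0 : 0 < `|y - y'| by rewrite normr_gt0 subr_eq0.
  have D0 : 0 < m * `|y - y'| by rewrite mulr_gt0.
  have T0 : 0 < (l * (m * `|y - y'|)) ^+ 2 by rewrite exprn_gt0 ?mulr_gt0.
  have TE : (l * m * (y - y')) ^+ 2 = (l * (m * `|y - y'|)) ^+ 2.
    by rewrite !exprMn real_normK ?num_real//; ring.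
  rewrite TE -ler_pdivlMr//.
  have dd x : is_derive1 (fun x => P x y - P x y') x (P1 x y - P1 x y') by exact: is_derive1B.
  have dd1 x : is_derive1 (fun x => P1 x y - P1 x y') x (P2 x y - P2 x y') by exact: is_derive1B.
  have dd2 x : is_derive1 (fun x => P2 x y - P2 x y') x (P3 x y - P3 x y') by exact: is_derive1B.
  have cc : continuous (fun x => P3 x y - P3 x y').
    by move=> x; apply: cvgB; exact: cP3.
  have hQ2 x : al <= x <= be -> `|P2 x y - P2 x y'| <= C * (m * `|y - y'|) / l.
    by move=> xI; apply: le_trans (hP2 xI yJ y'J) _; rewrite le_eqVlt; apply/orP; left; apply/eqP; ring.
  have hQ3 x : al <= x <= be -> `|P3 x y - P3 x y'| <= C * (m * `|y - y'|) / l ^+ 2.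
    by move=> xI; apply: le_trans (hP3 xI yJ y'J) _; rewrite le_eqVlt; apply/orP; left; apply/eqP; ring.
  have hQ1 x : al <= x <= be -> m * `|y - y'| <= `|P1 x y - P1 x y'|.
    by move=> xI; exact: hP1.
  have tal : tt al = - 1 by rewrite /tt addrAC subrr add0r mulNr divff.
  have tbe : tt be = 1 by rewrite /tt addrAC subrr add0r divff.
  have chal : chi al = 0 /\ chi1 al = 0.
    by rewrite /chi /chi1 tal sqrrN expr1n subrr mulr0 mul0r expr0n.
  have chbe : chi be = 0 /\ chi1 be = 0.
    by rewrite /chi /chi1 tbe expr1n subrr mulr0 mul0r expr0n.
  have bal : b al = 0 /\ b1 al = 0.
    by rewrite /b /b1; case: chal => -> ->; rewrite !mul0r addr0.
  have bbe : b be = 0 /\ b1 be = 0.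
    by rewrite /b /b1; case: chbe => -> ->; rewrite !mul0r addr0.
  clearbody b b1 b2; rewrite kE.
  have V := @van_der_corput2 R (fun x => P x y - P x y') (fun x => P1 x y - P1 x y')
     (fun x => P2 x y - P2 x y') (fun x => P3 x y - P3 x y') b b1 b2 al be
     (m * `|y - y'|) C (28 * A ^+ 2) l
     alx dd dd1 dd2 cc db db1 cb2 D0 l0 hQ1 hQ2 hQ3 hb hb1 hb2 bal bbe.
  apply: le_trans V _.
  by rewrite WE le_eqVlt; apply/orP; left; apply/eqP; ring.
rewrite ler_pdivlMr; last by rewrite ltr_pwDl// sqr_ge0.
by rewrite mulrDr mulr1 (_ : M = W + W) ?lerD// /W; field.
Qed.

Let J := `[e1, e2]%classic.
Let IS := `[al, be]%classic.
Let bp x y := \1_IS x * a x y * \1_J y.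

Let lIS : lebesgue_measure IS = (2 * l)%:E :> \bar R.
Proof.
by rewrite lebesgue_measure_itv /= lte_fin alx -EFinB; congr EFin; ring.
Qed.

Let lJ : lebesgue_measure J = (e2 - e1)%:E :> \bar R.
Proof. by rewrite lebesgue_measure_itv /= lte_fin e12 EFinB. Qed.

Let mJ : measurable (J : set (measurableTypeR R)). Proof. exact: measurable_itv. Qed.
Let mIS : measurable (IS : set (measurableTypeR R)). Proof. exact: measurable_itv. Qed.

Let mbp : measurable_fun setT (fun z : R * R => bp z.1 z.2).
Proof.
apply: measurable_funM; last by apply: measurableT_comp => //; exact: measurable_indic.
apply: measurable_funM => //.
by apply: measurableT_comp => //; exact: measurable_indic.
Qed.

Let bp_le x y : `|bp x y| <= A * \1_IS x * \1_J y.
Proof.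
rewrite /bp !indicE; have [|] := boolP (x \in IS) => xI; last first.
  by rewrite !mul0r normr0 mulr0 mul0r.
have [|] := boolP (y \in J) => yJ; last by rewrite !mulr0 normr0.
rewrite !mul1r !mulr1; apply: ha.
- by move/set_mem: xI; rewrite /IS /= in_itv.
- by move/set_mem: yJ; rewrite /J /= in_itv.
Qed.

(** The antiderivative in y' is an arctangent, whose variation is at most pi. *)
Let schur y : (\int[leb]_(y' in J) (M / (1 + (l * m * (y - y')) ^+ 2))%:E <=
   (112 * A ^+ 2 * (1 + 4 * C + 3 * C ^+ 2) * pi / m)%:E)%E.
Proof.
have lm0 : 0 < l * m by rewrite mulr_gt0.
pose F y' := (M / (l * m)) * atan (l * m * (y' - y)).
have M0 : 0 <= M.
  by rewrite /M !mulr_ge0 ?sqr_ge0 ?(ltW l0)// !addr_ge0 ?mulr_ge0 ?sqr_ge0.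
have nz y' : 1 + (l * m * (y - y')) ^+ 2 != 0.
  by rewrite gt_eqF// ltr_pwDl// sqr_ge0.
have dF y' : is_derive1 F y' (M / (1 + (l * m * (y - y')) ^+ 2)).
  have da' : is_derive1 (fun y' => l * m * (y' - y)) y' (l * m).
    have h := is_derive1M (is_derive1_cst (l * m) y')
      (is_derive1B (is_derive_id y' 1) (is_derive1_cst y y')).
    by apply: (is_derive1_eq h); ring.
  have h1 := @is_derive1_comp R atan (fun y' => l * m * (y' - y)) y' _ _
    (is_derive1_atan _) da'.
  have h := is_derive1M (is_derive1_cst (M / (l * m)) y') h1.
  apply: (is_derive1_eq h) => /=.
  have -> : (l * m * (y' - y)) ^+ 2 = (l * m * (y - y')) ^+ 2 by ring.
  by field; rewrite nz !gt_eqF.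
have cF := is_derive1_continuous dF.
have cf : continuous (fun y' => M / (1 + (l * m * (y - y')) ^+ 2)).
  move=> y'; apply: cvgM; first exact: cst_continuous.
  apply: cvgV => //; apply: cvgD; first exact: cst_continuous.
  under eq_fun do rewrite expr2.
  have c1 : {for y', continuous (fun z => l * m * (y - z))}.
    apply: cvgM; first exact: cst_continuous.
    by apply: cvgB; [exact: cst_continuous|exact: cvg_id].
  by apply: cvgM.
rewrite (@continuous_FTC2 _ _ F)//.
- rewrite -EFinB lee_fin /F -mulrBr.
  have -> : 112 * A ^+ 2 * (1 + 4 * C + 3 * C ^+ 2) * pi / m = M / (l * m) * pi.
    by rewrite /M; field; rewrite !gt_eqF.
  rewrite ler_wpM2l ?divr_ge0 ?(ltW lm0)//.
  have := atan_ltpi2 (l * m * (e2 - y)); have := atan_gtNpi2 (l * m * (e1 - y)); lra.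
- exact: continuous_subspaceT.
- split.
  + by move=> z _; exact: (@ex_derive _ _ _ _ _ _ _ (dF z)).
  + by apply: cvg_at_right_filter; exact: cF.
  + by apply: cvg_at_left_filter; exact: cF.
- by move=> z _; rewrite derive1E; exact: (@derive_val _ _ _ _ _ _ _ (dF z)).
Qed.

Let integrable_tensor (u v : R -> R) (c0 : R) : leb.-integrable setT (EFin \o u) ->
  leb.-integrable setT (EFin \o v) ->
  (leb \x leb)%E.-integrable setT (EFin \o (fun z : R * R => c0 * (u z.1 * v z.2))).
Proof.
move=> iu iv.
have mu0 : measurable_fun setT u by apply/measurable_EFinP; case/integrableP : iu.
have mv0 : measurable_fun setT v by apply/measurable_EFinP; case/integrableP : iv.
apply/integrable12ltyP.
  apply/measurable_EFinP; apply: measurable_funM => //.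
  by apply: measurable_funM; exact: measurableT_comp.
have -> : (\int[leb]_x \int[leb]_y `|(EFin \o (fun z : R * R => c0 * (u z.1 * v z.2))%R) (x, y)| =
  \int[leb]_x ((`|c0| * `|u x|)%:E * \int[leb]_y (`|v y|)%:E))%E.
  apply: eq_integral => x _; rewrite -ge0_integralZl//.
  - by apply: eq_integral => y _; rewrite /= !normrM mulrA EFinM.
  - by apply/measurable_EFinP; exact: measurableT_comp.
rewrite ge0_integralZr//; last 2 first.
- by apply/measurable_EFinP; apply: measurable_funM => //; exact: measurableT_comp.
- by apply: integral_ge0 => y _; rewrite lee_fin.
have voo : (\int[leb]_y (`|v y|)%:E < +oo)%E by case/integrableP : iv.
have uoo : (\int[leb]_y (`|u y|)%:E < +oo)%E by case/integrableP : iu.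
rewrite lte_mul_pinfty//.
- by apply: integral_ge0 => y _; rewrite lee_fin mulr_ge0.
- rewrite ge0_fin_numE; last by apply: integral_ge0 => y _; rewrite lee_fin mulr_ge0.
  under eq_integral do rewrite EFinM.
  rewrite ge0_integralZl//; last by apply/measurable_EFinP; exact: measurableT_comp.
  by rewrite lte_mul_pinfty.
Qed.

Section energy.
Variable f : R -> R.
Hypothesis mf : measurable_fun setT f.
Hypothesis f2 : (Lpp leb 2 f < +oo)%E.

Let kc (z : R * R) := cos (P z.1 z.2) * bp z.1 z.2.
Let ks (z : R * R) := sin (P z.1 z.2) * bp z.1 z.2.
Let Cx := kop leb kc f.
Let Sx := kop leb ks f.

Let mcosP : measurable_fun setT (fun z : R * R => cos (P z.1 z.2)).
Proof.
apply: (measurableT_comp (f := @cos R)) => //; apply: continuous_measurable_fun.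
exact: continuous_cos.
Qed.

Let msinP : measurable_fun setT (fun z : R * R => sin (P z.1 z.2)).
Proof.
apply: (measurableT_comp (f := @sin R)) => //; apply: continuous_measurable_fun.
exact: continuous_sin.
Qed.

Let tame_trig (s : R * R -> R) : measurable_fun setT s -> (forall z, `|s z| <= 1) ->
  tame_on leb leb (IS : set (measurableTypeR R)) (J : set (measurableTypeR R)) A
    (fun z : R * R => s z * bp z.1 z.2).
Proof.
move=> ms s1; split.
- exact: measurable_funM.
- by split => //; rewrite [X in (X < _)%E]lIS ltry.
- by split => //; rewrite [X in (X < _)%E]lJ ltry.
- move=> x y; rewrite normrM; apply: le_trans (bp_le x y).
  by rewrite ler_piMl.
Qed.

Let cos1 (t : R) : `|cos t| <= 1. Proof. by rewrite ler_norml cos_geN1 cos_le1. Qed.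
Let sin1 (t : R) : `|sin t| <= 1. Proof. by rewrite ler_norml sin_geN1 sin_le1. Qed.

Let tkc := tame_trig mcosP (fun z => cos1 (P z.1 z.2)).
Let tks := tame_trig msinP (fun z => sin1 (P z.1 z.2)).

Let fJ y := \1_J y * f y.
Let ifJ : leb.-integrable setT (EFin \o fJ).
Proof.
apply: (@Lpp_integrable _ _ _ leb 2 f \1_J J 1) => //.
- by rewrite ler1n.
- by rewrite [X in (X < _)%E]lJ ltry.
- by move=> y; rewrite mul1r ger0_norm.
Qed.
Let iIS : leb.-integrable setT (EFin \o (\1_IS : R -> R)).
Proof.
have := @integrable_cindic _ _ R leb IS 1 mIS; rewrite [X in (X < _)%E]lIS ltry => /(_ isT).
by apply: eq_integrable => // y _ /=; rewrite mul1r.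
Qed.

Let V := \int[leb]_y `|fJ y|.

Let kop_le (s : R * R -> R) x : measurable_fun setT s -> (forall z, `|s z| <= 1) ->
  `|kop leb (fun z : R * R => s z * bp z.1 z.2) f x| <= A * V.
Proof.
move=> ms s1; have i0 := tame_integrable (x : measurableTypeR R) (tame_trig ms s1) (ler1n _ 2) mf f2.
apply: le_trans (le_normr_Rintegral _ i0) _ => //.
rewrite /V -RintegralZl//; last exact: integrable_norm.
apply: le_Rintegral => //.
- exact: integrable_norm.
- have := integrable_norm ifJ; rewrite /comp => h.
  under eq_fun do rewrite EFinM.
  exact: integrableZl.
- move=> y _ /=; rewrite normrM [X in X * _ <= _]normrM -mulrA; apply: le_trans (ler_piMl _ (s1 _)) _.
    by rewrite mulr_ge0.
  rewrite /fJ [`|\1_J y * _|]normrM mulrA ler_wpM2r// [`|\1_J y|]ger0_norm//.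
  apply: le_trans (bp_le x y) _; by rewrite ler_wpM2r// ler_piMr.
Qed.

Let CxV x : `|Cx x| <= A * V. Proof. exact: kop_le. Qed.
Let SxV x : `|Sx x| <= A * V. Proof. exact: kop_le. Qed.

Let mCx : measurable_fun setT Cx.
Proof. by apply: measurable_kop => //; case: tkc. Qed.
Let mSx : measurable_fun setT Sx.
Proof. by apply: measurable_kop => //; case: tks. Qed.

Let mchi : measurable_fun setT chi.
Proof.
by apply: continuous_measurable_fun; exact: is_derive1_continuous dchi.
Qed.

Let V0 : 0 <= V. Proof. exact: Rintegral_ge0. Qed.

Let chi_bp x y : `|chi x * bp x y| <= A * \1_IS x * \1_J y.
Proof.
have [xI|xI] := boolP (x \in IS); last first.
  by rewrite /bp !indicE (negbTE xI) !(mul0r, mulr0) normr0.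
rewrite normrM; apply: le_trans (bp_le x y); rewrite ler_piMl//.
have : al <= x <= be by move/set_mem: xI; rewrite /IS /= in_itv.
by move=> /chi_le /andP[h1 h2]; rewrite ger0_norm.
Qed.

(** Its integral over y is the energy density, its integral over x the quadratic
    form with kernel kappa. *)
Let h (z : R * R) := chi z.1 * (Cx z.1 * cos (P z.1 z.2) + Sx z.1 * sin (P z.1 z.2)) *
  bp z.1 z.2 * f z.2.

Let mh : measurable_fun setT h.
Proof.
apply: measurable_funM; last exact: measurableT_comp.
apply: measurable_funM => //; apply: measurable_funM; first exact: measurableT_comp.
apply: measurable_funD; (apply: measurable_funM => //; exact: measurableT_comp).
Qed.

Let h_le x y : `|h (x, y)| <= 2 * A ^+ 2 * V * (\1_IS x * `|fJ y|).
Proof.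
have -> : h (x, y) = (Cx x * cos (P x y) + Sx x * sin (P x y)) * (chi x * bp x y) * f y.
  by rewrite /h /=; ring.
have -> : 2 * A ^+ 2 * V * (\1_IS x * `|fJ y|) = (A * V + A * V) * (A * \1_IS x * \1_J y) * `|f y|.
  by rewrite /fJ normrM [`|\1_J y|]ger0_norm//; ring.
have AV0 : 0 <= A * V by rewrite mulr_ge0.
rewrite normrM ler_wpM2r// normrM ler_pM//.
apply: le_trans (ler_normD _ _) _; rewrite !normrM; apply: lerD.
- by rewrite -[leRHS]mulr1 ler_pM// ?CxV ?cos1.
- by rewrite -[leRHS]mulr1 ler_pM// ?SxV ?sin1.
Qed.

Let ih : (leb \x leb)%E.-integrable setT (EFin \o h).
Proof.
apply: le_integrable (integrable_tensor (2 * A ^+ 2 * V) iIS (integrable_norm ifJ)) => //.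
  exact/measurable_EFinP.
by move=> [x y] _ /=; rewrite lee_fin; apply: le_trans (h_le x y) _; exact: ler_norm.
Qed.

Let E1 x : \int[leb]_y h (x, y) = chi x * (Cx x ^+ 2 + Sx x ^+ 2).
Proof.
have ic := tame_integrable (x : measurableTypeR R) tkc (ler1n _ 2) mf f2.
have is_ := tame_integrable (x : measurableTypeR R) tks (ler1n _ 2) mf f2.
transitivity (\int[leb]_y ((chi x * Cx x) * (kc (x, y) * f y) +
    (chi x * Sx x) * (ks (x, y) * f y))).
  by apply: eq_Rintegral => y _; rewrite /h /kc /ks /=; ring.
rewrite RintegralD//; first last.
- by rewrite /comp; under eq_fun do rewrite EFinM; exact: integrableZl.
- by rewrite /comp; under eq_fun do rewrite EFinM; exact: integrableZl.
rewrite !RintegralZl// -/(kop leb kc f x) -/(kop leb ks f x) -/(Cx x) -/(Sx x).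
by ring.
Qed.

Let g (y : R) (z : R * R) := chi z.1 * bp z.1 y * bp z.1 z.2 * cos (P z.1 y - P z.1 z.2) * f y * f z.2.

Let mpy (y : R) : measurable_fun setT (fun z : R * R => (z.1, y)).
Proof. by apply: measurable_fun_pair. Qed.

Let mPy y : measurable_fun setT (fun z : R * R => P z.1 y).
Proof. exact: (measurableT_comp mP (mpy y)). Qed.

Let mbpy y : measurable_fun setT (fun z : R * R => bp z.1 y).
Proof. exact: (measurableT_comp mbp (mpy y)). Qed.

Let mg y : measurable_fun setT (g y).
Proof.
apply: measurable_funM; last exact: measurableT_comp.
apply: measurable_funM => //; apply: measurable_funM; last first.
  apply: (measurableT_comp (f := @cos R)); last exact: measurable_funB.
  by apply: continuous_measurable_fun; exact: continuous_cos.
apply: measurable_funM => //; apply: measurable_funM => //.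
exact: measurableT_comp.
Qed.

Let ig y : (leb \x leb)%E.-integrable setT (EFin \o g y).
Proof.
apply: le_integrable (integrable_tensor (A ^+ 2 * `|f y|) iIS (integrable_norm ifJ)) => //.
  apply/measurable_EFinP; exact: (mg y).
move=> [x y'] _ /=; rewrite lee_fin; apply: le_trans _ (ler_norm _).
have -> : A ^+ 2 * `|f y| * (\1_IS x * `|fJ y'|) =
    A * (A * \1_IS x * \1_J y') * 1 * `|f y| * `|f y'|.
  by rewrite /fJ normrM [`|\1_J y'|]ger0_norm//; ring.
rewrite /g /= normrM ler_wpM2r// normrM ler_wpM2r// normrM ler_pM// normrM ler_pM//.
by apply: le_trans (chi_bp x y) _; rewrite -mulrA ler_piMr// !indicE.
Qed.

Let kc_f y x : h (x, y) = \int[leb]_y' g y (x, y').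
Proof.
have ic := tame_integrable (x : measurableTypeR R) tkc (ler1n _ 2) mf f2.
have is_ := tame_integrable (x : measurableTypeR R) tks (ler1n _ 2) mf f2.
transitivity (\int[leb]_y' ((chi x * bp x y * f y * cos (P x y)) * (kc (x, y') * f y') +
    (chi x * bp x y * f y * sin (P x y)) * (ks (x, y') * f y'))); last first.
  by apply: eq_Rintegral => y' _; rewrite /g /kc /ks /= cosB; ring.
rewrite RintegralD//; first last.
- by rewrite /comp; under eq_fun do rewrite EFinM; exact: integrableZl.
- by rewrite /comp; under eq_fun do rewrite EFinM; exact: integrableZl.
rewrite !RintegralZl// -/(kop leb kc f x) -/(kop leb ks f x) -/(Cx x) -/(Sx x) /h /=.
by ring.
Qed.

Let E2' y y' : \int[leb]_x g y (x, y') = fJ y * fJ y' * kappa y y'.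
Proof.
have [yJ|yJ] := boolP (y \in J); last first.
  rewrite /fJ indicE (negbTE yJ) !mul0r /Rintegral integral0_eq// => x _.
  by rewrite /g /bp /= [\1_J y]indicE (negbTE yJ) !(mulr0, mul0r).
have [y'J|y'J] := boolP (y' \in J); last first.
  rewrite /fJ [\1_J y']indicE (negbTE y'J) !(mulr0, mul0r) /Rintegral integral0_eq// => x _.
  by rewrite /g /bp /= [\1_J y']indicE (negbTE y'J) !(mulr0, mul0r).
have ck : leb.-integrable `[al, be]
    (EFin \o (fun x => chi x * a x y * a x y' * cos (P x y - P x y'))).
  apply: continuous_compact_integrable; first exact: segment_compact.
  have c1 := is_derive1_continuous dchi.
  have c2 z := is_derive1_continuous (da z).
  have c3 := is_derive1_continuous (fun x => is_derive1_cos (is_derive1B (dP y x) (dP y' x))).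
  by apply: continuous_subspaceT => x; apply: cvgM; [apply: cvgM; [apply: cvgM|]|];
    [exact: c1|exact: c2|exact: c2|exact: c3].
rewrite /kappa -RintegralZl// [RHS]Rintegral_mkcond.
apply: eq_Rintegral => x _; rewrite patchE /fJ /g /bp /= !indicE yJ y'J /IS.
by case: ifPn => xI; rewrite ?xI ?(negbTE xI) /=; [ring|rewrite !(mulr0, mul0r)].
Qed.

Let E2 y : \int[leb]_x h (x, y) = \int[leb]_y' (fJ y * fJ y' * kappa y y').
Proof.
under eq_Rintegral do rewrite kc_f.
rewrite -Rintegral_fubini1; last exact: ig.
rewrite Rintegral_fubini2; last exact: ig.
by apply: eq_Rintegral => y' _; exact: E2'.
Qed.

Let normr_Rintegral_le (r : R -> R) : measurable_fun setT r ->
  ((`|\int[leb]_y r y|)%:E <= \int[leb]_y (`|r y|)%:E)%E.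
Proof.
move=> mr; apply: (@le_trans _ _ `|\int[leb]_y (r y)%:E|%E).
  rewrite /Rintegral; case: (integral _ _ _) => [v| |] //=; rewrite normr0 leey//.
by apply: le_abse_integral => //; exact/measurable_EFinP.
Qed.

Let S0 := 112 * A ^+ 2 * (1 + 4 * C + 3 * C ^+ 2) * pi / m.

Let Hs (z : R * R) := M / (1 + (l * m * (z.1 - z.2)) ^+ 2).

Let M0 : 0 <= M.
Proof. by rewrite /M !mulr_ge0 ?sqr_ge0 ?(ltW l0)// !addr_ge0 ?mulr_ge0 ?sqr_ge0. Qed.

Let Hs0 z : 0 <= Hs z.
Proof. by rewrite /Hs divr_ge0// addr_ge0 ?sqr_ge0. Qed.

Let mHs : measurable_fun setT Hs.
Proof.
apply: measurable_funM => //.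
apply: (measurableT_comp (f := fun t : R => (1 + (l * m * t) ^+ 2)^-1)); last first.
  exact: measurable_funB.
apply: continuous_measurable_fun => t.
apply: cvgV; first by rewrite gt_eqF// ltr_pwDl// sqr_ge0.
apply: cvgD; first exact: cst_continuous.
under eq_fun do rewrite expr2.
have c1 : {for t, continuous (fun z => l * m * z)}.
  by apply: cvgM; [exact: cst_continuous|exact: cvg_id].
by apply: cvgM.
Qed.

(** Schur's test: the product |f y| |f y'| is at most the mean of the two
    squares, and the kernel being symmetric both squares give the same integral. *)
Let W (z : R * R) := 2^-1 * (fJ z.1 ^+ 2 + fJ z.2 ^+ 2) * (\1_J z.1 * \1_J z.2) * Hs z.

Let fJk_le y y' : `|fJ y * fJ y' * kappa y y'| <= W (y, y').
Proof.
have [yJ|yJ] := boolP (y \in J); last first.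
  rewrite /W /fJ /= [\1_J y]indicE (negbTE yJ) !(mul0r, mulr0) normr0//.
have [y'J|y'J] := boolP (y' \in J); last first.
  rewrite /W /fJ /= [\1_J y']indicE (negbTE y'J) !(mul0r, mulr0) normr0//.
rewrite /W /= [\1_J y]indicE [\1_J y']indicE yJ y'J !mulr1 normrM ler_pM//.
- rewrite normrM -(real_normK (num_real (fJ y))) -(real_normK (num_real (fJ y'))).
  by have := sqr_ge0 (`|fJ y| - `|fJ y'|); rewrite sqrrB; lra.
- by apply: kappa_le; [move/set_mem: yJ|move/set_mem: y'J]; rewrite /J /= in_itv.
Qed.

Let mfJ : measurable_fun setT fJ. Proof. exact: measurable_funM. Qed.

Let m1J : measurable_fun setT (fun z : R * R => \1_J z.1 * \1_J z.2 : R).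
Proof. by apply: measurable_funM; apply: measurableT_comp => //; exact: measurable_indic. Qed.

Let W1 (z : R * R) := 2^-1 * fJ z.1 ^+ 2 * (\1_J z.1 * \1_J z.2) * Hs z.

Let mW1 : measurable_fun setT W1.
Proof.
apply: measurable_funM => //; apply: measurable_funM => //.
apply: measurable_funM => //; apply: measurable_funX; exact: measurableT_comp.
Qed.

Let mW : measurable_fun setT W.
Proof.
apply: measurable_funM => //; apply: measurable_funM => //.
apply: measurable_funM => //; apply: measurable_funD;
  apply: measurable_funX; exact: measurableT_comp.
Qed.

Let W10 z : 0 <= W1 z.
Proof.
apply: mulr_ge0 => //; apply: mulr_ge0; last by rewrite mulr_ge0.
by apply: mulr_ge0 => //; exact: sqr_ge0.
Qed.

Let WE z : W z = W1 z + W1 (z.2, z.1).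
Proof.
rewrite /W /W1 /= (_ : Hs (z.2, z.1) = Hs z); first by ring.
by rewrite /Hs /=; congr (_ / (_ + _)); ring.
Qed.

Let W1int : (\int[leb]_y \int[leb]_y' (W1 (y, y'))%:E <=
  (2^-1 * S0)%:E * Lpp leb 2 f)%E.
Proof.
rewrite /Lpp -ge0_integralZl//; last 2 first.
- exact: measurable_normpow.
- by rewrite lee_fin mulr_ge0// /S0 !mulr_ge0 ?invr_ge0 ?sqr_ge0 ?pi_ge0 ?(ltW m0)//
     !addr_ge0 ?mulr_ge0 ?sqr_ge0.
apply: ge0_le_integral => //.
- by move=> y _; apply: integral_ge0 => y' _; rewrite lee_fin.
- apply: (@measurable_fun_fubini_tonelli_F _ _ _ _ _ leb (fun z => (W1 z)%:E)).
    exact/measurable_EFinP.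
  by move=> z; rewrite lee_fin.
- by apply: emeasurable_funM => //; exact: measurable_normpow.
move=> y _.
apply: (@le_trans _ _ (\int[leb]_y' ((2^-1 * f y ^+ 2)%:E * ((EFin \o (fun y' => Hs (y, y'))) \_ J) y'))%E).
  apply: ge0_le_integral => //.
  - by move=> y' _; rewrite lee_fin.
  - apply/measurable_EFinP; exact: (measurableT_comp mW1 (measurable_pair1 y)).
  - apply: emeasurable_funM => //; apply/(measurable_restrictT _ mJ).
    apply: measurable_funTS; apply/measurable_EFinP.
    exact: (measurableT_comp mHs (measurable_pair1 y)).
  move=> y' _; rewrite patchE /W1 /fJ /=; case: ifPn => y'J.
    rewrite -EFinM lee_fin !indicE y'J mulr1; case: (y \in J) => /=.
      by rewrite mul1r mulr1.
    by rewrite mul0r mulr0 mul0r mulr_ge0// mulr_ge0 ?sqr_ge0.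
  by rewrite [\1_J y']indicE (negbTE y'J) !mulr0 mul0r mule0.
rewrite ge0_integralZl//; last 3 first.
- apply/(measurable_restrictT _ mJ).
  apply: measurable_funTS; apply/measurable_EFinP.
  exact: (measurableT_comp mHs (measurable_pair1 y)).
- by move=> y' _; apply: erestrict_ge0 => z _; rewrite lee_fin.
- by rewrite lee_fin mulr_ge0 ?sqr_ge0.
rewrite -integral_mkcond.
apply: le_trans (lee_wpmul2l _ (schur y)) _.
  by rewrite lee_fin mulr_ge0 ?sqr_ge0.
rewrite -/S0 -!EFinM lee_fin powR_mulrn// real_normK ?num_real//.
by rewrite le_eqVlt; apply/orP; left; apply/eqP; ring.
Qed.

Let Wint : (\int[leb]_y \int[leb]_y' (W (y, y'))%:E <= S0%:E * Lpp leb 2 f)%E.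
Proof.
have -> : (\int[leb]_y \int[leb]_y' (W (y, y'))%:E =
   \int[leb]_y \int[leb]_y' (W1 (y, y'))%:E +
   \int[leb]_y \int[leb]_y' (W1 (y', y))%:E)%E.
  rewrite -ge0_integralD//.
  - apply: eq_integral => y _; rewrite -ge0_integralD//.
    + by apply: eq_integral => y' _; rewrite WE EFinD.
    + by move=> y' _; rewrite lee_fin.
    + apply/measurable_EFinP; exact: (measurableT_comp mW1 (measurable_pair1 y)).
    + by move=> y' _; rewrite lee_fin.
    + apply/measurable_EFinP; exact: (measurableT_comp mW1 (measurable_pair2 y)).
  - by move=> y _; apply: integral_ge0 => y' _; rewrite lee_fin.
  - apply: (@measurable_fun_fubini_tonelli_F _ _ _ _ _ leb (fun z => (W1 z)%:E)).
      exact/measurable_EFinP.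
    by move=> z; rewrite lee_fin.
  - by move=> y _; apply: integral_ge0 => y' _; rewrite lee_fin.
  - apply: (@measurable_fun_fubini_tonelli_G _ _ _ _ _ leb (fun z => (W1 z)%:E)).
      exact/measurable_EFinP.
    by move=> z; rewrite lee_fin.
rewrite -(@fubini_tonelli _ _ _ _ _ leb leb (fun z => (W1 z)%:E)); last 2 first.
- exact/measurable_EFinP.
- by move=> z; rewrite lee_fin.
apply: le_trans (leeD W1int W1int) _.
have S00 : (0 <= (2^-1 * S0)%:E)%E.
  by rewrite lee_fin mulr_ge0// /S0 !mulr_ge0 ?invr_ge0 ?sqr_ge0 ?pi_ge0 ?(ltW m0)//
     !addr_ge0 ?mulr_ge0 ?sqr_ge0.
rewrite -ge0_muleDl// -EFinD.
by rewrite (_ : 2^-1 * S0 + 2^-1 * S0 = S0)//; field.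
Qed.

Let off x : x \notin IS -> Cx x = 0 /\ Sx x = 0.
Proof.
move=> xI; rewrite /Cx /Sx /kop /Rintegral /kc /ks /bp /= indicE (negbTE xI).
by split; rewrite integral0_eq// => y _; rewrite !(mul0r, mulr0).
Qed.

Let Eden x := chi x * (Cx x ^+ 2 + Sx x ^+ 2).

Let Eden_ge0 x : 0 <= Eden x.
Proof.
rewrite /Eden; have [xI|xI] := boolP (x \in IS); last first.
  by have [-> ->] := off xI; rewrite expr0n addr0 mulr0.
have : al <= x <= be by move/set_mem: xI; rewrite /IS /= in_itv.
by move=> /chi_le /andP[h1 _]; rewrite mulr_ge0// addr_ge0 ?sqr_ge0.
Qed.

Let mEden : measurable_fun setT Eden.
Proof.
by apply: measurable_funM => //; apply: measurable_funD; exact: measurable_funX.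
Qed.

Let iEden : leb.-integrable setT (EFin \o Eden).
Proof.
have := @integrable_cindic _ _ R leb IS (2 * (A * V) ^+ 2) mIS.
rewrite [X in (X < _)%E]lIS ltry => /(_ isT); apply: le_integrable => //.
  exact/measurable_EFinP.
move=> x _ /=; rewrite lee_fin (ger0_norm (Eden_ge0 x)) (le_trans _ (ler_norm _))//.
rewrite /Eden; have [xI|xI] := boolP (x \in IS); last first.
  by have [-> ->] := off xI; rewrite expr0n addr0 mulr0 indicE (negbTE xI) mulr0.
have : al <= x <= be by move/set_mem: xI; rewrite /IS /= in_itv.
move=> /chi_le /andP[h1 h2]; rewrite indicE xI mulr1.
have AV0 : 0 <= A * V by rewrite mulr_ge0.
have c2 : Cx x ^+ 2 <= (A * V) ^+ 2 by rewrite -(real_normK (num_real (Cx x))) lerXn2r ?nnegrE.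
have s2 : Sx x ^+ 2 <= (A * V) ^+ 2 by rewrite -(real_normK (num_real (Sx x))) lerXn2r ?nnegrE.
apply: le_trans (ler_wpM2r _ h2) _; first by rewrite addr_ge0 ?sqr_ge0.
by rewrite mul1r mulr_natl mulr2n lerD.
Qed.

Let energy_le : (\int[leb]_x (Eden x)%:E <= S0%:E * Lpp leb 2 f)%E.
Proof.
apply: le_trans Wint.
have -> : (\int[leb]_x (Eden x)%:E = (\int[leb]_y \int[leb]_x h (x, y))%:E)%E.
  rewrite -Rintegral_fubini2// Rintegral_fubini1//.
  have -> : (fun x => \int[leb]_y h (x, y)) = Eden by apply/funext => x; exact: E1.
  by rewrite /Rintegral fineK//; exact: integrable_fin_num.
have mQ : measurable_fun setT (fun y => \int[leb]_x h (x, y)).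
  exact: (measurable_Rintegral_section2 leb mh).
apply: (@le_trans _ _ (`|\int[leb]_y \int[leb]_x h (x, y)|)%:E).
  by rewrite lee_fin ler_norm.
apply: le_trans (normr_Rintegral_le mQ) _.
apply: ge0_le_integral => //.
- by apply/measurable_EFinP; exact: measurableT_comp.
- apply: (@measurable_fun_fubini_tonelli_F _ _ _ _ _ leb (fun z => (W z)%:E)).
    by apply/measurable_EFinP; exact: mW.
  by move=> z; rewrite lee_fin WE addr_ge0.
move=> y _; rewrite E2.
have mr : measurable_fun setT (fun y' => fJ y * fJ y' * kappa y y').
  have := measurable_Rintegral_section2 leb (mg y).
  by rewrite (_ : (fun y' => _) = (fun y' => fJ y * fJ y' * kappa y y'))//; apply/funext => y'; exact: E2'.
apply: le_trans (normr_Rintegral_le mr) _.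
apply: ge0_le_integral => //.
- by apply/measurable_EFinP; exact: measurableT_comp.
- by apply/measurable_EFinP; exact: (measurableT_comp mW (measurable_pair1 y)).
- by move=> y' _; rewrite lee_fin fJk_le.
Qed.

Let I := `[c - l / 2, c + l / 2]%classic.

(** The energy counts the cosine and the sine operators together; the bump is at
    least 9 / 16 on the interval of half the size. *)
Lemma oscillatory_energy (s : R -> R) : s = @cos R \/ s = @sin R ->
  (Lpp leb 2 (kop leb (fun z : R * R =>
     (\1_I z.1 * (s (P z.1 z.2) * a z.1 z.2) * \1_J z.2)%R) f) <=
   (16 / 9 * S0)%:E * Lpp leb 2 f)%E.
Proof.
move=> hs.
have II x : x \in I -> x \in IS.
  rewrite !inE /I /IS /= !in_itv /= => /andP[h1 h2].
  have := l0; lra.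
have kE x : kop leb (fun z : R * R =>
     \1_I z.1 * (s (P z.1 z.2) * a z.1 z.2) * \1_J z.2) f x ^+ 2 <= 16 / 9 * Eden x.
  have [xI|xI] := boolP (x \in I); last first.
    have -> : kop leb (fun z : R * R =>
        \1_I z.1 * (s (P z.1 z.2) * a z.1 z.2) * \1_J z.2) f x = 0.
      rewrite /kop /Rintegral integral0_eq// => y _.
      by rewrite /= indicE (negbTE xI) !mul0r.
    by rewrite expr0n /=; apply: mulr_ge0 (Eden_ge0 x).
  have xIS : al <= x <= be by move/set_mem: (II _ xI); rewrite /IS /= in_itv.
  have chi916 : 9 / 16 <= chi x.
    have t2 : tt x ^+ 2 <= 1 / 4.
      have : `|tt x| <= 1 / 2.
        rewrite /tt normrM normfV (gtr0_norm l0) ler_pdivrMr// ler_norml.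
        by move/set_mem: xI; rewrite /I /= in_itv /=; lra.
      by rewrite ler_norml; nra.
    by rewrite /chi; have := sqr_ge0 (tt x); nra.
  have h2 : kop leb (fun z : R * R =>
     \1_I z.1 * (s (P z.1 z.2) * a z.1 z.2) * \1_J z.2) f x ^+ 2 <= Cx x ^+ 2 + Sx x ^+ 2.
    case: hs => ->.
      rewrite (_ : kop _ _ _ _ = Cx x) ?lerDl ?sqr_ge0//.
      apply: eq_Rintegral => y _; rewrite /kc /bp /= !indicE xI (II _ xI) /=; ring.
    rewrite (_ : kop _ _ _ _ = Sx x) ?lerDr ?sqr_ge0//.
    apply: eq_Rintegral => y _; rewrite /ks /bp /= !indicE xI (II _ xI) /=; ring.
  apply: le_trans h2 _; rewrite /Eden mulrA ler_peMl ?addr_ge0 ?sqr_ge0//.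
  lra.
rewrite EFinM -muleA; apply: le_trans (lee_wpmul2l _ energy_le); last by rewrite lee_fin.
have mE2 : measurable_fun setT (EFin \o Eden) by exact/measurable_EFinP.
have n0 (x : R) : setT x -> (0 <= (EFin \o Eden) x)%E by move=> _; rewrite lee_fin.
have k0 : (0 <= (16 / 9 : R)%:E)%E by rewrite lee_fin.
rewrite -(ge0_integralZl leb measurableT mE2 n0 k0).
rewrite /Lpp; apply: ge0_le_integral => //.
- apply: measurable_normpow; apply: measurable_kop => //.
  apply: measurable_funM; last by apply: measurableT_comp.
  have mI : measurable (I : set (measurableTypeR R)) by exact: measurable_itv.
  apply: measurable_funM.
    by apply: measurableT_comp => //; exact: (measurable_indic mI).
  by apply: measurable_funM => //; case: hs => ->.
- exact: emeasurable_funM.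
- by move=> x _; rewrite /= -EFinM lee_fin powR_mulrn// real_normK ?num_real// kE.
Qed.

End energy.

Lemma oscillatory_L2 (s : R -> R) (N2 : R) : s = @cos R \/ s = @sin R -> 0 < N2 ->
  16 / 9 * (112 * A ^+ 2 * (1 + 4 * C + 3 * C ^+ 2) * pi / m) <= N2 ^+ 2 ->
  Lp_bounded leb leb 2 (fun z : R * R =>
     \1_(`[c - l / 2, c + l / 2]) z.1 * (s (P z.1 z.2) * a z.1 z.2) *
     \1_(`[e1, e2]) z.2) N2.
Proof.
move=> hs N20 hN f mf foo; apply: le_trans (oscillatory_energy mf foo hs) _.
by rewrite lee_wpmul2r ?Lpp_ge0// lee_fin powR_mulrn ?(ltW N20).
Qed.

End oscillatory_L2.

(** * The L^p bound in one variable *)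

Section mean_value.
Variables (R : realType) (g g' : R -> R) (e1 e2 M : R).
Hypothesis dg : forall t, is_derive1 g t (g' t).

Lemma mean_value_point t t' : e1 <= t <= e2 -> e1 <= t' <= e2 ->
  exists2 z, e1 <= z <= e2 & g t - g t' = g' z * (t - t').
Proof.
have main u v : u < v -> e1 <= u <= e2 -> e1 <= v <= e2 ->
    exists2 z, e1 <= z <= e2 & g v - g u = g' z * (v - u).
  move=> uv /andP[u1 u2] /andP[v1 v2].
  have [z zuv ->] := MVT uv (fun x _ => dg x)
    (continuous_subspaceT (is_derive1_continuous dg)).
  exists z => //; move: zuv; rewrite in_itv /= => /andP[h1 h2].
  by rewrite (le_trans u1 (ltW h1)) (le_trans (ltW h2) v2).
move=> ht ht'; have [tt|tt|->] := ltgtP t t'.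
- have [z hz e] := main _ _ tt ht ht'; exists z => //.
  by rewrite -[LHS]opprB e; ring.
- exact: main.
- by exists t' => //; rewrite !subrr mulr0.
Qed.

Lemma mean_value_ge t t' : (forall z, e1 <= z <= e2 -> M <= `|g' z|) ->
  e1 <= t <= e2 -> e1 <= t' <= e2 -> M * `|t - t'| <= `|g t - g t'|.
Proof.
move=> hM ht ht'; have [z hz ->] := mean_value_point ht ht'.
by rewrite normrM ler_wpM2r// hM.
Qed.

Lemma mean_value_le t t' : (forall z, e1 <= z <= e2 -> `|g' z| <= M) ->
  e1 <= t <= e2 -> e1 <= t' <= e2 -> `|g t - g t'| <= M * `|t - t'|.
Proof.
move=> hM ht ht'; have [z hz ->] := mean_value_point ht ht'.
by rewrite normrM ler_wpM2r// hM.
Qed.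

End mean_value.

(** P is the phase and a the amplitude; P1, P2, P3 are the derivatives of P in x
    and Q1, Q2, Q3 those of P1, P2, P3 in y. The length of the intervals is l,
    and every derivative in x costs 1 / l relative to the size m of the mixed
    derivative. *)
Record oscillating_block (R : realType) (P P1 P2 P3 Q1 Q2 Q3 a a1 a2 : R -> R -> R)
    (c l m C A e1 e2 : R) : Prop := OscillatingBlock {
  ob_dP : forall y x, is_derive1 (P^~ y) x (P1 x y);
  ob_dP1 : forall y x, is_derive1 (P1^~ y) x (P2 x y);
  ob_dP2 : forall y x, is_derive1 (P2^~ y) x (P3 x y);
  ob_cP3 : forall y, continuous (P3^~ y);
  ob_dQ1 : forall x y, is_derive1 (P1 x) y (Q1 x y);
  ob_dQ2 : forall x y, is_derive1 (P2 x) y (Q2 x y);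
  ob_dQ3 : forall x y, is_derive1 (P3 x) y (Q3 x y);
  ob_da : forall y x, is_derive1 (a^~ y) x (a1 x y);
  ob_da1 : forall y x, is_derive1 (a1^~ y) x (a2 x y);
  ob_ca2 : forall y, continuous (a2^~ y);
  ob_mP : measurable_fun setT (fun z : R * R => P z.1 z.2);
  ob_ma : measurable_fun setT (fun z : R * R => a z.1 z.2);
  ob_Q1 : forall x y, c - l <= x <= c + l -> e1 <= y <= e2 -> m <= `|Q1 x y|;
  ob_Q2 : forall x y, c - l <= x <= c + l -> e1 <= y <= e2 -> `|Q2 x y| <= C * m / l;
  ob_Q3 : forall x y, c - l <= x <= c + l -> e1 <= y <= e2 ->
    `|Q3 x y| <= C * m / l ^+ 2;
  ob_a : forall x y, c - l <= x <= c + l -> e1 <= y <= e2 -> `|a x y| <= A;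
  ob_a1 : forall x y, c - l <= x <= c + l -> e1 <= y <= e2 -> `|a1 x y| <= A / l;
  ob_a2 : forall x y, c - l <= x <= c + l -> e1 <= y <= e2 -> `|a2 x y| <= A / l ^+ 2
}.

(** Interpolation of the bound m^(-1/2) on L^2 with the trivial bound l on L^1
    and L^oo. *)
Lemma oscillating_block_Lp (R : realType) (p p' C A : R) :
  1 < p -> p^-1 + p'^-1 = 1 -> 0 <= C -> 0 < A ->
  let q := Num.max p p' in
  exists2 D : R, 0 < D &
    forall P P1 P2 P3 Q1 Q2 Q3 a a1 a2 (c l m e1 e2 : R) (s : R -> R),
      0 < l -> 0 < m -> e1 < e2 <= e1 + l -> s = @cos R \/ s = @sin R ->
      oscillating_block P P1 P2 P3 Q1 Q2 Q3 a a1 a2 c l m C A e1 e2 ->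
      Lp_bounded (@lebesgue_measure R) (@lebesgue_measure R) p
        (fun z : R * R => \1_(`[c - l / 2, c + l / 2]) z.1 *
           (s (P z.1 z.2) * a z.1 z.2) * \1_(`[e1, e2]) z.2)
        (D * m `^ (- q^-1) * l `^ (1 - 2 / q)).
Proof.
move=> p1 pp' C0 A0 q.
pose K := 16 / 9 * (112 * A ^+ 2 * (1 + 4 * C + 3 * C ^+ 2) * pi).
have K0 : 0 < K.
  by rewrite /K !mulr_gt0 ?pi_gt0 ?exprn_gt0// ltr_pwDl ?mulr_ge0 ?sqr_ge0// ltr_pwDl ?mulr_ge0.
exists (interp_cst p * Num.sqrt K `^ (2 / q) * A `^ (1 - 2 / q)).
  by rewrite !mulr_gt0 ?powR_gt0 ?interp_cst_gt0// sqrtr_gt0.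
move=> P P1 P2 P3 Q1 Q2 Q3 a a1 a2 c l m e1 e2 s l0 m0 /andP[e12 e12l] hs ob.
pose N2 := Num.sqrt (K / m); have N20 : 0 < N2 by rewrite sqrtr_gt0 divr_gt0.
have h2 := @oscillatory_L2 R P P1 P2 P3 a a1 a2 c l m C A e1 e2 l0 m0 C0 (ltW A0) e12
  (ob_dP ob) (ob_dP1 ob) (ob_dP2 ob) (ob_cP3 ob) (ob_da ob) (ob_da1 ob) (ob_ca2 ob)
  (ob_mP ob) (ob_ma ob)
  (fun x y y' hx => mean_value_ge (ob_dQ1 ob x) (fun z => ob_Q1 ob hx))
  (fun x y y' hx => mean_value_le (ob_dQ2 ob x) (fun z => ob_Q2 ob hx))
  (fun x y y' hx => mean_value_le (ob_dQ3 ob x) (fun z => ob_Q3 ob hx))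
  (ob_a ob) (ob_a1 ob) (ob_a2 ob) s N2 hs N20.
have {}h2 := h2 _.
set I := `[c - l / 2, c + l / 2]%classic; set J := `[e1, e2]%classic.
have mI : measurable (I : set (measurableTypeR R)) by exact: measurable_itv.
have mJ : measurable (J : set (measurableTypeR R)) by exact: measurable_itv.
have lI : (lebesgue_measure I <= l%:E :> \bar R)%E.
  rewrite lebesgue_measure_itv /= lte_fin; case: ifP => _; last by rewrite lee_fin ltW.
  by rewrite -EFinB lee_fin le_eqVlt; apply/orP; left; apply/eqP; field.
have lJ : (lebesgue_measure J <= l%:E :> \bar R)%E.
  rewrite lebesgue_measure_itv /= lte_fin e12 -EFinB lee_fin; lra.
have s1 t : `|s t| <= 1.
  by case: hs => ->; rewrite ler_norml ?cos_geN1 ?cos_le1 ?sin_geN1 ?sin_le1.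
have ms : measurable_fun setT s.
  by case: hs => ->; apply: continuous_measurable_fun; [exact: continuous_cos|exact: continuous_sin].
have tk : tame_on (@lebesgue_measure R) (@lebesgue_measure R) I J A
   (fun z : R * R => \1_I z.1 * (s (P z.1 z.2) * a z.1 z.2) * \1_J z.2).
  split.
  - apply: measurable_funM; last by apply: measurableT_comp => //; exact: (measurable_indic mJ).
    apply: measurable_funM; first by apply: measurableT_comp => //; exact: (measurable_indic mI).
    apply: measurable_funM; last exact: ob_ma ob.
    by apply: measurableT_comp => //; exact: ob_mP ob.
  - by split => //; apply: le_lt_trans lI _; exact: ltry.
  - by split => //; apply: le_lt_trans lJ _; exact: ltry.
  - move=> x y /=; rewrite !indicE.
    have [xI|] := boolP (x \in I); last by rewrite !mul0r mulr0 mul0r normr0.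
    have [yJ|] := boolP (y \in J); last by rewrite !mulr0 normr0.
    rewrite mul1r !mulr1 normrM -[leRHS]mul1r ler_pM//.
    apply: (ob_a ob).
      by move/set_mem: xI; rewrite /I /= in_itv /=; have := l0; lra.
    by move/set_mem: yJ; rewrite /J /= in_itv.
have N2E : 16 / 9 * (112 * A ^+ 2 * (1 + 4 * C + 3 * C ^+ 2) * pi / m) <= N2 ^+ 2.
  rewrite /N2 sqr_sqrtr ?divr_ge0 ?(ltW K0) ?(ltW m0)//.
  by rewrite le_eqVlt; apply/orP; left; apply/eqP; rewrite /K; ring.
have := Lp_bounded_interp tk A0 l0 N20 lI lJ (h2 N2E) p1 pp'.
rewrite -/q => h.
suff <- : interp_cst p * N2 `^ (2 / q) * (A * l) `^ (1 - 2 / q) =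
  interp_cst p * Num.sqrt K `^ (2 / q) * A `^ (1 - 2 / q) * m `^ (- q^-1) * l `^ (1 - 2 / q) by exact: h.
rewrite powRM ?(ltW A0) ?(ltW l0)//.
have -> : N2 `^ (2 / q) = Num.sqrt K `^ (2 / q) * m `^ (- q^-1).
  rewrite /N2 sqrtrM ?(ltW K0)// powRM ?sqrtr_ge0//; congr (_ * _).
  rewrite -powR12_sqrt ?invr_ge0 ?(ltW m0)// -powRrM invr_powR ?(ltW m0)//.
  congr (_ `^ _).
  have q0 : 0 < q by rewrite lt_max (lt_trans _ p1).
  by field; rewrite gt_eqF.
ring.
Qed.

(** * Lebesgue measure on rows *)

(** A name of its own for the measure on rows, on which its sigma-finiteness can
    be registered. *)
Definition lebn (R : realType) n : set 'rV[R]_n -> \bar R := lebesgue_rV R n.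

Section lebn.
Variables (R : realType).
Local Notation leb := (@lebesgue_measure R).

HB.instance Definition _ n := isMeasure.Build _ _ _ (@lebn R n)
  (@measure0 _ _ _ (lebesgue_rV R n)) (@measure_ge0 _ _ _ (lebesgue_rV R n))
  (@measure_semi_sigma_additive _ _ _ (lebesgue_rV R n)).

Definition box n (c : 'rV[R]_n) (r : R) : set 'rV[R]_n :=
  [set x | forall i, c ord0 i - r <= x ord0 i <= c ord0 i + r].

Lemma measurable_forall_coord d (T : measurableType d) n (A : 'I_n -> set T) :
  (forall i, measurable (A i)) -> measurable [set x : 'rV[T]_n | forall i, A i (x ord0 i)].
Proof.
move=> mA; rewrite [X in measurable X](_ : _ = \bigcap_(i in [set: 'I_n])
    ((fun x : 'rV[T]_n => x ord0 i) @^-1` A i)).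
  apply: fin_bigcap_measurable => // i _; rewrite -[X in measurable X]setTI.
  exact: measurable_rV_coord.
by apply/seteqP; split => [x xab i _|x xab i]; [exact: xab|exact: (xab i I)].
Qed.

Lemma measurable_box n (c : 'rV[R]_n) r : measurable (box c r).
Proof.
rewrite (_ : box c r = [set x | forall i : 'I_n,
    `[c ord0 i - r, c ord0 i + r]%classic (x ord0 i)]).
  apply: (@measurable_forall_coord _ (measurableTypeR R) n
    (fun i => `[c ord0 i - r, c ord0 i + r]%classic)) => i.
  exact: measurable_itv.
by apply/seteqP; split => x /= h i; have := h i; rewrite in_itv.
Qed.

Lemma lebn_box n (c : 'rV[R]_n) r : 0 <= r -> lebn (box c r) = ((2 * r) ^+ n)%:E.
Proof.
move=> r0; rewrite (_ : box c r = [set x : 'rV[R]_n | forall i,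
    x ord0 i \in `[(\row_i (c ord0 i - r)) ord0 i, (\row_i (c ord0 i + r)) ord0 i]]).
  have -> : (2 * r) ^+ n = \prod_(i < n) ((\row_i (c ord0 i + r)) ord0 i -
      (\row_i (c ord0 i - r)) ord0 i).
    rewrite (eq_bigr (fun=> 2 * r)); last by move=> i _; rewrite !mxE; ring.
    by rewrite prodr_const card_ord.
  apply: lebesgue_rV_box => i; rewrite !mxE; lra.
by apply/seteqP; split => x /= h i; have := h i; rewrite !mxE in_itv.
Qed.

Let lebn_sigma_finite n : sigma_finite setT (@lebn R n).
Proof.
exists (fun N : nat => box (0 : 'rV[R]_n) N%:R); last first.
  move=> N; split; first exact: measurable_box.
  by rewrite lebn_box// ltry.
apply/esym/seteqP; split => // x _.
exists (\sum_(i < n) (Num.truncn `|x ord0 i|).+1)%N => //= i.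
rewrite mxE sub0r add0r -ler_norml ltW//.
apply: lt_le_trans (truncnS_gt _) _; rewrite ler_nat.
by rewrite (bigD1 i)//= leq_addr.
Qed.

HB.instance Definition _ n := Measure_isSigmaFinite.Build _ _ _ (@lebn R n)
  (lebn_sigma_finite n).

Definition ins (T : Type) n (i : 'I_n.+1) (z : T * 'rV[T]_n) : 'rV[T]_n.+1 :=
  \row_j (if unlift i j is Some j' then z.2 ord0 j' else z.1).

Lemma ins_at (T : Type) n (i : 'I_n.+1) (z : T * 'rV[T]_n) : ins i z ord0 i = z.1.
Proof. by rewrite mxE unlift_none. Qed.

Lemma ins_lift (T : Type) n (i : 'I_n.+1) (z : T * 'rV[T]_n) j :
  ins i z ord0 (lift i j) = z.2 ord0 j.
Proof. by rewrite mxE liftK. Qed.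

Lemma measurable_ins d (T : measurableType d) n (i : 'I_n.+1) :
  measurable_fun setT (@ins T n i).
Proof.
apply: measurable_rVP => j; have [k ->|->] := unliftP i j.
  under eq_fun do rewrite ins_lift.
  exact: (measurableT_comp (measurable_rV_coord k) measurable_snd).
by under eq_fun do rewrite ins_at; exact: measurable_fst.
Qed.

Lemma rV_cons_ins (T : Type) n : @rV_cons T n = ins ord0.
Proof.
apply/funext => z; apply/matrixP => k j; rewrite ord1 {k}.
have [k ->|->] := unliftP ord0 j.
  rewrite ins_lift; have -> : lift ord0 k = rshift 1 k :> 'I_(1 + n) by exact/val_inj.
  by rewrite [LHS](@row_mxEr T 1 1 n).
rewrite ins_at; have -> : ord0 = lshift n ord0 :> 'I_(1 + n) by exact/val_inj.
by rewrite [LHS](@row_mxEl T 1 1 n) mxE.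
Qed.

Lemma ins_swap (T : Type) n (i : 'I_n.+1) (t u : T) (x : 'rV[T]_n) :
  ins (lift ord0 i) (t, ins ord0 (u, x)) = ins ord0 (u, ins i (t, x)).
Proof.
apply/matrixP => k j; rewrite ord1 {k}.
have [j' ->|->] := unliftP (lift ord0 i) j; last by rewrite ins_at ins_lift ins_at.
rewrite ins_lift /=; have [k ->|->] := unliftP ord0 j'.
  rewrite (_ : lift (lift ord0 i) (lift ord0 k) = lift ord0 (lift i k)).
    by rewrite !ins_lift.
  by apply/val_inj; rewrite /= /bump /= !add1n ltnS; case: (i <= k)%N.
rewrite (_ : lift (lift ord0 i) ord0 = ord0) ?ins_at//.
by apply/val_inj.
Qed.

Lemma ge0_integral_cons n (F : 'rV[R]_n.+1 -> \bar R) :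
  measurable_fun setT F -> (forall x, (0 <= F x)%E) ->
  (\int[@lebn R n.+1]_x F x = \int[leb]_t \int[@lebn R n]_x F (ins ord0 (t, x)))%E.
Proof.
move=> mF F0.
have mc : measurable_fun [set: measurableTypeR R * 'rV[R]_n]
  (@rV_cons R n : _ -> 'rV[R]_n.+1) by exact: measurable_rV_cons.
pose m2 : {measure set (measurableTypeR R * 'rV[R]_n)%type -> \bar R} :=
  (leb \x^ lebesgue_rV R n)%E.
rewrite [LHS](ge0_integral_pushforward mc m2)//.
rewrite preimage_setT rV_cons_ins.
have mG : measurable_fun setT (F \o @ins R n ord0).
  by apply: measurableT_comp => //; exact: measurable_ins.
have := @fubini_tonelli1 _ _ _ _ _ leb (@lebn R n) (F \o @ins R n ord0) mG (fun z => F0 _).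
rewrite /fubini_F /= => <-.
apply: eq_measure_integral => A mA _.
apply/esym; apply: product_measure_unique => // X Y mX mY.
exact: product_measure2E.
Qed.

(** By induction on n: Tonelli's theorem exchanges the coordinate singled out
    with the first one. *)
Lemma ge0_integral_ins n (i : 'I_n.+1) (F : 'rV[R]_n.+1 -> \bar R) :
  measurable_fun setT F -> (forall x, (0 <= F x)%E) ->
  (\int[@lebn R n.+1]_x F x = \int[leb]_t \int[@lebn R n]_x F (ins i (t, x)))%E.
Proof.
elim: n i F => [|n IHn] i F mF F0; first by rewrite (ord1 i) ge0_integral_cons.
have [k ->|->] := unliftP ord0 i; last exact: ge0_integral_cons.
rewrite [LHS](ge0_integral_cons mF F0).
pose G (z : (R * R) * 'rV[R]_n) := F (ins ord0 (z.1.1, ins k (z.1.2, z.2))).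
have mins m d (T : measurableType d) j (f : T -> R) (g : T -> 'rV[R]_m) :
    measurable_fun setT f -> measurable_fun setT g ->
    measurable_fun setT (fun z => ins j (f z, g z)).
  by move=> mf mg; apply: measurableT_comp; [exact: measurable_ins|exact/measurable_fun_pair].
have mG : measurable_fun setT G.
  by apply: (measurableT_comp mF); apply: (mins); [mproj|apply: (mins); mproj].
have mH := @measurable_fun_fubini_tonelli_F _ _ _ _ _ (@lebn R n) G mG (fun z => F0 _).
transitivity (\int[leb]_u \int[leb]_t \int[@lebn R n]_x G ((u, t), x))%E.
  apply: eq_integral => u _; rewrite (IHn k)//.
  by apply: (measurableT_comp mF); apply: (mins); mproj.
rewrite (@fubini_tonelli _ _ _ _ _ leb leb
  (fun z => \int[@lebn R n]_x G (z, x))%E)//=; last first.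
  by move=> z; apply: integral_ge0 => x _; exact: F0.
apply: eq_integral => t _.
have mFt : measurable_fun setT (fun x => F (ins (lift ord0 k) (t, x))).
  by apply: (measurableT_comp mF); apply: (mins); mproj.
rewrite [RHS](ge0_integral_cons mFt (fun=> F0 _)).
by apply: eq_integral => u _; apply: eq_integral => x _; rewrite ins_swap.
Qed.

Lemma ge0_integral_ins_prod n (i : 'I_n.+1) (F : 'rV[R]_n.+1 -> \bar R) :
  measurable_fun setT F -> (forall x, (0 <= F x)%E) ->
  (\int[@lebn R n.+1]_x F x = \int[(leb \x @lebn R n)%E]_z F (ins i z))%E.
Proof.
move=> mF F0; rewrite (ge0_integral_ins i)// fubini_tonelli1//.
by apply: measurableT_comp => //; exact: measurable_ins.
Qed.

Lemma integral_ins_prod n (i : 'I_n.+1) (F : 'rV[R]_n.+1 -> \bar R) :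
  measurable_fun setT F ->
  (\int[@lebn R n.+1]_x F x = \int[(leb \x @lebn R n)%E]_z F (ins i z))%E.
Proof.
move=> mF; rewrite integralE [RHS]integralE; congr (_ - _)%E.
  rewrite (ge0_integral_ins_prod i (measurable_funepos mF) (funepos_ge0 F)).
  by apply: eq_integral => z _; rewrite !funeposE.
rewrite (ge0_integral_ins_prod i (measurable_funeneg mF) (funeneg_ge0 F)).
by apply: eq_integral => z _; rewrite !funenegE.
Qed.

Lemma Lpp_ins n (i : 'I_n.+1) p (f : 'rV[R]_n.+1 -> R) : measurable_fun setT f ->
  Lpp (@lebn R n.+1) p f = Lpp (leb \x @lebn R n)%E p (fun z => f (ins i z)).
Proof.
move=> mf; rewrite /Lpp; apply: (ge0_integral_ins_prod i (F := fun x => (`|f x| `^ p)%:E)).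
  exact: measurable_normpow.
by move=> x; rewrite lee_fin powR_ge0.
Qed.

(** This is how estimates in a single pair of variables enter those on rows. *)
Lemma Lp_bounded_ins n m (i : 'I_n.+1) (j : 'I_m.+1) p
    (k : 'rV[R]_n.+1 * 'rV[R]_m.+1 -> R) a :
  0 <= p -> measurable_fun setT k ->
  Lp_bounded (leb \x @lebn R n)%E (leb \x @lebn R m)%E p
    (fun z => k (ins i z.1, ins j z.2)) a ->
  Lp_bounded (@lebn R n.+1) (@lebn R m.+1) p k a.
Proof.
move=> p0 mk hk f mf foo.
have mfj : measurable_fun setT (fun z => f (ins j z)).
  by apply: measurableT_comp => //; exact: measurable_ins.
have fE := Lpp_ins j p mf.
have mkf : measurable_fun setT (kop (@lebn R m.+1) k f) by exact: measurable_kop.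
rewrite (Lpp_ins i p mkf).
rewrite fE; apply: le_trans (hk _ mfj _); last by rewrite -fE.
rewrite /Lpp le_eqVlt; apply/orP; left; apply/eqP; apply: eq_integral => z _.
congr ((`| _ | `^ _)%:E); rewrite /kop /Rintegral; congr fine.
rewrite (integral_ins_prod j)//; apply/measurable_EFinP.
by apply: measurable_funM => //; exact: measurable_section.
Qed.

End lebn.

(** * Norms, boxes and measurability *)

Section row_norm.
Variable R : realType.

Lemma rV_coord_le n (x : 'rV[R]_n) i : `|x ord0 i| <= `|x|.
Proof.
rewrite [leRHS]/Num.norm /= mx_normrE; apply/bigmax_geP; right => /=.
by exists (ord0, i).
Qed.

Lemma rV_norm_le n (x : 'rV[R]_n) r : 0 <= r -> (forall i, `|x ord0 i| <= r) -> `|x| <= r.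
Proof.
move=> r0 h; rewrite [leLHS]/Num.norm /= mx_normrE; apply/bigmax_leP; split => // -[i j] _ /=.
by rewrite (ord1 i).
Qed.

Lemma box0E n r : 0 <= r -> box (0 : 'rV[R]_n) r = [set x | `|x| <= r].
Proof.
move=> r0; apply/seteqP; split => x /= h.
  by apply: rV_norm_le => // i; have := h i; rewrite mxE sub0r add0r -ler_norml.
by move=> i; rewrite mxE sub0r add0r -ler_norml (le_trans (rV_coord_le _ _)).
Qed.

Lemma pair_norm_le (V W : normedModType R) (z : V * W) r :
  `|z.1| <= r -> `|z.2| <= r -> `|z| <= r.
Proof. by move=> h1 h2; rewrite prod_normE ge_max h1. Qed.

Lemma pair_norm_ge (V W : normedModType R) (z : V * W) :
  `|z.1| <= `|z| /\ `|z.2| <= `|z|.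
Proof. by rewrite prod_normE !le_max !lexx orbT. Qed.

(** Rounding factors through a countable discrete space, so that every function
    of the rounded point is measurable; a continuous function is the limit of
    its values at the rounded points. *)
Let grid (N : nat) n (x : 'rV[int]_n) : 'rV[R]_n := \row_i ((x ord0 i)%:~R / N.+1%:R).
Let round (N : nat) n (x : 'rV[R]_n) : 'rV[int]_n := \row_i Num.floor (x ord0 i * N.+1%:R).

Let grid_round N n (x : 'rV[R]_n) : `|x - grid N (round N x)| <= N.+1%:R^-1.
Proof.
apply: rV_norm_le => [|i]; first by rewrite invr_ge0.
have N0 : 0 < N.+1%:R :> R by rewrite ltr0n.
rewrite !mxE; set t := x ord0 i; have /andP[h1 h2] := floor_itv (t * N.+1%:R).
have -> : t - (Num.floor (t * N.+1%:R))%:~R / N.+1%:R =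
    (t * N.+1%:R - (Num.floor (t * N.+1%:R))%:~R) / N.+1%:R by field; rewrite gt_eqF.
rewrite normrM normfV (ger0_norm (ltW N0)) ler_pdivrMr// mulVf ?gt_eqF//.
rewrite ger0_norm ?subr_ge0//; move: h2; rewrite intrD; lra.
Qed.

Let cvg_grid n (x : 'rV[R]_n) : grid N (round N x) @[N --> \oo] --> x.
Proof.
apply/cvgrPdist_le => e e0; near=> N.
apply: le_trans (grid_round _ _) _; rewrite ltW//.
by near: N; exact: near_infty_natSinv_lt (PosNum e0).
Unshelve. all: by end_near. Qed.

Let measurable_round N d (T : measurableType d) n (f : T -> 'rV[R]_n) (m : 'rV[int]_n) :
  measurable_fun setT f -> measurable [set x | round N (f x) = m].
Proof.
move=> mf.
have mA : measurable [set x : 'rV[R]_n | forall i : 'I_n,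
    [set t | Num.floor (t * N.+1%:R) = m ord0 i] (x ord0 i)].
  apply: (@measurable_forall_coord _ R n
    (fun i => [set t | Num.floor (t * N.+1%:R) = m ord0 i])) => i.
  rewrite (_ : mkset _ = `[(m ord0 i)%:~R / N.+1%:R, (m ord0 i + 1)%:~R / N.+1%:R[%classic).
    exact: measurable_itv.
  apply/seteqP; split => t /=; rewrite in_itv /= ler_pdivrMr ?ltr_pdivlMr ?ltr0n//.
    by move=> <-; exact: floor_itv.
  by move=> h; apply/eqP; rewrite floor_eq.
have := mf measurableT _ mA; rewrite setTI; congr measurable.
apply/seteqP; split => x /= h.
  by apply/matrixP => k i; rewrite ord1 mxE; exact: h.
by move=> i; rewrite -h mxE.
Qed.

Lemma continuous_measurable_rV2 n m (F : 'rV[R]_n * 'rV[R]_m -> R) :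
  continuous F -> measurable_fun setT F.
Proof.
move=> cF.
pose G N (z : 'rV[R]_n * 'rV[R]_m) := F (grid N (round N z.1), grid N (round N z.2)).
apply: (@measurable_fun_cvg _ _ _ _ G); last first.
  move=> [x y] _; rewrite /G /=.
  have h : ((grid N (round N x), grid N (round N y)) : 'rV[R]_n * 'rV[R]_m)
      @[N --> \oo] --> (x, y).
    apply/cvgrPdist_le => e e0; near=> N; apply: pair_norm_le => /=.
      by near: N; move: e e0; apply/cvgrPdist_le; exact: cvg_grid.
    by near: N; move: e e0; apply/cvgrPdist_le; exact: cvg_grid.
  exact: (cvg_comp _ F h (cF _)).
move=> N _ Y mY; rewrite setTI.
rewrite (_ : _ @^-1` _ = \bigcup_(u : 'rV[int]_n * 'rV[int]_m)
    (if pselect (Y (F (grid N u.1, grid N u.2))) then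
      [set z : 'rV[R]_n * 'rV[R]_m | round N z.1 = u.1] `&` [set z | round N z.2 = u.2]
     else set0)).
  apply: countable_bigcupT_measurable => // u; case: (pselect _) => hu /=; last exact: measurable0.
  by apply: measurableI; apply: measurable_round; [exact: measurable_fst|exact: measurable_snd].
apply/seteqP; split => [z /= h|z [u _]].
  by exists (round N z.1, round N z.2) => //; case: pselect.
by case: pselect => //= h [h1 h2]; rewrite /G h1 h2.
Unshelve. all: by end_near. Qed.

Lemma continuous_measurable_rV n (F : 'rV[R]_n -> R) : continuous F -> measurable_fun setT F.
Proof.
move=> cF; have := @continuous_measurable_rV2 n 0 (fun z => F z.1).
move=> /(_ (fun z => @continuous_comp _ _ _ fst F z (@cvg_fst _ _ _ _ _) (cF _))) mF.
exact: (measurableT_comp mF (measurable_fun_pair (@measurable_id _ 'rV[R]_n setT)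
  (@measurable_cst _ _ 'rV[R]_n 'rV[R]_0 setT 0))).
Qed.

Lemma measurable_rV_norm n : measurable_fun setT (fun x : 'rV[R]_n => `|x|).
Proof. by apply: continuous_measurable_rV; exact: norm_continuous. Qed.

End row_norm.

Section rows.
Variable R : realType.
Local Notation leb := (@lebesgue_measure R).

Lemma ins_box n (i : 'I_n.+1) (c : 'rV[R]_n.+1) r s (x : 'rV[R]_n) :
  box c r (ins i (s, x)) <->
  (`[c ord0 i - r, c ord0 i + r]%classic `*` box (\row_j c ord0 (lift i j)) r) (s, x).
Proof.
split => /= [h|[h1 h2] j].
  split; first by have := h i; rewrite ins_at /= in_itv.
  by move=> j; have := h (lift i j); rewrite ins_lift !mxE.
have [k ->|->] := unliftP i j; first by have := h2 k; rewrite ins_lift !mxE.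
by move: h1; rewrite ins_at in_itv.
Qed.

(** A bound in one pair of variables, uniform in the others, becomes a bound in
    all of them at the cost of the volume of the ranges of the others. *)
Lemma Lp_bounded_freeze_rV n m (i : 'I_n.+1) (j : 'I_m.+1) (p a b A r r' : R)
    (c : 'rV[R]_n.+1) (c' : 'rV[R]_m.+1) (k : 'rV[R]_n.+1 * 'rV[R]_m.+1 -> R) :
  1 <= p -> 0 < a -> measurable_fun setT k -> 0 <= r -> 0 <= r' ->
  (forall x y, `|k (x, y)| <= A * \1_(box c r) x * \1_(box c' r') y) ->
  (forall x y, Lp_bounded leb leb p (fun z => k (ins i (z.1, x), ins j (z.2, y))) a) ->
  a `^ p * (2 * r) ^+ n * ((2 * r') ^+ m) `^ (p - 1) <= b `^ p ->
  Lp_bounded (@lebn R n.+1) (@lebn R m.+1) p k b.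
Proof.
move=> p1 a0 mk r0 r'0 kA ka hb.
apply: (Lp_bounded_ins (i := i) (j := j)) => //; first exact: le_trans p1.
have lI u v : (leb `[u, v]%classic < +oo :> \bar R)%E.
  by rewrite lebesgue_measure_itv /=; case: ifP => // _; rewrite -EFinB ltry.
have indE l (h : 'I_l.+1) (e : 'rV[R]_l.+1) u s (x : 'rV[R]_l) : \1_(box e u) (ins h (s, x)) =
    \1_(`[e ord0 h - u, e ord0 h + u]%classic `*` box (\row_j e ord0 (lift h j)) u) (s, x) :> R.
  rewrite !indicE; congr (_%:R); congr nat_of_bool; apply/idP/idP => /set_mem hx; apply/mem_set.
    exact/ins_box.
  by apply/ins_box.
apply: (@Lp_bounded_freeze _ _ _ _ (measurableTypeR R) 'rV[R]_n (measurableTypeR R) 'rV[R]_m R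
  leb (@lebn R n) leb (@lebn R m) `[c ord0 i - r, c ord0 i + r]%classic
  (box (\row_l c ord0 (lift i l)) r) `[c' ord0 j - r', c' ord0 j + r']%classic
  (box (\row_l c' ord0 (lift j l)) r') A p a b
  (fun z => k (ins i z.1, ins j z.2))) => //.
- apply: (measurableT_comp mk); apply/measurable_fun_pair.
    exact: (measurableT_comp (measurable_ins i) measurable_fst).
  exact: (measurableT_comp (measurable_ins j) measurable_snd).
- exact: lI.
- exact: measurable_box.
- by rewrite [X in (X < _)%E]lebn_box// ltry.
- exact: lI.
- exact: measurable_box.
- by rewrite [X in (X < _)%E]lebn_box// ltry.
- by move=> s x t y; rewrite -!indE; exact: kA.
- rewrite [X in _ * fine X * _](lebn_box _ r0) [X in fine X `^ _](lebn_box _ r'0).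
  exact: hb.
Qed.

Lemma ge0_integral_rV1 (F : 'rV[R]_1 -> \bar R) :
  measurable_fun setT F -> (forall x, (0 <= F x)%E) ->
  (\int[@lebn R 1]_x F x = \int[leb]_t F (const_mx t))%E.
Proof.
move=> mF F0; rewrite (ge0_integral_ins ord0)//; apply: eq_integral => t _.
rewrite [LHS](@integral_dirac _ _ (0 : 'rV[R]_0) _ setT measurableT
  (fun x => F (ins ord0 (t, x)))).
  rewrite diracT mul1e; congr F; apply/matrixP => k i; rewrite ord1 (ord1 i) mxE.
  by rewrite unlift_none mxE.
by apply: (measurableT_comp mF); apply: (measurableT_comp (measurable_ins ord0)); mproj.
Qed.

Lemma integral_rV1 (F : 'rV[R]_1 -> \bar R) : measurable_fun setT F ->
  (\int[@lebn R 1]_x F x = \int[leb]_t F (const_mx t))%E.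
Proof.
move=> mF; rewrite integralE [RHS]integralE; congr (_ - _)%E.
  rewrite (ge0_integral_rV1 (measurable_funepos mF) (funepos_ge0 F)).
  by apply: eq_integral => z _; rewrite !funeposE.
rewrite (ge0_integral_rV1 (measurable_funeneg mF) (funeneg_ge0 F)).
by apply: eq_integral => z _; rewrite !funenegE.
Qed.

Lemma Lp_bounded_rV1 p (k : 'rV[R]_1 * 'rV[R]_1 -> R) a : measurable_fun setT k ->
  Lp_bounded (@lebn R 1) (@lebn R 1) p k a ->
  Lp_bounded leb leb p (fun z => k (const_mx z.1, const_mx z.2)) a.
Proof.
move=> mk hk f mf foo.
pose g (x : 'rV[R]_1) := f (x ord0 ord0).
have mg : measurable_fun setT g.
  by apply: (measurableT_comp mf); exact: measurable_rV_coord.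
have gE t : g (const_mx t) = f t by rewrite /g mxE.
have LE h : measurable_fun setT h ->
    Lpp (@lebn R 1) p h = Lpp leb p (fun t => h (const_mx t)).
  move=> mh; apply: (@ge0_integral_rV1 (fun x => (`|h x| `^ p)%:E)).
    exact: measurable_normpow.
  by move=> x; rewrite lee_fin powR_ge0.
have gfE : Lpp (@lebn R 1) p g = Lpp leb p f.
  by rewrite LE//; apply: eq_integral => t _; rewrite gE.
have := hk g mg; rewrite gfE => /(_ foo); apply: le_trans.
rewrite LE; last exact: measurable_kop.
rewrite /Lpp le_eqVlt; apply/orP; left; apply/eqP; apply: eq_integral => t _.
congr ((`| _ | `^ _)%:E); rewrite /kop /Rintegral; congr fine.
rewrite integral_rV1; first by apply: eq_integral => u _; rewrite gE.
apply/measurable_EFinP; apply: measurable_funM => //; exact: measurable_section.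
Qed.

End rows.

(** * Calculus of homogeneous polynomials *)

Section polynomial_calculus.
Variable R : realType.

Lemma mpoly_alg_ind N (P : mpoly N R -> Prop) :
  (forall c, P (mpolyC N c)) -> (forall i, P (mpolyX R (mnm1 i))) ->
  (forall p q, P p -> P q -> P (p + q)) -> (forall p q, P p -> P q -> P (p * q)) ->
  forall p, P p.
Proof.
move=> hC hX hD hM; apply: mpolyind; first by have := hC 0; rewrite mpolyC0.
move=> c m p _ _ hp; apply: (hD _ _ _ hp); rewrite -mul_mpolyC; apply: (hM) => //.
rewrite mpolyXE_id; elim/big_ind: _; [by have := hC 1|exact: hM|] => i _.
by elim: (m i) => [|k IH]; [have := hC 1|rewrite exprS; apply: (hM)].
Qed.

Lemma is_derive_meval N (Q : mpoly N R) (v : 'I_N -> R) l t :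
  is_derive1 (fun t => meval (fun k => if k == l then t else v k) Q) t
    (meval (fun k => if k == l then t else v k) (mderiv l Q)).
Proof.
elim/mpoly_alg_ind: Q => [c|i|p q hp hq|p q hp hq].
- under eq_fun do rewrite mevalC; rewrite mderivC meval0; exact: is_derive1_cst.
- under eq_fun do rewrite mevalXU; rewrite mderivX mnm1E mevalZ.
  have [->|il] := eqVneq i l; last by rewrite mul0r; exact: is_derive1_cst.
  apply: (@is_derive1_eq R (fun u => u)).
  rewrite (_ : mnm_sub _ _ = mnm0); first by rewrite mpolyX0 meval1 mulr1.
  by apply/mnmP => k; rewrite mnmBE mnm0E subnn.
- under eq_fun do rewrite mevalD; rewrite mderivD mevalD; exact: is_derive1D.
- under eq_fun do rewrite mevalM; rewrite mderivM mevalD !mevalM; exact: is_derive1M.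
Qed.

Lemma dhomog_mderiv N (Q : mpoly N R) D l :
  Q \is ishomog1 D mdeg -> mderiv l Q \is ishomog1 D.-1 mdeg.
Proof.
move=> /dhomogP hQ; apply/dhomogP => m.
rewrite mcoeff_msupp mcoeff_deriv => h.
have : mnm_add m (mnm1 l) \in msupp Q.
  by rewrite mcoeff_msupp; apply: contra_neq h => ->; rewrite mul0rn.
by move=> /hQ /= <-; rewrite mdegD mdeg1 addn1.
Qed.

Section phase.
Variable n : nat.
Implicit Types (Q S : mpoly (n + n) R) (z w : 'rV[R]_n * 'rV[R]_n).

Lemma phase_eval_lshift z i : phase_eval (mpolyX R (mnm1 (lshift n i))) z = z.1 ord0 i.
Proof. by rewrite /phase_eval mevalXU row_mxEl. Qed.

Lemma phase_eval_rshift z i : phase_eval (mpolyX R (mnm1 (rshift n i))) z = z.2 ord0 i.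
Proof. by rewrite /phase_eval mevalXU row_mxEr. Qed.

Lemma phase_evalD z Q S : phase_eval (Q + S) z = phase_eval Q z + phase_eval S z.
Proof. exact: mevalD. Qed.

Lemma phase_evalM z Q S : phase_eval (Q * S) z = phase_eval Q z * phase_eval S z.
Proof. exact: mevalM. Qed.

Lemma phase_evalC z c : phase_eval (mpolyC (n + n) c) z = c.
Proof. exact: mevalC. Qed.

Lemma phase_coordP (P : 'I_(n + n) -> Prop) :
  (forall i, P (lshift n i)) -> (forall i, P (rshift n i)) -> forall k, P k.
Proof. by move=> hl hr k; have [i ->|i ->] := split_ordP k. Qed.

Lemma continuous_phase_eval Q : continuous (phase_eval Q).
Proof.
have cfst i : continuous (fun z : 'rV[R]_n * 'rV[R]_n => z.1 ord0 i).
  by move=> z; exact: (@continuous_comp _ _ _ fst (fun x : 'rV[R]_n => x ord0 i) z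
    (@cvg_fst _ _ _ _ _) (@coord_continuous _ _ _ ord0 i _)).
have csnd i : continuous (fun z : 'rV[R]_n * 'rV[R]_n => z.2 ord0 i).
  by move=> z; exact: (@continuous_comp _ _ _ snd (fun x : 'rV[R]_n => x ord0 i) z
    (@cvg_snd _ _ _ _ _) (@coord_continuous _ _ _ ord0 i _)).
elim/mpoly_alg_ind: Q => [c|k|p q hp hq|p q hp hq].
- rewrite (_ : phase_eval _ = cst c); first by move=> z; exact: cvg_cst.
  by apply/funext => z; rewrite phase_evalC.
- elim/phase_coordP: k => i.
    by rewrite (_ : phase_eval _ = fun z => z.1 ord0 i) //; apply/funext => z; rewrite phase_eval_lshift.
  by rewrite (_ : phase_eval _ = fun z => z.2 ord0 i) //; apply/funext => z; rewrite phase_eval_rshift.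
- rewrite (_ : phase_eval _ = phase_eval p \+ phase_eval q).
    by move=> z; apply: cvgD; [exact: hp|exact: hq].
  by apply/funext => z; rewrite phase_evalD.
- rewrite (_ : phase_eval _ = phase_eval p \* phase_eval q).
    by move=> z; apply: cvgM; [exact: hp|exact: hq].
  by apply/funext => z; rewrite phase_evalM.
Qed.

Lemma measurable_phase_eval Q : measurable_fun setT (phase_eval Q).
Proof. exact: (continuous_measurable_rV2 (@continuous_phase_eval Q)). Qed.

Lemma phase_eval_scale Q D t z : Q \is ishomog1 D mdeg ->
  phase_eval Q (t *: z) = t ^+ D * phase_eval Q z.
Proof.
move=> /dhomogP hQ; rewrite /phase_eval !mevalE mulr_sumr.
apply: eq_big_seq => m /hQ /= <-; rewrite mulrCA; congr (_ * _).
rewrite mdegE -prodrXr -big_split /=; apply: eq_bigr => k _.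
rewrite -exprMn; congr (_ ^+ _).
by elim/phase_coordP: k => i; rewrite ?row_mxEl ?row_mxEr !mxE.
Qed.

Let unit_ball_bound Q : exists2 C, 0 < C & forall z w, `|z| <= 1 -> `|w| <= 1 ->
  `|phase_eval Q z| <= C /\ `|phase_eval Q z - phase_eval Q w| <= C * `|z - w|.
Proof.
elim/mpoly_alg_ind: Q => [c|k|p q [C C0 hC] [E E0 hE]|p q [C C0 hC] [E E0 hE]].
- exists (`|c| + 1) => [|z w _ _]; first by rewrite ltr_wpDl.
  by rewrite !phase_evalC subrr normr0 lerDl ler01 mulr_ge0 ?addr_ge0.
- exists 1 => // z w z1 w1; rewrite mul1r.
  have [h1 h2] := pair_norm_ge z; have [h3 h4] := pair_norm_ge (z - w).
  elim/phase_coordP: k => i.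
    rewrite !phase_eval_lshift; split; first exact: (le_trans (rV_coord_le _ _) (le_trans h1 z1)).
    by apply: le_trans h3; apply: le_trans (rV_coord_le (z - w).1 i); rewrite !mxE.
  rewrite !phase_eval_rshift; split; first exact: (le_trans (rV_coord_le _ _) (le_trans h2 z1)).
  by apply: le_trans h4; apply: le_trans (rV_coord_le (z - w).2 i); rewrite !mxE.
- exists (C + E) => [|z w z1 w1]; first exact: addr_gt0.
  have [a1 a2] := hC _ _ z1 w1; have [b1 b2] := hE _ _ z1 w1; rewrite !phase_evalD.
  split; first by apply: le_trans (ler_normD _ _) _; exact: lerD.
  rewrite mulrDl opprD addrACA; apply: le_trans (ler_normD _ _) _; exact: lerD.
- exists (C * E + C * E) => [|z w z1 w1]; first by rewrite addr_gt0// mulr_gt0.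
  have [a1 a2] := hC _ _ z1 w1; have [b1 b2] := hE _ _ z1 w1; rewrite !phase_evalM.
  have [d1 _] := hE _ _ w1 w1.
  split; first by rewrite normrM (le_trans (ler_pM _ _ a1 b1))// lerDl mulr_ge0// ltW.
  rewrite (_ : _ - _ = phase_eval p z * (phase_eval q z - phase_eval q w) +
    (phase_eval p z - phase_eval p w) * phase_eval q w); last by ring.
  apply: le_trans (ler_normD _ _) _; rewrite !normrM mulrDl; apply: lerD.
    by rewrite -mulrA ler_pM.
  by rewrite mulrAC ler_pM.
Qed.

(** By homogeneity it is enough to bound a polynomial and its increments on the
    unit ball, where sums and products preserve such bounds. *)
Lemma homog_bound Q D : Q \is ishomog1 D mdeg -> exists2 C, 0 < C &
  forall r z w, 0 < r -> `|z| <= r -> `|w| <= r ->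
    `|phase_eval Q z| <= C * r ^+ D /\
    r * `|phase_eval Q z - phase_eval Q w| <= C * r ^+ D * `|z - w|.
Proof.
move=> hQ; have [C C0 hC] := unit_ball_bound Q; exists C => // r z w r0 zr wr.
have sc (u : 'rV[R]_n * 'rV[R]_n) : `|u| <= r -> `|r^-1 *: u| <= 1.
  by move=> ur; rewrite normrZ gtr0_norm ?invr_gt0// ler_pdivrMl// mulr1.
have [] := hC _ _ (sc _ zr) (sc _ wr).
rewrite !(phase_eval_scale _ _ hQ) -mulrBr -scalerBr [X in _ <= C * X]normrZ !normrM.
have rD : 0 < r ^+ D by rewrite exprn_gt0.
rewrite exprVn (gtr0_norm (_ : 0 < (r ^+ D)^-1)) ?invr_gt0//.
rewrite (gtr0_norm (_ : 0 < r^-1)) ?invr_gt0//.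
rewrite ler_pdivrMl// mulrC => h1; rewrite ler_pdivrMl// => h2; split; first by [].
rewrite -ler_pdivlMl//; apply: le_trans h2 _.
by rewrite le_eqVlt; apply/orP; left; apply/eqP; ring.
Qed.

End phase.

Section slices.
Variable n : nat.
Implicit Types (Q S : mpoly (n.+1 + n.+1) R).

Lemma is_derive_phase_l Q (i : 'I_n.+1) (x : 'rV[R]_n) (Y : 'rV[R]_n.+1) t :
  is_derive1 (fun t => phase_eval Q (ins i (t, x), Y)) t
    (phase_eval (mderiv (lshift n.+1 i) Q) (ins i (t, x), Y)).
Proof.
pose v := row_mx (ins i (0, x)) Y ord0.
have e u : (fun k => row_mx (ins i (u, x)) Y ord0 k) =
    (fun k => if k == lshift n.+1 i then u else v k).
  apply/funext => k; rewrite /v; elim/phase_coordP: k => j.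
    rewrite !row_mxEl (inj_eq (@lshift_inj _ _)).
    by have [->|ji] := eqVneq; [rewrite ins_at|have [l ->|/esym/eqP] := unliftP i j; rewrite ?ins_lift// eq_sym (negbTE ji)].
  by rewrite !row_mxEr eq_sym eq_lrshift.
rewrite /phase_eval /= e; under eq_fun do rewrite e.
exact: is_derive_meval.
Qed.

Lemma is_derive_phase_r Q (i : 'I_n.+1) (X : 'rV[R]_n.+1) (y : 'rV[R]_n) t :
  is_derive1 (fun t => phase_eval Q (X, ins i (t, y))) t
    (phase_eval (mderiv (rshift n.+1 i) Q) (X, ins i (t, y))).
Proof.
pose v := row_mx X (ins i (0, y)) ord0.
have e u : (fun k => row_mx X (ins i (u, y)) ord0 k) =
    (fun k => if k == rshift n.+1 i then u else v k).
  apply/funext => k; rewrite /v; elim/phase_coordP: k => j.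
    by rewrite !row_mxEl eq_lrshift.
  rewrite !row_mxEr (inj_eq (@rshift_inj _ _)).
  by have [->|ji] := eqVneq; [rewrite ins_at|have [l ->|/esym/eqP] := unliftP i j; rewrite ?ins_lift// eq_sym (negbTE ji)].
rewrite /phase_eval /= e; under eq_fun do rewrite e.
exact: is_derive_meval.
Qed.

End slices.

Lemma compact_pair_ball m n (r : R) : compact [set z : 'rV[R]_m * 'rV[R]_n | `|z| <= r].
Proof.
have cB k : compact [set x : 'rV[R]_k | forall i, `[- r, r]%classic (x ord0 i)].
  by apply: (@rV_compact R k (fun=> `[- r, r]%classic)) => _; exact: segment_compact.
apply: subclosed_compact (compact_setX (cB m) (cB n)) _.
  apply: (@closed_comp _ _ (fun z : 'rV[R]_m * 'rV[R]_n => `|z|) [set t | t <= r]).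
    by move=> z _; exact: norm_continuous.
  exact: closed_le.
move=> z /= zr; have [h1 h2] := pair_norm_ge z.
by split => i /=; rewrite in_itv /= -ler_norml (le_trans (rV_coord_le _ _)) ?(le_trans h1)//
  (le_trans h2).
Qed.

(** The mixed Hessian does not vanish on the compact unit sphere; homogeneity
    turns this into a lower bound for one of its entries at every point. *)
Lemma hessian_entry_ge n d (S : mpoly (n + n) R) : (2 < d)%N ->
  S \is ishomog1 d mdeg -> (forall z : 'rV[R]_n * 'rV[R]_n, hessian_norm d S z = 0 -> z = 0) ->
  exists2 c, 0 < c & forall z : 'rV[R]_n * 'rV[R]_n, z != 0 -> exists i j : 'I_n,
    c * `|z| ^+ d.-2 <= `|phase_eval (mderiv (lshift n i) (mderiv (rshift n j) S)) z|.
Proof.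
move=> d2 hS hN.
pose H i j := phase_eval (mderiv (lshift n i) (mderiv (rshift n j) S)).
pose f z := \sum_i \sum_j `|H i j z|.
have cf : continuous f.
  apply: continuous_big => [|i _]; first exact: add_continuous.
  apply: continuous_big => [|j _ z]; first exact: add_continuous.
  apply: (@continuous_comp _ _ _ (H i j) (fun t => `|t|)); last exact: norm_continuous.
  exact: continuous_phase_eval.
have f0 z : z != 0 -> 0 < f z.
  move=> z0; rewrite lt_def sumr_ge0 ?andbT; last by move=> i _; exact: sumr_ge0.
  apply: contra_neq z0 => fz0; apply: hN; rewrite /hessian_norm.
  have H0 i j : H i j z = 0.
    apply/normr0_eq0/eqP; move/eqP: fz0; rewrite psumr_eq0; last first.
      by move=> k _; exact: sumr_ge0.
    by move=> /allP /(_ i (mem_index_enum _)) /=; rewrite psumr_eq0// => /allP /(_ j (mem_index_enum _)).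
  rewrite /HS_norm big1 ?sqrtr0; last first.
    by move=> i _; rewrite big1// => j _; rewrite mxE -/(H i j z) H0 normr0 expr0n.
  by rewrite powR0// invr_neq0// subr_eq0 (eqr_nat R d 2) gtn_eqF.
pose A := [set z : 'rV[R]_n * 'rV[R]_n | `|z| = 1].
have cA : compact A.
  apply: (subclosed_compact _ (@compact_pair_ball n n 1)); last by move=> z /= ->.
  apply: (@closed_comp _ _ (fun z : 'rV[R]_n * 'rV[R]_n => `|z|) [set 1]).
    by move=> z _; exact: norm_continuous.
  exact: closed_eq.
have sc z : z != 0 -> A (`|z|^-1 *: z).
  by move=> z0; rewrite /A /= normrZ normfV normr_id mulVf ?normr_eq0.
have fsc z t : f (t *: z) = `|t| ^+ d.-2 * f z.
  rewrite /f mulr_sumr; apply: eq_bigr => i _; rewrite mulr_sumr; apply: eq_bigr => j _.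
  rewrite /H (phase_eval_scale (D := d.-2)) ?normrM ?normrX//.
  exact/dhomog_mderiv/dhomog_mderiv.
have [A0|A0] := pselect (A !=set0); last first.
  by exists 1 => // z z0; case: A0; exists (`|z|^-1 *: z); exact: sc.
have [z0 /set_mem Az0 hmin] := compact_EVT_min A0 cA (continuous_subspaceT cf).
have fz0 : 0 < f z0.
  by apply: f0; apply/eqP => e; move: Az0; rewrite /A /= e normr0 => /esym/eqP; rewrite oner_eq0.
pose M : R := n%:R * n%:R + 1.
have M0 : 0 < M by rewrite ltr_wpDl.
exists (f z0 / M) => [|z zn0]; first exact: divr_gt0.
apply/not_existsP => hno.
have zD : 0 < `|z| ^+ d.-2 by rewrite exprn_gt0// normr_gt0.
have : f z <= n%:R * n%:R * (f z0 / M * `|z| ^+ d.-2).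
  rewrite -mulrA mulr_natl -[X in _ *+ X]card_ord -sumr_const; apply: ler_sum => i _.
  rewrite mulr_natl -[X in _ *+ X]card_ord -sumr_const; apply: ler_sum => j _.
  rewrite leNgt; apply/negP => hij; apply: (hno i); exists j; exact: ltW.
rewrite leNgt => /negP; apply.
have hz : f z0 <= f (`|z|^-1 *: z) by apply: hmin; apply/mem_set; exact: sc.
apply: lt_le_trans (_ : f z0 * `|z| ^+ d.-2 <= _).
  rewrite mulrA ltr_pM2r// mulrCA -[ltRHS]mulr1 ltr_pM2l// ltr_pdivrMr// mul1r /M; lra.
move: hz; rewrite fsc normfV normr_id exprVn ler_pdivlMl//; by rewrite mulrC.
Qed.

End polynomial_calculus.

(** * The estimate on a pair of cubes *)

Lemma Lp_bounded_zero d1 d2 (T1 : measurableType d1) (T2 : measurableType d2)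
    (R : realType) (mu : {measure set T1 -> \bar R})
    (nu : {sigma_finite_measure set T2 -> \bar R}) (p : R) (k : T1 * T2 -> R) (a : R) :
  1 <= p -> (forall z, k z = 0) -> Lp_bounded mu nu p k a.
Proof.
move=> p1 k0; have p0 : p != 0 by rewrite gt_eqF// (lt_le_trans _ p1).
apply: (@tame_Lp_bounded _ _ _ _ _ mu nu set0 set0 0) => //.
  split => //.
  - by rewrite (_ : k = cst 0); [exact: measurable_cst|exact/funext].
  - by rewrite measure0 ltry.
  - by rewrite measure0 ltry.
  - by move=> x y; rewrite k0 normr0 !mul0r.
by rewrite powR0// !mul0r powR_ge0.
Qed.

(** The value counts the initial conditions P 0, P 1, ... that hold. A shell is
    the number of dyadic balls that contain a point, and a grid cell is found in
    the same way along each axis. *)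
Lemma threshold_code d (T : measurableType d) K (P : nat -> T -> bool) :
  (forall i, measurable [set x | P i x]) ->
  exists2 c : T -> 'I_K.+1, (forall j, measurable [set x | c x = j]) &
    forall x, (forall i, (i < c x)%N -> P i x) /\ ((c x < K)%N -> ~~ P (c x) x).
Proof.
move=> mP; pose f x := find (fun i => ~~ P i x) (iota 0 K).
have fK x : (f x < K.+1)%N by rewrite ltnS -[leqRHS](size_iota 0) find_size.
have cE x : (inord (f x) : 'I_K.+1) = f x :> nat by rewrite inordK.
have spec x : (forall i, (i < f x)%N -> P i x) /\ ((f x < K)%N -> ~~ P (f x) x).
  split=> [i ix|h].
    have := @before_find _ 0%N (fun i => ~~ P i x) (iota 0 K) i ix.
    rewrite nth_iota; last by rewrite (leq_trans ix)// -ltnS fK.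
    by rewrite add0n => /negbFE.
  have := @nth_find _ 0%N (fun i => ~~ P i x) (iota 0 K); rewrite has_find size_iota => /(_ h).
  by rewrite nth_iota.
exists (fun x => inord (f x)) => [j|x]; last by rewrite cE; exact: spec.
rewrite (_ : mkset _ = \bigcap_(i in [set i | (i < j)%N]) [set x | P i x] `&`
    (if (j < K)%N then ~` [set x | P j x] else setT)).
  apply: measurableI; last by case: ifP => _ //; exact: measurableC.
  by apply: bigcap_measurableType.
apply/seteqP; split=> x /=.
  by move=> <-; rewrite cE; have [h1 h2] := spec x; split => //; case: ifP => // /h2 /negP.
move=> [h1 h2]; apply: val_inj; rewrite /= cE; have [s1 s2] := spec x.
have [fj|fj|//] := ltngtP (f x) j.
- by have := s2 (leq_trans fj (ltn_ord j : (j <= K)%N)); rewrite h1.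
- have jK : (j < K)%N by rewrite (leq_trans fj)// -ltnS fK.
  by move: h2; rewrite jK /= (s1 _ fj).
Qed.

Section dyadic_code.
Variables (R : realType) (n K N : nat) (B : R).
Hypothesis B0 : 0 < B.

Let b (j : nat) : R := B / 2 ^+ j.
Let b0 j : 0 < b j. Proof. by rewrite /b divr_gt0// exprn_gt0. Qed.

Definition cell_center (j : nat) (g : {ffun 'I_n -> 'I_N.+1}) : 'rV[R]_n :=
  \row_i (- b j + 2 * b j * ((g i)%:R + 2^-1) / N.+1%:R).

(** The dyadic shell of x, and the cell of x among the (N+1)^n cubes that cover
    the ball of that shell. *)
Lemma dyadic_code : exists2 c : 'rV[R]_n -> 'I_K.+1 * {ffun 'I_n -> 'I_N.+1},
  (forall u, measurable [set x | c x = u]) &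
  forall x, `|x| <= B -> [/\ `|x| <= B / 2 ^+ (c x).1,
    ((c x).1 < K)%N -> B / 2 ^+ (c x).1.+1 < `|x| &
    box (cell_center (c x).1 (c x).2) (B / 2 ^+ (c x).1 / N.+1%:R) x].
Proof.
have N0 : 0 < N.+1%:R :> R by rewrite ltr0n.
have mle (f g : 'rV[R]_n -> R) : measurable_fun setT f -> measurable_fun setT g ->
    measurable [set x | f x <= g x].
  by move=> mf mg; have := measurable_fun_le measurableT mf mg; rewrite setTI.
have mlt (f g : 'rV[R]_n -> R) : measurable_fun setT f -> measurable_fun setT g ->
    measurable [set x | f x < g x].
  move=> mf mg; rewrite (_ : mkset _ = ~` [set x | g x <= f x]).
    by apply: measurableC; exact: mle.
  by apply/seteqP; split=> x /=; rewrite ltNge => /negP.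
have [s ms hs] := @threshold_code _ 'rV[R]_n K (fun i x => `|x| <= b i.+1)
  (fun i => mle _ (cst (b i.+1)) (@measurable_rV_norm R n) (measurable_cst _)).
have hcell (j : 'I_K.+1) (i : 'I_n) : {c : 'rV[R]_n -> 'I_N.+1 |
    (forall k, measurable [set x | c x = k]) /\
    forall x, (forall r, (r < c x)%N -> - b j + 2 * b j * r.+1%:R / N.+1%:R < x ord0 i) /\
      ((c x < N)%N -> ~~ (- b j + 2 * b j * (c x).+1%:R / N.+1%:R < x ord0 i))}.
  apply: cid; have [|c mc hc] := @threshold_code _ 'rV[R]_n N
    (fun r x => - b j + 2 * b j * r.+1%:R / N.+1%:R < x ord0 i); last by exists c.
  by move=> r; exact: mlt (measurable_cst _) (measurable_rV_coord i).
pose cc x := (s x, [ffun i => sval (hcell (s x) i) x]).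
exists cc => [[j g]|x xB].
  rewrite (_ : mkset _ = [set x | s x = j] `&`
    \bigcap_(i in [set: 'I_n]) [set x | sval (hcell j i) x = g i]).
    apply: measurableI => //; apply: fin_bigcap_measurable => // i _.
    by case: (hcell j i) => c [].
  apply/seteqP; split=> x /=.
    by move=> [<- <-]; split => // i _; rewrite ffunE.
  move=> [sj h]; rewrite /cc sj; congr pair; apply/ffunP => i; rewrite ffunE.
  exact: h.
have [h1 h2] := hs x.
have xb : `|x| <= b (s x).
  case: (s x) h1 => -[|j] hj /= h1; first by rewrite /b expr0 divr1.
  exact: h1.
split => //=; first by move=> /h2; rewrite ltNge.
move=> i; rewrite mxE /= ffunE; case: (hcell (s x) i) => c [mc hc] /=.
have [c1 c2] := hc x.
have := le_trans (rV_coord_le x i) xb; rewrite ler_norml => /andP[xl xr].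
have NN : b (s x) / N.+1%:R * N.+1%:R = b (s x) by field; rewrite gt_eqF.
move: xl xr c1 c2; rewrite -/(b (s x)); set bb := b (s x) in NN *; set w := bb / N.+1%:R in NN *.
have w0 : 0 < w by rewrite divr_gt0 ?b0.
have E t : 2 * bb * t / N.+1%:R = 2 * w * t by rewrite /w; ring.
move=> xl xr c1 c2; rewrite !E; apply/andP; split.
  have [c0|c0] := posnP (c x); first by rewrite c0; lra.
  have := c1 (c x).-1; rewrite prednK// leqnn E => /(_ isT); lra.
have [cN|cN] := ltnP (c x) N.
  by have := c2 cN; rewrite E -leNgt -(natr1 (c x)); lra.
have -> : c x = N :> nat by apply/eqP; rewrite eqn_leq cN andbT -ltnS ltn_ord.
by move: NN; rewrite -(natr1 N); lra.
Qed.

End dyadic_code.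

(** The bounds are required on a ball that contains the enlarged cubes around
    the points of the ball of radius B. *)
Record amplitude (R : realType) n (B A : R) (a : 'rV[R]_n.+1 * 'rV[R]_n.+1 -> R)
    (a1 a2 : 'I_n.+1 -> 'rV[R]_n.+1 * 'rV[R]_n.+1 -> R) : Prop := Amplitude {
  am_meas : measurable_fun setT a;
  am_d : forall i x Y t,
    is_derive1 (fun t => a (ins i (t, x), Y)) t (a1 i (ins i (t, x), Y));
  am_d1 : forall i x Y t,
    is_derive1 (fun t => a1 i (ins i (t, x), Y)) t (a2 i (ins i (t, x), Y));
  am_c2 : forall i x Y, continuous (fun t => a2 i (ins i (t, x), Y));
  am_b : forall z, `|z| <= 3 * B -> `|a z| <= A;
  am_b1 : forall i z, `|z| <= 3 * B -> `|a1 i z| <= A;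
  am_b2 : forall i z, `|z| <= 3 * B -> `|a2 i z| <= A
}.

Section dyadic.
Variables (R : realType) (n e : nat) (S : mpoly (n.+1 + n.+1) R) (c0 : R).
Hypothesis hS : S \is ishomog1 e.+4 mdeg.
Hypothesis c00 : 0 < c0.
Local Notation mixed i j := (mderiv (lshift n.+1 i) (mderiv (rshift n.+1 j) S)).
Hypothesis hH : forall z : 'rV[R]_n.+1 * 'rV[R]_n.+1, z != 0 -> exists i j : 'I_n.+1,
  c0 * `|z| ^+ e.+2 <= `|phase_eval (mixed i j) z|.

Let common_bound : exists2 C, 0 < C & forall (i j : 'I_n.+1) r (z w : 'rV[R]_n.+1 * 'rV[R]_n.+1),
  0 < r -> `|z| <= r -> `|w| <= r ->
  [/\ r * `|phase_eval (mixed i j) z - phase_eval (mixed i j) w| <= C * r ^+ e.+2 * `|z - w|,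
     `|phase_eval (mderiv (lshift n.+1 i) (mixed i j)) z| <= C * r ^+ e.+1 &
     `|phase_eval (mderiv (lshift n.+1 i) (mderiv (lshift n.+1 i) (mixed i j))) z| <= C * r ^+ e].
Proof.
have h0 i j : mixed i j \is ishomog1 e.+2 mdeg by exact: (dhomog_mderiv _ (dhomog_mderiv _ hS)).
have h (u : 'I_n.+1 * 'I_n.+1) : {C | 0 < C /\ forall r (z w : 'rV[R]_n.+1 * 'rV[R]_n.+1),
  0 < r -> `|z| <= r -> `|w| <= r ->
  [/\ r * `|phase_eval (mixed u.1 u.2) z - phase_eval (mixed u.1 u.2) w| <=
        C * r ^+ e.+2 * `|z - w|,
     `|phase_eval (mderiv (lshift n.+1 u.1) (mixed u.1 u.2)) z| <= C * r ^+ e.+1 &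
     `|phase_eval (mderiv (lshift n.+1 u.1) (mderiv (lshift n.+1 u.1) (mixed u.1 u.2))) z| <=
        C * r ^+ e]}.
  case: u => i j /=; apply: cid.
  have [C1 C10 hC1] := homog_bound (h0 i j).
  have [C2 C20 hC2] := homog_bound (dhomog_mderiv (lshift n.+1 i) (h0 i j)).
  have [C3 C30 hC3] := homog_bound (dhomog_mderiv (lshift n.+1 i)
    (dhomog_mderiv (lshift n.+1 i) (h0 i j))).
  exists (C1 + C2 + C3); split=> [|r z w r0 zr wr]; first by rewrite !addr_gt0.
  have [_ a1] := hC1 _ _ _ r0 zr wr; have [a2 _] := hC2 _ _ _ r0 zr wr.
  have [a3 _] := hC3 _ _ _ r0 zr wr; have rk k : 0 <= r ^+ k by rewrite exprn_ge0// ltW.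
  split; [apply: le_trans a1 _; rewrite ler_wpM2r//|apply: le_trans a2 _|apply: le_trans a3 _];
    by rewrite ler_wpM2r//; move: C10 C20 C30; lra.
exists (\sum_u sval (h u)) => [|i j r z w r0 zr wr].
  rewrite (bigD1 (ord0, ord0))//= ltr_pwDl//; first by case: (h _) => C [].
  by apply: sumr_ge0 => u _; case: (h u) => C [C0 hC]; exact: ltW.
have hle : sval (h (i, j)) <= \sum_u sval (h u).
  rewrite (bigD1 (i, j))//= lerDl; apply: sumr_ge0 => u _; by case: (h u) => C [C0 hC]; exact: ltW.
have rk k : 0 <= r ^+ k by rewrite exprn_ge0// ltW.
move: hle; case: (h (i, j)) => C [C0 hC] /= hle; have [a1 a2 a3] := hC _ _ _ r0 zr wr.
split; [apply: le_trans a1 _; rewrite ler_wpM2r//|apply: le_trans a2 _|apply: le_trans a3 _];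
  by rewrite ler_wpM2r.
Qed.

Variables (p p' A B : R).
Hypothesis p1 : 1 < p.
Hypothesis pp' : p^-1 + p'^-1 = 1.
Hypothesis A0 : 0 < A.
Hypothesis B0 : 0 < B.
Let q := Num.max p p'.

Let p0 : 0 < p. Proof. exact: lt_trans p1. Qed.
Let p'0 : 0 < p'.
Proof. by rewrite -invr_gt0 -(addKr p^-1 p'^-1) pp' addrC subr_gt0 invf_lt1. Qed.
Let q0 : 0 < q. Proof. by rewrite lt_max p0. Qed.
Let pq1 : p / q <= 1. Proof. by rewrite ler_pdivrMr// mul1r le_max lexx. Qed.
Let pq2 : p / q <= p - 1.
Proof.
have -> : p - 1 = p / p'.
  by rewrite -[p'^-1](addKr p^-1) pp'; field; rewrite gt_eqF.
by rewrite ler_pM2l// lef_pV2 ?posrE// le_max lexx orbT.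
Qed.

Let shrink_volume M rho sx sy : 2 <= M -> 0 < rho -> 0 < sx <= 1 -> 0 < sy <= 1 ->
  (2 * (rho * sx / M)) ^+ n * ((2 * (rho * sy / M)) ^+ n) `^ (p - 1) <=
  (rho ^+ n * (sx * sy) `^ (n%:R / q)) `^ p.
Proof.
move=> M2 r0 /andP[sx0 sx1] /andP[sy0 sy1].
have M0 : 0 < M by apply: lt_le_trans M2.
have rn : 0 < rho ^+ n by rewrite exprn_gt0.
have h t : 0 < t -> (2 * (rho * t / M)) ^+ n <= rho ^+ n * t ^+ n.
  move=> t0; rewrite -exprMn; apply: lerXn2r; rewrite ?nnegrE ?mulr_ge0 ?invr_ge0 ?(ltW r0) ?(ltW t0) ?(ltW M0)//.
  by rewrite mulrA ler_pdivrMr// mulrC ler_pM2l ?mulr_gt0.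
have sE t : 0 < t -> t ^+ n = t `^ n%:R by move=> t0; rewrite powR_mulrn// ltW.
have pn : 0 <= p - 1 by rewrite subr_ge0 ltW.
apply: (@le_trans _ _ ((rho ^+ n * sx ^+ n) * (rho ^+ n * sy ^+ n) `^ (p - 1))).
  apply: ler_pM; rewrite ?exprn_ge0 ?powR_ge0 ?h//.
    by rewrite !mulr_ge0 ?invr_ge0 ?(ltW r0) ?(ltW sx0) ?(ltW M0).
  apply: ge0_ler_powR => //; rewrite ?nnegrE ?h//.
    by rewrite exprn_ge0// !mulr_ge0 ?invr_ge0 ?(ltW r0) ?(ltW sy0) ?(ltW M0).
  by rewrite mulr_ge0 ?exprn_ge0 ?ltW.
rewrite !powRM ?mulr_ge0 ?exprn_ge0 ?powR_ge0 ?(ltW rn) ?(ltW sx0) ?(ltW sy0) ?(ltW r0)//.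
rewrite (_ : (rho ^+ n) `^ p = rho ^+ n * (rho ^+ n) `^ (p - 1)); last first.
  by rewrite -[X in X * _]powRr1 ?(ltW rn)// -powRD ?(gt_eqF rn) ?implybT//; congr (_ `^ _); ring.
rewrite [leLHS](_ : _ = rho ^+ n * (rho ^+ n) `^ (p - 1) * (sx ^+ n * (sy ^+ n) `^ (p - 1))); last by ring.
rewrite ler_pM2l ?mulr_gt0 ?powR_gt0//.
have n0 : 0 <= n%:R :> R by [].
have E1 : n%:R / q * p = n%:R * (p / q) by ring.
apply: ler_pM; rewrite ?exprn_ge0 ?powR_ge0 ?(ltW sx0)// !sE// -!powRrM E1.
  by apply: ger_powR; rewrite ?sx0//; apply: ler_piMr.
by apply: ger_powR; rewrite ?sy0//; apply: ler_wpM2l.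
Qed.

Let expand_bound D kap lam rho M : 0 < kap -> 0 < lam -> 0 < rho -> 0 < M ->
  D * (lam * kap * rho ^+ e.+2) `^ (- q^-1) * (2 * rho / M) `^ (1 - 2 / q) * rho ^+ n =
  D * kap `^ (- q^-1) * (2 / M) `^ (1 - 2 / q) * lam `^ (- q^-1) *
    rho `^ (n.+1%:R - e.+4%:R / q).
Proof.
move=> k0 l0 r0 M0.
have r2 : 0 < rho ^+ e.+2 by rewrite exprn_gt0.
have -> : rho `^ (n.+1%:R - e.+4%:R / q) =
    (rho ^+ e.+2) `^ (- q^-1) * rho `^ (1 - 2 / q) * rho ^+ n.
  rewrite -!powR_mulrn ?(ltW r0)// -powRrM -!powRD ?(gt_eqF r0) ?implybT//.
  congr (_ `^ _); rewrite -(natr1 n) -(natr1 e.+3) -(natr1 e.+2); ring.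
rewrite (_ : 2 * rho / M = rho * (2 / M)); last by ring.
move: (rho ^+ e.+2) r2 => X X0.
have M1 : 0 < 2 / M by rewrite divr_gt0.
rewrite (powRM _ (ltW (mulr_gt0 l0 k0)) (ltW X0)) (powRM _ (ltW l0) (ltW k0)).
rewrite (powRM _ (ltW r0) (ltW M1)).
ring.
Qed.

(** Let (x0, y0) be a point of the two cubes, at distance about rho from the
    origin. Some entry (i, j) of the mixed Hessian has size rho^(d-2) there, and
    it keeps that size on cubes of side rho / N when N is large. In the pair
    (x_i, y_j) the operator is thus an oscillating block with m = lam rho^(d-2)
    and l = rho / N up to constants; integrating out the other variables costs
    the sides of the cubes. *)
Lemma cube_bound : exists2 N : nat, (0 < N)%N & exists2 D, 0 < D &
  forall (lam rho sx sy : R) (c c' : 'rV[R]_n.+1) (s : R -> R) a a1 a2 x0 y0,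
  0 < lam -> 0 < rho -> rho <= B -> 0 < sx <= 1 -> 0 < sy <= 1 ->
  s = @cos R \/ s = @sin R -> amplitude B A a a1 a2 ->
  box c (rho * sx / N.+1%:R) x0 -> box c' (rho * sy / N.+1%:R) y0 ->
  rho / 2 <= `|(x0, y0)| <= rho ->
  Lp_bounded (@lebn R n.+1) (@lebn R n.+1) p
    (fun z => \1_(box c (rho * sx / N.+1%:R)) z.1 * (s (lam * phase_eval S z) * a z) *
              \1_(box c' (rho * sy / N.+1%:R)) z.2)
    (D * lam `^ (- q^-1) * rho `^ (n.+1%:R - e.+4%:R / q) * (sx * sy) `^ (n%:R / q)).
Proof.
have [C C0 hC] := common_bound.
(* As |z0| >= rho / 2, the chosen entry is at least 2 kap rho^(d-2) at z0; N
   makes its variation on the cubes at most kap rho^(d-2). *)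
pose kap := c0 / 2 ^+ e.+3; have kap0 : 0 < kap by rewrite divr_gt0// exprn_gt0.
pose N := (Num.truncn (4 * C * 3 ^+ e.+1 / kap)).+1.
have hN : 4 * C * 3 ^+ e.+1 / kap <= N.+1%:R.
  by apply: ltW; apply: lt_le_trans (truncnS_gt _) _; rewrite ler_nat.
pose C' := C * 3 ^+ e.+1 / kap; have C'0 : 0 < C' by rewrite !mulr_gt0 ?invr_gt0 ?exprn_gt0.
pose A' := A * (1 + B) ^+ 2; have A'0 : 0 < A' by rewrite mulr_gt0// exprn_gt0// addr_gt0.
have [D D0 hD] := oscillating_block_Lp p1 pp' (ltW C'0) A'0; rewrite -/q in hD.
pose M : R := N.+1%:R; have M2 : 2 <= M by rewrite /M ler_nat.
have M0 : 0 < M by apply: lt_le_trans M2.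
exists N => //; exists (D * kap `^ (- q^-1) * (2 / M) `^ (1 - 2 / q)).
  by rewrite !mulr_gt0 ?powR_gt0 ?divr_gt0.
move=> lam rho sx sy c c' s a a1 a2 x0 y0 lam0 rho0 rhoB sx01 sy01 hs ha.
rewrite -/M; set rx := rho * sx / M; set ry := rho * sy / M => bx0 by0 /andP[z0l z0r].
have [[sx0 sx1] [sy0 sy1]] := (andP sx01, andP sy01).
set l := 2 * rho / M; set m := lam * kap * rho ^+ e.+2.
have l0 : 0 < l by rewrite !mulr_gt0 ?invr_gt0.
have rho2 : 0 < rho ^+ e.+2 by rewrite exprn_gt0.
have rho1 : 0 < rho ^+ e.+1 by rewrite exprn_gt0.
have m0 : 0 < m := mulr_gt0 (mulr_gt0 lam0 kap0) rho2.
have rx0 : 0 < rx by rewrite !mulr_gt0 ?invr_gt0.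
have ry0 : 0 < ry by rewrite !mulr_gt0 ?invr_gt0.
have rl t : t <= 1 -> rho * t / M <= l / 2.
  move=> t1; rewrite (_ : l / 2 = rho * 1 / M); last by rewrite /l; field; rewrite gt_eqF.
  by rewrite ler_pM2r ?invr_gt0// ler_pM2l.
have [rxl ryl] : rx <= l / 2 /\ ry <= l / 2 by split; exact: rl.
have lrho : l <= rho.
  by rewrite /l ler_pdivrMr// mulrC ler_pM2l.
have near_z0 (x y : 'rV[R]_n.+1) : (forall k, `|x ord0 k - x0 ord0 k| <= 2 * l) ->
    (forall k, `|y ord0 k - y0 ord0 k| <= 2 * l) ->
    `|(x, y) - (x0, y0)| <= 2 * l /\ `|(x, y)| <= 3 * rho.
  move=> hx hy; have h : `|(x, y) - (x0, y0)| <= 2 * l.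
    have l20 : 0 <= 2 * l by rewrite mulr_ge0 ?(ltW l0).
    apply: pair_norm_le; apply: rV_norm_le => // k1.
      by have := hx k1; rewrite /= !mxE.
    by have := hy k1; rewrite /= !mxE.
  split => //; rewrite -[X in `|X|](subrK (x0, y0)).
  by apply: le_trans (ler_normD _ _) _; move: h z0r lrho; lra.
have box_near c1 r1 (x x1 : 'rV[R]_n.+1) k : r1 <= l / 2 -> box c1 r1 x1 ->
    c1 ord0 k - l <= x ord0 k <= c1 ord0 k + l -> `|x ord0 k - x1 ord0 k| <= 2 * l.
  by move=> r1l /(_ k)/andP[h1 h2] /andP[h3 h4]; rewrite ler_norml; move: r1l l0; lra.
have z00 : (x0, y0) != 0 by rewrite -normr_gt0 (lt_le_trans _ z0l)// divr_gt0.
have [i [j hij]] := hH z00.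
pose slice := D * m `^ (- q^-1) * l `^ (1 - 2 / q).
have slice0 : 0 < slice by rewrite !mulr_gt0 ?powR_gt0.
pose k z := \1_(box c rx) z.1 * (s (lam * phase_eval S z) * a z) * \1_(box c' ry) z.2 : R.
have s1 t : `|s t| <= 1.
  by case: hs => ->; rewrite ler_norml ?cos_geN1 ?cos_le1 ?sin_geN1 ?sin_le1.
have ms : measurable_fun setT s.
  by case: hs => ->; apply: continuous_measurable_fun; [exact: continuous_cos|exact: continuous_sin].
have mk : measurable_fun setT k.
  apply: measurable_funM; last first.
    exact: (measurableT_comp (measurable_indic (measurable_box c' ry)) measurable_snd).
  apply: measurable_funM.
    exact: (measurableT_comp (measurable_indic (measurable_box c rx)) measurable_fst).
  apply: measurable_funM; last exact: am_meas ha.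
  apply: (measurableT_comp ms); apply: measurable_funM; first exact: measurable_cst.
  exact: measurable_phase_eval.
have wide c1 r1 (x : 'rV[R]_n.+1) k1 : r1 <= l / 2 -> box c1 r1 x ->
    c1 ord0 k1 - l <= x ord0 k1 <= c1 ord0 k1 + l.
  by move=> r1l /(_ k1)/andP[h1 h2]; move: r1l l0; lra.
have kA x y : `|k (x, y)| <= A * \1_(box c rx) x * \1_(box c' ry) y.
  rewrite /k /= !indicE; have [/set_mem xb|] := boolP (x \in _); last by rewrite !mul0r mulr0 mul0r normr0.
  have [/set_mem yb|] := boolP (y \in _); last by rewrite !mulr0 normr0.
  rewrite mul1r !mulr1 normrM -[leRHS]mul1r ler_pM//; apply: (am_b ha).
  have [_ h] : `|(x, y) - (x0, y0)| <= 2 * l /\ `|(x, y)| <= 3 * rho.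
    apply: near_z0 => k1; first exact: (box_near _ _ _ _ _ rxl bx0 (wide _ _ _ _ rxl xb)).
    exact: (box_near _ _ _ _ _ ryl by0 (wide _ _ _ _ ryl yb)).
  by move: h rhoB; lra.
have -> : (D * kap `^ (- q^-1) * (2 / M) `^ (1 - 2 / q) * lam `^ (- q^-1) *
    rho `^ (n.+1%:R - e.+4%:R / q) * (sx * sy) `^ (n%:R / q)) =
    slice * (rho ^+ n * (sx * sy) `^ (n%:R / q)).
  by rewrite -expand_bound// /slice /m /l; ring.
apply: (Lp_bounded_freeze_rV (i := i) (j := j) (a := slice) (A := A) (r := rx) (r' := ry)
  (c := c) (c' := c') (k := k)) => //; [exact: ltW|exact: ltW|exact: ltW| |]; last first.
  have sl0 := ltW slice0.
  have rs0 : 0 <= rho ^+ n * (sx * sy) `^ (n%:R / q).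
    by rewrite mulr_ge0 ?powR_ge0 ?exprn_ge0 ?(ltW rho0).
  rewrite [leRHS](powRM _ sl0 rs0) -mulrA.
  by rewrite ler_wpM2l ?powR_ge0//; exact: shrink_volume.
move=> x y; have [xyb|xyb] := pselect (box (\row_k c ord0 (lift i k)) rx x /\
    box (\row_k c' ord0 (lift j k)) ry y); last first.
  apply: Lp_bounded_zero => [|z]; first exact: ltW.
  rewrite /k /= !indicE.
  have [/set_mem/ins_box[_ xb]|] := boolP (ins i (z.1, x) \in _); last by rewrite !mul0r.
  have [/set_mem/ins_box[_ yb]|] := boolP (ins j (z.2, y) \in _); last by rewrite !mulr0.
  by case: xyb.
case: xyb => xb yb.
pose e1 := c' ord0 j - ry; pose e2 := c' ord0 j + ry.
pose Q T t u := phase_eval T (ins i (t, x), ins j (u, y)).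
have mD (T : mpoly (n.+1 + n.+1) R) : mderiv (rshift n.+1 j) (mderiv (lshift n.+1 i) T) =
   mderiv (lshift n.+1 i) (mderiv (rshift n.+1 j) T) by rewrite mderiv_comm.
pose T1 := mderiv (lshift n.+1 i) S; pose T2 := mderiv (lshift n.+1 i) T1.
pose T3 := mderiv (lshift n.+1 i) T2.
pose U1 := mixed i j; pose U2 := mderiv (lshift n.+1 i) U1.
pose U3 := mderiv (lshift n.+1 i) U2.
have dl T w u t : is_derive1 (fun t => w * Q T t u) t (w * Q (mderiv (lshift n.+1 i) T) t u).
  apply: (@is_derive1_eq R _ _ (0 * Q T t u + w * Q (mderiv (lshift n.+1 i) T) t u)).
    exact: (is_derive1M (is_derive1_cst w t) (is_derive_phase_l _ _ _ _ _)).
  by rewrite mul0r add0r.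
have dr T w u t : is_derive1 (fun u => w * Q T t u) u (w * Q (mderiv (rshift n.+1 j) T) t u).
  apply: (@is_derive1_eq R _ _ (0 * Q T t u + w * Q (mderiv (rshift n.+1 j) T) t u)).
    exact: (is_derive1M (is_derive1_cst w u) (is_derive_phase_r _ _ _ _ _)).
  by rewrite mul0r add0r.
have near_pt t u : c ord0 i - l <= t <= c ord0 i + l -> e1 <= u <= e2 ->
    `|(ins i (t, x), ins j (u, y)) - (x0, y0)| <= 2 * l /\
    `|(ins i (t, x), ins j (u, y))| <= 3 * rho.
  move=> ht hu; apply: near_z0 => k1; have := l0 => l0'.
    apply: (box_near _ _ _ _ _ rxl bx0); have [k2 ->|->] := unliftP i k1; last by rewrite ins_at.
    by rewrite ins_lift /=; have := xb k2; rewrite mxE; move: rxl; lra.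
  apply: (box_near _ _ _ _ _ ryl by0); have [k2 ->|->] := unliftP j k1.
    by rewrite ins_lift /=; have := yb k2; rewrite mxE; move: ryl; lra.
  by rewrite ins_at /=; move: hu ryl; rewrite /e1 /e2; lra.
have rho3 : 0 < 3 * rho by rewrite mulr_gt0.
have hz0 : `|(x0, y0)| <= 3 * rho by move: z0r rho0; lra.
have ll : 0 < l ^+ 2 by rewrite exprn_gt0.
have lB : l <= 1 + B by move: lrho rhoB; lra.
have B1 : 1 <= 1 + B by rewrite lerDl ltW.
have ob : oscillating_block (fun t u => lam * Q S t u) (fun t u => lam * Q T1 t u)
    (fun t u => lam * Q T2 t u) (fun t u => lam * Q T3 t u)
    (fun t u => lam * Q U1 t u) (fun t u => lam * Q U2 t u) (fun t u => lam * Q U3 t u)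
    (fun t u => a (ins i (t, x), ins j (u, y))) (fun t u => a1 i (ins i (t, x), ins j (u, y)))
    (fun t u => a2 i (ins i (t, x), ins j (u, y))) (c ord0 i) l m C' A' e1 e2.
  split.
  - by move=> u t; exact: dl.
  - by move=> u t; exact: dl.
  - by move=> u t; exact: dl.
  - by move=> u; apply: is_derive1_continuous => t; exact: dl.
  - by move=> t u; have := dr T1 lam u t; rewrite mD.
  - by move=> t u; have := dr T2 lam u t; rewrite /T2 mD /T1 mD.
  - by move=> t u; have := dr T3 lam u t; rewrite /T3 mD /T2 mD /T1 mD.
  - by move=> u t; exact: (am_d ha).
  - by move=> u t; exact: (am_d1 ha).
  - by move=> u; exact: (am_c2 ha).
  - apply: measurable_funM; first exact: measurable_cst.
    apply: (measurableT_comp (@measurable_phase_eval R n.+1 S)); apply/measurable_fun_pair.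
      by apply: (measurableT_comp (measurable_ins i)); mproj.
    by apply: (measurableT_comp (measurable_ins j)); mproj.
  - apply: (measurableT_comp (am_meas ha)); apply/measurable_fun_pair.
      by apply: (measurableT_comp (measurable_ins i)); mproj.
    by apply: (measurableT_comp (measurable_ins j)); mproj.
  - move=> t u ht hu; have [n1 n2] := near_pt _ _ ht hu.
    rewrite normrM (gtr0_norm lam0) /m -mulrA ler_pM2l//.
    have [h _ _] := hC i j _ _ _ rho3 n2 hz0; rewrite /Q.
    set X := phase_eval U1 _; set Y := phase_eval U1 (x0, y0) in h.
    have hY : 2 * kap * rho ^+ e.+2 <= `|Y|.
      apply: le_trans hij; rewrite /kap.
      apply: le_trans (_ : c0 * (rho / 2) ^+ e.+2 <= _).
        by rewrite expr_div_n le_eqVlt; apply/orP; left; apply/eqP; rewrite exprS; field.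
      by rewrite ler_pM2l//; apply: lerXn2r; rewrite ?nnegrE ?divr_ge0 ?(ltW rho0).
    have hXY : `|X - Y| <= kap * rho ^+ e.+2.
      rewrite -(ler_pM2l rho3); apply: le_trans h _.
      apply: le_trans (_ : C * (3 * rho) ^+ e.+2 * (2 * l) <= _).
        by rewrite ler_wpM2l// mulr_ge0 ?exprn_ge0 ?(ltW C0) ?(ltW rho3).
      rewrite /l exprMn (exprS 3).
      rewrite [leLHS](_ : _ = (4 * C * 3 ^+ e.+1 / kap) * (3 * rho * kap * rho ^+ e.+2 / M)); last first.
        by field; rewrite !gt_eqF.
      rewrite [leRHS](_ : _ = M * (3 * rho * kap * rho ^+ e.+2 / M)); last by field; rewrite gt_eqF.
      have h3 := ltW (mulr_gt0 (mulr_gt0 rho3 kap0) rho2).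
      by apply: ler_wpM2r => //; apply: divr_ge0 => //; exact: ltW.
    have := lerB_dist Y (Y - X); rewrite subKr distrC; move: hY hXY; lra.
  - move=> t u ht hu; have [n1 n2] := near_pt _ _ ht hu.
    have [_ h _] := hC i j _ _ _ rho3 n2 hz0.
    rewrite normrM (gtr0_norm lam0).
    apply: le_trans (_ : lam * (C * (3 * rho) ^+ e.+1) <= _); first by rewrite ler_wpM2l// ltW.
    rewrite /m /l /C' exprMn [leRHS](_ : _ = lam * (C * (3 ^+ e.+1 * rho ^+ e.+1)) * (M / 2)).
      apply: ler_peMr; last by rewrite ler_pdivlMr// mul1r.
      have t31 : 0 < 3 ^+ e.+1 :> R by rewrite exprn_gt0.
      exact: ltW (mulr_gt0 lam0 (mulr_gt0 C0 (mulr_gt0 t31 rho1))).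
    by rewrite (exprS rho); field; rewrite !gt_eqF.
  - move=> t u ht hu; have [n1 n2] := near_pt _ _ ht hu.
    have [_ _ h] := hC i j _ _ _ rho3 n2 hz0.
    rewrite normrM (gtr0_norm lam0).
    apply: le_trans (_ : lam * (C * (3 * rho) ^+ e) <= _); first by rewrite ler_wpM2l// ltW.
    rewrite /m /l /C' exprMn [leRHS](_ : _ = lam * (C * (3 ^+ e * rho ^+ e)) * (3 * (M / 2) ^+ 2)).
      have M21 : 1 <= M / 2 by rewrite ler_pdivlMr// mul1r.
      apply: ler_peMr; last by rewrite -[leLHS]mul1r ler_pM// ?ler1n// exprn_ege1.
      have t3 : 0 < 3 ^+ e :> R by rewrite exprn_gt0.
      exact: ltW (mulr_gt0 lam0 (mulr_gt0 C0 (mulr_gt0 t3 (exprn_gt0 _ rho0)))).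
    by rewrite (exprS rho) (exprS rho) (exprS 3); field; rewrite !gt_eqF.
  - move=> t u ht hu; have [n1 n2] := near_pt _ _ ht hu.
    have zB : `|(ins i (t, x), ins j (u, y))| <= 3 * B by move: n2 rhoB; lra.
    apply: (le_trans (am_b ha zB)).
    by rewrite /A' ler_peMr ?(ltW A0)// exprn_ege1.
  - move=> t u ht hu; have [n1 n2] := near_pt _ _ ht hu.
    have zB : `|(ins i (t, x), ins j (u, y))| <= 3 * B by move: n2 rhoB; lra.
    apply: (le_trans (am_b1 ha i zB)).
    rewrite /A' ler_pdivlMr// ler_pM2l// (le_trans lB)// expr2 ler_peMr// ltW//.
    exact: lt_le_trans B1.
  - move=> t u ht hu; have [n1 n2] := near_pt _ _ ht hu.
    have zB : `|(ins i (t, x), ins j (u, y))| <= 3 * B by move: n2 rhoB; lra.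
    apply: (le_trans (am_b2 ha i zB)).
    rewrite /A' ler_pdivlMr// ler_pM2l//; apply: lerXn2r => //; rewrite ?nnegrE ?(ltW l0)//.
    exact: le_trans B1.
have e12 : e1 < e2 <= e1 + l.
  by rewrite /e1 /e2; apply/andP; split; move: ry0 ryl; lra.
have hb := hD _ _ _ _ _ _ _ _ _ _ (c ord0 i) l m e1 e2 s l0 m0 e12 hs ob.
set k0 := (fun z : R * R => _) in hb.
have mI : measurable (`[c ord0 i - rx, c ord0 i + rx]%classic : set (measurableTypeR R)).
  exact: measurable_itv.
have mT : measurable ([set: R] : set (measurableTypeR R)) by exact: measurableT.
have mk0 : measurable_fun [set: measurableTypeR R * measurableTypeR R] k0.
  apply: measurable_funM; last by apply: measurableT_comp => //; apply: measurable_indic; exact: measurable_itv.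
  apply: measurable_funM; first by apply: measurableT_comp => //; apply: measurable_indic; exact: measurable_itv.
  apply: measurable_funM; last exact: ob_ma ob.
  by apply: measurableT_comp => //; exact: ob_mP ob.
have hr := Lp_bounded_restrict (ltW p1) mI mT mk0 hb.
set kk := (fun z => k _); suff -> : kk = (fun z : R * R =>
    \1_(`[c ord0 i - rx, c ord0 i + rx]) z.1 * k0 z * \1_[set: R] z.2) by exact: hr.
apply/funext => -[t u]; rewrite /kk /k0 /k /= !indicE.
rewrite in_setT mulr1.
have -> : (ins i (t, x) \in box c rx) = (t \in `[c ord0 i - rx, c ord0 i + rx]%classic).
  by apply/idP/idP => /set_mem h; apply/mem_set; [case/ins_box: h|apply/ins_box].
have -> : (ins j (u, y) \in box c' ry) = (u \in `[e1, e2]%classic).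
  by apply/idP/idP => /set_mem h; apply/mem_set; [case/ins_box: h|apply/ins_box].
have [/set_mem tI|] := boolP (t \in `[c ord0 i - rx, _]%classic); last by rewrite !mul0r.
rewrite (_ : (t \in `[c ord0 i - l / 2, _]%classic) = true) ?mul1r//.
by apply/mem_set; move: tI => /=; rewrite !in_itv /=; move: rxl; lra.
Qed.

End dyadic.

(** * Summation over dyadic shells *)

Section geometric.
Variable R : realType.
Implicit Types w v : R.

Lemma geometric_dist w j K : 0 < w < 1 ->
  \sum_(k < K) w ^+ ((j - k) + (k - j)) <= 2 / (1 - w).
Proof.
move=> /andP[w0 w1]; have w1' : 0 < 1 - w by rewrite subr_gt0.
suff : \sum_(k < K) w ^+ ((j - k) + (k - j)) <=
    if (K <= j.+1)%N then w ^+ (j.+1 - K) / (1 - w) else (2 - w ^+ (K - j.+1)) / (1 - w).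
  move=> h; apply: le_trans h _; case: ifP => _; rewrite ler_pM2r ?invr_gt0//.
    by apply: (@le_trans _ _ 1); rewrite ?ler1n// exprn_ile1// ltW.
  by rewrite gerBl exprn_ge0// ltW.
elim: K => [|K IH]; first by rewrite big_ord0 subn0 divr_ge0 ?exprn_ge0// ltW.
rewrite big_ord_recr /=; apply: le_trans (lerD IH (lexx _)) _.
have [Kj|Kj|->] := ltngtP K j.
- rewrite (leq_trans (ltnW Kj))// ltnS (ltnW Kj) (_ : (K - j = 0)%N); last by apply/eqP; rewrite subn_eq0 ltnW.
  rewrite addn0 subSS subSn ?(ltnW Kj)// exprS le_eqVlt; apply/orP; left; apply/eqP.
  by field; rewrite gt_eqF.
- have -> : (if (K <= j.+1)%N then w ^+ (j.+1 - K) / (1 - w) else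
      (2 - w ^+ (K - j.+1)) / (1 - w)) = (2 - w ^+ (K - j.+1)) / (1 - w).
    case: ifP => // h; have -> : K = j.+1 by apply/eqP; rewrite eqn_leq h Kj.
    by rewrite subnn expr0; congr (_ / _); ring.
  rewrite ltnS leqNgt Kj /= (_ : (j - K = 0)%N); last by apply/eqP; rewrite subn_eq0 ltnW.
  rewrite add0n subSS -(subnSK Kj); set m := (K - j.+1)%N.
  have wm : 0 <= w ^+ m by rewrite exprn_ge0// ltW.
  rewrite exprS ler_pdivlMr// mulrDl divfK ?gt_eqF//.
  by have := sqr_ge0 (1 - w); nra.
- rewrite leqnSn leqnn subSnn !subnn expr1 expr0 le_eqVlt; apply/orP; left; apply/eqP.
  by field; rewrite gt_eqF.
Qed.

Lemma geometric_growth v K : 1 < v -> \sum_(k < K.+1) v ^+ k <= v ^+ K * (v / (v - 1)).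
Proof.
move=> v1; have v1' : 0 < v - 1 by rewrite subr_gt0.
elim: K => [|K IH].
  by rewrite big_ord1 !expr0 mul1r ler_pdivlMr// mul1r; lra.
rewrite big_ord_recr /=; apply: le_trans (lerD IH (lexx _)) _.
by rewrite exprS le_eqVlt; apply/orP; left; apply/eqP; field; rewrite gt_eqF.
Qed.

End geometric.

Section dyadic_sum.
Variables (R : realType) (n : nat) (E r B : R).
Hypothesis B0 : 0 < B.
Hypothesis r0 : 0 <= r.
Hypothesis hnE : 0 < r \/ E < 0.

(** Up to the power of lam, the bound for a pair of cells in the shells j and k:
    E is the exponent of the distance to the origin, and r that of the ratio of
    the sides. *)
Definition dyadic_term (j k : nat) : R :=
  (B / 2 ^+ minn j k) `^ E * (2^-1 ^+ ((j - k) + (k - j))) `^ r.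

Lemma dyadic_termC j k : dyadic_term j k = dyadic_term k j.
Proof. by rewrite /dyadic_term minnC addnC. Qed.

Lemma dyadic_term_gt0 j k : 0 < dyadic_term j k.
Proof. by rewrite mulr_gt0// powR_gt0// ?divr_gt0 ?exprn_gt0 ?invr_gt0. Qed.

Let pow2 K : (2 ^+ K) `^ (- E) = (2 `^ (- E)) ^+ K :> R.
Proof. by rewrite -(powR_mulrn K (ler0n R 2)) -(powR_mulrn K (powR_ge0 2 (- E))) -!powRrM mulrC. Qed.

(** The sum over one index is geometric: the interaction of two shells decays
    with their distance when 0 < r, and for E < 0 the innermost shell dominates. *)
Lemma dyadic_sum : exists2 c, 0 < c & forall K j, (j <= K)%N ->
  \sum_(k < K.+1) dyadic_term j k <= c * (if 0 <= E then 1 else (2 ^+ K) `^ (- E)).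
Proof.
have BE : 0 < B `^ E by rewrite powR_gt0.
have rhoE k : (B / 2 ^+ k) `^ E = B `^ E * (2 `^ (- E)) ^+ k.
  rewrite -pow2 powRM ?invr_ge0 ?exprn_ge0 ?(ltW B0)//; congr (_ * _).
  by rewrite -invr_powR ?exprn_ge0// powRN.
have dist1 d : (2^-1 ^+ d) `^ r <= 1 :> R.
  apply: (@le_trans _ _ (1 `^ r)); last by rewrite powR1.
  apply: ge0_ler_powR => //; rewrite ?nnegrE ?exprn_ge0 ?invr_ge0//.
  by apply: exprn_ile1; rewrite ?invr_ge0// invf_le1// ler1n.
case: (leP 0 E) => [E0|E0].
  have rp : 0 < r by case: hnE => // /lt_le_trans /(_ E0); rewrite ltxx.
  pose w : R := 2^-1 `^ r.
  have w01 : 0 < w < 1.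
    rewrite powR_gt0 ?invr_gt0//=; apply: (@lt_le_trans _ _ (1 `^ r)); last by rewrite powR1.
    by rewrite gt0_ltr_powR// ?nnegrE ?invr_ge0// invf_lt1// ltr1n.
  exists (B `^ E * (2 / (1 - w))) => [|K j jK].
    by rewrite mulr_gt0// divr_gt0// subr_gt0; case/andP: w01.
  rewrite mulr1; apply: le_trans (ler_wpM2l (ltW BE) (geometric_dist j K.+1 w01)).
  rewrite mulr_sumr; apply: ler_sum => k _; rewrite /dyadic_term.
  have -> : (2^-1 ^+ ((j - k) + (k - j))) `^ r = w ^+ ((j - k) + (k - j)).
    have h2 : 0 <= 2^-1 :> R by [].
    by rewrite /w -(powR_mulrn _ h2) -(powR_mulrn _ (powR_ge0 _ _)) -!powRrM mulrC.
  rewrite ler_wpM2r ?exprn_ge0 ?powR_ge0// rhoE ler_piMr ?(ltW BE)//.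
  rewrite -pow2 powRN invf_le1 ?powR_gt0 ?exprn_gt0//.
  apply: (@le_trans _ _ (1 `^ E)); first by rewrite powR1.
  apply: ge0_ler_powR => //; rewrite ?nnegrE ?exprn_ge0//.
  by rewrite exprn_ege1// ler1n.
pose v : R := 2 `^ (- E).
have v1 : 1 < v.
  apply: (@le_lt_trans _ _ (1 `^ (- E))); first by rewrite powR1.
  by rewrite gt0_ltr_powR ?oppr_gt0 ?nnegrE// ltr1n.
exists (B `^ E * (v / (v - 1))) => [|K j jK].
  by rewrite mulr_gt0// divr_gt0 ?subr_gt0// (lt_trans _ v1).
rewrite pow2 -/v -mulrA [X in _ * X]mulrC.
apply: le_trans (ler_wpM2l (ltW BE) (geometric_growth K v1)).
rewrite mulr_sumr; apply: ler_sum => k _; rewrite /dyadic_term rhoE -/v.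
rewrite -[leRHS]mulr1 ler_pM ?powR_ge0 ?mulr_ge0 ?exprn_ge0 ?powR_ge0//.
by rewrite ler_wpM2l ?(ltW BE)// ler_weXn2l ?(ltW v1)// geq_minr.
Qed.

End dyadic_sum.

Lemma dyadic_scale (R : realType) (t : R) : 1 <= t -> exists K, 2 ^+ K <= t < 2 ^+ K.+1.
Proof.
move=> t1; exists (trunc_log 2 (Num.truncn t)).
have t0 : (0 < Num.truncn t)%N by rewrite Num.Theory.truncn_gt0.
have /andP[h1 h2] := trunc_log_bounds (isT : (1 < 2)%N) t0.
have /andP[h3 h4] := truncn_itv (le_trans ler01 t1).
apply/andP; split.
  by apply: le_trans h3; rewrite -natrX ler_nat.
by apply: lt_le_trans h4 _; rewrite -natrX ler_nat.
Qed.

Section dyadic_bound.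
Variables (R : realType) (n e : nat) (S : mpoly (n.+1 + n.+1) R) (c0 : R).
Hypothesis hS : S \is ishomog1 e.+4 mdeg.
Hypothesis c00 : 0 < c0.
Local Notation mixed i j := (mderiv (lshift n.+1 i) (mderiv (rshift n.+1 j) S)).
Hypothesis hH : forall z : 'rV[R]_n.+1 * 'rV[R]_n.+1, z != 0 -> exists i j : 'I_n.+1,
  c0 * `|z| ^+ e.+2 <= `|phase_eval (mixed i j) z|.
Variables (p p' A B : R).
Hypothesis p1 : 1 < p.
Hypothesis pp' : p^-1 + p'^-1 = 1.
Hypothesis A0 : 0 < A.
Hypothesis B0 : 0 < B.
Let q := Num.max p p'.
Let dn : R := e.+4%:R.
Let E := n.+1%:R - dn / q.

(** Both balls are cut into dyadic shells down to the radius lam^(-1/d), and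
    each shell into cells. A pair of cells in the shells j and k lies at
    distance about B / 2^min(j, k) from the origin, where the estimate on a pair
    of cubes applies; the pair of innermost cells only has the trivial bound,
    which is the volume lam^(-(n+1)/d). Schur's test sums these bounds, which
    decay geometrically in |j - k| as soon as there are at least two variables. *)
Lemma dyadic_bound : (0 < n)%N \/ n.+1%:R < dn / q -> exists2 C, 0 < C &
  forall lam (s : R -> R) a a1 a2, 1 <= lam -> s = @cos R \/ s = @sin R ->
  amplitude B A a a1 a2 ->
  Lp_bounded (@lebn R n.+1) (@lebn R n.+1) p
    (fun z => \1_(box 0 B) z.1 * (s (lam * phase_eval S z) * a z) * \1_(box 0 B) z.2)
    (C * (lam `^ (- q^-1) + lam `^ (- (n.+1%:R / dn)))).
Proof.
move=> hn; have p0 : 0 < p by apply: lt_trans p1.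
have q0 : 0 < q by rewrite lt_max p0.
have dn0 : 0 < dn by rewrite ltr0n.
have [N N0 [D D0 hD]] := cube_bound hS c00 hH p1 pp' A0 B0; rewrite -/q -/dn -/E in hD.
have r0 : 0 <= n%:R / q by rewrite divr_ge0 // ltW.
have hr : 0 < n%:R / q \/ E < 0.
  by case: hn => h; [left; rewrite divr_gt0 ?ltr0n|right; rewrite subr_lt0].
have [c c_gt0 hc] := dyadic_sum B0 r0 hr.
pose M : R := N.+1%:R; have M2 : 2 <= M by rewrite ler_nat.
have M0 : 0 < M by apply: lt_le_trans M2.
pose G : R := #|{ffun 'I_n.+1 -> 'I_N.+1}|%:R.
have G0 : 0 < G.
  by rewrite ltr0n; apply/card_gt0P; exists [ffun => ord0].
pose H := A * (2 * B) ^+ n.+1; have H0 : 0 < H by rewrite mulr_gt0// exprn_gt0// mulr_gt0.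
exists (G * (H + D * c)) => [|lam s a a1 a2 lam1 hs ha].
  by rewrite mulr_gt0// addr_gt0// mulr_gt0.
have lam0 : 0 < lam by apply: lt_le_trans lam1.
(* With 2^K comparable to t = lam^(1/d), the innermost radius is about
   lam^(-1/d). *)
pose t := lam `^ dn^-1.
have t1 : 1 <= t.
  apply: (@le_trans _ _ (1 `^ dn^-1)); first by rewrite powR1.
  by rewrite ge0_ler_powR// ?nnegrE ?invr_ge0// ltW.
have t0 : 0 < t by apply: lt_le_trans t1.
have [K /andP[Kt tK]] := dyadic_scale t1.
have K0 : 0 < 2 ^+ K :> R by rewrite exprn_gt0.
have [cx mcx hcx] := @dyadic_code R n.+1 K N B B0.
set k := (fun z => _).
have box0 : box (0 : 'rV[R]_n.+1) B = [set x | `|x| <= B] by apply: box0E; exact: ltW.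
have mbox0 : measurable (box (0 : 'rV[R]_n.+1) B) by exact: measurable_box.
have s1 u : `|s u| <= 1.
  by case: hs => ->; rewrite ler_norml ?cos_geN1 ?cos_le1 ?sin_geN1 ?sin_le1.
have ms : measurable_fun setT s.
  by case: hs => ->; apply: continuous_measurable_fun; [exact: continuous_cos|exact: continuous_sin].
have mk : measurable_fun setT k.
  apply: measurable_funM; last exact: (measurableT_comp (measurable_indic mbox0) measurable_snd).
  apply: measurable_funM; first exact: (measurableT_comp (measurable_indic mbox0) measurable_fst).
  apply: measurable_funM; last exact: am_meas ha.
  apply: (measurableT_comp ms); apply: measurable_funM; first exact: measurable_cst.
  exact: measurable_phase_eval.
have saA x y : `|x| <= B -> `|y| <= B -> `|s (lam * phase_eval S (x, y)) * a (x, y)| <= A.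
  move=> xB yB; rewrite normrM -[leRHS]mul1r ler_pM//; apply: (am_b ha).
  by apply: pair_norm_le => /=; [apply: le_trans xB _|apply: le_trans yB _]; move: B0; lra.
have kA x y : `|k (x, y)| <= A * \1_(box 0 B) x * \1_(box 0 B) y.
  rewrite /k /= !indicE; have [/set_mem xb|] := boolP (x \in _); last by rewrite !mul0r mulr0 mul0r normr0.
  have [/set_mem yb|] := boolP (y \in _); last by rewrite !mulr0 normr0.
  by rewrite mul1r !mulr1; rewrite box0 in xb yb; exact: saA.
have finb (c1 : 'rV[R]_n.+1) r1 : 0 <= r1 -> (lebn (box c1 r1) < +oo)%E.
  by move=> r10; rewrite [X in (X < _)%E]lebn_box// ltry.
have tk : tame_on (@lebn R n.+1) (@lebn R n.+1) (box 0 B) (box 0 B) A k.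
  by split => //; split => //; apply: finb; exact: ltW.
pose hh (j k : 'I_K.+1) : R := if (j == K :> nat) && (k == K :> nat) then
  A * (B / 2 ^+ K) ^+ n.+1 else 0.
pose al (u v : 'I_K.+1 * {ffun 'I_n.+1 -> 'I_N.+1}) : R :=
  D * lam `^ (- q^-1) * dyadic_term E (n%:R / q) B u.1 v.1 + hh u.1 v.1.
have bK0 : 0 < A * (B / 2 ^+ K) ^+ n.+1 by rewrite mulr_gt0// exprn_gt0// divr_gt0.
have hh0 j l : 0 <= hh j l by rewrite /hh; case: ifP => // _; exact: ltW.
have Dl : 0 < D * lam `^ (- q^-1) by rewrite mulr_gt0// powR_gt0.
have al1 u v : 0 < D * lam `^ (- q^-1) * dyadic_term E (n%:R / q) B u v.
  by rewrite mulr_gt0//; exact: dyadic_term_gt0.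
have al0 u v : 0 < al u v by rewrite ltr_pwDl.
have alC u v : al u v = al v u.
  by rewrite /al /hh dyadic_termC andbC.
pose L2 := lam `^ (- (n.+1%:R / dn)).
have L20 : 0 < L2 by rewrite powR_gt0.
have L2E : t ^- n.+1 = L2.
  rewrite /t -powR_mulrn ?powR_ge0// -powRrM -powRN /L2; congr (_ `^ _); ring.
have row u : \sum_v al u v <= G * (H + D * c) * (lam `^ (- q^-1) + L2).
  have -> : \sum_v al u v = G * \sum_(l < K.+1)
      (D * lam `^ (- q^-1) * dyadic_term E (n%:R / q) B u.1 l + hh u.1 l).
    rewrite mulr_sumr; rewrite -(pair_bigA _ (fun l g => al u (l, g))) /=.
    by apply: eq_bigr => l _; rewrite /G mulr_natl -sumr_const; apply: eq_bigr.
  rewrite -mulrA ler_pM2l// big_split /= -mulr_sumr.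
  have hsum : \sum_(l < K.+1) hh u.1 l <= H * L2.
    rewrite (bigD1 ord_max)//= big1 ?addr0; last first.
      move=> l lK; rewrite /hh; case: ifP => // /andP[_ /eqP lE].
      by case/eqP: lK; apply/val_inj.
    rewrite /hh; case: ifP => _; last by rewrite mulr_ge0// ltW.
    rewrite /H -mulrA ler_pM2l// -L2E -(exprVn t) -exprMn; apply: lerXn2r.
    - by rewrite nnegrE divr_ge0 ?ltW.
    - by rewrite nnegrE mulr_ge0 ?invr_ge0 ?mulr_ge0 ?ltW.
    - rewrite (_ : B / _ = 2 * B * (2 ^+ K.+1)^-1).
        by rewrite ler_pM2l ?mulr_gt0// lef_pV2 ?posrE ?exprn_gt0// ltW.
      by rewrite exprS; field; rewrite gt_eqF.
  have hL : lam `^ (- q^-1) * (if 0 <= E then 1 else (2 ^+ K) `^ (- E)) <=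
      lam `^ (- q^-1) + L2.
    case: ifPn => [_|]; first by rewrite mulr1 lerDl ltW.
    rewrite -ltNge => E0; apply: (@le_trans _ _ L2); last by rewrite lerDr powR_ge0.
    apply: (@le_trans _ _ (lam `^ (- q^-1) * t `^ (- E))).
      rewrite ler_wpM2l ?powR_ge0// ge0_ler_powR ?nnegrE ?oppr_ge0 ?(ltW K0) ?(ltW t0)//.
      exact: ltW.
    rewrite /t -powRrM -powRD ?(gt_eqF lam0) ?implybT// le_eqVlt; apply/orP; left; apply/eqP.
    by congr (_ `^ _); rewrite /E; field; rewrite !gt_eqF.
  have hcu := hc K u.1 (ltn_ord u.1 : (u.1 <= K)%N).
  have h1 : D * lam `^ (- q^-1) * (\sum_(l < K.+1) dyadic_term E (n%:R / q) B u.1 l) <=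
      D * c * (lam `^ (- q^-1) + L2).
    apply: le_trans (ler_wpM2l (ltW Dl) hcu) _.
    rewrite [leLHS](_ : _ = D * c * (lam `^ (- q^-1) * (if 0 <= E then 1 else (2 ^+ K) `^ (- E)))); last by rewrite !mulrA (mulrAC D).
    by rewrite ler_wpM2l// mulr_ge0// ltW.
  apply: le_trans (lerD h1 hsum) _; rewrite [leRHS]mulrDl addrC lerD2r ler_pM2l//.
  by rewrite lerDr powR_ge0.
apply: (@Lp_bounded_codes _ _ _ _ R (@lebn R n.+1) (@lebn R n.+1) _ _ cx cx k al p _
  mcx mcx (ltW p1) al0 _ _ _ A tk row).
- apply: mulr_gt0; last by rewrite addr_gt0// powR_gt0.
  by apply: mulr_gt0 => //; rewrite addr_gt0// mulr_gt0.
- by move=> v; under eq_bigr do rewrite alC; exact: row.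
move=> u v.
pose Eu := [set x | cx x = u] `&` box 0 B; pose Ev := [set x | cx x = v] `&` box 0 B.
have mE w : measurable ([set x | cx x = w] `&` box 0 B) by exact: measurableI.
pose bx (w : 'I_K.+1 * {ffun 'I_n.+1 -> 'I_N.+1}) :=
  box (cell_center B w.1 w.2) (B / 2 ^+ w.1 / M).
have mbx w : measurable (bx w) by exact: measurable_box.
have Ebx w x : ([set x | cx x = w] `&` box 0 B) x ->
    [/\ `|x| <= B / 2 ^+ w.1, (w.1 < K)%N -> B / 2 ^+ w.1.+1 < `|x| & bx w x].
  by rewrite box0 => -[<- xB]; exact: hcx.
pose k' z := \1_(bx u) z.1 * (s (lam * phase_eval S z) * a z) * \1_(bx v) z.2.
have kE : (fun z => \1_[set x | cx x = u] z.1 * k z * \1_[set y | cx y = v] z.2) =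
    (fun z => \1_Eu z.1 * k' z * \1_Ev z.2).
  apply/funext => -[x y]; rewrite /k /k' /= !indicE.
  have -> : (x \in Eu) = (x \in [set x | cx x = u]) && (x \in box 0 B) by rewrite in_setI.
  have -> : (y \in Ev) = (y \in [set x | cx x = v]) && (y \in box 0 B) by rewrite in_setI.
  have [xu|] /= := boolP (x \in [set x | cx x = u]); last by rewrite !mul0r.
  have [xb|] /= := boolP (x \in box 0 B); last by rewrite !(mul0r, mulr0).
  have [yv|] /= := boolP (y \in [set x | cx x = v]); last by rewrite !mulr0.
  have [yb|] /= := boolP (y \in box 0 B); last by rewrite !(mul0r, mulr0).
  have [_ _ xbu] := Ebx u x (conj (set_mem xu) (set_mem xb)).
  have [_ _ ybv] := Ebx v y (conj (set_mem yv) (set_mem yb)).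
  by rewrite (mem_set xbu) (mem_set ybv).
rewrite kE.
have mk' : measurable_fun setT k'.
  apply: measurable_funM; last exact: (measurableT_comp (measurable_indic (mbx v)) measurable_snd).
  apply: measurable_funM; first exact: (measurableT_comp (measurable_indic (mbx u)) measurable_fst).
  apply: measurable_funM; last exact: am_meas ha.
  apply: (measurableT_comp ms); apply: measurable_funM; first exact: measurable_cst.
  exact: measurable_phase_eval.
have [[x0 Ex0]|nE] := pselect (Eu !=set0); last first.
  apply: Lp_bounded_zero => [|z]; first exact: ltW.
  rewrite indicE (_ : (z.1 \in Eu) = false) ?mul0r//; apply/negP => /set_mem hz.
  by case: nE; exists z.1.
have [[y0 Ey0]|nE] := pselect (Ev !=set0); last first.
  apply: Lp_bounded_zero => [|z]; first exact: ltW.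
  rewrite [X in _ * X]indicE (_ : (z.2 \in Ev) = false) ?mulr0//; apply/negP => /set_mem hz.
  by case: nE; exists z.2.
have [x0u x0l bx0] := Ebx u x0 Ex0; have [y0v y0l by0] := Ebx v y0 Ey0.
have [/andP[/eqP uK /eqP vK]|nK] := boolP ((u.1 == K :> nat) && (v.1 == K :> nat)).
  apply: (@Lp_bounded_le _ _ _ _ _ _ _ _ _ (A * (B / 2 ^+ K) ^+ n.+1)); first exact: ltW.
    rewrite ltW//= /al /hh uK vK eqxx /= lerDr ltW//.
  have r10 : 0 <= B / 2 ^+ K / M by rewrite !divr_ge0 ?exprn_ge0 ?ltW.
  apply: (@tame_Lp_bounded _ _ _ _ _ _ _ (bx u) (bx v) A); [exact: ltW|exact: ltW| |].
    split.
    - apply: measurable_funM; last exact: (measurableT_comp (measurable_indic (mE v)) measurable_snd).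
      by apply: measurable_funM => //; exact: (measurableT_comp (measurable_indic (mE u)) measurable_fst).
    - by split; [exact: mbx|apply: finb; rewrite uK].
    - by split; [exact: mbx|apply: finb; rewrite vK].
    - move=> x y; rewrite /k' /= !indicE.
      have [/set_mem xu|] := boolP (x \in Eu); last by rewrite !mul0r normr0 !mulr_ge0// ltW.
      have [/set_mem yv|] := boolP (y \in Ev); last by rewrite mulr0 normr0 !mulr_ge0// ltW.
      have [_ _ xbu] := Ebx _ _ xu; have [_ _ ybv] := Ebx _ _ yv.
      rewrite (mem_set xbu) (mem_set ybv) !mul1r !mulr1.
      by move: xu yv => [_ xu] [_ yv]; rewrite box0 in xu yv; exact: saA.
  rewrite [X in _ * fine X * _](lebn_box _ (_ : 0 <= _)) ?uK//.
  rewrite [X in fine X `^ _](lebn_box _ (_ : 0 <= _)) ?vK//= -mulrA.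
  rewrite -[X in _ * (X * _)]powRr1 ?exprn_ge0 ?mulr_ge0 ?invr_ge0 ?(ltW B0) ?(ltW M0)//.
  set X := (2 * _) ^+ n.+1; have X0 : 0 < X by rewrite exprn_gt0// !mulr_gt0 ?invr_gt0.
  rewrite -powRD ?(gt_eqF X0) ?implybT// (_ : 1 + (p - 1) = p); last by ring.
  rewrite powRM ?exprn_ge0 ?divr_ge0 ?(ltW A0) ?(ltW B0) ?(ltW K0)//.
  rewrite ler_wpM2l ?powR_ge0// ge0_ler_powR ?nnegrE ?(ltW p0) ?(ltW X0)//.
    by rewrite exprn_ge0// divr_ge0 ?ltW.
  apply: lerXn2r; rewrite ?nnegrE.
  - by apply: ltW; rewrite !mulr_gt0 ?invr_gt0.
  - by apply: ltW; rewrite divr_gt0.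
  by rewrite mulrA ler_pdivrMr// mulrC ler_pM2l ?divr_gt0.
apply: Lp_bounded_restrict => //; [exact: ltW|exact: mE|exact: mE|].
pose m := minn u.1 v.1.
have rE (x y : nat) : B / 2 ^+ minn x y * 2^-1 ^+ (x - y) = B / 2 ^+ x.
  rewrite -mulrA exprVn -invfM -exprD; congr (_ / _ ^+ _).
  by rewrite minnE addnC addnBA ?leq_subr// addnC addnK.
have s01 d : 0 < (2^-1 : R) ^+ d <= 1.
  by rewrite exprn_gt0 ?invr_gt0//= exprn_ile1 ?invr_ge0// invf_le1// ler1n.
have half (x : nat) : B / 2 ^+ x / 2 = B / 2 ^+ x.+1 by rewrite exprSr invfM mulrA.
have rho0 : 0 < B / 2 ^+ m by rewrite divr_gt0// exprn_gt0.
have mono (x y : nat) : (x <= y)%N -> B / 2 ^+ y <= B / 2 ^+ x.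
  by move=> xy; rewrite ler_pM2l// lef_pV2 ?posrE ?exprn_gt0// ler_weXn2l// ler1n.
have := hD lam (B / 2 ^+ m) (2^-1 ^+ (u.1 - v.1)) (2^-1 ^+ (v.1 - u.1))
  (cell_center B u.1 u.2) (cell_center B v.1 v.2) s a a1 a2 x0 y0 lam0 rho0.
have eu : B / 2 ^+ m * 2^-1 ^+ (u.1 - v.1) = B / 2 ^+ u.1 by exact: rE.
have ev : B / 2 ^+ m * 2^-1 ^+ (v.1 - u.1) = B / 2 ^+ v.1 by rewrite /m minnC rE.
rewrite eu ev -/M => h.
have hrB : B / 2 ^+ m <= B by rewrite -[leRHS]divr1 -(expr0 2); exact: mono.
have hx := le_trans x0u (mono m u.1 (geq_minl _ _)).
have hy := le_trans y0v (mono m v.1 (geq_minr _ _)).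
have hz : B / 2 ^+ m / 2 <= `|(x0, y0)| <= B / 2 ^+ m.
  rewrite half; apply/andP; split; last exact: pair_norm_le.
  have [n1 n2] := pair_norm_ge (x0, y0).
  have [uv|vu] := leqP u.1 v.1.
    have mu : m = u.1 by apply/minn_idPl.
    rewrite mu; apply: le_trans n1; apply/ltW/x0l.
    rewrite ltn_neqAle -ltnS ltn_ord andbT; apply: contra nK => /eqP uK.
    by rewrite uK eqxx /= eqn_leq -ltnS ltn_ord /= -{1}uK.
  have mv : m = v.1 by apply/minn_idPr; exact: ltnW.
  rewrite mv; apply: le_trans n2; apply/ltW/y0l.
  by apply: leq_trans vu _; rewrite -ltnS.
have hb := h hrB (s01 _) (s01 _) hs ha bx0 by0 hz.
apply: (Lp_bounded_le _ _ hb); first exact: ltW.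
rewrite -exprD; apply/andP; split.
  by apply: mulr_ge0; rewrite ?powR_ge0//; apply: mulr_ge0; rewrite ?powR_ge0// ltW.
by rewrite /al /dyadic_term -/m mulrA lerDl.
Qed.

End dyadic_bound.

(** * The Newton distance *)

Lemma convex_sum (R : realType) (V : lmodType R) (A : set (convex_lmodType V)) :
  convex_set A -> forall N (c : 'I_N -> R) (x : 'I_N -> V),
  (forall k, 0 <= c k) -> \sum_k c k = 1 -> (forall k, A (x k)) -> A (\sum_k c k *: x k).
Proof.
move=> hA; elim=> [|N IH] c x c0 c1 Ax.
  by move: c1; rewrite big_ord0 => /esym/eqP; rewrite oner_eq0.
rewrite big_ord_recl; rewrite big_ord_recl in c1.
set s := \sum_(i < N) c (lift ord0 i) in c1.
have s0 : 0 <= s by apply: sumr_ge0.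
have [se|sn] := eqVneq s 0.
  have -> : c ord0 = 1 by move: c1; rewrite se addr0.
  rewrite scale1r big1 ?addr0// => i _.
  have /eqP := se; rewrite psumr_eq0// => /allP /(_ i (mem_index_enum _)) /eqP ->.
  by rewrite scale0r.
have sp : 0 < s by rewrite lt_def sn.
have h : A (\sum_i (c (lift ord0 i) / s) *: x (lift ord0 i)).
  apply: IH => [i||i]; [by rewrite divr_ge0| |exact: Ax].
  by rewrite -mulr_suml divff.
have c01 : c ord0 <= 1 by rewrite -c1 lerDl.
have := hA _ _ (Itv01 (c0 ord0) c01) (mem_set (Ax ord0)) (mem_set h).
move=> /set_mem; rewrite /conv /=; congr A; congr (_ + _).
rewrite /onem -c1 addrAC subrr add0r scaler_sumr; apply: eq_bigr => i _.
by rewrite scalerA mulrCA divff// mulr1.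
Qed.

Section simplex_iteration.
Variables (R : realType) (N : nat) (M : 'I_N -> 'I_N -> nat) (d : nat) (s0 : R).
Hypothesis M2 : forall k, (\sum_j M k j)%N = 2%N.
Hypothesis M1 : forall k j, (M k j <= 1)%N.
Hypothesis d4 : (4 < d)%N.
Hypothesis s01 : 1 <= s0.
Hypothesis Ns0 : N%:R * s0 = d%:R.

Let e : R := d%:R - 2.
Let e2 : 2 < e.
Proof. by rewrite /e ltrBrDr -(natrD R 2 2) ltr_nat. Qed.
Let e0 : 0 < e. Proof. exact: lt_trans e2. Qed.

Definition simplex_step (c : 'I_N -> R) (j : 'I_N) : R := (s0 - \sum_k c k * (M k j)%:R) / e.

Let sumM (f : 'I_N -> R) : \sum_j \sum_k f k * (M k j)%:R = 2 * \sum_k f k.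
Proof.
rewrite exchange_big mulr_sumr; apply: eq_bigr => k _.
by rewrite -mulr_sumr -natr_sum M2 mulrC.
Qed.

Let step_sum c : \sum_k c k = 1 -> \sum_k simplex_step c k = 1.
Proof.
move=> c1; rewrite -mulr_suml big_split /= sumrN sumM c1 sumr_const card_ord.
by rewrite -[X in X - _]mulr_natl Ns0 mulr1 divff// gt_eqF.
Qed.

Let step_ge0 c : (forall k, 0 <= c k) -> \sum_k c k = 1 -> forall k, 0 <= simplex_step c k.
Proof.
move=> c0 c1 k; rewrite divr_ge0 ?(ltW e0)// subr_ge0.
have h : \sum_j c j * (M j k)%:R <= \sum_j c j.
  by apply: ler_sum => j _; rewrite ler_piMr//; have := M1 j k; rewrite -(ler_nat R).
by rewrite c1 in h; exact: le_trans h s01.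
Qed.

Let step_contract (c c' : 'I_N -> R) :
  \sum_j `|simplex_step c j - simplex_step c' j| <= 2 / e * \sum_j `|c j - c' j|.
Proof.
rewrite mulrAC ler_pdivlMr// -sumM mulr_suml; apply: ler_sum => j _.
have -> : simplex_step c j - simplex_step c' j =
    (\sum_k (c' k - c k) * (M k j)%:R) / e.
  rewrite -mulrBl; congr (_ / _); rewrite opprD addrACA subrr add0r opprK addrC -sumrB.
  by apply: eq_bigr => k _; rewrite mulrBl.
rewrite normrM normfV (gtr0_norm e0) divfK ?gt_eqF//.
apply: le_trans (ler_norm_sum _ _ _) _; apply: ler_sum => k _.
by rewrite normrM distrC (ger0_norm (ler0n _ _)).
Qed.

(** The weights c with e c + c M = s0 are the fixed point of a contraction of
    the simplex; iterating it produces weights that solve the equation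
    approximately. *)
Lemma simplex_fixpoint eps : 0 < eps -> exists c : 'I_N -> R,
  [/\ forall k, 0 <= c k, \sum_k c k = 1 &
      forall j, `|e * c j + \sum_k c k * (M k j)%:R - s0| <= eps].
Proof.
move=> eps0; have N0 : 0 < N%:R :> R.
  rewrite ltr0n lt0n; apply/eqP => N0; move: Ns0; rewrite N0 mul0r => /esym/eqP.
  by rewrite pnatr_eq0; case: (d) d4.
pose c0 : 'I_N -> R := fun=> N%:R^-1; pose it r := iter r simplex_step c0.
have itP r : (forall k, 0 <= it r k) /\ \sum_k it r k = 1.
  elim: r => [|r [h1 h2]] /=.
    split=> [k|]; first by rewrite /c0 invr_ge0.
    have -> : \sum_k c0 k = N%:R * N%:R^-1 by rewrite /c0 sumr_const card_ord mulr_natl.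
    by rewrite mulfV// gt_eqF.
  by split; [exact: step_ge0|exact: step_sum].
pose w := 2 / e; have w0 : 0 <= w by rewrite divr_ge0 // ltW.
have w1 : w < 1 by rewrite ltr_pdivrMr// mul1r.
have hit r : \sum_j `|it r.+1 j - it r j| <= w ^+ r * \sum_j `|it 1%N j - it 0%N j|.
  elim: r => [|r IH]; first by rewrite expr0 mul1r.
  by apply: le_trans (step_contract _ _) _; rewrite exprS -[leRHS]mulrA; exact: (ler_wpM2l w0 IH).
set D := \sum_j _ in hit.
have cw : w ^+ r * (D * e) @[r --> \oo] --> (0 : R).
  rewrite -[X in _ --> X](mul0r (D * e)); apply: cvgM; last exact: cvg_cst.
  by apply: cvg_expr; rewrite ger0_norm.
have [r hr] : exists r, `|w ^+ r * (D * e)| <= eps.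
  move/cvgrPdist_le : cw => /(_ _ eps0) [r _ hr]; exists r.
  by have := hr r (leqnn r); rewrite /= sub0r normrN.
have [i1 i2] := itP r; exists (it r); split => // j.
have -> : e * it r j + \sum_k it r k * (M k j)%:R - s0 = e * (it r j - it r.+1 j).
  by rewrite /= /simplex_step; field; rewrite gt_eqF.
rewrite normrM (gtr0_norm e0) distrC; apply: le_trans hr; apply: le_trans _ (ler_norm _).
rewrite mulrA mulrC ler_pM2r//; apply: le_trans (hit r).
by rewrite (bigD1 j)//= lerDl sumr_ge0.
Qed.

End simplex_iteration.

Section newton.
Variables (R : realType) (n d : nat) (S : mpoly (n + n) R).
Hypothesis n2 : (4 <= 2 * n)%N.
Hypothesis dn : (2 * n < d)%N.
Hypothesis hS : S \is ishomog1 d mdeg.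
Hypothesis hN : forall z : 'rV[R]_n * 'rV[R]_n, hessian_norm d S z = 0 -> z = 0.

(** The mixed Hessian does not vanish on the coordinate axes: this provides a
    monomial of S that is a power of the variable k up to two exponents. *)
Let axis_monomial (k : 'I_(n + n)) : exists i j : 'I_n,
  exists2 m : multinom (n + n), mcoeff m S != 0 &
    forall l, m l = ((d - 2) * (l == k) + ((l == lshift n i) + (l == rshift n j)))%N.
Proof.
have d2 : (2 < d)%N by apply: leq_trans dn; rewrite ltnS (leq_trans _ n2).
have [c c0 hc] := hessian_entry_ge d2 hS hN.
pose u : 'rV[R]_(n + n) := delta_mx 0 k.
pose z := (lsubmx u, rsubmx u).
have uz : row_mx z.1 z.2 = u by exact: hsubmxK.
have z0 : z != 0.
  apply/eqP => zE; have : u = 0 by rewrite -uz zE row_mx0.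
  move=> /matrixP /(_ ord0 k); rewrite !mxE !eqxx => /eqP; by rewrite oner_eq0.
have [i [j]] := hc z z0; set T := mderiv _ _ => hT; exists i, j.
have : phase_eval T z != 0.
  rewrite -normr_gt0; apply: lt_le_trans hT.
  by rewrite mulr_gt0// exprn_gt0// normr_gt0.
rewrite /phase_eval uz mevalE => /negP hsum.
have [m mT mne] : exists2 m, m \in msupp T & \prod_l u ord0 l ^+ m l != 0.
  apply/not_exists2P => hno; apply: hsum; apply/eqP; apply: big1_seq => m /andP[_ mT].
  by have [//|/negP] := hno m; rewrite negbK => /eqP ->; rewrite mulr0.
have ml l : l != k -> m l = 0%N.
  move=> lk; apply/eqP; apply: contraNT mne => mlne.
  by rewrite (bigD1 l)//= mxE eqxx /= (negbTE lk) expr0n (negbTE mlne) mul0r.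
have hom : T \is ishomog1 d.-1.-1 mdeg by exact: (dhomog_mderiv _ (dhomog_mderiv _ hS)).
have mk : m k = (d - 2)%N.
  have /dhomogP /(_ _ mT) := hom; rewrite /= mdegE (bigD1 k)//= big1 ?addn0; last by move=> l; exact: ml.
  by move=> ->; rewrite subn2.
exists (mnm_add (mnm_add m (mnm1 (lshift n i))) (mnm1 (rshift n j))).
  move: mT; rewrite /T mcoeff_msupp !mcoeff_deriv => h.
  by apply: contra_neq h => ->; rewrite !mul0rn.
move=> l; rewrite !mnmDE !mnm1E addnA (eq_sym l (lshift n i)) (eq_sym l (rshift n j)).
congr (_ + _ + _)%N; have [->|lk] := eqVneq l k; first by rewrite mk muln1.
by rewrite muln0 ml.
Qed.

Let N := (n + n)%N.
Let s0 : R := d%:R / (2 * n%:R).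
Let n0 : 0 < n%:R :> R.
Proof. by rewrite ltr0n; case: (n) n2. Qed.
Let Ns0 : N%:R * s0 = d%:R.
Proof. by rewrite /N natrD /s0; field; rewrite gt_eqF. Qed.
Let s0gt1 : 1 <= s0.
Proof.
rewrite /s0 ler_pdivlMr ?mulr_gt0// mul1r.
by have := ltnW dn; rewrite -(ler_nat R) natrM.
Qed.

Let newton_convex : convex_set (newton_polyhedron S : set (convex_lmodType 'rV[R]_(n + n))).
Proof.
move=> x y l /set_mem xN /set_mem yN; apply/mem_set => A [/= cA GA].
apply/set_mem/cA; apply/mem_set; [exact: xN|exact: yN].
Qed.

Let sum_ge : newton_polyhedron S `<=` [set z | d%:R <= \sum_k z ord0 k].
Proof.
apply: smallest_sub.
  move=> x y l /set_mem /= xd /set_mem /= yd; apply/mem_set => /=.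
  have -> : \sum_k (conv l x y : 'rV[R]_(n + n)) ord0 k =
      l%:num * (\sum_k x ord0 k) + (1 - l%:num) * (\sum_k y ord0 k).
    rewrite !mulr_sumr -big_split /=; apply: eq_bigr => k _.
    by rewrite /conv /= !mxE.
  have l0 : 0 <= l%:num by [].
  have l1 : 0 <= 1 - l%:num by rewrite subr_ge0.
  by move: (ler_wpM2l l0 xd) (ler_wpM2l l1 yd); lra.
move=> z [m /= mS mz] /=; have mS' : m \in msupp S by rewrite mcoeff_msupp.
have /dhomogP /(_ _ mS') /= <- := hS; rewrite mdegE natr_sum.
by apply: ler_sum => k _.
Qed.

Let sum_continuous_rV : continuous (fun z : 'rV[R]_(n + n) => \sum_k z ord0 k).
Proof.
apply: continuous_big => [|k _]; first exact: add_continuous.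
exact: coord_continuous.
Qed.

Let closure_ge : closure (newton_polyhedron S) `<=` [set z | d%:R <= \sum_k z ord0 k].
Proof.
rewrite closureE; apply: smallest_sub; last exact: sum_ge.
apply: (@closed_comp _ _ (fun z : 'rV[R]_(n + n) => \sum_k z ord0 k) [set t | d%:R <= t]).
  by move=> z _; exact: sum_continuous_rV.
exact: closed_ge.
Qed.

(** A convex combination of the axis monomials with the approximate weights
    above is close to the diagonal point. *)
Let in_closure : closure (newton_polyhedron S) (const_mx s0).
Proof.
have d4 : (4 < d)%N by exact: leq_ltn_trans dn.
have [ij hij] := choice axis_monomial.
have [ji hji] := choice hij.
pose M (k l : 'I_(n + n)) : nat := ((l == lshift n (ij k)) + (l == rshift n (ji k)))%N.
have M2 k : (\sum_l M k l)%N = 2%N.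
  rewrite big_split /= (bigD1 (lshift n (ij k)))//= eqxx big1; last by move=> l /negbTE ->.
  rewrite addn0 (bigD1 (rshift n (ji k)))//= eqxx big1; last by move=> l /negbTE ->.
  by [].
have M1 k l : (M k l <= 1)%N.
  by rewrite /M; have [->|_] := eqVneq l (lshift n (ij k)); rewrite ?eq_lrshift// leq_b1.
move=> B /nbhs_ballP [eps /= eps0 hB].
have eps2 : 0 < eps / 2 by rewrite divr_gt0.
have [c [c0 c1 hc]] := simplex_fixpoint M2 M1 d4 s0gt1 Ns0 eps2.
have hm k : {m : multinom (n + n) | mcoeff m S != 0 /\
    forall l, m l = ((d - 2) * (l == k) + M k l)%N}.
  by apply: cid; have [m m1 m2] := hji k; exists m.
pose x k : 'rV[R]_(n + n) := \row_l ((sval (hm k)) l)%:R.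
exists (\sum_k c k *: x k); split.
  apply: (convex_sum newton_convex) => // k; apply: sub_gen_smallest.
  exists (sval (hm k)); first by case: (hm k) => m [].
  by move=> l; rewrite mxE.
apply: hB; rewrite mx_norm_ball /ball_ /=.
apply: le_lt_trans (_ : eps / 2 < eps); last by rewrite ltr_pdivrMr// ltr_pMr// ltr1n.
apply: rV_norm_le => [|l]; first exact: ltW.
have := hc l; rewrite !mxE distrC; congr (`| _ - _ | <= _); rewrite summxE.
rewrite [X in _ + X](eq_bigr (fun k => c k * (M k l)%:R))//.
transitivity (\sum_k (c k * ((d - 2)%:R * (l == k)%:R) + c k * (M k l)%:R)).
  rewrite big_split /=; congr (_ + _).
  rewrite (bigD1 l)//= eqxx mulr1 big1 ?addr0; last first.
    by move=> k kl; rewrite eq_sym (negbTE kl) !mulr0.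
  by rewrite (natrB R (leq_trans (isT : (2 <= 5)%N) d4)) mulrC.
apply: eq_bigr => k _; rewrite !mxE -mulrDr; congr (_ * _).
by case: (hm k) => m [m1 m2] /=; rewrite m2 natrD natrM.
Qed.

Let not_interior : ~ (newton_polyhedron S)° (const_mx s0).
Proof.
move=> /nbhs_ballP [eps /= eps0 hB].
have : newton_polyhedron S (const_mx (s0 - eps / 2)).
  apply: hB; rewrite mx_norm_ball /ball_ /=.
  apply: le_lt_trans (_ : eps / 2 < eps); last by rewrite ltr_pdivrMr// ltr_pMr// ltr1n.
  apply: rV_norm_le => [|l]; first by rewrite divr_ge0// ltW.
  by rewrite !mxE subKr ger0_norm// divr_ge0// ltW.
move=> /sum_ge /=; under eq_bigr do rewrite mxE.
have -> : \sum_(k < n + n) (s0 - eps / 2) = N%:R * (s0 - eps / 2).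
  by rewrite sumr_const card_ord mulr_natl.
rewrite mulrBr Ns0.
have : 0 < N%:R * (eps / 2) by rewrite mulr_gt0 ?divr_gt0// /N natrD addr_gt0.
rewrite /N; lra.
Qed.

(** The diagonal point (s0, ..., s0) lies on the hyperplane where the
    coordinates sum to d, and the polyhedron lies on one side of it. The point
    belongs to the polytope because it is also adherent to the polyhedron. *)
Lemma newton_distanceE : newton_distance S = 2 * n%:R / d%:R.
Proof.
rewrite /newton_distance; set E := [set s : R | _].
have Es0 : E s0.
  split; first exact: lt_le_trans s0gt1.
  by split; [exact: in_closure|exact: not_interior].
have lbE : lbound E s0.
  move=> s [s_gt0 [/closure_ge /= + _]]; under eq_bigr do rewrite mxE.
  have -> : \sum_(k < n + n) s = N%:R * s by rewrite sumr_const card_ord mulr_natl.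
  by rewrite -Ns0 ler_pM2l// /N natrD addr_gt0.
have -> : inf E = s0.
  apply/eqP; rewrite eq_le; apply/andP; split; first by apply: ge_inf => //; exists s0.
  by apply: lb_le_inf => //; exists s0.
by rewrite /s0 invfM invrK mulrC.
Qed.

End newton.

(** * The lower bound *)

Section complex_Lp.
Variables (R : realType) (n : nat).
Implicit Types (f : 'rV[R]_n -> R[i]).

Lemma Lp_normE p f : 0 < p ->
  Lp_norm p f = ((\int[@lebn R n]_x ((Normc.normc (f x)) `^ p)%:E) `^ p^-1)%E.
Proof.
move=> p0; rewrite /Lp_norm unlock /=; congr (poweR _ _); apply: eq_integral => x _.
by rewrite /= ger0_norm// /Normc.normc; case: (f x) => a b; rewrite sqrtr_ge0.
Qed.

Lemma normc_ge_Re (z : R[i]) : `|complex.Re z| <= Normc.normc z.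
Proof.
case: z => a b /=; rewrite -sqrtr_sqr; apply: ler_wsqrtr.
by rewrite lerDl sqr_ge0.
Qed.

Lemma normc_ge_Im (z : R[i]) : `|complex.Im z| <= Normc.normc z.
Proof.
case: z => a b /=; rewrite -sqrtr_sqr; apply: ler_wsqrtr.
by rewrite lerDr sqr_ge0.
Qed.

Lemma normc_ge0 (z : R[i]) : 0 <= Normc.normc z.
Proof. by case: z => a b /=; rewrite sqrtr_ge0. Qed.

Lemma normc_le (z : R[i]) : Normc.normc z <= `|complex.Re z| + `|complex.Im z|.
Proof.
case: z => a b /=; rewrite -[leRHS]ger0_norm ?addr_ge0// -[leRHS]sqrtr_sqr.
apply: ler_wsqrtr; rewrite sqrrD !real_normK ?num_real// -addrA lerD2l lerDr.
by rewrite mulrn_wge0// mulr_ge0.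
Qed.

Lemma measurable_normc f : cmeasurable f -> measurable_fun setT (fun x => Normc.normc (f x)).
Proof.
move=> [m1 m2]; rewrite (_ : (fun _ => _) =
    (fun x => Num.sqrt (complex.Re (f x) ^+ 2 + complex.Im (f x) ^+ 2))); last first.
  by apply/funext => x; case: (f x).
apply: (measurableT_comp (continuous_measurable_fun (@sqrt_continuous R))).
by apply: measurable_funD; exact: measurable_funX.
Qed.

Section operator.
Variables (S : mpoly (n + n) R) (psi : 'rV[R]_n * 'rV[R]_n -> R[i]) (lam : R).
Local Notation c z := (cos (lam * phase_eval S z)).
Local Notation s z := (sin (lam * phase_eval S z)).
Local Notation u z := (complex.Re (psi z)).
Local Notation v z := (complex.Im (psi z)).

Lemma osc_op_Re f x : complex.Re (osc_op S psi lam f x) = \int[@lebn R n]_y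
  ((c (x, y) * u (x, y) - s (x, y) * v (x, y)) * complex.Re (f y) -
   (c (x, y) * v (x, y) + s (x, y) * u (x, y)) * complex.Im (f y)).
Proof.
rewrite /osc_op /cintegral /=; apply: eq_Rintegral => y _.
by case: (psi (x, y)) => a b; case: (f y) => a' b'.
Qed.

Lemma osc_op_Im f x : complex.Im (osc_op S psi lam f x) = \int[@lebn R n]_y
  ((c (x, y) * u (x, y) - s (x, y) * v (x, y)) * complex.Im (f y) +
   (c (x, y) * v (x, y) + s (x, y) * u (x, y)) * complex.Re (f y)).
Proof.
rewrite /osc_op /cintegral /=; apply: eq_Rintegral => y _.
by case: (psi (x, y)) => a b; case: (f y) => a' b'.
Qed.

Hypothesis mu : measurable_fun setT (fun z => u z).
Hypothesis mv : measurable_fun setT (fun z => v z).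

Lemma measurable_cos_phase : measurable_fun setT (fun z => c z).
Proof.
apply: (measurableT_comp (continuous_measurable_fun (@continuous_cos R))).
by apply: measurable_funM; [exact: measurable_cst|exact: measurable_phase_eval].
Qed.

Lemma measurable_sin_phase : measurable_fun setT (fun z => s z).
Proof.
apply: (measurableT_comp (continuous_measurable_fun (@continuous_sin R))).
by apply: measurable_funM; [exact: measurable_cst|exact: measurable_phase_eval].
Qed.

Lemma measurable_osc_op f : cmeasurable f -> cmeasurable (osc_op S psi lam f).
Proof.
move=> [mr mi].
have m1 : measurable_fun setT (fun z => c z * u z - s z * v z).
  by apply: measurable_funB; apply: measurable_funM => //;
    [exact: measurable_cos_phase|exact: measurable_sin_phase].
have m2 : measurable_fun setT (fun z => c z * v z + s z * u z).
  by apply: measurable_funD; apply: measurable_funM => //;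
    [exact: measurable_cos_phase|exact: measurable_sin_phase].
have mr2 := measurableT_comp mr (@measurable_snd _ _ 'rV[R]_n 'rV[R]_n).
have mi2 := measurableT_comp mi (@measurable_snd _ _ 'rV[R]_n 'rV[R]_n).
split.
  rewrite (funext (osc_op_Re f)).
  apply: (measurable_Rintegral_section (@lebn R n) (F := fun z =>
    (c z * u z - s z * v z) * complex.Re (f z.2) - (c z * v z + s z * u z) * complex.Im (f z.2))).
  by apply: measurable_funB; apply: measurable_funM.
rewrite (funext (osc_op_Im f)).
apply: (measurable_Rintegral_section (@lebn R n) (F := fun z =>
    (c z * u z - s z * v z) * complex.Im (f z.2) + (c z * v z + s z * u z) * complex.Re (f z.2))).
by apply: measurable_funD; apply: measurable_funM.
Qed.

End operator.

End complex_Lp.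

Lemma continuous_bounded_ball (R : realType) m n (w : 'rV[R]_m * 'rV[R]_n -> R) r :
  continuous w -> exists2 D, 0 < D & forall z, `|z| <= r -> `|w z| <= D.
Proof.
move=> cw; have cB := @compact_pair_ball R m n r.
have := @continuous_compact _ _ w _ (continuous_subspaceT cw) cB.
move=> /compact_bounded [D [_ /(_ (`|D| + 1))]].
rewrite (le_lt_trans (ler_norm D)) ?ltrDl// => /(_ isT) hD.
by exists (`|D| + 1) => [|z zh]; [rewrite ltr_wpDl|apply: hD; exists z].
Qed.

Section lower_bound.
Variables (R : realType) (n d : nat) (S : mpoly (n + n) R).
Variables (psi : 'rV[R]_n * 'rV[R]_n -> R[i]) (p : R).
Hypothesis d0 : (0 < d)%N.
Hypothesis hS : S \is ishomog1 d mdeg.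
Hypothesis cRe : continuous (fun z => complex.Re (psi z)).
Hypothesis cIm : continuous (fun z => complex.Im (psi z)).
Hypothesis psi0 : psi 0 != 0.
Hypothesis p1 : 1 < p.
Let p0 : 0 < p. Proof. exact: lt_trans p1. Qed.

Local Notation RePsi z := (complex.Re (psi z)).
Local Notation ImPsi z := (complex.Im (psi z)).

(** Near the origin the real or the imaginary part of the kernel keeps a sign. *)
Let part : exists (b : bool) (kap del : R), [/\ 0 < kap, 0 < del & exists2 sg : R,
  sg = 1 \/ sg = -1 & forall th z, `|th| <= del -> `|z| <= del ->
    kap <= sg * (if b then cos th * RePsi z - sin th * ImPsi z
                 else cos th * ImPsi z + sin th * RePsi z)].
Proof.
have gen (u v : 'rV[R]_n * 'rV[R]_n -> R) : continuous u -> continuous v -> u 0 != 0 ->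
    exists (kap del : R), [/\ 0 < kap, 0 < del & exists2 sg : R,
    sg = 1 \/ sg = -1 & forall th z, `|th| <= del -> `|z| <= del ->
    kap <= sg * (cos th * u z + sin th * v z)].
  move=> cu cv u0; pose U := `|u 0|; have U0 : 0 < U by rewrite normr_gt0.
  pose W := U + `|v 0| + 2; have W0 : 0 < W by rewrite /W; move: (normr_ge0 (v 0)) U0; lra.
  pose eta := Num.min 1 (U / (8 * W)).
  have eta0 : 0 < eta by rewrite lt_min ltr01 divr_gt0// mulr_gt0.
  have ccos := @continuous_cos R 0; have csin := @continuous_sin R 0.
  have near0 (V : normedModType R) (g : V -> R) : {for 0, continuous g} -> exists2 e, 0 < e &
      forall z, `|z| <= e -> `|g z - g 0| <= eta.
    move=> /cvgrPdist_le /(_ _ eta0) /nbhs_ballP [e /= e0 he]; exists (e / 2); first by rewrite divr_gt0.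
    move=> z ze; rewrite distrC; apply: he; rewrite -ball_normE /ball_ /= sub0r normrN.
    by apply: le_lt_trans ze _; rewrite ltr_pdivrMr// ltr_pMr// ltr1n.
  have [e1 e10 h1] := near0 _ u (cu 0); have [e2 e20 h2] := near0 _ v (cv 0).
  have [e3 e30 h3] := near0 R (@cos R) ccos; have [e4 e40 h4] := near0 R (@sin R) csin.
  pose del := Num.min (Num.min e1 e2) (Num.min e3 e4).
  exists (U / 2), del; split; [by rewrite divr_gt0|by rewrite !lt_min e10 e20 e30 e40|].
  exists (Num.sg (u 0)).
    have [h|h|h] := ltrgt0P (u 0); [by left; rewrite gtr0_sg|by right; rewrite ltr0_sg|].
    by rewrite h eqxx in u0.
  move=> th z; rewrite !le_min => /andP[_ /andP[t3 t4]] /andP[/andP[z1 z2] _].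
  have {}h1 := h1 _ z1; have {}h2 := h2 _ z2; have {}h3 := h3 _ t3; have {}h4 := h4 _ t4.
  rewrite cos0 in h3; rewrite sin0 subr0 in h4.
  set A := cos th in h3 *; set B := sin th in h4 *.
  have eta1 : eta <= 1 by rewrite ge_min lexx.
  have etaU : eta * (8 * W) <= U by rewrite -ler_pdivlMr ?mulr_gt0// ge_min lexx orbT.
  have uU : Num.sg (u 0) * u 0 = U by rewrite /U [RHS]normrEsg.
  have sg1 : `|Num.sg (u 0)| = 1 by rewrite normr_sg u0.
  have -> : Num.sg (u 0) * (A * u z + B * v z) =
    U - Num.sg (u 0) * (u 0 - u z + (1 - A) * u z - B * v z) by rewrite -uU; ring.
  have hX : `|Num.sg (u 0) * (u 0 - u z + (1 - A) * u z - B * v z)| <= eta * (4 * W).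
    rewrite normrM sg1 mul1r.
    have uz : `|u z| <= U + 1.
      rewrite -[u z](subrK (u 0)); apply: le_trans (ler_normD _ _) _; rewrite addrC lerD2l.
      exact: le_trans eta1.
    have vz : `|v z| <= `|v 0| + 1.
      rewrite -[v z](subrK (v 0)); apply: le_trans (ler_normD _ _) _; rewrite addrC lerD2l.
      exact: le_trans eta1.
    apply: le_trans (ler_normB _ _) _; apply: le_trans (lerD (ler_normD _ _) (lexx _)) _.
    rewrite !normrM; rewrite distrC in h1; rewrite distrC in h3.
    have q1 : `|1 - A| * `|u z| <= eta * (U + 1) by apply: ler_pM.
    have q2 : `|B| * `|v z| <= eta * (`|v 0| + 1) by apply: ler_pM.
    apply: le_trans (lerD (lerD h1 q1) q2) _.
    have := mulr_ge0 (ltW eta0) (ltW U0); have := mulr_ge0 (ltW eta0) (normr_ge0 (v 0)).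
    rewrite /W; move: eta0; lra.
  have := ler_norm (Num.sg (u 0) * (u 0 - u z + (1 - A) * u z - B * v z)).
  by move: hX etaU; lra.
have [r0|r0] := eqVneq (RePsi 0) 0; last first.
  have [kap [del [k0 d0' [sg hsg h]]]] := gen (fun z => RePsi z) (fun z => - ImPsi z) cRe
    (fun z => cvgN (cIm (x := z))) r0.
  exists true, kap, del; split => //; exists sg => // th z t1 z1.
  by have := h th z t1 z1; rewrite mulrN.
have i0 : ImPsi 0 != 0.
  by apply: contra psi0 => /eqP i0; apply/eqP; move: r0 i0; case: (psi 0) => a b /= -> ->.
have [kap [del [k0 d0' [sg hsg h]]]] := gen (fun z => ImPsi z) (fun z => RePsi z) cIm cRe i0.
by exists false, kap, del; split => //; exists sg.
Qed.

Let cpart (b : bool) (w : R[i]) : R := if b then complex.Re w else complex.Im w.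

Let part_kernel (b : bool) th (w : R[i]) : cpart b ((cos th +i* sin th)%C * w) =
  if b then cos th * complex.Re w - sin th * complex.Im w
  else cos th * complex.Im w + sin th * complex.Re w.
Proof. by case: w => u v; case: b. Qed.

(** The operator is tested on the indicator of a cube of side about lam^(-1/d),
    on which lam S is small: one part of the kernel keeps a sign there, and
    nothing cancels. *)
Lemma osc_op_lower : exists2 c : R, 0 < c & forall lam, 1 <= lam ->
  ((c * lam `^ (- (n%:R / d%:R)))%:E <= op_norm p (osc_op S psi lam))%E.
Proof.
have [b [kap [del [kap0 del0 [sg hsg hker]]]]] := part.
have [C C0 hC] := homog_bound hS.
pose eps := Num.min (Num.min 1 del) (del / C).
have eps0 : 0 < eps by rewrite !lt_min ltr01 del0 divr_gt0.
have eps1 : eps <= 1 by rewrite !ge_min lexx.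
have epsd : eps <= del by rewrite !ge_min lexx !orbT.
have epsC : C * eps <= del by rewrite mulrC -ler_pdivlMr// !ge_min lexx !orbT.
exists (kap * (2 * eps) ^+ n) => [|lam lam1]; first by rewrite mulr_gt0// exprn_gt0// mulr_gt0.
have lam0 : 0 < lam by apply: lt_le_trans lam1.
have dR : 0 < d%:R :> R by rewrite ltr0n.
pose t := lam `^ (- d%:R^-1); have t0 : 0 < t by rewrite powR_gt0.
have t1 : t <= 1.
  by rewrite /t powRN invf_le1 ?powR_gt0// -[leLHS](powRr0 lam) ler_powR// invr_ge0 ltW.
have td : lam * t ^+ d = 1.
  rewrite /t -powR_mulrn ?powR_ge0// -powRrM mulNr mulVf ?gt_eqF// powRN powRr1 ?(ltW lam0)//.
  by rewrite divff// gt_eqF.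
pose h := eps * t; have h0 : 0 < h by rewrite mulr_gt0.
have heps : h <= eps by rewrite ler_piMr// ltW.
pose Q := box (0 : 'rV[R]_n) h.
have mQ : measurable Q by exact: measurable_box.
have QE : Q = [set x | `|x| <= h] by apply: box0E; exact: ltW.
pose V := (2 * h) ^+ n; have V0 : 0 < V by rewrite exprn_gt0// mulr_gt0.
have muQ : @lebn R n Q = V%:E by rewrite [LHS]lebn_box// ltW.
pose al := V `^ (- p^-1); have al0 : 0 < al by rewrite powR_gt0.
have alp : al `^ p * V = 1.
  rewrite /al -powRrM mulNr mulVf ?gt_eqF// powRN powRr1 ?(ltW V0)// mulVf// gt_eqF//.
pose f (x : 'rV[R]_n) : R[i] := ((sg * al * \1_Q x)%:C)%C.
have sg1 : `|sg| = 1 by case: hsg => ->; rewrite ?normrN1 ?normr1.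
have nf x : Normc.normc (f x) `^ p = al `^ p * \1_Q x.
  rewrite /f /= expr0n /= addr0 sqrtr_sqr !normrM sg1 mul1r (gtr0_norm al0).
  rewrite !indicE; case: (x \in Q); first by rewrite normr1 !mulr1.
  by rewrite normr0 !mulr0 powR0// gt_eqF.
have fnorm : (Lp_norm p f <= 1)%E.
  rewrite Lp_normE//; under eq_integral do rewrite nf EFinM.
  rewrite ge0_integralZl//; last 2 first.
  - by apply/measurable_EFinP; exact: measurable_indic.
  - by rewrite lee_fin powR_ge0.
  rewrite integral_indic// setIT [X in (_ * X)%E]muQ -EFinM alp.
  by rewrite poweR_EFin powR1.
have mf : cmeasurable f.
  split => /=; last exact: measurable_cst.
  by apply: measurable_funM; [exact: measurable_cst|exact: measurable_indic].
apply: (@le_trans _ _ (Lp_norm p (osc_op S psi lam f))); last first.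
  by apply: ereal_sup_ubound; exists f.
pose g x y := cpart b
  ((cos (lam * phase_eval S (x, y)) +i* sin (lam * phase_eval S (x, y)))%C * psi (x, y) * f y).
pose K x y := if b then cos (lam * phase_eval S (x, y)) * RePsi (x, y) -
    sin (lam * phase_eval S (x, y)) * ImPsi (x, y)
  else cos (lam * phase_eval S (x, y)) * ImPsi (x, y) + sin (lam * phase_eval S (x, y)) * RePsi (x, y).
have gE x y : g x y = K x y * (sg * al * \1_Q y).
  rewrite /g /K /f -part_kernel; set z := (_ * psi _); case: z => u v.
  by rewrite /cpart; case: (b); rewrite /= !(mulr0, subr0, addr0, add0r) // mulrC.
have pt x : Q x -> kap * al * V <= Normc.normc (osc_op S psi lam f x).
  move=> Qx; have Kb y : Q y -> kap <= sg * K x y.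
    rewrite QE /= in Qx * => Qy.
    have xyh : `|(x, y)| <= h by exact: pair_norm_le.
    apply: hker; last exact: le_trans xyh (le_trans heps epsd).
    have [hb _] := hC h (x, y) (x, y) h0 xyh xyh.
    rewrite normrM (gtr0_norm lam0); apply: le_trans (ler_wpM2l (ltW lam0) hb) _.
    rewrite /h exprMn [leLHS](_ : _ = C * eps ^+ d * (lam * t ^+ d)); last by ring.
    rewrite td mulr1; apply: le_trans epsC; rewrite ler_pM2l//.
    by case: (d) d0 => // d' _; rewrite exprS ler_piMr ?(ltW eps0)// exprn_ile1// ltW.
  have mK : measurable_fun setT (K x).
    have mS : measurable_fun setT (fun y => lam * phase_eval S (x, y)).
      apply: measurable_funM; first exact: measurable_cst.
      exact: (@measurable_section _ _ _ _ _ _ x (measurable_phase_eval S)).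
    have mc := measurableT_comp (continuous_measurable_fun (@continuous_cos R)) mS.
    have msn := measurableT_comp (continuous_measurable_fun (@continuous_sin R)) mS.
    have mr := measurable_section x (continuous_measurable_rV2 cRe).
    have mi := measurable_section x (continuous_measurable_rV2 cIm).
    by rewrite /K; case: (b); [apply: measurable_funB|apply: measurable_funD]; apply: measurable_funM.
  have mg : measurable_fun setT (g x).
    rewrite (funext (gE x)); apply: measurable_funM => //.
    by apply: measurable_funM; [exact: measurable_cst|exact: measurable_indic].
  pose low y := kap * al * \1_Q y.
  have lowg y : low y <= g x y.
    rewrite gE /low !indicE; have [/set_mem Qy|] := boolP (y \in Q); last by rewrite !mulr0.
    by rewrite !mulr1 mulrA ler_pM2r// mulrC; exact: Kb.
  have intlow : (\int[@lebn R n]_y (low y)%:E = (kap * al * V)%:E)%E.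
    rewrite /low; under eq_integral do rewrite EFinM.
    rewrite ge0_integralZl//; last 2 first.
    - by apply/measurable_EFinP; exact: measurable_indic.
    - by rewrite lee_fin mulr_ge0// ltW.
    by rewrite integral_indic// setIT [X in (_ * X)%E]muQ -EFinM.
  have g0 y : 0 <= g x y.
    apply: le_trans (lowg y); rewrite /low !mulr_ge0 ?(ltW kap0) ?(ltW al0)//.
  have partE : cpart b (osc_op S psi lam f x) =
      \int[@lebn R n]_y g x y.
    by rewrite /osc_op /cintegral /g /cpart; case: (b).
  have gfin : (\int[@lebn R n]_y (g x y)%:E < +oo)%E.
    have [D hD] : exists D, forall y, Q y -> `|K x y| <= D.
      have [D1 _ hD1] := continuous_bounded_ball h cRe; have [D2 _ hD2] := continuous_bounded_ball h cIm; exists (D1 + D2) => y Qy.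
      have xyh : `|(x, y)| <= h by apply: pair_norm_le; [move: Qx|move: Qy]; rewrite QE.
      have c1 := @cos_max R (lam * phase_eval S (x, y)).
      have s1 := @sin_max R (lam * phase_eval S (x, y)).
      have m1 (a1 b1 : R) D' : `|a1| <= 1 -> `|b1| <= D' -> `|a1 * b1| <= D'.
        by move=> ha hb; rewrite normrM -[leRHS]mul1r ler_pM.
      rewrite /K; case: (b); first by apply: le_trans (ler_normB _ _) _; apply: lerD; apply: m1 => //; [exact: hD1|exact: hD2].
      by apply: le_trans (ler_normD _ _) _; rewrite addrC; apply: lerD; apply: m1 => //; [exact: hD1|exact: hD2].
    apply: (@le_lt_trans _ _ (\int[@lebn R n]_y ((Num.max 0 D * al)%:E * (\1_Q y)%:E))%E).
      apply: ge0_le_integral => //.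
      - by move=> y _; rewrite lee_fin.
      - exact/measurable_EFinP.
      - apply: emeasurable_funM => //; apply/measurable_EFinP; exact: measurable_indic.
      move=> y _; rewrite -EFinM lee_fin gE !indicE.
      have [/set_mem Qy|] := boolP (y \in Q); last by rewrite !mulr0.
      rewrite !mulr1 mulrA ler_pM2r//; apply: le_trans (ler_norm _) _.
      by rewrite normrM sg1 mulr1 le_max (hD _ Qy) orbT.
    rewrite ge0_integralZl//; last 2 first.
    - by apply/measurable_EFinP; exact: measurable_indic.
    - by rewrite lee_fin mulr_ge0 ?le_max ?lexx// ltW.
    by rewrite integral_indic// setIT [X in (_ * X < _)%E]muQ -EFinM ltry.
  apply: le_trans (_ : `|cpart b (osc_op S psi lam f x)| <= _).
    rewrite partE; apply: le_trans _ (ler_norm _); rewrite /Rintegral -lee_fin fineK.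
      rewrite -intlow; apply: ge0_le_integral => //.
      - by move=> y _; rewrite lee_fin /low !mulr_ge0 ?(ltW kap0) ?(ltW al0).
      - by apply/measurable_EFinP; apply: measurable_funM; [exact: measurable_cst|exact: measurable_indic].
      - exact/measurable_EFinP.
      - by move=> y _; rewrite lee_fin.
    by rewrite ge0_fin_numE//; apply: integral_ge0 => y _; rewrite lee_fin.
  by rewrite /cpart; case: (b); [exact: normc_ge_Re|exact: normc_ge_Im].
rewrite Lp_normE//.
have -> : (kap * (2 * eps) ^+ n * lam `^ (- (n%:R / d%:R)))%:E =
    (((kap * al * V) `^ p * V)%:E `^ p^-1)%E.
  have -> : lam `^ (- (n%:R / d%:R)) = t ^+ n.
    by rewrite /t -powR_mulrn ?powR_ge0// -powRrM; congr (_ `^ _); ring.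
  rewrite poweR_EFin; congr EFin.
  have -> : kap * (2 * eps) ^+ n * t ^+ n = kap * V by rewrite /V /h !exprMn; ring.
  rewrite (_ : kap * al * V = al * (kap * V)); last by ring.
  have kv0 := ltW (mulr_gt0 kap0 V0).
  rewrite (powRM _ (ltW al0) kv0) mulrAC alp mul1r.
  by rewrite -powRrM mulfV ?gt_eqF// powRr1.
apply: gt0_ler_poweR; rewrite ?invr_ge0 ?(ltW p0)//.
- by rewrite in_itv /= lee_fin mulr_ge0 ?powR_ge0 ?(ltW V0)//= leey.
- rewrite in_itv /= leey andbT; apply: integral_ge0 => x _; by rewrite lee_fin powR_ge0.
have -> : (((kap * al * V) `^ p * V)%:E =
    \int[@lebn R n]_x (((kap * al * V) `^ p)%:E * (\1_Q x)%:E))%E.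
  rewrite ge0_integralZl//; last 2 first.
  - by apply/measurable_EFinP; exact: measurable_indic.
  - by rewrite lee_fin powR_ge0.
  by rewrite integral_indic// setIT [X in (_ = _ * X)%E]muQ.
have mT := measurable_osc_op S lam (continuous_measurable_rV2 cRe) (continuous_measurable_rV2 cIm) mf.
apply: ge0_le_integral => //.
- by move=> x _; rewrite mule_ge0// lee_fin powR_ge0.
- apply: emeasurable_funM; first exact: measurable_cst.
  by apply/measurable_EFinP; exact: measurable_indic.
- apply/measurable_EFinP; apply: (measurableT_comp (measurable_powR p)).
  exact: measurable_normc.
move=> x _; rewrite -EFinM lee_fin indicE.
have [/set_mem Qx|] := boolP (x \in Q); last by rewrite mulr0 powR_ge0.
rewrite mulr1; apply: ge0_ler_powR; rewrite ?nnegrE ?(ltW p0) ?normc_ge0 ?pt//.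
by rewrite !mulr_ge0 ?(ltW al0) ?(ltW kap0) ?(ltW V0).
Qed.

End lower_bound.

(** * From complex to real operators *)

Section finite_sums.
Variable R : realType.

Lemma powR_sum_le (I : finType) (t : I -> R) p : 1 <= p -> (forall i, 0 <= t i) ->
  (\sum_i t i) `^ p <= #|I|%:R `^ p * \sum_i t i `^ p.
Proof.
move=> p1 t0; have p0 : 0 < p by apply: lt_le_trans p1.
set M := \sum_i t i `^ p; have M0 : 0 <= M by apply: sumr_ge0 => i _; exact: powR_ge0.
have -> : #|I|%:R `^ p * M = (#|I|%:R * M `^ p^-1) `^ p.
  by rewrite powRM ?powR_ge0// -powRrM mulVf ?gt_eqF// powRr1.
apply: ge0_ler_powR; rewrite ?nnegrE ?(ltW p0) ?sumr_ge0 ?mulr_ge0 ?powR_ge0//.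
rewrite mulr_natl -sumr_const; apply: ler_sum => i _.
have -> : t i = (t i `^ p) `^ p^-1 by rewrite -powRrM mulfV ?gt_eqF// powRr1.
apply: ge0_ler_powR; rewrite ?nnegrE ?invr_ge0 ?(ltW p0) ?powR_ge0//.
by rewrite /M (bigD1 i)//= lerDl; apply: sumr_ge0 => j _; exact: powR_ge0.
Qed.

(** One factor of the cardinal comes from the convexity of the power function,
    the other from the number of terms. *)
Lemma Lpp_sum_le d (T : measurableType d) (mu : {measure set T -> \bar R})
    (I : finType) (h : T -> R) (g : I -> T -> R) p b : 1 <= p -> 0 <= b ->
  measurable_fun setT h -> (forall i, measurable_fun setT (g i)) ->
  (forall x, `|h x| <= \sum_i `|g i x|) -> (forall i, (Lpp mu p (g i) <= (b `^ p)%:E)%E) ->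
  (Lpp mu p h <= ((#|I|%:R ^+ 2 * b) `^ p)%:E)%E.
Proof.
move=> p1 b0 mh mg hg gb; have p0 : 0 < p by apply: lt_le_trans p1.
have [I0|I0] := posnP #|I|.
  rewrite /Lpp integral0_eq ?lee_fin ?powR_ge0// => x _.
  suff -> : h x = 0 by rewrite normr0 powR0// gt_eqF.
  apply/eqP; rewrite -normr_le0; apply: le_trans (hg x) _.
  by rewrite big1// => i _; have := card0_eq I0 i.
apply: (@le_trans _ _ (\int[mu]_x ((#|I|%:R `^ p)%:E * \sum_i (`|g i x| `^ p)%:E))%E).
  apply: ge0_le_integral => //.
  - exact: measurable_normpow.
  - apply: emeasurable_funM => //; apply: emeasurable_sum => i; exact: measurable_normpow.
  move=> x _; rewrite sumEFin -EFinM lee_fin; apply: le_trans _ (powR_sum_le p1 _) => //.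
  by apply: ge0_ler_powR; rewrite ?nnegrE ?(ltW p0) ?sumr_ge0.
rewrite ge0_integralZl//; last 2 first.
- by apply: emeasurable_sum => i; exact: measurable_normpow.
- by move=> x _; apply: sume_ge0 => i _; rewrite lee_fin powR_ge0.
rewrite ge0_integral_sum//; last by move=> i; exact: measurable_normpow.
apply: (@le_trans _ _ ((#|I|%:R `^ p)%:E * \sum_(i : I) (b `^ p)%:E)%E).
  by rewrite lee_wpmul2l ?lee_fin ?powR_ge0//; apply: lee_sum => i _; exact: gb.
rewrite sumEFin sumr_const -EFinM lee_fin -[X in _ * X <= _]mulr_natl.
have: 1 <= #|I|%:R :> R by rewrite ler1n.
move: (#|I|%:R : R) => N N1; have N0 : 0 <= N by apply: le_trans N1.
have -> : N ^+ 2 * b = N * (N * b) by rewrite expr2 mulrA.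
rewrite (powRM _ N0 (mulr_ge0 N0 b0)) (powRM _ N0 b0).
apply: ler_wpM2l; first exact: powR_ge0.
apply: ler_wpM2r; first exact: powR_ge0.
by rewrite -[leLHS]powRr1// ler_powR.
Qed.

End finite_sums.

Section complex_operator.
Variables (R : realType) (n : nat) (S : mpoly (n + n) R).
Variables (psi : 'rV[R]_n * 'rV[R]_n -> R[i]) (lam p A B b : R).
Local Notation kernel s part := (fun z : 'rV[R]_n * 'rV[R]_n =>
  \1_(box 0 B) z.1 * (s (lam * phase_eval S z) * part (psi z)) * \1_(box 0 B) z.2).
Hypothesis p1 : 1 < p.
Hypothesis b0 : 0 <= b.
Hypothesis A0 : 0 <= A.
Hypothesis B0 : 0 <= B.
Hypothesis mRe : measurable_fun setT (fun z => complex.Re (psi z)).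
Hypothesis mIm : measurable_fun setT (fun z => complex.Im (psi z)).
Hypothesis psiA : forall z, `|complex.Re (psi z)| <= A /\ `|complex.Im (psi z)| <= A.
Hypothesis psiB : forall z, ~ `|z| <= B -> psi z = 0.
Hypothesis hb : forall s : R -> R, s = @cos R \/ s = @sin R ->
  Lp_bounded (@lebn R n) (@lebn R n) p (kernel s (@complex.Re R)) b /\
  Lp_bounded (@lebn R n) (@lebn R n) p (kernel s (@complex.Im R)) b.

Let k (i : bool * bool) : 'rV[R]_n * 'rV[R]_n -> R :=
  let s := if i.1 then @cos R else @sin R in
  if i.2 then kernel s (@complex.Re R) else kernel s (@complex.Im R).

Let tk i : tame_on (@lebn R n) (@lebn R n) (box 0 B) (box 0 B) A (k i).
Proof.
have mb := measurable_box (0 : 'rV[R]_n) B.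
have fb : (lebn (box (0 : 'rV[R]_n) B) < +oo)%E by rewrite [X in (X < _)%E]lebn_box// ltry.
have main s (part : 'rV[R]_n * 'rV[R]_n -> R) : s = @cos R \/ s = @sin R ->
    measurable_fun setT part -> (forall z, `|part z| <= A) ->
    tame_on (@lebn R n) (@lebn R n) (box 0 B) (box 0 B) A
    (fun z => \1_(box 0 B) z.1 * (s (lam * phase_eval S z) * part z) * \1_(box 0 B) z.2).
  move=> hs mpart hpart; split => //.
    apply: measurable_funM; last exact: (measurableT_comp (measurable_indic mb) measurable_snd).
    apply: measurable_funM; first exact: (measurableT_comp (measurable_indic mb) measurable_fst).
    apply: measurable_funM => //.
    by case: hs => ->; [exact: measurable_cos_phase|exact: measurable_sin_phase].
  move=> x y /=; rewrite !normrM mulrAC -[leRHS]mulrA [leRHS]mulrC.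
  rewrite !(ger0_norm (_ : 0 <= \1_ _ _)) ?indicE//.
  apply: ler_wpM2l; first by rewrite mulr_ge0.
  rewrite -[leRHS]mul1r ler_pM//.
  by case: hs => ->; rewrite ler_norml ?cos_geN1 ?cos_le1 ?sin_geN1 ?sin_le1.
rewrite /k; case: i => [[] []] /=; apply: (main _ (fun z => _ (psi z))) => //;
  try (by left); try (by right); by move=> z; have [] := psiA z.
Qed.

Let kb i : Lp_bounded (@lebn R n) (@lebn R n) p (k i) b.
Proof.
have [c1 c2] := hb (or_introl (erefl (@cos R))).
have [s1 s2] := hb (or_intror (erefl (@sin R))).
case: i => [[] []]; [exact: c1|exact: c2|exact: s1|exact: s2].
Qed.

Let kE (s : bool) (t : bool) x y : k (s, t) (x, y) =
  (if s then cos else sin) (lam * phase_eval S (x, y)) *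
  (if t then complex.Re (psi (x, y)) else complex.Im (psi (x, y))).
Proof.
have hbox (w : 'rV[R]_n) : (w \in box 0 B) = (`|w| <= B).
  by rewrite box0E//; apply/idP/idP => [/set_mem|h]; [|apply/mem_set].
have [zB|zB] := pselect (`|(x, y)| <= B); last first.
  have e := psiB zB; rewrite /k; case: s t => [] [] /=; rewrite e /= !mulr0 ?mul0r//.
have [n1 n2] := pair_norm_ge (x, y).
rewrite /k; case: s t => [] [] /=; rewrite !indicE !hbox (le_trans n1 zB) (le_trans n2 zB);
  by rewrite mul1r mulr1.
Qed.

(** The real and the imaginary part of the output are each a combination of four
    real operators applied to the real or imaginary part of f; the constant 64
    is the square of the number of these operators. *)
Lemma op_norm_le_real : (op_norm p (osc_op S psi lam) <= (64 * b)%:E)%E.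
Proof.
have p0 : 0 < p by apply: lt_trans p1.
apply: ge_ereal_sup => _ [f [mf f1] <-].
have mT := measurable_osc_op S lam mRe mIm mf.
rewrite Lp_normE// in f1.
have fp : (\int[@lebn R n]_x ((Normc.normc (f x)) `^ p)%:E <= 1)%E.
  have I0 : (0 <= \int[@lebn R n]_x ((Normc.normc (f x)) `^ p)%:E)%E.
    by apply: integral_ge0 => x _; rewrite lee_fin powR_ge0.
  have pp : p^-1 * p = 1 by rewrite mulVf// gt_eqF.
  rewrite -[leLHS]poweRe1// -[X in poweR _ X]pp poweRrM.
  rewrite -[leRHS](poweR1r p); apply: gt0_ler_poweR; rewrite ?(ltW p0)//.
  - by rewrite in_itv /= poweR_ge0 leey.
  - by rewrite in_itv /= leey andbT.
pose fp_ (t : bool) y := if t then complex.Re (f y) else complex.Im (f y).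
have mfp t : measurable_fun setT (fp_ t) by case: mf => m1 m2; case: t.
have Lf t : (Lpp (@lebn R n) p (fp_ t) <= 1)%E.
  apply: le_trans fp; apply: ge0_le_integral => //.
  - exact: measurable_normpow.
  - apply/measurable_EFinP; apply: (measurableT_comp (measurable_powR p)).
    exact: measurable_normc.
  move=> x _; rewrite lee_fin; apply: ge0_ler_powR; rewrite ?nnegrE ?(ltW p0) ?normc_ge0//.
  by case: t; [exact: normc_ge_Re|exact: normc_ge_Im].
have Lfoo t : (Lpp (@lebn R n) p (fp_ t) < +oo)%E by apply: le_lt_trans (Lf t) _; rewrite ltry.
pose g (i : bool * bool * bool) x := kop (@lebn R n) (k i.1) (fp_ i.2) x.
have mg i : measurable_fun setT (g i) by apply: measurable_kop => //; case: (tk i.1).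
have gb i : (Lpp (@lebn R n) p (g i) <= (b `^ p)%:E)%E.
  apply: (@le_trans _ _ ((b `^ p)%:E * Lpp (@lebn R n) p (fp_ i.2))%E); first exact: (kb i.1 (mfp i.2) (Lfoo i.2)).
  by rewrite -[leRHS]mule1 lee_wpmul2l// lee_fin powR_ge0.
have ig i x : (@lebn R n).-integrable setT (EFin \o (fun y => k i.1 (x, y) * fp_ i.2 y)).
  by apply: (tame_integrable x (tk i.1) (ltW p1)).
have ReE x : complex.Re (osc_op S psi lam f x) = g (true, true, true) x - g (false, false, true) x -
    (g (true, false, false) x + g (false, true, false) x).
  rewrite osc_op_Re /g /kop -(RintegralB _ (ig (true, true, true) x) (ig (false, false, true) x))//.
  rewrite -(RintegralD _ (ig (true, false, false) x) (ig (false, true, false) x))//.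
  rewrite -RintegralB//; last 2 first.
  - exact: (integrableB _ (ig (true, true, true) x) (ig (false, false, true) x)).
  - exact: (integrableD _ (ig (true, false, false) x) (ig (false, true, false) x)).
  by apply: eq_Rintegral => y _; rewrite !kE /fp_ /=; ring.
have ImE x : complex.Im (osc_op S psi lam f x) = g (true, true, false) x - g (false, false, false) x +
    (g (true, false, true) x + g (false, true, true) x).
  rewrite osc_op_Im /g /kop -(RintegralB _ (ig (true, true, false) x) (ig (false, false, false) x))//.
  rewrite -(RintegralD _ (ig (true, false, true) x) (ig (false, true, true) x))//.
  rewrite -RintegralD//; last 2 first.
  - exact: (integrableB _ (ig (true, true, false) x) (ig (false, false, false) x)).
  - exact: (integrableD _ (ig (true, false, true) x) (ig (false, true, true) x)).
  by apply: eq_Rintegral => y _; rewrite !kE /fp_ /=; ring.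
pose h x := Normc.normc (osc_op S psi lam f x).
have hg x : `|h x| <= \sum_i `|g i x|.
  rewrite /h ger0_norm ?normc_ge0//; apply: le_trans (normc_le _) _; rewrite ReE ImE.
  have -> : \sum_i `|g i x| = \sum_(s : bool) \sum_(t : bool) \sum_(u : bool) `|g (s, t, u) x|.
    by rewrite pair_bigA pair_bigA; apply: eq_bigr => -[[s t] u].
  rewrite !big_bool /=.
  have N4 (a1 a2 a3 a4 : R) : `|a1 - a2 - (a3 + a4)| <= `|a1| + `|a2| + (`|a3| + `|a4|).
    by apply: le_trans (ler_normB _ _) _; apply: lerD; [exact: ler_normB|exact: ler_normD].
  have N4' (a1 a2 a3 a4 : R) : `|a1 - a2 + (a3 + a4)| <= `|a1| + `|a2| + (`|a3| + `|a4|).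
    by apply: le_trans (ler_normD _ _) _; apply: lerD; [exact: ler_normB|exact: ler_normD].
  apply: le_trans (lerD (N4 _ _ _ _) (N4' _ _ _ _)) _.
  by rewrite le_eqVlt; apply/orP; left; apply/eqP; ring.
have := Lpp_sum_le (ltW p1) b0 (measurable_normc mT) mg hg gb.
rewrite !card_prod card_bool => hh; rewrite Lp_normE//.
have -> : (64 * b)%:E = (((64 * b) `^ p)%:E `^ p^-1)%E :> \bar R.
  by rewrite poweR_EFin -powRrM mulfV ?gt_eqF// powRr1// mulr_ge0.
apply: gt0_ler_poweR; rewrite ?invr_ge0 ?(ltW p0)//.
- rewrite in_itv /= leey andbT; apply: integral_ge0 => x _; by rewrite lee_fin powR_ge0.
- by rewrite in_itv /= lee_fin powR_ge0 leey.
apply: le_trans _ (le_trans hh _).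
  rewrite le_eqVlt; apply/orP; left; apply/eqP; apply: eq_integral => x _.
  by rewrite /h ger0_norm ?normc_ge0.
by rewrite lee_fin (_ : (2 * 2 * 2)%:R ^+ 2 = 64 :> R)// -natrX.
Qed.

End complex_operator.

(** * Smooth cutoffs *)

Section cutoff_amplitude.
Variable R : realType.

Lemma is_derive_slice (V : normedModType R) (f : V -> R) (g : R -> V) v t :
  (forall h, g (h + t) = h *: v + g t) -> derivable f (g t) v ->
  is_derive1 (fun u => f (g u)) t ('D_v f (g t)).
Proof.
move=> hg df.
have E : (fun h : R => h^-1 *: (((fun u => f (g u)) \o shift t) (h *: (1 : R)) - f (g t))) =
    (fun h => h^-1 *: ((f \o shift (g t)) (h *: v) - f (g t))).
  by apply/funext => h; rewrite /= /shift /= -hg; congr (_ *: (f (g (_ + _)) - _)); exact: mulr1.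
by split; rewrite /derivable /derive /= E.
Qed.

Definition axis_l n (i : 'I_n.+1) : 'rV[R]_n.+1 * 'rV[R]_n.+1 := (delta_mx 0 i, 0).

Lemma ins_shift n (i : 'I_n.+1) (x : 'rV[R]_n) (Y : 'rV[R]_n.+1) h t :
  (ins i (h + t, x), Y) = h *: axis_l i + (ins i (t, x), Y).
Proof.
have -> : h *: axis_l i + (ins i (t, x), Y) =
    (h *: delta_mx 0 i + ins i (t, x), h *: 0 + Y) by [].
congr pair; last by rewrite scaler0 add0r.
apply/matrixP => a j; rewrite ord1 {a} !mxE eqxx /=.
by case: unliftP => [k ->|->]; rewrite ?eqxx ?mulr1// eq_sym (negbTE (neq_lift _ _)) mulr0 add0r.
Qed.

Lemma smooth_amplitude n (a : 'rV[R]_n.+1 * 'rV[R]_n.+1 -> R) B : smooth a ->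
  exists2 A, 0 < A & amplitude B A a (fun i => 'D_(axis_l i) a)
    (fun i => 'D_(axis_l i) ('D_(axis_l i) a)).
Proof.
move=> /(_ 2) /= [c0 h0].
have [A0 A00 hA0] := continuous_bounded_ball (3 * B) c0.
have h1 i : exists D, 0 < D /\ forall z, `|z| <= 3 * B ->
    `|'D_(axis_l i) a z| <= D /\ `|'D_(axis_l i) ('D_(axis_l i) a) z| <= D.
  have [_ [c1 /(_ (axis_l i)) [_ [c2 _]]]] := h0 (axis_l i).
  have [D1 D10 hD1] := continuous_bounded_ball (3 * B) c1.
  have [D2 D20 hD2] := continuous_bounded_ball (3 * B) c2.
  exists (D1 + D2); split=> [|z zB]; first exact: addr_gt0.
  by split; [apply: le_trans (hD1 z zB) _; rewrite lerDl ltW|apply: le_trans (hD2 z zB) _; rewrite lerDr ltW].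
have [D hD] := choice h1.
have D0 i : 0 <= D i by have [/ltW] := hD i.
have Dle i : D i <= A0 + \sum_j D j.
  by rewrite (bigD1 i)//= addrCA lerDl addr_ge0 ?(ltW A00)// sumr_ge0.
exists (A0 + \sum_j D j); first by rewrite ltr_pwDl// sumr_ge0.
split.
- exact: continuous_measurable_rV2.
- move=> i x Y t; apply: (is_derive_slice (g := fun t => (ins i (t, x), Y))).
    by move=> h; exact: ins_shift.
  by have [/(_ (ins i (t, x), Y))] := h0 (axis_l i).
- move=> i x Y t; apply: (is_derive_slice (g := fun t => (ins i (t, x), Y))).
    by move=> h; exact: ins_shift.
  by have [_ [_ /(_ (axis_l i)) [/(_ (ins i (t, x), Y))]]] := h0 (axis_l i).
- move=> i x Y t.
  have [_ [_ /(_ (axis_l i)) [_ [c2 _]]]] := h0 (axis_l i).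
  have ct : {for t, continuous (fun t => (ins i (t, x), Y))}.
    rewrite (_ : (fun t => _) = (fun t => t *: axis_l i + (ins i (0, x), Y))).
      by apply: cvgD; [apply: cvgZr_tmp; exact: cvg_id|exact: cvg_cst].
    by apply/funext => u; rewrite -[u in LHS]addr0 ins_shift.
  exact: (continuous_comp ct (c2 _)).
- by move=> z zB; apply: le_trans (hA0 z zB) _; rewrite lerDl sumr_ge0.
- by move=> i z zB; apply: le_trans (Dle i); have [_ /(_ z zB) []] := hD i.
- by move=> i z zB; apply: le_trans (Dle i); have [_ /(_ z zB) []] := hD i.
Qed.

Lemma cutoff_support n (psi : 'rV[R]_n * 'rV[R]_n -> R[i]) : cutoff psi ->
  exists2 B, 0 < B & forall z, ~ `|z| <= B -> psi z = 0.
Proof.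
move=> [_ _ [K [cK _ hK]]].
have [D [_ /(_ (`|D| + 1))]] := compact_bounded cK.
rewrite (le_lt_trans (ler_norm D)) ?ltrDl// => /(_ isT) hD.
exists (`|D| + 1); first by rewrite ltr_wpDl.
by move=> z zB; apply: hK => Kz; apply: zB; exact: hD.
Qed.

Lemma cutoff_bounded n (psi : 'rV[R]_n * 'rV[R]_n -> R[i]) : cutoff psi ->
  exists2 A, 0 <= A & forall z, `|complex.Re (psi z)| <= A /\ `|complex.Im (psi z)| <= A.
Proof.
move=> hpsi; have [B B0 hB] := cutoff_support hpsi; have [s1 s2 _] := hpsi.
have [/(_ 0%N) [c1 _] /(_ 0%N) [c2 _]] := (s1, s2).
have [A1 A10 h1] := continuous_bounded_ball B c1.
have [A2 A20 h2] := continuous_bounded_ball B c2.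
exists (A1 + A2) => [|z]; first by rewrite addr_ge0 ?ltW.
have [zB|zB] := pselect (`|z| <= B); last by rewrite hB//= normr0 addr_ge0 ?ltW.
by split; [apply: le_trans (h1 z zB) _; rewrite lerDl ltW|apply: le_trans (h2 z zB) _; rewrite lerDr ltW].
Qed.

End cutoff_amplitude.

Section upper_bound.
Variables (R : realType) (n e : nat) (S : mpoly (n.+1 + n.+1) R).
Variables (psi : 'rV[R]_n.+1 * 'rV[R]_n.+1 -> R[i]) (p p' : R).
Hypothesis hS : S \is ishomog1 e.+4 mdeg.
Hypothesis hN : forall z : 'rV[R]_n.+1 * 'rV[R]_n.+1, hessian_norm e.+4 S z = 0 -> z = 0.
Hypothesis hpsi : cutoff psi.
Hypothesis p1 : 1 < p.
Hypothesis pp' : p^-1 + p'^-1 = 1.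
Hypothesis n0 : (0 < n)%N.

Lemma osc_op_upper : exists2 C, 0 < C & forall lam, 1 <= lam ->
  (op_norm p (osc_op S psi lam) <=
    (C * (lam `^ (- (Num.max p p')^-1) + lam `^ (- (n.+1%:R / e.+4%:R))))%:E)%E.
Proof.
have [c c0 hc] := hessian_entry_ge (isT : (2 < e.+4)%N) hS hN.
have [B B0 hB] := cutoff_support hpsi; have [A A0 hA] := cutoff_bounded hpsi.
have [s1 s2 _] := hpsi.
have [A1 A10 am1] := smooth_amplitude B s1; have [A2 A20 am2] := smooth_amplitude B s2.
have [C1 C10 h1] := dyadic_bound hS c0 hc p1 pp' A10 B0 (or_introl n0).
have [C2 C20 h2] := dyadic_bound hS c0 hc p1 pp' A20 B0 (or_introl n0).
exists (64 * (C1 + C2)) => [|lam lam1]; first by rewrite mulr_gt0 ?addr_gt0.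
set L := _ + lam `^ _; have L0 : 0 <= L by rewrite addr_ge0 ?powR_ge0.
rewrite -mulrA; apply: (@op_norm_le_real _ _ S psi lam p A B) => //.
- by rewrite mulr_ge0// ltW// addr_gt0.
- exact: ltW.
- exact: am_meas am1.
- exact: am_meas am2.
move=> s hs; split.
  apply: Lp_bounded_le (h1 lam s _ _ _ lam1 hs am1).
    by rewrite ltW// (lt_trans _ p1).
  by rewrite mulr_ge0 ?(ltW C10)//= ler_wpM2r// lerDl ltW.
apply: Lp_bounded_le (h2 lam s _ _ _ lam1 hs am2).
  by rewrite ltW// (lt_trans _ p1).
by rewrite mulr_ge0 ?(ltW C20)//= ler_wpM2r// lerDr ltW.
Qed.

End upper_bound.

(** * Averages and tensor products of operators *)

Section Rintegral_scale.
Context d (T : measurableType d) (R : realType) (mu : {measure set T -> \bar R}).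

(** The extended integral is then infinite, and the finite part of an infinite
    value is zero. *)
Lemma Rintegral_eq0 (g : T -> R) : measurable_fun setT g ->
  ~ mu.-integrable setT (EFin \o g) -> \int[mu]_x g x = 0.
Proof.
move=> mg hg; rewrite /Rintegral.
have mE : measurable_fun setT (EFin \o g) by exact/measurable_EFinP.
have [hf|] := boolP (\int[mu]_x (g x)%:E \is a fin_num)%E; last first.
  by case: (\int[mu]_x _)%E.
case: hg; apply/integrableP; split => //.
move: hf; rewrite integralE fin_numB => /andP[h1 h2].
rewrite (eq_integral (fun x => ((EFin \o g)^\+ x + (EFin \o g)^\- x)%E)); last first.
  by move=> x _; rewrite -[LHS]/((abse \o (EFin \o g)) x) fune_abse.
rewrite ge0_integralD//; last 2 first.
- exact: measurable_funepos.
- exact: measurable_funeneg.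
by rewrite lte_add_pinfty// ltey_eq ?h1 ?h2.
Qed.

Lemma RintegralZl_measurable (g : T -> R) r : measurable_fun setT g ->
  \int[mu]_x (r * g x) = r * \int[mu]_x g x.
Proof.
move=> mg; have [ig|ig] := pselect (mu.-integrable setT (EFin \o g)).
  exact: RintegralZl.
rewrite (Rintegral_eq0 mg ig) mulr0; have [->|r0] := eqVneq r 0.
  by rewrite /Rintegral integral0_eq// => x _; rewrite mul0r.
apply: Rintegral_eq0; first by apply: measurable_funM => //; exact: measurable_cst.
move=> h; apply: ig.
have := integrableZl measurableT r^-1 h; apply: eq_integrable => // x _ /=.
by rewrite -EFinM mulrA mulVf// mul1r.
Qed.

End Rintegral_scale.

Section average.
Context d1 d2 d3 (T1 : measurableType d1) (T2 : measurableType d2)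
  (T3 : measurableType d3) (R : realType).
Variables (mu : {sigma_finite_measure set T1 -> \bar R})
          (nu : {sigma_finite_measure set T2 -> \bar R})
          (th : {sigma_finite_measure set T3 -> \bar R}).
Variables (X : set T1) (Y : set T2) (D : set T3) (A p a : R) (K : T3 * (T1 * T2) -> R).

(** Minkowski's inequality for operators: Hölder's inequality in t at each point
    x, then the bound of each operator of the family. *)
Lemma Lp_bounded_average :
  1 <= p -> 0 < a -> measurable_fun setT K ->
  measurable X -> (mu X < +oo)%E -> measurable Y -> (nu Y < +oo)%E ->
  measurable D -> (th D < +oo)%E ->
  (forall t x y, `|K (t, (x, y))| <= A * \1_X x * \1_(D `*` Y) (t, y)) ->
  (forall t, Lp_bounded mu nu p (fun z => K (t, z)) a) ->
  Lp_bounded mu nu p (fun z => \int[th]_t K (t, z)) (a * fine (th D)).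
Proof.
move=> p1 a0 mK mX Xoo mY Yoo mD Doo hK ha f mf foo.
have p0 : 0 < p by apply: lt_le_trans p1.
pose c := fine (th D); have c0 : 0 <= c by apply: fine_ge0.
have thD : th D = c%:E by rewrite /c fineK// ge0_fin_numE.
have DYoo : ((th \x nu) (D `*` Y) < +oo)%E.
  by rewrite product_measure1E// lte_mul_pinfty// ge0_fin_numE.
have mDY : measurable (D `*` Y) by exact: measurableX.
pose f' (w : T3 * T2) := \1_D w.1 * f w.2.
have mf' : measurable_fun setT f'.
  apply: measurable_funM; last exact: (measurableT_comp mf measurable_snd).
  exact: (measurableT_comp (measurable_indic mD) measurable_fst).
have f'oo : (Lpp (th \x nu)%E p f' < +oo)%E.
  rewrite /Lpp fubini_tonelli1; last 2 first.
  - exact: measurable_normpow.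
  - by move=> w; rewrite lee_fin powR_ge0.
  rewrite (eq_integral (fun t => (Lpp nu p f * (\1_D t)%:E)%E)); last first.
    move=> t _; rewrite /fubini_F /f' /= indicE; have [_|_] := boolP (t \in D).
      by rewrite mule1; apply: eq_integral => y _; rewrite mul1r.
    by rewrite mule0; apply: integral0_eq => y _; rewrite mul0r normr0 powR0// gt_eqF.
  rewrite ge0_integralZl ?Lpp_ge0//; last by apply/measurable_EFinP; exact: measurable_indic.
  by rewrite integral_indic// setIT lte_mul_pinfty ?Lpp_ge0// ge0_fin_numE// Lpp_ge0.
have tk : tame_on mu (th \x nu)%E X (D `*` Y) A
    (fun z : T1 * (T3 * T2) => K (z.2.1, (z.1, z.2.2))).
  split => //.
    apply: (measurableT_comp mK); apply/measurable_fun_pair; first mproj.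
    by apply/measurable_fun_pair; mproj.
have iK x := tame_integrable x tk p1 mf' f'oo.
pose G (w : T3 * T1) : R := \int[nu]_y (K (w.1, (w.2, y)) * f y).
have mG : measurable_fun setT G.
  apply: (@measurable_Rintegral_section _ _ _ _ _ nu
    (fun z : (T3 * T1) * T2 => K (z.1.1, (z.1.2, z.2)) * f z.2)).
  apply: measurable_funM; last exact: (measurableT_comp mf measurable_snd).
  apply: (measurableT_comp mK); apply/measurable_fun_pair; first mproj.
  by apply/measurable_fun_pair; mproj.
have KD t x y : t \notin D -> K (t, (x, y)) = 0.
  move=> tD; apply/eqP; rewrite -normr_le0; apply: le_trans (hK _ _ _) _.
  by rewrite !indicE in_setX (negbTE tD) mulr0.
have f'E t x y : K (t, (x, y)) * f' (t, y) = K (t, (x, y)) * f y.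
  rewrite /f' indicE /=; have [_|tD] := boolP (t \in D); first by rewrite mul1r.
  by rewrite KD// !mul0r.
have kE x : kop nu (fun z => \int[th]_t K (t, z)) f x = \int[th]_t G (t, x).
  transitivity (\int[(th \x nu)%E]_w (K (w.1, (x, w.2)) * f' w)); last first.
    rewrite Rintegral_fubini1; last exact: iK.
    by apply: eq_Rintegral => t _; apply: eq_Rintegral => y _; rewrite f'E.
  rewrite Rintegral_fubini2; last exact: iK.
  apply: eq_Rintegral => y _; rewrite mulrC -RintegralZl_measurable.
    by apply: eq_Rintegral => t _; rewrite f'E mulrC.
  apply: (measurableT_comp mK); apply/measurable_fun_pair; first mproj.
  by apply/measurable_fun_pair; mproj.
have mGp : measurable_fun setT (fun w => (`|G w| `^ p)%:E) by exact: measurable_normpow.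
have mGs x : measurable_fun setT (fun t => G (t, x)).
  by apply: (measurableT_comp mG); apply/measurable_fun_pair; mproj.
have pt x : ((`|kop nu (fun z => \int[th]_t K (t, z)) f x| `^ p)%:E <=
    (c `^ (p - 1))%:E * \int[th]_t (`|G (t, x)| `^ p)%:E)%E.
  rewrite kE; apply: powR_Rintegral_le => // t tD; rewrite /G /Rintegral integral0_eq//.
  by move=> y _; rewrite KD ?mul0r// notin_setE.
have mGx : measurable_fun setT (fun x => \int[th]_t (`|G (t, x)| `^ p)%:E)%E.
  apply: (measurable_fun_fubini_tonelli_G (fun w : T3 * T1 => (`|G w| `^ p)%:E)) => //.
have mk : measurable_fun setT (kop nu (fun z => \int[th]_t K (t, z)) f).
  rewrite (funext kE); exact: (measurable_Rintegral_section2 th mG).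
apply: (@le_trans _ _ (\int[mu]_x ((c `^ (p - 1))%:E * \int[th]_t (`|G (t, x)| `^ p)%:E))%E).
  apply: ge0_le_integral => //.
  - exact: measurable_normpow.
  - exact: emeasurable_funM.
rewrite ge0_integralZl//; last 2 first.
- by move=> x _; apply: integral_ge0 => t _; rewrite lee_fin powR_ge0.
- by rewrite lee_fin powR_ge0.
rewrite -(fubini_tonelli (fun w : T3 * T1 => (`|G w| `^ p)%:E))//=.
have Gle t : (\int[mu]_x (`|G (t, x)| `^ p)%:E <= ((a `^ p)%:E * Lpp nu p f) * (\1_D t)%:E)%E.
  have [tD|tD] := boolP (t \in D); rewrite indicE ?tD ?(negbTE tD).
    by rewrite mule1; exact: (Lp_bounded_gt0 a0 (ha t) mf).
  rewrite mule0 le_eqVlt; apply/orP; left; apply/eqP; apply: integral0_eq => x _.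
  rewrite /G /Rintegral integral0_eq ?normr0 ?powR0 ?gt_eqF// => y _.
  by rewrite KD// mul0r.
apply: (@le_trans _ _ ((c `^ (p - 1))%:E * \int[th]_t (((a `^ p)%:E * Lpp nu p f) * (\1_D t)%:E))%E).
  rewrite lee_wpmul2l ?lee_fin ?powR_ge0//; apply: ge0_le_integral => //.
  - by move=> t _; apply: integral_ge0 => x _; rewrite lee_fin powR_ge0.
  - by apply: (measurable_fun_fubini_tonelli_F (fun w : T3 * T1 => (`|G w| `^ p)%:E)).
  - by apply: emeasurable_funM => //; apply/measurable_EFinP; exact: measurable_indic.
have aL : (0 <= (a `^ p)%:E * Lpp nu p f)%E by rewrite mule_ge0 ?Lpp_ge0// lee_fin powR_ge0.
rewrite ge0_integralZl//; last by apply/measurable_EFinP; exact: measurable_indic.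
have -> : (\int[th]_x (\1_D x)%:E = c%:E)%E by rewrite integral_indic// setIT.
have e1 : ((c `^ (p - 1))%:E * ((a `^ p)%:E * Lpp nu p f * c%:E) =
    (c `^ (p - 1) * (a `^ p * c))%:E * Lpp nu p f)%E.
  by rewrite [in RHS]EFinM [in RHS]EFinM -[RHS]muleA -[in RHS]muleA; congr (_ * _)%E;
    rewrite -muleA; congr (_ * _)%E; rewrite muleC.
rewrite e1; apply: lee_wpmul2r; first exact: Lpp_ge0.
rewrite lee_fin (powRM _ (ltW a0) c0) mulrCA; apply: ler_wpM2l; first exact: powR_ge0.
have [->|cn] := eqVneq c 0; first by rewrite mulr0 powR0// gt_eqF.
rewrite -[X in _ * X](powRr1 c0) -powRD ?cn ?implybT//.
by rewrite subrK.
Qed.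

End average.

Section tensor.
Context d1 d1' d2 d2' (T1 : measurableType d1) (T1' : measurableType d1')
  (T2 : measurableType d2) (T2' : measurableType d2') (R : realType).
Variables (mu : {sigma_finite_measure set T1 -> \bar R})
          (mu' : {sigma_finite_measure set T1' -> \bar R})
          (nu : {sigma_finite_measure set T2 -> \bar R})
          (nu' : {sigma_finite_measure set T2' -> \bar R}).
Variables (X : set T1) (X' : set T1') (Y : set T2) (Y' : set T2') (A A' p a b : R)
  (k1 : T1 * (T2 * T2') -> R) (k2 : T1' * T2' -> R).

(** One pair of variables at a time: the first pair is integrated out with y'
    fixed, and the second operator is applied to the result. *)
Lemma Lp_bounded_tensor :
  1 <= p -> 0 < a -> 0 < b -> 0 <= A -> 0 <= A' ->
  measurable_fun setT k1 -> measurable_fun setT k2 ->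
  measurable X -> (mu X < +oo)%E -> measurable X' -> (mu' X' < +oo)%E ->
  measurable Y -> (nu Y < +oo)%E -> measurable Y' -> (nu' Y' < +oo)%E ->
  (forall x y y', `|k1 (x, (y, y'))| <= A * \1_X x * \1_(Y `*` Y') (y, y')) ->
  (forall x' y', `|k2 (x', y')| <= A' * \1_X' x') ->
  (forall y', Lp_bounded mu nu p (fun z => k1 (z.1, (z.2, y'))) a) ->
  Lp_bounded mu' nu' p k2 b ->
  Lp_bounded (mu \x mu')%E (nu \x nu')%E p
    (fun z => k1 (z.1.1, z.2) * k2 (z.1.2, z.2.2)) (a * b).
Proof.
move=> p1 a0 b0 A0 A'0 mk1 mk2 mX Xoo mX' X'oo mY Yoo mY' Y'oo h1 h2 ha hb f mf foo.
have p0 : 0 < p by exact: lt_le_trans p1.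
set k := (fun z => _).
have mXX : measurable (X `*` X') by exact: measurableX.
have mYY : measurable (Y `*` Y') by exact: measurableX.
have XXoo : ((mu \x mu') (X `*` X') < +oo)%E.
  by rewrite product_measure1E// lte_mul_pinfty// ge0_fin_numE.
have YYoo : ((nu \x nu') (Y `*` Y') < +oo)%E.
  by rewrite product_measure1E// lte_mul_pinfty// ge0_fin_numE.
have mk : measurable_fun setT k.
  apply: measurable_funM.
    by apply: (measurableT_comp mk1); apply/measurable_fun_pair; mproj.
  by apply: (measurableT_comp mk2); apply/measurable_fun_pair; mproj.
have tk : tame_on (mu \x mu')%E (nu \x nu')%E (X `*` X') (Y `*` Y') (A * A') k.
  split => // -[x x'] [y y']; rewrite /k /= normrM.
  apply: le_trans (ler_pM _ _ (h1 _ _ _) (h2 _ _)) _ => //.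
  rewrite (_ : \1_(X `*` X') (x, x') = \1_X x * \1_X' x'); last first.
    by rewrite !indicE in_setX; case: (x \in X); case: (x' \in X'); rewrite ?mulr1 ?mulr0.
  by rewrite le_eqVlt; apply/orP; left; apply/eqP; ring.
pose G (w : T1 * T2') : R := \int[nu]_y (k1 (w.1, (y, w.2)) * f (y, w.2)).
have mG : measurable_fun setT G.
  apply: (@measurable_Rintegral_section _ _ _ _ _ nu
    (fun z : (T1 * T2') * T2 => k1 (z.1.1, (z.2, z.1.2)) * f (z.2, z.1.2))).
  apply: measurable_funM.
    apply: (measurableT_comp mk1); apply/measurable_fun_pair; first mproj.
    by apply/measurable_fun_pair; mproj.
  by apply: (measurableT_comp mf); apply/measurable_fun_pair; mproj.
have mGs x : measurable_fun setT (fun y' => G (x, y')).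
  by apply: (measurableT_comp mG); apply/measurable_fun_pair; mproj.
have kE x x' : kop (nu \x nu')%E k f (x, x') = kop nu' k2 (fun y' => G (x, y')) x'.
  rewrite /kop Rintegral_fubini2//; last by have := tame_integrable (x, x') tk p1 mf foo.
  apply: eq_Rintegral => y' _; rewrite /G -RintegralZl_measurable.
    by apply: eq_Rintegral => y _; rewrite /k /=; ring.
  apply: measurable_funM.
    apply: (measurableT_comp mk1); apply/measurable_fun_pair; first mproj.
    by apply/measurable_fun_pair; mproj.
  by apply: (measurableT_comp mf); apply/measurable_fun_pair; mproj.
have mK : measurable_fun setT (kop (nu \x nu')%E k f).
  rewrite (_ : kop _ k f = (fun w : T1 * T1' => \int[nu']_y' (k2 (w.2, y') * G (w.1, y')))).
    apply: (measurable_Rintegral_section nu' (F := fun z : (T1 * T1') * T2' =>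
      k2 (z.1.2, z.2) * G (z.1.1, z.2))).
    apply: measurable_funM.
      by apply: (measurableT_comp mk2); apply/measurable_fun_pair; mproj.
    by apply: (measurableT_comp mG); apply/measurable_fun_pair; mproj.
  by apply/funext => -[x x']; rewrite kE.
have mGp : measurable_fun setT (fun w => (`|G w| `^ p)%:E) by exact: measurable_normpow.
rewrite {1}/Lpp fubini_tonelli1; last 2 first.
- exact: measurable_normpow.
- by move=> w; rewrite lee_fin powR_ge0.
have mGx : measurable_fun setT (fun x => \int[nu']_y' (`|G (x, y')| `^ p)%:E)%E.
  by apply: (measurable_fun_fubini_tonelli_F (fun w : T1 * T2' => (`|G w| `^ p)%:E)).
apply: (@le_trans _ _ (\int[mu]_x ((b `^ p)%:E * \int[nu']_y' (`|G (x, y')| `^ p)%:E))%E).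
  apply: ge0_le_integral => //.
  - by move=> x _; apply: integral_ge0 => x' _; rewrite lee_fin powR_ge0.
  - apply: (measurable_fun_fubini_tonelli_F (fun w => (`|kop (nu \x nu')%E k f w| `^ p)%:E)) => //.
    exact: measurable_normpow.
  - exact: emeasurable_funM.
  move=> x _; rewrite /fubini_F; under eq_integral do rewrite kE.
  exact: (Lp_bounded_gt0 b0 hb (mGs x)).
rewrite ge0_integralZl//; last 2 first.
- by move=> x _; apply: integral_ge0 => t _; rewrite lee_fin powR_ge0.
- by rewrite lee_fin powR_ge0.
rewrite (fubini_tonelli (fun w : T1 * T2' => (`|G w| `^ p)%:E))//=.
rewrite mulrC (powRM _ (ltW b0) (ltW a0)) EFinM -muleA lee_wpmul2l ?lee_fin ?powR_ge0//.
have Gle y' : (\int[mu]_x (`|G (x, y')| `^ p)%:E <= (a `^ p)%:E * \int[nu]_y (`|f (y, y')| `^ p)%:E)%E.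
  have mfy : measurable_fun setT (fun y => f (y, y')) by exact: (measurableT_comp mf (measurable_pair2 y')).
  exact: (Lp_bounded_gt0 a0 (ha y') mfy).
have mf2 : measurable_fun setT (fun y' => \int[nu]_y (`|f (y, y')| `^ p)%:E)%E.
  apply: (measurable_fun_fubini_tonelli_G (fun z => (`|f z| `^ p)%:E)).
    exact: measurable_normpow.
  by move=> w; rewrite lee_fin powR_ge0.
have mG2 : measurable_fun setT (fun y' => \int[mu]_x (`|G (x, y')| `^ p)%:E)%E.
  by apply: (measurable_fun_fubini_tonelli_G (fun w : T1 * T2' => (`|G w| `^ p)%:E)).
rewrite /Lpp fubini_tonelli2; last 2 first.
- exact: measurable_normpow.
- by move=> w; rewrite lee_fin powR_ge0.
rewrite -ge0_integralZl//; last 2 first.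
- by move=> y' _; apply: integral_ge0 => y _; rewrite lee_fin powR_ge0.
- by rewrite lee_fin powR_ge0.
apply: ge0_le_integral; first exact: measurableT.
- by move=> y' _; apply: integral_ge0 => x _; rewrite lee_fin powR_ge0.
- exact: mG2.
- exact: (emeasurable_funM (measurable_cst _) mf2).
by move=> y' _; exact: Gle.
Qed.

End tensor.

(** * A phase whose Hessian norm is a norm *)

Section homogeneous_norm.
Variable R : realType.

Lemma sqr_convex (t a b : R) : 0 <= t <= 1 ->
  (t * a + (1 - t) * b) ^+ 2 <= t * a ^+ 2 + (1 - t) * b ^+ 2.
Proof.
move=> /andP[t0 t1]; rewrite -subr_ge0.
have -> : t * a ^+ 2 + (1 - t) * b ^+ 2 - (t * a + (1 - t) * b) ^+ 2 =
  t * (1 - t) * (a - b) ^+ 2 by ring.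
by rewrite mulr_ge0 ?sqr_ge0// mulr_ge0// subr_ge0.
Qed.

Lemma sqr_convex_le (t a b c : R) : 0 <= t <= 1 -> 0 <= c -> c <= t * a + (1 - t) * b ->
  c ^+ 2 <= t * a ^+ 2 + (1 - t) * b ^+ 2.
Proof.
move=> t01 c0 h; apply: le_trans (sqr_convex _ _ t01).
by rewrite lerXn2r ?nnegrE// (le_trans c0).
Qed.

Lemma quartic_convex (t a b : R) : 0 <= t <= 1 ->
  (t * a + (1 - t) * b) ^+ 4 <= t * a ^+ 4 + (1 - t) * b ^+ 4.
Proof.
move=> t01; rewrite (exprM _ 2 2) (exprM a 2 2) (exprM b 2 2).
by apply: sqr_convex_le => //; [exact: sqr_ge0|exact: sqr_convex].
Qed.

(** The triangle inequality follows by normalising the two vectors: their convex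
    combinations stay in the unit ball, which is a sublevel set of the convex
    function P. *)
Lemma is_norm_powR (V : lmodType R) (P : V -> R) k : (0 < k)%N ->
  (forall v, 0 <= P v) -> (forall v, P v = 0 -> v = 0) ->
  (forall a v, P (a *: v) = `|a| ^+ k * P v) ->
  (forall t v w, 0 <= t <= 1 -> P (t *: v + (1 - t) *: w) <= t * P v + (1 - t) * P w) ->
  is_norm (fun v => P v `^ k%:R^-1).
Proof.
move=> k0 P0 Pz Ph Pc; pose N v := P v `^ k%:R^-1.
have kn : k%:R != 0 :> R by rewrite pnatr_eq0 -lt0n.
have Nz v : N v = 0 -> v = 0 by move/eqP; rewrite powR_eq0 => /andP[/eqP/Pz].
have Nh a v : N (a *: v) = `|a| * N v.
  by rewrite /N Ph powRM ?exprn_ge0// -powR_mulrn// -powRrM mulfV// powRr1.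
have N0 v : 0 <= N v by exact: powR_ge0.
split=> // v w; rewrite -/(N v) -/(N w) -/(N (v + w)).
have [/Nz ->|v0] := eqVneq (N v) 0; first by rewrite add0r lerDr.
have [/Nz ->|w0] := eqVneq (N w) 0; first by rewrite addr0 lerDl.
have Nv : 0 < N v by rewrite lt_def v0 N0.
have Nw : 0 < N w by rewrite lt_def w0 N0.
have one u : 0 < N u -> P ((N u)^-1 *: u) = 1.
  move=> u0; have h : N ((N u)^-1 *: u) = 1 by rewrite Nh ger0_norm ?invr_ge0// mulVf// gt_eqF.
  have -> : P ((N u)^-1 *: u) = N ((N u)^-1 *: u) `^ k%:R by rewrite /N -powRrM mulVf// powRr1.
  by rewrite h powR1.
set s := N v + N w; have s0 : 0 < s by exact: addr_gt0.
have t01 : 0 <= N v / s <= 1.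
  by rewrite divr_ge0 ?(ltW s0)//= ler_pdivrMr// mul1r lerDl ltW.
have E : v + w = s *: ((N v / s) *: ((N v)^-1 *: v) + (1 - N v / s) *: ((N w)^-1 *: w)).
  have -> : 1 - N v / s = N w / s by rewrite -[1](divff (lt0r_neq0 s0)) -mulrBl /s addrAC subrr add0r.
  rewrite scalerDr !scalerA; congr (_ + _); rewrite -[LHS]scale1r; congr (_ *: _);
    by field; rewrite !gt_eqF.
rewrite E Nh gtr0_norm// -[leRHS]mulr1; apply: ler_wpM2l; first exact: ltW.
apply: (@le_trans _ _ (1 `^ k%:R^-1)); last by rewrite powR1.
apply: ge0_ler_powR; rewrite ?nnegrE ?invr_ge0//.
by apply: le_trans (Pc _ _ _ t01) _; rewrite !one// !mulr1 addrC subrK.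
Qed.

End homogeneous_norm.

Section quintic.
Variables (R : realType) (n : nat).
Local Notation X i := (mpolyX R (mnm1 (lshift n i))).
Local Notation Y i := (mpolyX R (mnm1 (rshift n i))).

(** In each pair of variables the mixed derivative is 5 (x^4 + y^4), which
    vanishes at the origin only; the mixed Hessian is diagonal, and the square
    of its norm is a convex function. *)
Definition quintic : mpoly (n + n) R := \sum_(i < n) (X i ^+ 5 * Y i + X i * Y i ^+ 5).

Let phase_eval0 z : phase_eval (0 : mpoly (n + n) R) z = 0. Proof. exact: meval0. Qed.
Let phase_eval1 z : phase_eval (1 : mpoly (n + n) R) z = 1. Proof. exact: meval1. Qed.

Lemma phase_eval_quintic z : phase_eval quintic z =
  \sum_(i < n) (z.1 ord0 i ^+ 5 * z.2 ord0 i + z.1 ord0 i * z.2 ord0 i ^+ 5).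
Proof.
rewrite /quintic (big_morph (fun Q => phase_eval Q z) (phase_evalD z) (phase_eval0 z)).
apply: eq_bigr => i _.
by rewrite phase_evalD !phase_evalM !phase_eval_lshift !phase_eval_rshift; ring.
Qed.

Lemma mderiv_coord (l : 'I_(n + n)) : mderiv l (mpolyX R (mnm1 l)) = 1.
Proof.
rewrite mderivX mnm1E eqxx mulr1n scale1r (_ : mnm_sub _ _ = mnm0) ?mpolyX0//.
by apply/mnmP => j; rewrite mnmBE mnm0E subnn.
Qed.

Lemma mderiv_coord0 (k l : 'I_(n + n)) : k != l -> mderiv l (mpolyX R (mnm1 k)) = 0.
Proof. by move=> kl; rewrite mderivX mnm1E (negbTE kl) mulr0n scale0r. Qed.

Lemma phase_eval_mderiv_quintic z i j :
  phase_eval (mderiv (lshift n i) (mderiv (rshift n j) quintic)) z =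
  (i == j)%:R * (5 * (z.1 ord0 j ^+ 4 + z.2 ord0 j ^+ 4)).
Proof.
have dX k : mderiv (rshift n j) (X k) = 0 by apply: mderiv_coord0; rewrite eq_lrshift.
pose M := X j * Y j ^+ 4.
have -> : mderiv (rshift n j) quintic = X j ^+ 5 + (M + M + M + M + M).
  rewrite /quintic (big_morph _ (mderivD (rshift n j)) (mderiv0 _ (rshift n j))).
  rewrite (bigD1 j)//= big1 => [|k kj].
    by rewrite addr0 mderivD !mderivM !dX !mderiv_coord /M; ring.
  have dY : mderiv (rshift n j) (Y k) = 0.
    by apply: mderiv_coord0; rewrite (inj_eq (@rshift_inj _ _)).
  by rewrite mderivD !mderivM !dX !dY; ring.
have dX1 : phase_eval (mderiv (lshift n i) (X j)) z = (i == j)%:R.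
  have [->|ij] := eqVneq i j; first by rewrite mderiv_coord phase_eval1.
  by rewrite mderiv_coord0 ?phase_eval0// (inj_eq (@lshift_inj _ _)) eq_sym.
have dY : mderiv (lshift n i) (Y j) = 0 by rewrite mderiv_coord0// eq_rlshift.
have dM : mderiv (lshift n i) M = mderiv (lshift n i) (X j) * Y j ^+ 4.
  have dY4 : mderiv (lshift n i) (Y j ^+ 4) = 0 by rewrite !mderivM !dY; ring.
  by rewrite /M (mderivM _ (X j)) dY4 mulr0 addr0.
pose Z := mderiv (lshift n i) (X j) * X j ^+ 4.
have d5 : mderiv (lshift n i) (X j ^+ 5) = Z + Z + Z + Z + Z by rewrite !mderivM /Z; ring.
rewrite !mderivD dM d5 !phase_evalD.
rewrite /Z !phase_evalM dX1 !phase_eval_lshift !phase_eval_rshift; ring.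
Qed.

Lemma quintic_mixed : mixed_homog 6 quintic.
Proof.
have key (m m' : multinom (n + n)) k : m k = 0%N -> m' k != 0%N -> (m' == m)%:R = 0 :> R.
  by move=> h1; case: (eqVneq m' m) => [->|//]; rewrite h1.
split.
- apply: rpred_sum => i _; rewrite !mpolyXn -!mpolyXD.
  by apply: rpredD; rewrite dhomogX /= mdegD mdegMn !mdeg1.
- move=> m hm; rewrite /quintic raddf_sum big1//= => i _.
  rewrite !mpolyXn -!mpolyXD mcoeffD !mcoeffX.
  rewrite (key _ _ _ (hm i)) ?(key _ _ _ (hm i)) ?addr0//;
    by rewrite mnmDE mulmnE !mnm1E eqxx addn_eq0 negb_and /= ?orbT.
- move=> m hm; rewrite /quintic raddf_sum big1//= => i _.
  rewrite !mpolyXn -!mpolyXD mcoeffD !mcoeffX.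
  rewrite (key _ _ _ (hm i)) ?(key _ _ _ (hm i)) ?addr0//;
    by rewrite mnmDE mulmnE !mnm1E eqxx addn_eq0 negb_and /= ?orbT.
Qed.

Lemma hessian_norm_quintic z : hessian_norm 6 quintic z =
  (25 * \sum_(j < n) (z.1 ord0 j ^+ 4 + z.2 ord0 j ^+ 4) ^+ 2) `^ 8%:R^-1.
Proof.
rewrite /hessian_norm /HS_norm -powR12_sqrt; last first.
  by apply: sumr_ge0 => i _; apply: sumr_ge0 => j _; exact: sqr_ge0.
rewrite -powRrM; congr (_ `^ _); last by rewrite -invfM; congr (_^-1); lra.
rewrite mulr_sumr; apply: eq_bigr => i _; rewrite (bigD1 i)//= big1 => [|j ji].
  by rewrite addr0 mxE phase_eval_mderiv_quintic eqxx mul1r real_normK ?num_real//; ring.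
by rewrite mxE phase_eval_mderiv_quintic eq_sym (negbTE ji) mul0r normr0 expr0n.
Qed.

Lemma quintic_norm : is_norm (hessian_norm 6 quintic).
Proof.
rewrite (_ : hessian_norm 6 quintic = fun z =>
  (25 * \sum_(j < n) (z.1 ord0 j ^+ 4 + z.2 ord0 j ^+ 4) ^+ 2) `^ 8%:R^-1); last first.
  by apply/funext => z; exact: hessian_norm_quintic.
have e4 (x : R) : 0 <= x ^+ 4 by rewrite (exprM x 2 2) sqr_ge0.
apply: (@is_norm_powR R _ (fun z : 'rV[R]_n * 'rV[R]_n =>
  25 * \sum_(j < n) (z.1 ord0 j ^+ 4 + z.2 ord0 j ^+ 4) ^+ 2)) => //.
- by move=> z; rewrite mulr_ge0// sumr_ge0// => i _; exact: sqr_ge0.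
- move=> [x y] /eqP; rewrite mulf_eq0 pnatr_eq0 /= => /eqP h.
  have h0 j : x ord0 j = 0 /\ y ord0 j = 0.
    have /eqP : (x ord0 j ^+ 4 + y ord0 j ^+ 4) ^+ 2 = 0.
      by apply: (psumr_eq0P _ h) => // i _; exact: sqr_ge0.
    by rewrite expf_eq0 /= paddr_eq0// !expf_eq0 /= => /andP[/eqP -> /eqP ->].
  by congr pair; apply/matrixP => i j; rewrite ord1 mxE; have [] := h0 j.
- move=> a z; rewrite [RHS]mulrCA; congr (_ * _); rewrite mulr_sumr; apply: eq_bigr => i _ /=.
  by rewrite !mxE (exprM `|a| 2 4) real_normK ?num_real//; ring.
- move=> t z w t01.
  have -> (a b : R) : t * (25 * a) + (1 - t) * (25 * b) = 25 * (t * a + (1 - t) * b) by ring.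
  apply: ler_wpM2l => //; rewrite !mulr_sumr -big_split /=; apply: ler_sum => i _.
  rewrite !mxE; apply: sqr_convex_le => //; first by rewrite addr_ge0.
  apply: le_trans (lerD (quartic_convex _ _ t01) (quartic_convex _ _ t01)) _.
  by rewrite le_eqVlt; apply/orP; left; apply/eqP; ring.
Qed.

End quintic.

(** * The separable phase below the critical exponents *)

Section sum_of_operators.
Context d1 d2 (T1 : measurableType d1) (T2 : measurableType d2) (R : realType).
Variables (mu : {measure set T1 -> \bar R}) (nu : {sigma_finite_measure set T2 -> \bar R}).

Lemma Lp_bounded_addZ (X : set T1) (Y : set T2) (A p b c : R) (k k1 k2 : T1 * T2 -> R) :
  1 <= p -> 0 <= b -> `|c| <= 1 -> measurable_fun setT k ->
  tame_on mu nu X Y A k1 -> tame_on mu nu X Y A k2 ->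
  (forall z, k z = k1 z + c * k2 z) ->
  Lp_bounded mu nu p k1 b -> Lp_bounded mu nu p k2 b -> Lp_bounded mu nu p k (4 * b).
Proof.
move=> p1 b0 c1 mk t1 t2 kE h1 h2 f mf foo.
have p0 : 0 < p by exact: lt_le_trans p1.
have [mk1 _ _ _] := t1; have [mk2 _ _ _] := t2.
pose l := fine (Lpp nu p f); have lE : Lpp nu p f = l%:E by rewrite fineK// ge0_fin_numE// Lpp_ge0.
have l0 : 0 <= l by rewrite -lee_fin -lE Lpp_ge0.
pose g (i : bool) x := if i then kop nu k1 f x else kop nu k2 f x.
have E (a : R) : 0 <= a -> ((a `^ p)%:E * Lpp nu p f = ((a * l `^ p^-1) `^ p)%:E)%E.
  by move=> a0; rewrite lE -EFinM (powRM _ a0 (powR_ge0 _ _)) -(powRrM l) mulVf ?gt_eqF// powRr1.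
have := @Lpp_sum_le R _ T1 mu bool (kop nu k f) g p (b * l `^ p^-1) p1.
rewrite card_bool (E _ (mulr_ge0 (ler0n _ 4) b0)) (_ : 2%:R ^+ 2 * (b * _) = 4 * b * l `^ p^-1); last by ring.
apply.
- by rewrite mulr_ge0// powR_ge0.
- exact: measurable_kop.
- by case; exact: measurable_kop.
- move=> x; rewrite big_bool /=.
  have i1 := tame_integrable x t1 p1 mf foo; have i2 := tame_integrable x t2 p1 mf foo.
  have -> : kop nu k f x = kop nu k1 f x + c * kop nu k2 f x.
    have zl : \int[nu]_y (c * (k2 (x, y) * f y)) = c * \int[nu]_y (k2 (x, y) * f y).
      exact: RintegralZl.
    rewrite /kop -zl -RintegralD//; last exact: (integrableZl _ c i2).
    by apply: eq_Rintegral => y _; rewrite kE; ring.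
  by rewrite (le_trans (ler_normD _ _))// lerD2l normrM ler_piMl.
- by case; rewrite -(E _ b0); [exact: h1|exact: h2].
Qed.

End sum_of_operators.

Section product_measure.
Context d1 d2 (T1 : measurableType d1) (T2 : measurableType d2) (R : realType).
Variables (m1 : {sigma_finite_measure set T1 -> \bar R})
          (m2 : {sigma_finite_measure set T2 -> \bar R}).

(** The product measure under a name of its own, on which its sigma-finiteness
    can be registered. *)
Definition prod_measure : set (T1 * T2) -> \bar R := (m1 \x m2)%E.

HB.instance Definition _ := Measure.copy prod_measure (m1 \x m2)%E.

Let prod_measure_sigma_finite : sigma_finite setT prod_measure.
Proof.
have /sigma_finiteP[F [TF ndF Foo]] := sigma_finiteT m1.
have /sigma_finiteP[G [TG ndG Goo]] := sigma_finiteT m2.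
exists (fun n => F n `*` G n); last first.
  move=> k; have [mF fF] := Foo k; have [mG fG] := Goo k.
  split; first exact: measurableX.
  by rewrite /prod_measure product_measure1E// lte_mul_pinfty// ge0_fin_numE.
apply/esym/seteqP; split => // -[x y] _.
have [i _ Fx] : (\bigcup_i F i) x by rewrite -TF.
have [j _ Gy] : (\bigcup_i G i) y by rewrite -TG.
exists (maxn i j) => //; split.
  by move: x Fx; exact/subsetPset/ndF/leq_maxl.
by move: y Gy; exact/subsetPset/ndG/leq_maxr.
Qed.

HB.instance Definition _ := Measure_isSigmaFinite.Build _ _ _ prod_measure
  prod_measure_sigma_finite.

End product_measure.

Section separable_phase.
Variables (R : realType) (p p' B : R).
Hypothesis p1 : 1 < p.
Hypothesis pp' : p^-1 + p'^-1 = 1.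
Hypothesis pmax : Num.max p p' < 6%:R.
Hypothesis B1 : 1 <= B.
Local Notation leb := (@lebesgue_measure R).
Local Notation q x y := (x ^+ 5 * y + x * y ^+ 5).
Local Notation row t := (const_mx t : 'rV[R]_1).
Local Notation trig s := (s = @cos R \/ s = @sin R).
Local Notation snd_ax := (lift ord0 ord0 : 'I_2).

Let B0 : 0 < B. Proof. by apply: lt_le_trans B1. Qed.
Let p0 : 0 <= p. Proof. by rewrite ltW// (lt_trans _ p1). Qed.

(** The estimate in one pair of variables: for q < 6 the bound lam^(-1/6) of the
    innermost cells dominates lam^(-1/q). *)
Let quintic_bound1 A : 0 < A -> exists2 C, 0 < C & forall lam s a a1 a2, 1 <= lam -> trig s ->
  @amplitude R 0 B A a a1 a2 ->
  Lp_bounded (@lebn R 1) (@lebn R 1) p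
    (fun z => \1_(box 0 B) z.1 * (s (lam * q (z.1 ord0 ord0) (z.2 ord0 ord0)) * a z) * \1_(box 0 B) z.2)
    (C * lam `^ (- 6%:R^-1)).
Proof.
move=> A0; have [hS _ _] := quintic_mixed R 1; have [_ hN _ _] := quintic_norm R 1.
have [c c0 hc] := hessian_entry_ge (isT : (2 < 6)%N) hS hN.
have q0 : 0 < Num.max p p' by rewrite lt_max (lt_trans _ p1).
have hq : 1%:R < 6%:R / Num.max p p' by rewrite ltr_pdivlMr// mul1r.
have [C C0 hC] := @dyadic_bound R 0 2 (quintic R 1) c hS c0 hc p p' A B p1 pp' A0 B0 (or_intror hq).
exists (2 * C) => [|lam s a a1 a2 lam1 hs am]; first by rewrite mulr_gt0.
rewrite (_ : (fun z => _) = (fun z => \1_(box 0 B) z.1 * (s (lam * phase_eval (quintic R 1) z) * a z) *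
   \1_(box 0 B) z.2)); last by apply/funext => z; rewrite phase_eval_quintic big_ord1.
apply: Lp_bounded_le (hC lam s a a1 a2 lam1 hs am) => //.
rewrite mulr_ge0 ?addr_ge0 ?powR_ge0 ?(ltW C0)//= [2 * C]mulrC -mulrA ler_wpM2l ?(ltW C0)//.
rewrite div1r (_ : 2 * lam `^ (- 6%:R^-1) = lam `^ (- 6%:R^-1) + lam `^ (- 6%:R^-1)); last by ring.
by rewrite lerD2r ler_powR// lerN2 lef_pV2 ?posrE// ltW.
Qed.

Let unit_amplitude : @amplitude R 0 B 1 (fun=> 1) (fun _ _ => 0) (fun _ _ => 0).
Proof.
split => //; try by (move=> *; rewrite ?normr0 ?normr1).
- by move=> i x Y t; exact: is_derive1_cst.
- by move=> i x Y t; exact: is_derive1_cst.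
- by move=> i x Y t; exact: cvg_cst.
Qed.

Let trig_le1 s x : trig s -> `|s x| <= 1.
Proof. by case=> ->; rewrite ler_norml ?cos_geN1 ?cos_le1 ?sin_geN1 ?sin_le1. Qed.

Let measurable_trig s : trig s -> measurable_fun setT s.
Proof.
by case=> ->; [exact: (continuous_measurable_fun (@continuous_cos R))|
  exact: (continuous_measurable_fun (@continuous_sin R))].
Qed.

Let measurable_q d (T : measurableType d) lam s (g h : T -> R) : trig s ->
  measurable_fun setT g -> measurable_fun setT h ->
  measurable_fun setT (fun z => s (lam * q (g z) (h z))).
Proof.
move=> hs mg mh; apply: (measurableT_comp (measurable_trig hs)).
apply: measurable_funM; first exact: measurable_cst.
by apply: measurable_funD; apply: measurable_funM => //; exact: measurable_funX.
Qed.

Let mem_itv (i : interval R) x : (x \in [set` i]) = (x \in i).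
Proof. by apply/idP/idP; rewrite inE. Qed.

Let row_box t : \1_(box 0 B) (row t) = \1_`[- B, B] t :> R.
Proof.
rewrite !indicE mem_itv; congr ((_ : bool)%:R); apply/idP/idP => [/set_mem /(_ ord0)|].
  by rewrite !mxE !add0r in_itv.
by rewrite in_itv => h; apply/mem_set => i; rewrite !mxE !add0r.
Qed.

Let ins_box0 t (x : 'rV[R]_1) :
  \1_(box 0 B) (ins ord0 (t, x)) = \1_`[- B, B] t * \1_(box 0 B) x :> R.
Proof.
rewrite !indicE mem_itv -natrM mulnb; congr ((_ : bool)%:R); apply/idP/idP => [/set_mem h|].
  apply/andP; split; first by have := h ord0; rewrite ins_at !mxE !add0r in_itv.
  by apply/mem_set => i; have := h (lift ord0 i); rewrite ins_lift !mxE.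
move=> /andP[h1 /set_mem h2]; apply/mem_set => j; have [i ->|->] := unliftP ord0 j.
  by have := h2 i; rewrite ins_lift !mxE.
by move: h1; rewrite in_itv ins_at !mxE !add0r.
Qed.

Let ins_norm n t (x : 'rV[R]_n) r : 0 <= r -> `|t| <= r -> `|x| <= r -> `|ins ord0 (t, x)| <= r.
Proof.
move=> r0 tr xr; apply: rV_norm_le => // j; have [i ->|->] := unliftP ord0 j.
  by rewrite ins_lift (le_trans (rV_coord_le _ _)).
by rewrite ins_at.
Qed.

Let ins_row x1 t : ins ord0 (x1, row t) = ins snd_ax (t, ins ord0 (x1, 0 : 'rV[R]_0)).
Proof.
rewrite ins_swap; congr (ins _ (_, _)).
by apply/matrixP => i j; rewrite !ord1 mxE ins_at.
Qed.

Variable f : 'rV[R]_2 * 'rV[R]_2 -> R.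
Hypothesis sf : smooth f.
Hypothesis fB : forall z, ~ `|z| <= B -> f z = 0.

Let w := 'D_(axis_l R snd_ax) f.

Let sw : smooth w.
Proof. by move=> k; have [_ /(_ (axis_l R snd_ax)) []] := sf k.+1. Qed.

Let is_derive_line (g : 'rV[R]_2 * 'rV[R]_2 -> R) x1 Y t : smooth g ->
  is_derive1 (fun t => g (ins ord0 (x1, row t), Y)) t
    ('D_(axis_l R snd_ax) g (ins ord0 (x1, row t), Y)).
Proof.
move=> sg; have [A _ am] := smooth_amplitude B sg.
rewrite ins_row; under eq_fun do rewrite ins_row.
exact: (am_d am snd_ax (ins ord0 (x1, 0)) Y t).
Qed.

Variable A : R.
Hypothesis A0 : 0 < A.
Hypothesis am : amplitude B A w (fun i => 'D_(axis_l R i) w) (fun i => 'D_(axis_l R i) ('D_(axis_l R i) w)).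

Let norm3 (Z : 'rV[R]_1 * 'rV[R]_1) (t : R) (y : 'rV[R]_1) : `|Z| <= 3 * B -> `|t| <= 3 * B -> `|y| <= 3 * B ->
  `|((ins ord0 (Z.1 ord0 ord0, row t), ins ord0 (Z.2 ord0 ord0, y)) : 'rV[R]_2 * 'rV[R]_2)| <= 3 * B.
Proof.
move=> ZB tB yB; have B3 : 0 <= 3 * B by rewrite mulr_ge0// ltW.
have [n1 n2] := pair_norm_ge Z.
apply: pair_norm_le => /=; apply: ins_norm => //; rewrite ?(le_trans (rV_coord_le _ _))//.
- exact: le_trans ZB.
- by apply: rV_norm_le => // i; rewrite mxE.
- exact: le_trans ZB.
Qed.

Let slice_amplitude t (y : 'rV[R]_1) : `|t| <= 3 * B -> `|y| <= 3 * B ->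
  let sl (g : 'rV[R]_2 * 'rV[R]_2 -> R) (Z : 'rV[R]_1 * 'rV[R]_1) :=
    g (ins ord0 (Z.1 ord0 ord0, row t), ins ord0 (Z.2 ord0 ord0, y)) in
  @amplitude R 0 B A (sl w) (fun=> sl ('D_(axis_l R ord0) w))
    (fun=> sl ('D_(axis_l R ord0) ('D_(axis_l R ord0) w))).
Proof.
move=> tB yB sl; split.
- apply: (measurableT_comp (am_meas am)); apply/measurable_fun_pair;
    apply: (measurableT_comp (measurable_ins ord0)); apply/measurable_fun_pair;
    try exact: measurable_cst.
  + exact: (measurableT_comp (measurable_rV_coord ord0) measurable_fst).
  + exact: (measurableT_comp (measurable_rV_coord ord0) measurable_snd).
- move=> i x Y u; rewrite (ord1 i) /sl /= ins_at; under eq_fun do rewrite ins_at.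
  exact: (am_d am ord0 (row t) (ins ord0 (Y ord0 ord0, y)) u).
- move=> i x Y u; rewrite (ord1 i) /sl /= ins_at; under eq_fun do rewrite ins_at.
  exact: (am_d1 am ord0 (row t) (ins ord0 (Y ord0 ord0, y)) u).
- move=> i x Y; rewrite (ord1 i) /sl /=.
  rewrite (_ : (fun u => _) = (fun u => 'D_(axis_l R ord0) ('D_(axis_l R ord0) w)
    (ins ord0 (u, row t), ins ord0 (Y ord0 ord0, y)))); last by apply/funext => u; rewrite ins_at.
  exact: (@am_c2 _ _ _ _ _ _ _ am ord0 (row t) (ins ord0 (Y ord0 ord0, y))).
- by move=> Z ZB; apply: (am_b am); exact: norm3.
- by move=> i Z ZB; apply: (am_b1 am); exact: norm3.
- by move=> i Z ZB; apply: (am_b2 am); exact: norm3.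
Qed.

Let L := B + 1.
Let D : set R := `[- L, L]%classic.
Let J : set R := `[- B, B]%classic.
Let Q : set 'rV[R]_1 := box 0 B.

(** The amplitude f is the integral over t <= x_2 of its derivative w at x_2 =
    t. For fixed t the kernel is the product of k1, in the first pair of
    variables with y_2 as a side value, and of k2 in the second pair, where the
    condition t <= x_2 is a restriction of the output. *)
Let k1 lam (s : R -> R) (u : R * (R * (R * 'rV[R]_1))) : R :=
  \1_D u.1 * (\1_J u.2.1 * (s (lam * q u.2.1 u.2.2.1) *
    w (ins ord0 (u.2.1, row u.1), ins ord0 u.2.2)) * \1_J u.2.2.1) * \1_Q u.2.2.2.

Let k2 lam (s : R -> R) (u : R * ('rV[R]_1 * 'rV[R]_1)) : R :=
  \1_(`[0, +oo[%classic : set R) (u.2.1 ord0 ord0 - u.1) *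
  (\1_Q u.2.1 * (s (lam * q (u.2.1 ord0 ord0) (u.2.2 ord0 ord0)) * 1) * \1_Q u.2.2).

Let K lam s1 s2 (v : R * ((R * 'rV[R]_1) * (R * 'rV[R]_1))) : R :=
  k1 lam s1 (v.1, (v.2.1.1, v.2.2)) * k2 lam s2 (v.1, (v.2.1.2, v.2.2.2)).

Let F lam (s1 s2 : R -> R) (Z : 'rV[R]_2 * 'rV[R]_2) : R :=
  \1_(box 0 B) Z.1 * (s1 (lam * q (Z.1 ord0 ord0) (Z.2 ord0 ord0)) *
    s2 (lam * q (Z.1 ord0 snd_ax) (Z.2 ord0 snd_ax)) * f Z) * \1_(box 0 B) Z.2.

Let mD : measurable D. Proof. exact: measurable_itv. Qed.
Let mJ : measurable J. Proof. exact: measurable_itv. Qed.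
Let mQ : measurable Q. Proof. exact: measurable_box. Qed.

Let mrow d (T : measurableType d) (g : T -> R) : measurable_fun setT g ->
  measurable_fun setT (fun z => row (g z)).
Proof. by move=> mg; apply: measurable_rVP => i; under eq_fun do rewrite mxE. Qed.

Let measurable_k1 lam s : trig s -> measurable_fun setT (k1 lam s).
Proof.
move=> hs; apply: measurable_funM; [apply: measurable_funM; [|apply: measurable_funM; [apply: measurable_funM; [|apply: measurable_funM]|]]|].
- by apply: (measurableT_comp (measurable_indic mD)); mproj.
- by apply: (measurableT_comp (measurable_indic mJ)); mproj.
- apply: measurable_q => //; first by mproj.
  exact: (measurableT_comp measurable_fst (measurableT_comp measurable_snd measurable_snd)).
- apply: (measurableT_comp (am_meas am)); apply/measurable_fun_pair;
    apply: (measurableT_comp (measurable_ins ord0)); last by mproj.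
  by apply/measurable_fun_pair; [mproj|apply: mrow; mproj].
- apply: (measurableT_comp (measurable_indic mJ)).
  exact: (measurableT_comp measurable_fst (measurableT_comp measurable_snd measurable_snd)).
- apply: (measurableT_comp (measurable_indic mQ)).
  exact: (measurableT_comp measurable_snd (measurableT_comp measurable_snd measurable_snd)).
Qed.

Let measurable_k2 lam s : trig s -> measurable_fun setT (k2 lam s).
Proof.
move=> hs; have c1 : measurable_fun setT (fun u : R * ('rV[R]_1 * 'rV[R]_1) => u.2.1 ord0 ord0).
  by apply: (measurableT_comp (measurable_rV_coord ord0)); mproj.
have c2 : measurable_fun setT (fun u : R * ('rV[R]_1 * 'rV[R]_1) => u.2.2 ord0 ord0).
  by apply: (measurableT_comp (measurable_rV_coord ord0)); mproj.
apply: measurable_funM;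
  [|apply: measurable_funM; [apply: measurable_funM; [|apply: measurable_funM]|]].
- apply: (measurableT_comp (measurable_indic (measurable_itv _))).
  by apply: measurable_funB => //; mproj.
- by apply: (measurableT_comp (measurable_indic mQ)); mproj.
- exact: measurable_q.
- exact: measurable_cst.
- by apply: (measurableT_comp (measurable_indic mQ)); mproj.
Qed.

Let D_norm t : t \in D -> `|t| <= 3 * B.
Proof.
rewrite mem_itv in_itv /= -ler_norml => /le_trans; apply.
by rewrite /L; move: B1; lra.
Qed.

Let J_norm t : t \in J -> `|t| <= 3 * B.
Proof.
rewrite mem_itv in_itv /= -ler_norml => /le_trans; apply.
by move: B1; lra.
Qed.

Let Q_norm y : y \in Q -> `|y| <= 3 * B.
Proof.
rewrite /Q (box0E _ (ltW B0)) => /set_mem /le_trans; apply.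
by move: B1; lra.
Qed.

Let k1_le lam s t x y y' : trig s ->
  `|k1 lam s (t, (x, (y, y')))| <= A * \1_J x * \1_(J `*` Q) (y, y') * \1_D t.
Proof.
move=> hs; have A0' := ltW A0; rewrite /k1 /= !indicE in_setX /=.
have [tD|_] := boolP (t \in D); last by rewrite !(mul0r, mulr0) normr0.
have [xJ|_] := boolP (x \in J); last by rewrite !(mul0r, mulr0) normr0.
have [yJ|_] := boolP (y \in J); last by rewrite !(mul0r, mulr0) normr0.
have [yQ|_] := boolP (y' \in Q); last by rewrite !(mul0r, mulr0) normr0.
rewrite /= !mul1r !mulr1 normrM -[leRHS]mul1r ler_pM// ?trig_le1//.
apply: (am_b am).
have := @norm3 (row x, row y) t y'; rewrite /= !mxE; apply; rewrite ?D_norm ?Q_norm//.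
have B3 : 0 <= 3 * B by rewrite mulr_ge0// ltW.
by apply: pair_norm_le => /=; apply: rV_norm_le => // i; rewrite mxE J_norm.
Qed.

Let k2_le lam s t x y : trig s -> `|k2 lam s (t, (x, y))| <= 1 * \1_Q x.
Proof.
move=> hs; rewrite /k2 /= !indicE mul1r.
case: (_ \in `[0, +oo[%classic); last by rewrite !mul0r normr0.
case: (x \in Q); last by rewrite !(mul0r, mulr0) normr0.
case: (y \in Q); last by rewrite !(mul0r, mulr0) normr0.
by rewrite !mul1r !mulr1 trig_le1.
Qed.

Let lebJ : (leb J < +oo)%E.
Proof. by rewrite /J lebesgue_measure_itv /=; case: ifP; rewrite ltry. Qed.

Let lebD : leb D = (2 * L)%:E.
Proof.
have L0 : 0 < L by rewrite /L addr_gt0.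
rewrite /D lebesgue_measure_itv /= lte_fin ifT; last by rewrite gtrN.
by rewrite -EFinB opprK; congr EFin; ring.
Qed.

Let lebnQ : (@lebn R 1 Q < +oo)%E.
Proof. by rewrite [X in (X < _)%E](lebn_box _ (ltW B0)) ltry. Qed.

Let bound_k1 C lam s t y' : trig s -> 0 < C -> 
  (forall a a1 a2, @amplitude R 0 B A a a1 a2 -> Lp_bounded (@lebn R 1) (@lebn R 1) p
    (fun z => \1_(box 0 B) z.1 * (s (lam * q (z.1 ord0 ord0) (z.2 ord0 ord0)) * a z) * \1_(box 0 B) z.2) C) ->
  Lp_bounded leb leb p (fun z => k1 lam s (t, (z.1, (z.2, y')))) C.
Proof.
move=> hs C0 hC.
have [tD|tD] := boolP (t \in D); last first.
  by apply: Lp_bounded_zero (ltW p1) _ => z; rewrite /k1 /= indicE (negbTE tD) !mul0r.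
have [yQ|yQ] := boolP (y' \in Q); last first.
  by apply: Lp_bounded_zero (ltW p1) _ => z; rewrite /k1 /= [\1_Q _]indicE (negbTE yQ) mulr0.
have sa := slice_amplitude (D_norm tD) (Q_norm yQ).
have mk : measurable_fun setT (fun z : 'rV[R]_1 * 'rV[R]_1 => \1_(box 0 B) z.1 *
    (s (lam * q (z.1 ord0 ord0) (z.2 ord0 ord0)) *
     w (ins ord0 (z.1 ord0 ord0, row t), ins ord0 (z.2 ord0 ord0, y'))) * \1_(box 0 B) z.2 : R).
  apply: measurable_funM; first apply: measurable_funM; last 2 first.
  - apply: measurable_funM; last exact: (am_meas sa).
    by apply: measurable_q => //; apply: (measurableT_comp (measurable_rV_coord ord0)); mproj.
  - by apply: (measurableT_comp (measurable_indic mQ)); mproj.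
  - by apply: (measurableT_comp (measurable_indic mQ)); mproj.
have := Lp_bounded_rV1 mk (hC _ _ _ sa).
rewrite (_ : (fun z => _) = (fun z => k1 lam s (t, (z.1, (z.2, y')))))//.
apply/funext => z; rewrite /k1 /= !mxE !row_box -/J [\1_D t]indicE tD [\1_Q y']indicE yQ.
by rewrite mul1r mulr1.
Qed.

Let bound_k2 C lam s t : trig s -> 
  Lp_bounded (@lebn R 1) (@lebn R 1) p
    (fun z => \1_Q z.1 * (s (lam * q (z.1 ord0 ord0) (z.2 ord0 ord0)) * 1) * \1_Q z.2) C ->
  Lp_bounded (@lebn R 1) (@lebn R 1) p (fun z => k2 lam s (t, z)) C.
Proof.
move=> hs hC.
pose E : set 'rV[R]_1 := (fun x : 'rV[R]_1 => x ord0 ord0 - t) @^-1` `[0, +oo[%classic.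
have mE : measurable E.
  have mf : measurable_fun setT (fun x : 'rV[R]_1 => x ord0 ord0 - t).
    by apply: measurable_funB; [exact: measurable_rV_coord|exact: measurable_cst].
  by have := mf measurableT `[0, +oo[%classic (measurable_itv _); rewrite setTI.
have mk : measurable_fun setT (fun z : 'rV[R]_1 * 'rV[R]_1 =>
    \1_Q z.1 * (s (lam * q (z.1 ord0 ord0) (z.2 ord0 ord0)) * 1) * \1_Q z.2 : R).
  apply: measurable_funM; first apply: measurable_funM; last 2 first.
  - apply: measurable_funM; last exact: measurable_cst.
    by apply: measurable_q => //; apply: (measurableT_comp (measurable_rV_coord ord0)); mproj.
  - by apply: (measurableT_comp (measurable_indic mQ)); mproj.
  - by apply: (measurableT_comp (measurable_indic mQ)); mproj.
have := Lp_bounded_restrict (ltW p1) mE (@measurableT _ 'rV[R]_1) mk hC.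
rewrite (_ : (fun z => _) = (fun z => k2 lam s (t, z)))//.
by apply/funext => z; rewrite /k2 [\1_setT _]indicE in_setT [LHS]mulr1; congr (_ * _).
Qed.

Let bound_K C lam s1 s2 t : trig s1 -> trig s2 -> 0 < C ->
  (forall s a a1 a2, trig s -> @amplitude R 0 B A a a1 a2 -> Lp_bounded (@lebn R 1) (@lebn R 1) p
    (fun z => \1_(box 0 B) z.1 * (s (lam * q (z.1 ord0 ord0) (z.2 ord0 ord0)) * a z) * \1_(box 0 B) z.2) C) ->
  (forall s a a1 a2, trig s -> @amplitude R 0 B 1 a a1 a2 -> Lp_bounded (@lebn R 1) (@lebn R 1) p
    (fun z => \1_(box 0 B) z.1 * (s (lam * q (z.1 ord0 ord0) (z.2 ord0 ord0)) * a z) * \1_(box 0 B) z.2) C) ->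
  Lp_bounded (leb \x @lebn R 1)%E (leb \x @lebn R 1)%E p (fun z => K lam s1 s2 (t, z)) (C * C).
Proof.
move=> h1 h2 C0 hA h1'.
apply: (@Lp_bounded_tensor _ _ _ _ _ _ _ _ R leb (@lebn R 1) leb (@lebn R 1) J Q J Q A 1 p C C
  (fun u => k1 lam s1 (t, u)) (fun u => k2 lam s2 (t, u))) => //.
- exact: ltW.
- exact: ltW.
- by apply: (measurableT_comp (measurable_k1 lam h1)); apply/measurable_fun_pair; mproj.
- by apply: (measurableT_comp (measurable_k2 lam h2)); apply/measurable_fun_pair; mproj.
- move=> x y y'; apply: le_trans (k1_le _ _ _ _ _ h1) _.
  by rewrite ler_piMr ?mulr_ge0 ?(ltW A0)// indicE; case: (_ \in _).
- by move=> x y; exact: k2_le.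
- by move=> y'; apply: bound_k1 => // a a1 a2; exact: hA.
- by apply: bound_k2 => //; exact: (h1' _ _ _ _ h2 unit_amplitude).
Qed.

Let measurable_K lam s1 s2 : trig s1 -> trig s2 -> measurable_fun setT (K lam s1 s2).
Proof.
have m21 := measurableT_comp (@measurable_fst _ _ (R * 'rV[R]_1)%type (R * 'rV[R]_1)%type)
  (@measurable_snd _ _ R ((R * 'rV[R]_1) * (R * 'rV[R]_1))%type).
have m22 := measurableT_comp (@measurable_snd _ _ (R * 'rV[R]_1)%type (R * 'rV[R]_1)%type)
  (@measurable_snd _ _ R ((R * 'rV[R]_1) * (R * 'rV[R]_1))%type).
move=> h1 h2; apply: measurable_funM.
  apply: (measurableT_comp (measurable_k1 lam h1)); apply/measurable_fun_pair; first mproj.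
  by apply/measurable_fun_pair; [exact: (measurableT_comp measurable_fst m21)|exact: m22].
apply: (measurableT_comp (measurable_k2 lam h2)); apply/measurable_fun_pair; first mproj.
by apply/measurable_fun_pair; [exact: (measurableT_comp measurable_snd m21)|exact: (measurableT_comp measurable_snd m22)].
Qed.

Let clip tau t : tau <= L -> \1_D t * \1_(`[0, +oo[%classic : set R) (tau - t) = \1_`[- L, tau] t :> R.
Proof.
move=> tauL; rewrite !indicE !mem_itv !in_itv /= andbT subr_ge0 -natrM mulnb; congr ((_ : bool)%:R).
apply/idP/idP => [/andP[/andP[-> _] ->]//|/andP[h1 h2]].
by rewrite h1 h2 (le_trans h2).
Qed.

(** The lower limit - L lies to the left of the support of f. *)
Let integral_w x1 tau Y : - B <= tau -> 
  \int[leb]_t (\1_`[- L, tau] t * w (ins ord0 (x1, row t), Y)) = f (ins ord0 (x1, row tau), Y).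
Proof.
move=> tauB; have Ltau : - L < tau by rewrite /L; move: tauB; lra.
pose W t := f (ins ord0 (x1, row t), Y); pose W' t := w (ins ord0 (x1, row t), Y).
have dW t : is_derive1 W t (W' t) by exact: is_derive_line.
have cW : continuous W by exact: (is_derive1_continuous dW).
have cW' : continuous W'.
  exact: (is_derive1_continuous (fun t => is_derive_line x1 Y t sw)).
have WL : W (- L) = 0.
  apply: fB => h; have [/(fun h' => le_trans h' h) n1 _] := pair_norm_ge (ins ord0 (x1, row (- L)), Y).
  have := le_trans (rV_coord_le (ins ord0 (x1, row (- L))) snd_ax) n1.
  rewrite ins_lift mxE normrN ger0_norm /L; first by move: B1; lra.
  by rewrite addr_ge0// ltW.
transitivity (fine (\int[leb]_(t in `[- L, tau]) (W' t)%:E)).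
  rewrite /Rintegral [in RHS]integral_mkcond; congr fine; apply: eq_integral => t _.
  rewrite patchE indicE; case: (_ \in _); first by rewrite mul1r.
  by rewrite mul0r.
rewrite (@continuous_FTC2 _ W' W)//.
- by rewrite WL sube0.
- exact: continuous_subspaceT.
- split.
  + by move=> z _; exact: (@ex_derive _ _ _ _ _ _ _ (dW z)).
  + by apply: cvg_at_right_filter; exact: cW.
  + by apply: cvg_at_left_filter; exact: cW.
- by move=> z _; rewrite derive1E; exact: (@derive_val _ _ _ _ _ _ _ (dW z)).
Qed.

Let integral_K lam s1 s2 z :
  \int[leb]_t K lam s1 s2 (t, z) = F lam s1 s2 (ins ord0 z.1, ins ord0 z.2).
Proof.
case: z => [[x1 x2] [y1 y2]]; set Y := ins ord0 (y1, y2).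
pose c := \1_J x1 * s1 (lam * q x1 y1) * \1_J y1 * \1_Q y2 *
  (\1_Q x2 * s2 (lam * q (x2 ord0 ord0) (y2 ord0 ord0)) * \1_Q y2) : R.
pose g t := \1_D t * \1_(`[0, +oo[%classic : set R) (x2 ord0 ord0 - t) * w (ins ord0 (x1, row t), Y) : R.
have mg : measurable_fun setT g.
  apply: measurable_funM; first apply: measurable_funM.
  - exact: measurable_indic.
  - apply: (measurableT_comp (measurable_indic (measurable_itv _))).
    by apply: measurable_funB => //; exact: measurable_cst.
  - apply: (measurableT_comp (am_meas am)); apply/measurable_fun_pair; last exact: measurable_cst.
    apply: (measurableT_comp (measurable_ins ord0)); apply/measurable_fun_pair; first exact: measurable_cst.
    exact: mrow.
transitivity (\int[leb]_t (c * g t)).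
  by apply: eq_Rintegral => t _; rewrite /K /k1 /k2 /c /g /Y /=; ring.
rewrite RintegralZl_measurable//.
rewrite /F /= !ins_box0 !ins_at -/J -/Q.
have -> : ins ord0 (x1, x2) ord0 snd_ax = x2 ord0 ord0 by rewrite ins_lift.
have -> : ins ord0 (y1, y2) ord0 snd_ax = y2 ord0 ord0 by rewrite ins_lift.
have QQ : \1_Q y2 * \1_Q y2 = \1_Q y2 :> R by rewrite indicE; case: (_ \in _); rewrite ?mul1r ?mul0r.
have [xQ|xQ] := boolP (x2 \in Q); last first.
  by rewrite /c [\1_Q x2]indicE (negbTE xQ) !(mul0r, mulr0).
have := set_mem xQ ord0; rewrite !mxE !add0r => /andP[tau1 tau2].
have tauL : x2 ord0 ord0 <= L by rewrite (le_trans tau2)// /L lerDl.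
have -> : \int[leb]_t g t = \int[leb]_t (\1_`[- L, x2 ord0 ord0] t * w (ins ord0 (x1, row t), Y)).
  by apply: eq_Rintegral => t _; rewrite /g clip.
rewrite integral_w// (_ : row (x2 ord0 ord0) = x2); last by apply/matrixP => i j; rewrite !ord1 mxE.
rewrite /c [\1_Q x2]indicE xQ -{3}QQ; ring.
Qed.

Let measurable_F lam s1 s2 : trig s1 -> trig s2 -> measurable_fun setT (F lam s1 s2).
Proof.
move=> h1 h2; have mb := measurable_box (0 : 'rV[R]_2) B.
have mc i : measurable_fun setT (fun Z : 'rV[R]_2 * 'rV[R]_2 => Z.1 ord0 i).
  by apply: (measurableT_comp (measurable_rV_coord i)); mproj.
have mc' i : measurable_fun setT (fun Z : 'rV[R]_2 * 'rV[R]_2 => Z.2 ord0 i).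
  by apply: (measurableT_comp (measurable_rV_coord i)); mproj.
have mf : measurable_fun setT f by apply: continuous_measurable_rV2; have [] := sf 0%N.
apply: measurable_funM; first apply: measurable_funM; last 2 first.
- by apply: measurable_funM => //; apply: measurable_funM; exact: measurable_q.
- by apply: (measurableT_comp (measurable_indic mb)); mproj.
- by apply: (measurableT_comp (measurable_indic mb)); mproj.
Qed.

Let bound_F C lam s1 s2 : trig s1 -> trig s2 -> 0 < C ->
  (forall s a a1 a2, trig s -> @amplitude R 0 B A a a1 a2 -> Lp_bounded (@lebn R 1) (@lebn R 1) p
    (fun z => \1_(box 0 B) z.1 * (s (lam * q (z.1 ord0 ord0) (z.2 ord0 ord0)) * a z) * \1_(box 0 B) z.2) C) ->
  (forall s a a1 a2, trig s -> @amplitude R 0 B 1 a a1 a2 -> Lp_bounded (@lebn R 1) (@lebn R 1) p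
    (fun z => \1_(box 0 B) z.1 * (s (lam * q (z.1 ord0 ord0) (z.2 ord0 ord0)) * a z) * \1_(box 0 B) z.2) C) ->
  Lp_bounded (@lebn R 2) (@lebn R 2) p (F lam s1 s2) (C * C * (2 * L)).
Proof.
move=> h1 h2 C0 hA hB; apply: (Lp_bounded_ins (i := ord0) (j := ord0)) => //.
  exact: measurable_F.
rewrite (_ : (fun z => _) = (fun z => \int[leb]_t K lam s1 s2 (t, z))); last first.
  by apply/funext => z; rewrite integral_K.
rewrite (_ : 2 * L = fine (leb D)); last by rewrite lebD.
have fQ : ((leb \x @lebn R 1) (J `*` Q) < +oo)%E.
  by rewrite product_measure1E// lte_mul_pinfty// ge0_fin_numE.
apply: (@Lp_bounded_average _ _ _ _ _ _ R (prod_measure leb (@lebn R 1)) (prod_measure leb (@lebn R 1)) leb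
  (J `*` Q) (J `*` Q) D A p (C * C) (K lam s1 s2)) => //.
- exact: ltW.
- exact: mulr_gt0.
- exact: measurable_K.
- exact: measurableX.
- exact: measurableX.
- by rewrite [X in (X < _)%E]lebD ltry.
- move=> t [x x'] [y y']; rewrite /K /= normrM.
  apply: le_trans (ler_pM _ _ (k1_le _ _ _ _ _ h1) (k2_le _ _ _ _ h2)) _ => //.
  rewrite !indicE !in_setX /=.
  by case: (t \in D); case: (x \in J); case: (x' \in Q); case: (y \in J); case: (y' \in Q);
    rewrite /= !(mul1r, mulr1, mul0r, mulr0).
- by move=> t; exact: bound_K.
Qed.

Let tame_F lam s1 s2 A1 : trig s1 -> trig s2 -> (forall z, `|f z| <= A1) ->
  tame_on (@lebn R 2) (@lebn R 2) (box 0 B) (box 0 B) A1 (F lam s1 s2).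
Proof.
move=> h1 h2 fA; have mb := measurable_box (0 : 'rV[R]_2) B.
have fb : (@lebn R 2 (box 0 B) < +oo)%E by rewrite [X in (X < _)%E](lebn_box _ (ltW B0)) ltry.
split => //; first exact: measurable_F.
move=> x y; rewrite /F /= !indicE.
case: (x \in _); last by rewrite !(mul0r, mulr0) normr0.
case: (y \in _); last by rewrite !(mul0r, mulr0) normr0.
rewrite !mul1r !mulr1 !normrM -[leRHS]mul1r ler_pM// ?mulr_ge0//.
by rewrite -[leRHS]mul1r ler_pM// trig_le1.
Qed.

(** The addition formulas of the cosine and the sine separate the two pairs of
    variables. Each product is an average over t of tensor products of two
    operators with the one-dimensional bound lam^(-1/6). *)
Lemma quintic_kernel_bound : exists2 C, 0 < C & forall lam s, 1 <= lam -> trig s ->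
  Lp_bounded (@lebn R 2) (@lebn R 2) p
    (fun z => \1_(box 0 B) z.1 * (s (lam * phase_eval (quintic R 2) z) * f z) * \1_(box 0 B) z.2)
    (C * lam `^ (- 3%:R^-1)).
Proof.
have [C1 C10 h1] := quintic_bound1 A0; have [C2 C20 h2] := quintic_bound1 (ltr01 : 0 < 1 :> R).
have [c0 _] := sf 0%N; have [A1 A10 fA1] := continuous_bounded_ball B c0.
have fA z : `|f z| <= A1.
  by have [/fA1//|/fB ->] := pselect (`|z| <= B); rewrite normr0 ltW.
have L0 : 0 < 2 * L by rewrite mulr_gt0// /L addr_gt0.
pose C := C1 + C2; have C0 : 0 < C by exact: addr_gt0.
exists (4 * (C * C * (2 * L))) => [|lam s lam1 hs]; first by apply: (mulr_gt0 _ (mulr_gt0 (mulr_gt0 C0 C0) L0)).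
have l0 : 0 < lam by apply: lt_le_trans lam1.
set e := lam `^ (- 6%:R^-1); have e0 : 0 < e by exact: powR_gt0.
have -> : 4 * (C * C * (2 * L)) * lam `^ (- 3%:R^-1) = 4 * (C * e * (C * e) * (2 * L)).
  have -> : lam `^ (- 3%:R^-1) = e * e.
    rewrite /e -powRD; last by apply/implyP => _; rewrite gt_eqF.
    by congr (_ `^ _); field.
  by ring.
have hA s' a a1 a2 : trig s' -> @amplitude R 0 B A a a1 a2 -> Lp_bounded (@lebn R 1) (@lebn R 1) p
    (fun z => \1_(box 0 B) z.1 * (s' (lam * q (z.1 ord0 ord0) (z.2 ord0 ord0)) * a z) * \1_(box 0 B) z.2) (C * e).
  move=> hs' ha; apply: Lp_bounded_le (h1 lam s' a a1 a2 lam1 hs' ha) => //.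
  by rewrite mulr_ge0 ?(ltW e0) ?(ltW C10)//= ler_wpM2r ?(ltW e0)// lerDl ltW.
have hB s' a a1 a2 : trig s' -> @amplitude R 0 B 1 a a1 a2 -> Lp_bounded (@lebn R 1) (@lebn R 1) p
    (fun z => \1_(box 0 B) z.1 * (s' (lam * q (z.1 ord0 ord0) (z.2 ord0 ord0)) * a z) * \1_(box 0 B) z.2) (C * e).
  move=> hs' ha; apply: Lp_bounded_le (h2 lam s' a a1 a2 lam1 hs' ha) => //.
  by rewrite mulr_ge0 ?(ltW e0) ?(ltW C20)//= ler_wpM2r ?(ltW e0)// lerDr ltW.
have Ce : 0 < C * e by exact: mulr_gt0.
have bF s1 s2 : trig s1 -> trig s2 -> Lp_bounded (@lebn R 2) (@lebn R 2) p (F lam s1 s2) (C * e * (C * e) * (2 * L)).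
  by move=> hs1 hs2; exact: bound_F.
have tc : trig (@cos R) by left.
have ts : trig (@sin R) by right.
have b0 : 0 <= C * e * (C * e) * (2 * L) by exact: (mulr_ge0 (mulr_ge0 (ltW Ce) (ltW Ce)) (ltW L0)).
have phE z : lam * phase_eval (quintic R 2) z = lam * q (z.1 ord0 ord0) (z.2 ord0 ord0) +
    lam * q (z.1 ord0 snd_ax) (z.2 ord0 snd_ax).
  by rewrite phase_eval_quintic !big_ord_recl big_ord0 addr0 mulrDr.
have mk : measurable_fun setT (fun z : 'rV[R]_2 * 'rV[R]_2 =>
    \1_(box 0 B) z.1 * (s (lam * phase_eval (quintic R 2) z) * f z) * \1_(box 0 B) z.2 : R).
  have mb := measurable_box (0 : 'rV[R]_2) B.
  have mf : measurable_fun setT f by exact: continuous_measurable_rV2.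
  apply: measurable_funM; first apply: measurable_funM; last 2 first.
  - apply: measurable_funM => //; apply: (measurableT_comp (measurable_trig hs)).
    by apply: measurable_funM; [exact: measurable_cst|exact: measurable_phase_eval].
  - by apply: (measurableT_comp (measurable_indic mb)); mproj.
  - by apply: (measurableT_comp (measurable_indic mb)); mproj.
case: hs mk => -> mk.
- apply: (Lp_bounded_addZ (c := -1) (ltW p1) b0 _ mk (tame_F lam tc tc fA) (tame_F lam ts ts fA)) => //.
  + by rewrite normrN1.
  + by move=> z; rewrite phE cosD /F; ring.
  + exact: bF.
  + exact: bF.
- apply: (Lp_bounded_addZ (c := 1) (ltW p1) b0 _ mk (tame_F lam ts tc fA) (tame_F lam tc ts fA)) => //.
  + by rewrite normr1.
  + by move=> z; rewrite phE sinD /F; ring.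
  + exact: bF.
  + exact: bF.
Qed.

End separable_phase.

Lemma osc_op_quintic_upper (R : realType) (p p' : R) (psi : 'rV[R]_2 * 'rV[R]_2 -> R[i]) :
  1 < p -> p^-1 + p'^-1 = 1 -> Num.max p p' < 6%:R -> cutoff psi ->
  exists2 C, 0 < C & forall lam, 1 <= lam ->
  (op_norm p (osc_op (quintic R 2) psi lam) <= (C * lam `^ (- 3%:R^-1))%:E)%E.
Proof.
move=> p1 pp' pmax hpsi.
have [B0 B00 hB0] := cutoff_support hpsi; have [A A0 hA] := cutoff_bounded hpsi.
pose B := B0 + 1; have B1 : 1 <= B by rewrite /B lerDr ltW.
have B0' : 0 <= B by apply: le_trans B1.
have hB z : ~ `|z| <= B -> psi z = 0.
  by move=> h; apply: hB0 => h'; apply: h; rewrite (le_trans h')// /B lerDl.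
have [s1 s2 _] := hpsi.
pose v := axis_l R (lift ord0 ord0 : 'I_2).
have sD g : smooth g -> smooth ('D_v g) by move=> sg k; have [_ /(_ v) []] := sg k.+1.
have [A1 A10 am1] := smooth_amplitude B (sD _ s1); have [A2 A20 am2] := smooth_amplitude B (sD _ s2).
have hRe z : ~ `|z| <= B -> complex.Re (psi z) = 0 by move=> /hB ->.
have hIm z : ~ `|z| <= B -> complex.Im (psi z) = 0 by move=> /hB ->.
have [C1 C10 h1] := quintic_kernel_bound p1 pp' pmax B1 s1 hRe A10 am1.
have [C2 C20 h2] := quintic_kernel_bound p1 pp' pmax B1 s2 hIm A20 am2.
have [/(_ 0%N) [c1 _] /(_ 0%N) [c2 _]] := (s1, s2).
exists (64 * (C1 + C2)) => [|lam lam1]; first by rewrite mulr_gt0 ?addr_gt0.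
have L0 := powR_ge0 lam (- 3%:R^-1); have p0 : 0 <= p by rewrite ltW// (lt_trans _ p1).
rewrite -mulrA; apply: (@op_norm_le_real _ _ (quintic R 2) psi lam p A B) => //.
- by rewrite mulr_ge0// ltW// addr_gt0.
- exact: continuous_measurable_rV2.
- exact: continuous_measurable_rV2.
move=> s hs; split.
  apply: Lp_bounded_le (h1 lam s lam1 hs) => //.
  by rewrite mulr_ge0 ?(ltW C10)//= ler_wpM2r// lerDl ltW.
apply: Lp_bounded_le (h2 lam s lam1 hs) => //.
by rewrite mulr_ge0 ?(ltW C20)//= ler_wpM2r// lerDr ltW.
Qed.

(** * The decay estimates *)

Theorem theoremA (R : realType) :
  (forall (n d : nat) (S : mpoly (n + n) R)
      (psi : 'rV[R]_n * 'rV[R]_n -> R[i]),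
    (4 <= 2 * n)%N -> (2 * n < d)%N ->
    mixed_homog d S -> is_norm (hessian_norm d S) -> cutoff psi ->
    (forall p p' : R, 1 < p -> p^-1 + p'^-1 = 1 ->
      exists C : R, forall lam : R, 2 <= lam ->
        [/\ d%:R / (d%:R - n%:R) < p < d%:R / n%:R ->
              (op_norm p (osc_op S psi lam) <=
                (C * lam `^ (- (newton_distance S / 2)))%:E)%E,
            p = d%:R / n%:R \/ p = d%:R / (d%:R - n%:R) ->
              (op_norm p (osc_op S psi lam) <=
                (C * lam `^ (- (newton_distance S / 2)) *
                  (ln lam) `^ (newton_distance S))%:E)%E,
            1 < p < d%:R / (d%:R - n%:R) ->
              (op_norm p (osc_op S psi lam) <= (C * lam `^ (- p'^-1))%:E)%E
          & d%:R / n%:R < p ->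
              (op_norm p (osc_op S psi lam) <= (C * lam `^ (- p^-1))%:E)%E])
    /\
    (forall p : R, d%:R / (d%:R - n%:R) <= p <= d%:R / n%:R ->
      psi 0 != 0 ->
      exists2 c : R, 0 < c & \forall lam \near +oo,
        ((c * lam `^ (- (newton_distance S / 2)))%:E <=
          op_norm p (osc_op S psi lam))%E))
  /\
  (exists (n d : nat) (S : mpoly (n + n) R) (p : R),
    [/\ (4 <= 2 * n)%N /\ (2 * n < d)%N,
        mixed_homog d S,
        is_norm (hessian_norm d S),
        1 < p /\ ~~ (d%:R / (d%:R - n%:R) <= p <= d%:R / n%:R)
      & forall psi : 'rV[R]_n * 'rV[R]_n -> R[i], cutoff psi ->
          (exists C : R, forall lam : R, 2 <= lam ->
            (op_norm p (osc_op S psi lam) <=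
              (C * lam `^ (- (newton_distance S / 2)))%:E)%E)
          /\
          (psi 0 != 0 ->
            exists2 c : R, 0 < c & \forall lam \near +oo,
              ((c * lam `^ (- (newton_distance S / 2)))%:E <=
                op_norm p (osc_op S psi lam))%E)]).
Proof.
split.
- move=> n d S psi n2 dn hS hN hpsi.
  have [e de] : exists e, d = e.+4.
    by exists (d - 4)%N; rewrite -addn4 subnK// (leq_trans n2)// ltnW.
  move: dn hS hN; rewrite {}de {d} => dn hS hN.
  case: n S psi n2 dn hS hN hpsi => [//|n] S psi n2 dn hS hN hpsi.
  have n0 : (0 < n)%N by case: n n2 {S psi dn hS hN hpsi}.
  have [hom _ _] := hS; have [_ hz _ _] := hN.
  pose r : R := n.+1%:R / e.+4%:R.
  have d0 : 0 < e.+4%:R :> R by rewrite ltr0n.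
  have hd : newton_distance S / 2 = r.
    by rewrite (newton_distanceE n2 dn hom hz) /r; field; rewrite gt_eqF.
  have r0 : 0 < r by rewrite divr_gt0.
  have r2 : 2 * r < 1 by rewrite /r mulrA ltr_pdivrMr// mul1r -natrM ltr_nat.
  have r1 : 0 < 1 - r by move: r0 r2; lra.
  have dE : n.+1%:R = r * e.+4%:R by rewrite /r divfK// gt_eqF.
  have e1 : e.+4%:R / (e.+4%:R - n.+1%:R) = (1 - r)^-1.
    by rewrite dE -[X in X - _]mul1r -mulrBl invfM mulrCA mulfV ?mulr1// gt_eqF.
  have e2 : e.+4%:R / n.+1%:R = r^-1 by rewrite /r invf_div.
  rewrite e1 e2 hd; split=> [p p' p1 pp'|p /andP[pl _] psi0]; last first.
    have p1 : 1 < p by apply: lt_le_trans pl; rewrite invf_gt1//; move: r0; lra.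
    have [/(_ 0%N) [cRe _] /(_ 0%N) [cIm _] _] := hpsi.
    have [c c0 hc] := osc_op_lower (isT : (0 < e.+4)%N) hom cRe cIm psi0 p1.
    by exists c => //; exists 1; split => [|lam /ltW lam1]; [exact: num_real|exact: hc].
  have [C C0 hC] := osc_op_upper hom hz hpsi p1 pp' n0.
  have pp : 0 < p by apply: lt_trans p1.
  set delta := newton_distance S; have ln2 : 0 < ln 2 :> R by rewrite ln_gt0// ltr1n.
  pose m : R := (ln 2) `^ (- delta); have m0 : 0 < m by exact: powR_gt0.
  exists (2 * C * (1 + m)) => lam lam2.
  have lam1 : 1 <= lam by apply: le_trans lam2; rewrite ler1n.
  have key X : lam `^ (- (Num.max p p')^-1) <= X -> lam `^ (- r) <= X ->
      (op_norm p (osc_op S psi lam) <= (2 * C * X)%:E)%E.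
    move=> h1 h2; apply: le_trans (hC lam lam1) _; rewrite lee_fin [2 * C]mulrC -mulrA.
    apply: ler_wpM2l; first exact: ltW.
    by rewrite (_ : 2 * X = X + X); [exact: lerD|ring].
  have key' X : 0 <= X -> lam `^ (- (Num.max p p')^-1) <= X -> lam `^ (- r) <= X ->
      (op_norm p (osc_op S psi lam) <= (2 * C * (1 + m) * X)%:E)%E.
    move=> X0 h1 h2; apply: le_trans (key X h1 h2) _; rewrite lee_fin; apply: ler_wpM2r => //.
    by rewrite ler_peMr ?lerDl ?(ltW m0)// mulr_ge0// ltW.
  have mono a b : a <= b -> lam `^ (- b) <= lam `^ (- a).
    by move=> ab; rewrite ler_powR// lerN2.
  have qge a : a <= p^-1 -> a <= p'^-1 -> a <= (Num.max p p')^-1.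
    by move=> h1 h2; rewrite maxEle; case: ifP.
  have ey : p'^-1 = 1 - p^-1 by rewrite -pp' addrAC subrr add0r.
  have x0 : 0 < p^-1 by rewrite invr_gt0.
  have x1 : p^-1 < 1 by rewrite invf_lt1.
  split.
  + rewrite (invf_plt _ _) ?posrE// (invf_pgt _ _) ?posrE// => /andP[h1 h2].
    apply: key'; rewrite ?powR_ge0//; apply: mono; apply: qge; rewrite ?ey; first exact: ltW.
    by move: h1; lra.
  + move=> h; have hq : lam `^ (- (Num.max p p')^-1) <= lam `^ (- r).
      by apply: mono; apply: qge; rewrite ?ey; case: h => ->; rewrite invrK//; move: r2; lra.
    apply: le_trans (key _ hq (lexx _)) _; rewrite lee_fin.
    have delta0 : 0 <= delta by rewrite /delta -[newton_distance S](@divfK _ 2)// hd mulr_ge0// ltW.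
    have lnle : ln 2 <= ln lam by rewrite ler_ln ?posrE// (lt_le_trans _ lam1).
    have hm : 1 <= (1 + m) * ln lam `^ delta.
      apply: (@le_trans _ _ (m * ln 2 `^ delta)).
        by rewrite /m -powRD; [rewrite addNr powRr0|apply/implyP => _; rewrite gt_eqF].
      apply: ler_pM; rewrite ?powR_ge0 ?(ltW m0)//; first by rewrite lerDr.
      apply: ge0_ler_powR; rewrite ?nnegrE ?(ltW ln2)//.
      by rewrite (le_trans (ltW ln2)).
    rewrite (_ : 2 * C * (1 + m) * _ * _ = 2 * C * lam `^ (- r) * ((1 + m) * ln lam `^ delta)); last by ring.
    by rewrite ler_peMr// mulr_ge0 ?powR_ge0// mulr_ge0// ltW.
  + rewrite (invf_pgt _ _) ?posrE// => /andP[_ h].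
    apply: key'; rewrite ?powR_ge0//; apply: mono; last by rewrite ey; move: h; lra.
    by apply: qge; rewrite ?ey//; move: h r2; lra.
  + rewrite (invf_plt _ _) ?posrE// => h.
    apply: key'; rewrite ?powR_ge0//; apply: mono; last exact: ltW.
    by apply: qge; rewrite ?ey//; move: h r2; lra.
(* Here d / n = 3 < 4, while the maximum of 4 and its conjugate exponent 4 / 3
   is still below d = 6. *)
exists 2%N, 6%N, (quintic R 2), 4%:R.
have [hom _ _] := quintic_mixed R 2; have [_ hz _ _] := quintic_norm R 2.
have hd : newton_distance (quintic R 2) / 2 = 3%:R^-1.
  by rewrite (newton_distanceE (isT : (4 <= 2 * 2)%N) (isT : (2 * 2 < 6)%N) hom hz); field.
split => //; [exact: quintic_mixed|exact: quintic_norm| |move=> psi hpsi; rewrite hd].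
  split; first by rewrite ltr1n.
  by rewrite negb_and -!ltNge; apply/orP; right; rewrite ltr_pdivrMr// -natrM ltr_nat.
have p1 : 1 < 4%:R :> R by rewrite ltr1n.
split=> [|psi0].
  have [||C C0 hC] := @osc_op_quintic_upper R 4%:R (4%:R / 3%:R) psi p1 _ _ hpsi.
  - by field.
  - by rewrite gt_max ltr_nat ltr_pdivrMr// -natrM ltr_nat.
  by exists C => lam lam2; apply: hC; apply: le_trans lam2; rewrite ler1n.
have [/(_ 0%N) [cRe _] /(_ 0%N) [cIm _] _] := hpsi.
have [c c0 hc] := osc_op_lower (isT : (0 < 6)%N) hom cRe cIm psi0 p1.
exists c => //; exists 1; split => [|lam /ltW lam1]; first exact: num_real.
by rewrite (_ : 3%:R^-1 = 2%:R / 6%:R); [exact: hc|field].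
Qed.
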